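(* For any $V\in C(\mathcal X)$ and any $\bar\mu_0\in\mathcal P(\mathcal X)$ there exists a unique Sinkhorn potential flow $(\mu_t)_{t\ge0}$ of $V$ starting at $\bar\mu_0$. Moreover: (i) (Energy dissipation) $t\mapsto E(\mu_t)$ is locally absolutely continuous, non-increasing, and for a.e. $t\ge 0$, $\frac{d}{dt}E(\mu_t)=-\mathbf g_{\mu_t}(\dot\mu_t,\dot\mu_t)$. (ii) (Long-term behavior) $\lim_{t\to+\infty}E(\mu_t)=\min_{\mathcal P(\mathcal X)}E=\min_{\mathcal X}V$. If moreover $V$ has a unique minimizer $x^\star\in\mathcal X$, then $\mu_t\to\delta_{x^\star}$ weakly-* as $t\to+\infty$. (iii) (Non-expansiveness) If $(\mu^1_t)_{t\ge0}$ and $(\mu^2_t)_{t\ge0}$ are two Sinkhorn potential flows of $V$, then $t\mapsto\|B(\mu^1_t)-B(\mu^2_t)\|_{\mathcal H_c}$ is non-increasing.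
   Context: Standing setting: $(\mathcal X,\mathsf d)$ is a compact metric space; $\varepsilon>0$; $c\in C(\mathcal X\times\mathcal X)$ is symmetric and nonnegative and $k_c:=\exp(-c/\varepsilon)$ is a positive definite universal kernel (its RKHS is dense in $(C(\mathcal X),\|\cdot\|_\infty)$). $V\in C(\mathcal X)$ and $E(\mu):=\int V\,d\mu$. $\mathcal M(\mathcal X)$ denotes signed Radon measures (dual of $C(\mathcal X)$, weak-* topology), $\mathcal M_+(\mathcal X)$ the nonnegative ones, $\mathcal P(\mathcal X)$ the probability measures. Schrödinger potentials: for $f\in C(\mathcal X)$, $\mu\in\mathcal P(\mathcal X)$ let $T_\varepsilon(f,\mu)(y):=-\varepsilon\log\int\exp((f(x)-c(x,y))/\varepsilon)\,d\mu(x)$. For $\mu,\nu\in\mathcal P(\mathcal X)$, $(f_{\mu,\nu},f_{\nu,\mu})$ is the unique pair in $C(\mathcal X)^2$ with $f_{\mu,\nu}=T_\varepsilon(f_{\nu,\mu},\nu)$, $f_{\nu,\mu}=T_\varepsilon(f_{\mu,\nu},\mu)$ and $\int f_{\mu,\nu}d\mu=\int f_{\nu,\mu}d\nu$; write $f_\mu:=f_{\mu,\mu}$. Operators: $k_\mu(x,y):=\exp((f_\mu(x)+f_\mu(y)-c(x,y))/\varepsilon)$; $\mathcal H_c$, $\mathcal H_\mu\subset C(\mathcal X)$ are the RKHSs of $k_c$, $k_\mu$. $H_c:\mathcal H_c^*\to\mathcal H_c$ and $H_\mu:\mathcal H_\mu^*\to\mathcal H_\mu$ are the Riesz isomorphisms;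 on measures $H_c[\sigma](y)=\int k_c(x,y)d\sigma(x)$ and $H_\mu[\sigma](y)=\int k_\mu(x,y)d\sigma(x)$. $K_\mu[\phi]:=H_\mu[\phi\mu]$ for $\phi\in C(\mathcal X)$; $\mathrm{Id}-K_\mu^2$ is invertible on $C(\mathcal X)/\mathbb R$. Embedding: $B(\mu):=\exp(-f_\mu/\varepsilon)\in\mathcal H_c$; $B$ is a homeomorphism from $\mathcal P(\mathcal X)$ onto $\mathcal B:=H_c[\mathcal M_+(\mathcal X)]\cap\{b\in\mathcal H_c:\|b\|_{\mathcal H_c}=1\}$, with inverse $B^{-1}(b)=b\,H_c^{-1}[b]$. Tangent space and metric: $T_\mu:=\{\sigma\in\mathcal H_\mu^*:\langle\sigma,1\rangle=0\}$, $\mathbf g_\mu(\sigma_1,\sigma_2):=\frac\varepsilon2\langle\sigma_1,(\mathrm{Id}-K_\mu^2)^{-1}H_\mu[\sigma_2]\rangle$. Admissible curves: a curve $(\mu_t)_{t\in I}$ in $\mathcal P(\mathcal X)$ is locally absolutely continuous for the Sinkhorn distance (equivalently) iff $t\mapsto B(\mu_t)$ belongs to the Hilbert-valued Sobolev space $\mathscr H^1_{loc}(I;\mathcal H_c)$; then for a.e. $t$ there is $\dot\mu_t\in T_{\mu_t}$ with $\langle\dot\mu_t,\phi\rangle=\frac{d}{ds}\langle\mu_s,\phi\rangle|_{s=t}$ for all $\phi\in\mathcal H_{\mu_t}$. Pressures: $P\mu:=\{p\in C(\mathcal X):p\le0,\ p=0\text{ on }\operatorname{supp}\mu\}$. Definition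 (Sinkhorn potential flow): $(\mu_t)_{t\ge0}$ is a Sinkhorn potential flow of $V$ starting at $\bar\mu_0$ if it is admissible on $[0,\infty)$, $\mu_0=\bar\mu_0$, and for a.e. $t$ there exist $p_t\in P\mu_t$ and $C_t\in\mathbb R$ with $\frac\varepsilon2(\mathrm{Id}-K_{\mu_t}^2)^{-1}H_{\mu_t}[\dot\mu_t]+V+p_t=C_t$ (i.e. the inclusion $\frac\varepsilon2(\mathrm{Id}-K_{\mu_t}^2)^{-1}H_{\mu_t}[\dot\mu_t]+V+P\mu_t\ni0$ holds in $C(\mathcal X)/\mathbb R$). *)

(* Defs.v *)
From HB Require Import structures.
From mathcomp Require Import all_boot all_order all_algebra.
From mathcomp Require Import all_classical all_reals all_analysis.
From Stdlib Require Import ClassicalEpsilon.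
Set Implicit Arguments. Unset Strict Implicit. Unset Printing Implicit Defensive.
Import Order.TTheory GRing.Theory Num.Theory.
Import numFieldNormedType.Exports.
Local Open Scope classical_set_scope.
Local Open Scope ring_scope.

Section SinkhornDefs.
Context {R : realType} {X : pseudoMetricType R}.

(* ---------- measures as (positive, normalized) functionals on C(X) ----------
   M(X) is the dual of C(X); a measure mu is represented by its action
   phi |-> \int phi dmu on continuous functions (values on non-continuous
   functions are irrelevant). *)
Definition is_prob (mu : (X -> R) -> R) : Prop :=
  [/\ (forall (f g : X -> R) (a : R), continuous f -> continuous g ->
         mu (fun x => a * f x + g x) = a * mu f + mu g),
      (forall f : X -> R, continuous f -> (forall x, 0 <= f x) -> 0 <= mu f) &
      mu (fun _ => 1) = 1].

Definition meas_eq (mu nu : (X -> R) -> R) : Prop :=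
  forall f : X -> R, continuous f -> mu f = nu f.

Definition dirac_f (x0 : X) : (X -> R) -> R := fun f => f x0.

Definition supp (mu : (X -> R) -> R) : set X :=
  [set x | forall g : X -> R, continuous g -> (forall y, 0 <= g y) ->
           0 < g x -> 0 < mu g].

Definition pressures (mu : (X -> R) -> R) : set (X -> R) :=
  [set p : X -> R | continuous p /\ (forall x, p x <= 0) /\ (forall x, supp mu x -> p x = 0)].

Definition Teps (eps : R) (c : X -> X -> R) (f : X -> R) (mu : (X -> R) -> R)
  : X -> R :=
  fun y => - eps * ln (mu (fun x => expR ((f x - c x y) / eps))).

Definition schr_pair (eps : R) (c : X -> X -> R) (mu nu : (X -> R) -> R)
  (fg : (X -> R) * (X -> R)) : Prop :=
  [/\ continuous fg.1, continuous fg.2,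
      fg.1 = Teps eps c fg.2 nu, fg.2 = Teps eps c fg.1 mu &
      mu fg.1 = nu fg.2].

(* f_{mu,nu} : first component of the (unique) Schroedinger pair *)
Definition f_pot (eps : R) (c : X -> X -> R) (mu nu : (X -> R) -> R) : X -> R :=
  (epsilon (inhabits ((fun _ => 0), (fun _ => 0)) : inhabited ((X -> R) * (X -> R)))
           (schr_pair eps c mu nu)).1.

Definition f_self eps c mu := f_pot eps c mu mu.

Definition k_c (eps : R) (c : X -> X -> R) : X -> X -> R :=
  fun x y => expR (- c x y / eps).

Definition k_mu (eps : R) (c : X -> X -> R) (mu : (X -> R) -> R) : X -> X -> R :=
  fun x y => expR ((f_self eps c mu x + f_self eps c mu y - c x y) / eps).

(* squared RKHS norm of f for the (positive semidefinite) kernel k: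
   the least C >= 0 with (sum_i a_i f(x_i))^2 <= C sum_{ij} a_i a_j k(x_i,x_j)
   for all finite families; +oo if no such C (i.e. f is not in H_k). *)
Definition hnorm2 (k : X -> X -> R) (f : X -> R) : \bar R :=
  ereal_inf [set C%:E | C in [set C : R | 0 <= C /\
    forall (n : nat) (x : 'I_n -> X) (a : 'I_n -> R),
      (\sum_(i < n) a i * f (x i)) ^+ 2 <=
      C * \sum_(i < n) \sum_(j < n) a i * a j * k (x i) (x j)]].

Definition in_rkhs (k : X -> X -> R) (f : X -> R) : Prop :=
  (hnorm2 k f < +oo)%E.

Definition hnorm (k : X -> X -> R) (f : X -> R) : R := Num.sqrt (fine (hnorm2 k f)).

Definition in_dual (k : X -> X -> R) (s : (X -> R) -> R) : Prop :=
  (forall (f g : X -> R) (a : R), in_rkhs k f -> in_rkhs k g ->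
     s (fun x => a * f x + g x) = a * s f + s g) /\
  exists C : R, forall f, in_rkhs k f -> `|s f| <= C * hnorm k f.

(* Riesz isomorphism H_k : H_k^* -> H_k,  H[s](y) = <s, k(., y)> *)
Definition Hop (k : X -> X -> R) (s : (X -> R) -> R) : X -> R :=
  fun y => s (fun x => k x y).

(* K_mu[phi] = H_mu[phi mu] *)
Definition Kop eps c (mu : (X -> R) -> R) (phi : X -> R) : X -> R :=
  fun y => mu (fun x => k_mu eps c mu x y * phi x).

(* (Id - K_mu^2)^{-1} on C(X)/R : some representative psi of the class
   solving psi - K_mu^2 psi = g modulo constants *)
Definition inv_IdK2 eps c (mu : (X -> R) -> R) (g : X -> R) : X -> R :=
  epsilon (inhabits (fun _ : X => (0 : R)))
    (fun psi : X -> R => continuous psi /\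
       exists C : R, forall y, psi y - Kop eps c mu (Kop eps c mu psi) y = g y + C).

Definition tangent eps c (mu : (X -> R) -> R) (s : (X -> R) -> R) : Prop :=
  in_dual (k_mu eps c mu) s /\ s (fun _ => 1) = 0.

Definition gmet eps c (mu : (X -> R) -> R) (s : (X -> R) -> R) : R :=
  eps / 2 * s (inv_IdK2 eps c mu (Hop (k_mu eps c mu) s)).

Definition Bemb eps c (mu : (X -> R) -> R) : X -> R :=
  fun x => expR (- f_self eps c mu x / eps).

Definition energy (V : X -> R) (mu : (X -> R) -> R) : R := mu V.

Definition ae_pos (P : R -> Prop) : Prop :=
  exists N : set R, measurable N /\ (@lebesgue_measure R N = 0)%E /\
    forall t, 0 < t -> ~ N t -> P t.

(* t |-> b t belongs to H^1_loc([0,oo); H_k): locally absolutely continuous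
   with locally square-integrable metric derivative (AC^2_loc curve in the
   Hilbert space H_k) *)
Definition H1loc (k : X -> X -> R) (b : R -> X -> R) : Prop :=
  (forall t, 0 <= t -> in_rkhs k (b t)) /\
  exists m : R -> R, measurable_fun setT m /\ (forall r, 0 <= m r) /\
    (forall T : R, 0 <= T ->
       (\int[@lebesgue_measure R]_(r in `[0%R, T]) ((m r) ^+ 2)%:E < +oo)%E) /\
    forall s t : R, 0 <= s -> s <= t ->
      ((hnorm k (fun x => b t x - b s x))%:E <=
         \int[@lebesgue_measure R]_(r in `[s%R, t%R]) (m r)%:E)%E.

Definition admissible eps c (mu : R -> (X -> R) -> R) : Prop :=
  (forall t, 0 <= t -> is_prob (mu t)) /\
  H1loc (k_c eps c) (fun t => Bemb eps c (mu t)).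

Definition is_velocity eps c (mu : R -> (X -> R) -> R) (t : R)
  (s : (X -> R) -> R) : Prop :=
  tangent eps c (mu t) s /\
  forall phi : X -> R, in_rkhs (k_mu eps c (mu t)) phi ->
    is_derive t 1 (fun r => mu r phi) (s phi).

Definition SPF eps c (V : X -> R) (mu0 : (X -> R) -> R)
  (mu : R -> (X -> R) -> R) : Prop :=
  [/\ admissible eps c mu, meas_eq (mu 0) mu0 &
      ae_pos (fun t => exists s, is_velocity eps c mu t s /\
        exists p, pressures (mu t) p /\ exists C : R, forall y,
          eps / 2 * inv_IdK2 eps c (mu t) (Hop (k_mu eps c (mu t)) s) y
          + V y + p y = C)].

Definition loc_abs_cont (g : R -> R) : Prop :=
  forall T : R, 0 <= T -> forall e : R, 0 < e -> exists d : R, 0 < d /\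
    forall (n : nat) (a b : 'I_n -> R),
      (forall i, 0 <= a i /\ a i <= b i /\ b i <= T) ->
      (forall i j, i != j -> b i <= a j \/ b j <= a i) ->
      \sum_(i < n) (b i - a i) < d ->
      \sum_(i < n) `|g (b i) - g (a i)| < e.

End SinkhornDefs.

(* Main.v *)
Require Import Defs.
From HB Require Import structures.
From mathcomp Require Import all_boot all_order all_algebra.
From mathcomp Require Import all_classical all_reals all_analysis.
From mathcomp Require Import measurable_realfun.
From mathcomp Require Import ring lra.
From Stdlib Require ClassicalEpsilon.
Set Implicit Arguments. Unset Strict Implicit. Unset Printing Implicit Defensive.
Import Order.TTheory GRing.Theory Num.Theory.
Import numFieldNormedType.Exports.
Local Open Scope classical_set_scope.
Local Open Scope ring_scope.

(** Put [b_t = B(mu_t)] and [a_t = mu_t / b_t], so that [b_t = H a_t] has norm 1 in the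
    RKHS of [k = k_c].  Solving the flow equation for the velocity gives
    [b_t' = - A b_t + r_t], where [A] is multiplication by [U = 2 V / eps] minus its
    adjoint and [r_t] is nonnegative and vanishes on the support.  The one-sided
    inequality [b_t' >= - A b_t] on the unit sphere already determines the flow: since
    [A] is skew, it makes the scalar product of two such paths nondecreasing, whence
    uniqueness, nonexpansiveness and, comparing a path with its translates, a
    nonincreasing speed.  At the continuity times of the speed, that is outside a
    countable set, the difference quotients are Cauchy because their limits are
    admissible velocities of minimal norm; the path is differentiable there and the
    flow equation is recovered from [r_t].  The kernel normalized by the potentials is a
    reversible Markov kernel, which yields [E' <= - |b'|^2] up to a factor, hence the
    [H^1] bound, and a speed tending to zero; at a minimizer [x] of [V] the inequality
    [- A b_t (x) <= |b_t'|] then bounds [E - min V].  Existence comes from an Euler scheme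
    on finite subsets of [X], projecting on the cone of positive measures, and from
    limits along an ultrafilter.  Schroedinger potentials are fixed points of a map
    contracting Hilbert's projective metric. *)

(** * Ultralimits and functionals on continuous functions *)

(** Why the equation is linear in [b]: for [mu = b a] the product rule gives [H_mu[mu'] = (Id +
    K_mu) beta] with [beta = b' / b]. As [Id - K_mu^2 = (Id + K_mu)(Id - K_mu)] and [Id + K_mu] is
    injective, the flow equation becomes, up to constants, [beta = (Id - K_mu)(- U - p')] with
    [p' = 2 p / eps]. Multiplied by [b] this reads [b' = - (U b - H (U a)) - b p'], because
    [p' a = 0]; so [r = - b p'], and the factor [2 / eps] in [U] inverts the [eps / 2] of the
    equation. The obstacle: multiplication by [U] need not preserve the RKHS, so no Lipschitz theory
    of differential equations applies to [A]. What survives is that [A] is continuous from the dual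
    norm to the sup norm on measures of bounded mass, and positive measures of dual norm 1 have
    bounded mass since [k] is bounded below. On a finite set the dual norm controls total variation
    and an Euler scheme converges, but with constants that depend on the set; the passage to [X]
    rests on [|b_t - b_s|^2 <= (t - s) (E_s - E_t)], whose constant does not. *)

Section Ultralimit.
Context {R : realType}.

(** Along a nonprincipal ultrafilter every bounded real sequence converges, so a bounded sequence of
    functionals converges on all continuous functions at once, and approximate flows converge at all
    times simultaneously, with no extraction of subsequences. *)
Definition ultraN : set_system nat := sval (cid (@ultraFilterLemma nat \oo _)).

Lemma ultraN_ultra : UltraFilter ultraN.
Proof. by rewrite /ultraN; case: cid => G []. Qed.

#[global] Instance ultraN_instance : UltraFilter ultraN := ultraN_ultra.

Lemma ultraN_eventually (P : nat -> Prop) :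
  (\forall n \near \oo, P n) -> \forall n \near ultraN, P n.
Proof. by move=> h; rewrite /ultraN; case: cid => G [? /=]; apply. Qed.

Lemma ultraN_ge m : \forall n \near ultraN, (m <= n)%N.
Proof. by apply: ultraN_eventually; exact: nbhs_infty_ge. Qed.

Lemma cvg_ultraN (u : nat -> R) (l : R) : u @ \oo --> l -> u @ ultraN --> l.
Proof. by move=> h A /h; exact: ultraN_eventually. Qed.

Lemma cvg_ultraN_harmonic : (fun n => n.+1%:R^-1 : R) @ ultraN --> (0 : R).
Proof. by apply: cvg_ultraN; exact: cvg_harmonic. Qed.

Definition ulim (u : nat -> R) : R := lim (u @ ultraN).

Lemma ulim_cvg (u : nat -> R) (M : R) :
  (\forall n \near ultraN, `|u n| <= M) -> u @ ultraN --> ulim u.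
Proof.
move=> bu; suff [l ul] : exists l : R, u @ ultraN --> l.
  by rewrite /ulim (cvg_lim (@Rhausdorff R) ul).
have := @segment_compact R (- M) M; rewrite compact_ultra => /(_ (u @ ultraN)).
case.
- have -> : fmap u ultraN = [set A | ultraN (u @^-1` A)] by [].
  split; first exact: fmap_proper_filter.
  move=> G PG sG; rewrite eqEsubset; split => // A GA.
  have [//|nA] := @in_ultra_setVsetC _ ultraN (u @^-1` A) ultraN_ultra.
  have : G (~` A) by apply: sG.
  move=> GnA; exfalso; have := @filterI _ _ PG _ _ GA GnA.
  by rewrite setICr => /filter_ex [].
- by apply: filterS bu => n /=; rewrite in_itv /= ler_norml.
- by move=> l [_ ul]; exists l.
Qed.

Lemma ulimE (u : nat -> R) (l : R) : u @ ultraN --> l -> ulim u = l.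
Proof. by move=> ul; rewrite /ulim (cvg_lim (@Rhausdorff R) ul). Qed.

Lemma ultra_le (u v : nat -> R) (l m : R) : u @ ultraN --> l -> v @ ultraN --> m ->
  (\forall n \near ultraN, u n <= v n) -> l <= m.
Proof. by move=> ul vm uv; apply: ler_cvg_to ul vm uv. Qed.

Lemma ultra_lec (u : nat -> R) (l m : R) : u @ ultraN --> l ->
  (\forall n \near ultraN, u n <= m) -> l <= m.
Proof. by move=> ul uv; apply: ultra_le ul (cvg_cst m) uv. Qed.

Lemma ultra_gec (u : nat -> R) (l m : R) : u @ ultraN --> l ->
  (\forall n \near ultraN, m <= u n) -> m <= l.
Proof. by move=> ul uv; apply: ultra_le (cvg_cst m) ul uv. Qed.

Lemma ultra_eq (u : nat -> R) (l m : R) :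
  u @ ultraN --> l -> u @ ultraN --> m -> l = m.
Proof. by move=> /ulimE <- /ulimE <-. Qed.

Lemma ultraP (u : nat -> R) (l : R) : u @ ultraN --> l <->
  (forall e, 0 < e -> \forall n \near ultraN, `|u n - l| <= e).
Proof.
split => [ul e e0|h].
  by have /cvgrPdist_le/(_ e e0) := ul; apply: filterS => n; rewrite distrC.
by apply/cvgrPdist_le => e e0; have := h e e0; apply: filterS => n; rewrite distrC.
Qed.

Lemma ultra_squeeze (u v : nat -> R) (l : R) : v @ ultraN --> (0 : R) ->
  (\forall n \near ultraN, `|u n - l| <= v n) -> u @ ultraN --> l.
Proof.
move=> v0 h; apply/ultraP => e e0.
have /ultraP/(_ e e0) := v0.
by apply: filterS2 h => n h1; rewrite subr0 => /ler_normlW; apply: le_trans.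
Qed.

Lemma ultra_sum m (F : nat -> 'I_m -> R) (l : 'I_m -> R) :
  (forall i, F n i @[n --> ultraN] --> l i) ->
  \sum_(i < m) F n i @[n --> ultraN] --> \sum_(i < m) l i.
Proof.
elim: m F l => [|m IH] F l Fl.
  under eq_fun do rewrite big_ord0.
  by rewrite big_ord0; exact: cvg_cst.
under eq_fun do rewrite big_ord_recr.
by rewrite big_ord_recr; apply: cvgD => //; apply: IH.
Qed.

Lemma choose_seq (T : Type) (P : nat -> T -> Prop) :
  (forall n, exists x, P n x) -> exists u : nat -> T, forall n, P n (u n).
Proof. by move=> /(_ _)/cid h; exists (fun n => sval (h n)) => n; case: (h n). Qed.

End Ultralimit.

(** * Measures as functionals on continuous functions *)

Section Functionals.
Context {R : realType} {X : pseudoMetricType R}.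
Implicit Types (f g : X -> R) (Y : set X) (s a : (X -> R) -> R).

Lemma cont_cst (c : R) : continuous (fun _ : X => c).
Proof. by move=> x; exact: cvg_cst. Qed.
Lemma cont_add f g : continuous f -> continuous g -> continuous (fun x => f x + g x).
Proof. by move=> cf cg x; exact: continuousD (cf x) (cg x). Qed.
Lemma cont_opp f : continuous f -> continuous (fun x => - f x).
Proof. by move=> cf x; exact: continuousN (cf x). Qed.
Lemma cont_mul f g : continuous f -> continuous g -> continuous (fun x => f x * g x).
Proof. by move=> cf cg x; exact: continuousM (cf x) (cg x). Qed.
Lemma cont_inv f : (forall x, 0 < f x) -> continuous f -> continuous (fun x => (f x)^-1).
Proof. by move=> f0 cf x; apply: (@cvgV _ _ (nbhs x) _ f (f x)) => //; [by rewrite gt_eqF|exact: cf]. Qed.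
Lemma cont_sqr f : continuous f -> continuous (fun x => f x ^+ 2).
Proof. by move=> cf; exact: cont_mul. Qed.
Lemma cont_max f g : continuous f -> continuous g -> continuous (fun x => Num.max (f x) (g x)).
Proof. by move=> cf cg x; exact: (continuous_max (cf x) (cg x)). Qed.
Lemma cont_norm f : continuous f -> continuous (fun x => `|f x|).
Proof. by move=> cf x; exact: cvg_norm (cf x). Qed.
Lemma cont_sum n (F : 'I_n -> X -> R) : (forall i, continuous (F i)) ->
  continuous (fun x => \sum_(i < n) F i x).
Proof.
elim: n F => [|n IH] F cF.
  rewrite (_ : (fun x => _) = (fun _ => 0)); first exact: cont_cst.
  by apply/funext => x; rewrite big_ord0.
rewrite (_ : (fun x => _) = (fun x => \sum_(i < n) F (widen_ord (leqnSn n) i) x + F ord_max x)).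
  by apply: cont_add => //; apply: IH.
by apply/funext => x; rewrite big_ord_recr.
Qed.

Definition linC s := forall f g (c : R), continuous f -> continuous g ->
  s (fun x => c * f x + g x) = c * s f + s g.

(* Signed measures of total variation at most [M]. *)
Definition bdf (M : R) s := linC s /\
  forall f (e : R), continuous f -> 0 <= e -> (forall x, `|f x| <= e) -> `|s f| <= M * e.

(* Positive measures carried by the closure of [Y]. *)
Definition posfun Y a := linC a /\
  forall f, continuous f -> (forall y, Y y -> 0 <= f y) -> 0 <= a f.

Definition mass a : R := a (fun _ => 1).

Section Linear.
Context s (ls : linC s).

Lemma lin0 : s (fun _ => 0) = 0.
Proof.
have := @ls (fun _ => 0) (fun _ => 0) 1 (@cont_cst 0) (@cont_cst 0).
rewrite (_ : (fun _ => _) = fun _ => 0); first by lra.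
by apply/funext => x; rewrite mulr0 addr0.
Qed.

Lemma linD f g : continuous f -> continuous g -> s (fun x => f x + g x) = s f + s g.
Proof.
move=> cf cg; rewrite -[s f]mul1r -ls//; congr s.
by apply/funext => x; rewrite mul1r.
Qed.

Lemma linZ (c : R) f : continuous f -> s (fun x => c * f x) = c * s f.
Proof.
move=> cf; rewrite -[RHS]addr0 -lin0 -ls//; last exact: cont_cst.
by congr s; apply/funext => x; rewrite addr0.
Qed.

Lemma linZr (c : R) f : continuous f -> s (fun x => f x * c) = s f * c.
Proof.
by move=> cf; rewrite mulrC -linZ//; congr s; apply/funext => x; rewrite mulrC.
Qed.

Lemma linN f : continuous f -> s (fun x => - f x) = - s f.
Proof.
by move=> cf; rewrite -mulN1r -linZ//; congr s; apply/funext => x; rewrite mulN1r.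
Qed.

Lemma linB f g : continuous f -> continuous g -> s (fun x => f x - g x) = s f - s g.
Proof. by move=> cf cg; rewrite linD ?linN//; exact: cont_opp. Qed.

Lemma lin_cst (c : R) : s (fun _ => c) = c * mass s.
Proof.
rewrite /mass -linZ; last exact: cont_cst.
by congr s; apply/funext => x; rewrite mulr1.
Qed.

Lemma lin_sum n (F : 'I_n -> X -> R) : (forall i, continuous (F i)) ->
  s (fun x => \sum_(i < n) F i x) = \sum_(i < n) s (F i).
Proof.
elim: n F => [|n IH] F cF.
  rewrite big_ord0 (_ : (fun x => _) = (fun _ => 0)); first exact: lin0.
  by apply/funext => x; rewrite big_ord0.
rewrite (_ : (fun x => _) = (fun x => \sum_(i < n) F (widen_ord (leqnSn n) i) x + F ord_max x)).
  by rewrite big_ord_recr linD ?IH//; apply: cont_sum.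
by apply/funext => x; rewrite big_ord_recr.
Qed.

End Linear.

Lemma linC_comb s a (c d : R) : linC s -> linC a -> linC (fun f => c * s f + d * a f).
Proof. by move=> ls la f g e cf cg; rewrite ls// la//; ring. Qed.

Lemma linC_sub s a : linC s -> linC a -> linC (fun f => s f - a f).
Proof. by move=> ls la f g e cf cg; rewrite ls// la//; ring. Qed.

Lemma bdf_comb s a (M M' c d : R) : bdf M s -> bdf M' a ->
  bdf (`|c| * M + `|d| * M') (fun f => c * s f + d * a f).
Proof.
move=> [ls bs] [la ba]; split; first exact: linC_comb.
move=> f e cf e0 fe; rewrite mulrDl.
apply: (le_trans (ler_normD _ _)); apply: lerD; rewrite normrM -mulrA;
  apply: ler_wpM2l => //; [exact: bs|exact: ba].
Qed.

Lemma bdf_sub s a (M M' : R) : bdf M s -> bdf M' a -> bdf (M + M') (fun f => s f - a f).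
Proof.
move=> [ls bs] [la ba]; split; first exact: linC_sub.
move=> f e cf e0 fe; rewrite mulrDl.
by apply: (le_trans (ler_normB _ _)); apply: lerD; [exact: bs|exact: ba].
Qed.

Lemma bdf_le s (M M' : R) : M <= M' -> bdf M s -> bdf M' s.
Proof.
move=> MM [ls bs]; split => // f e cf e0 fe.
by apply: (le_trans (bs f e cf e0 fe)); apply: ler_wpM2r.
Qed.

End Functionals.

(** * Kernels and their dual norm *)

Section Kernel.
Context {R : realType} {X : pseudoMetricType R}.

(* [f] lies in the RKHS of [k], with squared norm at most [C]. *)
Definition hb (k : X -> X -> R) (f : X -> R) (C : R) : Prop := 0 <= C /\
  forall (n : nat) (x : 'I_n -> X) (a : 'I_n -> R),
    (\sum_(i < n) a i * f (x i)) ^+ 2 <=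
    C * \sum_(i < n) \sum_(j < n) a i * a j * k (x i) (x j).

Record pdkernel := PDKernel {
  ker :> X -> X -> R;
  kmin : R;
  gk_compact : compact [set: X];
  gk_cont : continuous (fun p : X * X => ker p.1 p.2);
  gk_sym : forall x y, ker x y = ker y x;
  gk_kap : 0 < kmin;
  gk_low : forall x y, kmin <= ker x y;
  gk_up : forall x y, ker x y <= 1;
  gk_psd : forall (n : nat) (x : 'I_n -> X) (a : 'I_n -> R),
     0 <= \sum_(i < n) \sum_(j < n) a i * a j * ker (x i) (x j);
  gk_univ : forall f : X -> R, continuous f -> forall d : R, 0 < d ->
     exists h C, hb ker h C /\ forall x, `|f x - h x| <= d }.

(** The double integral of [k] against [s] and [t], that is the scalar product of [H s] and [H t] in
    the RKHS. Computing with measures through this form avoids constructing the RKHS as a Hilbert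
    space. *)
Definition kdot (k : X -> X -> R) (s t : (X -> R) -> R) : R := s (Hop k t).

Context {K : pdkernel}.
Local Notation k := (ker K).
Implicit Types (f g : X -> R) (s t : (X -> R) -> R).
Local Notation H := (Hop k).
Local Notation dot := (kdot k).

Lemma gk_pos x y : 0 < k x y.
Proof. exact: lt_le_trans (gk_kap K) (gk_low K x y). Qed.

Lemma cont_kl y : continuous (fun x => k x y).
Proof.
move=> x; apply: (@continuous_comp X (X * X)%type R (fun x => (x, y)) (fun p => k p.1 p.2)).
  by apply: cvg_pair; [exact: cvg_id|exact: cvg_cst].
exact: (@gk_cont K).
Qed.

Lemma cont_kd : continuous (fun x => k x x).
Proof.
move=> x; apply: (@continuous_comp X (X * X)%type R (fun x => (x, x)) (fun p => k p.1 p.2)).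
  by apply: cvg_pair; exact: cvg_id.
exact: (@gk_cont K).
Qed.

(** The squared RKHS distance between [k(x, .)] and [k(y, .)]. It gives a continuous semimetric for
    which every element of the RKHS is Lipschitz; nets and moduli of continuity refer to it. *)
Definition ker_sqdist x y : R := k x x - 2 * k x y + k y y.
Definition ker_dist x y : R := Num.sqrt (ker_sqdist x y).

Lemma cont_kD y : continuous (fun x => ker_sqdist x y).
Proof.
apply: cont_add; last exact: cont_cst.
apply: cont_add; first exact: cont_kd.
by apply: cont_opp; apply: cont_mul; [exact: cont_cst|exact: cont_kl].
Qed.

Lemma kDxx x : ker_sqdist x x = 0. Proof. by rewrite /ker_sqdist; ring. Qed.

Lemma kD_sym x y : ker_sqdist x y = ker_sqdist y x. Proof. by rewrite /ker_sqdist (gk_sym K x y); ring. Qed.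

Lemma psd3 x y z (a b c : R) :
  0 <= a ^+ 2 * k x x + b ^+ 2 * k y y + c ^+ 2 * k z z
     + 2 * (a * b * k x y + a * c * k x z + b * c * k y z).
Proof.
have := gk_psd K (fun i : 'I_3 => nth x [:: x; y; z] i) (fun i => nth 0 [:: a; b; c] i).
rewrite !big_ord_recr !big_ord0 /=.
rewrite (gk_sym K y x) (gk_sym K z x) (gk_sym K z y).
by move=> h; apply: le_trans h _; rewrite le_eqVlt; apply/orP; left; apply/eqP; ring.
Qed.

Lemma kD_ge0 x y : 0 <= ker_sqdist x y.
Proof. by have := psd3 x y y 1 (-1) 0; rewrite /ker_sqdist; lra. Qed.

Lemma quad_disc (A B C : R) : (forall x y, 0 <= x ^+ 2 * A + 2 * x * y * B + y ^+ 2 * C) ->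
  B ^+ 2 <= A * C.
Proof.
move=> h; have A0 : 0 <= A by have := h 1 0; rewrite expr1n !(mulr0, mul0r, expr0n)/=; lra.
have [Ae|An0] := eqVneq A 0.
  have C0 : 0 <= C by have := h 0 1; rewrite expr1n !(mulr0, mul0r, expr0n)/=; lra.
  rewrite Ae mul0r leNgt; apply/negP => B0.
  have Bn0 : B != 0 by rewrite -sqrf_eq0 gt_eqF.
  have := h (- ((C + 1) / B)) 1.
  have : (C + 1) / B * B = C + 1 by rewrite divfK.
  by move: (_ / B) => u uB; rewrite Ae mulr0 expr1n mul1r mulr1; lra.
have Ap : 0 < A by rewrite lt_neqAle eq_sym An0.
have := h (- B) A.
rewrite (_ : _ + _ = A * (A * C - B ^+ 2)); last by ring.
by rewrite pmulr_rge0// subr_ge0.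
Qed.

(** Cauchy-Schwarz between [k(x, .) - k(x', .)] and [k(y, .)], from positivity on three points,
    followed by [k y y <= 1]. *)
Lemma k_lip2 x x' y : (k x y - k x' y) ^+ 2 <= ker_sqdist x x'.
Proof.
have : (k x y - k x' y) ^+ 2 <= ker_sqdist x x' * k y y.
  apply: quad_disc => a b; have := psd3 x x' y a (- a) b.
  move=> h; apply: le_trans h _; rewrite le_eqVlt; apply/orP; left; apply/eqP.
  by rewrite /ker_sqdist; ring.
move=> h; apply: (le_trans h); rewrite ler_piMr ?kD_ge0//; exact: (gk_up K).
Qed.

Lemma sq_abs_sqrt (u v : R) : u ^+ 2 <= v -> `|u| <= Num.sqrt v.
Proof. by move=> h; rewrite -sqrtr_sqr ler_wsqrtr. Qed.

Lemma sqrt_le_sq (u v : R) : 0 <= v -> u <= v ^+ 2 -> Num.sqrt u <= v.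
Proof. by move=> v0 h; rewrite -(ger0_norm v0) -sqrtr_sqr ler_wsqrtr. Qed.

Lemma sq_le_sqrt (u v : R) : 0 <= v -> u ^+ 2 <= v -> u <= Num.sqrt v.
Proof. by move=> v0 /sq_abs_sqrt; apply: le_trans; exact: ler_norm. Qed.

Definition lipk (L : R) f := 0 <= L /\ forall x y, `|f x - f y| <= L * ker_dist x y.

Lemma kd_ge0 x y : 0 <= ker_dist x y. Proof. exact: sqrtr_ge0. Qed.
Lemma lipk_kl y : lipk 1 (fun x => k x y).
Proof. by split => // x x'; rewrite mul1r; apply: sq_abs_sqrt; exact: k_lip2. Qed.

Lemma cont_kd_at x : ker_dist z x @[z --> x] --> (0 : R).
Proof.
have -> : (0 : R) = Num.sqrt (ker_sqdist x x) by rewrite kDxx sqrtr0.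
exact: (continuous_comp (cont_kD (x := x)) (@sqrt_continuous R _)).
Qed.

Lemma lipk_cont L f : lipk L f -> continuous f.
Proof.
move=> [L0 lf] x; apply/cvgrPdist_le => e e0.
have : L * ker_dist z x @[z --> x] --> L * 0 by apply: cvgMr; exact: cont_kd_at.
rewrite mulr0 => /cvgrPdist_le/(_ e e0); apply: filterS => z.
rewrite sub0r normrN => /ler_normlW hz; rewrite distrC; exact: le_trans (lf _ _) hz.
Qed.

Lemma hb_ge0 f C : hb k f C -> 0 <= C. Proof. by case. Qed.

Lemma hb_lip f C : hb k f C -> lipk (Num.sqrt C) f.
Proof.
move=> [C0 hf]; split; first exact: sqrtr_ge0.
move=> x y; rewrite -sqrtrM//; apply: sq_abs_sqrt.
have := hf _ (fun i : 'I_2 => nth x [:: x; y] i) (fun i => nth 0 [:: 1; -1] i).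
rewrite !big_ord_recr !big_ord0 /= (gk_sym K y x).
rewrite (_ : _ + _ = f x - f y); last by ring.
by move=> h; apply: (le_trans h); rewrite le_eqVlt; apply/orP; left; apply/eqP; rewrite /ker_sqdist; ring.
Qed.

Lemma hb_cont f C : hb k f C -> continuous f.
Proof. by move=> /hb_lip/lipk_cont. Qed.

Lemma hb_sup f C x : hb k f C -> `|f x| <= Num.sqrt C.
Proof.
move=> [C0 hf]; apply: sq_abs_sqrt.
have := hf _ (fun i : 'I_1 => x) (fun i => 1).
rewrite !big_ord_recr !big_ord0 /= !add0r !mul1r => h.
by apply: (le_trans h); rewrite ler_piMr//; exact: (gk_up K).
Qed.

Lemma net (r : R) : 0 < r -> exists n (p : 'I_n -> X), forall x, exists i, ker_dist x (p i) < r.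
Proof.
move=> r0; have [[x0 _]|nx] := pselect ([set: X] !=set0); last first.
  by exists 0, (fun i : 'I_0 => match notF (ltn_ord i) with end) => x; exfalso; apply: nx; exists x.
pose PX := isPointed.Build X x0; pose XP : ptopologicalType := HB.pack X PX.
have : @compact XP setT by exact: (gk_compact K).
rewrite compact_cover => /(_ X setT (fun y => [set x | ker_sqdist x y < r ^+ 2])).
case.
- move=> y _; have -> : [set x | ker_sqdist x y < r ^+ 2] = (fun x => ker_sqdist x y) @^-1` [set z | z < r ^+ 2] by [].
  by apply: open_comp; [move=> ? _; exact: cont_kD|exact: open_lt].
- by move=> x _; exists x => //=; rewrite kDxx exprn_gt0.
- move=> D' _ cov; exists (size (finmap.enum_fset D')), (tnth (in_tuple (finmap.enum_fset D'))) => x.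
  have [y /= yD xy] := cov x I.
  have /(tnthP (in_tuple (finmap.enum_fset D')))[i yi] : y \in in_tuple (finmap.enum_fset D') by [].
  exists i; rewrite -yi /ker_dist -(ger0_norm (ltW r0)) -sqrtr_sqr ltr_sqrt//.
  by rewrite exprn_gt0.
Qed.

Lemma partition_of (r : R) n (p : 'I_n -> X) : 0 < r -> (forall x, exists i, ker_dist x (p i) < r) ->
  exists chi : 'I_n -> X -> R,
  [/\ forall i, continuous (chi i), forall i x, 0 <= chi i x,
      forall x, \sum_(i < n) chi i x = 1 &
      forall i x, chi i x != 0 -> ker_dist x (p i) <= r].
Proof.
move=> r0 np.
pose psi i x : R := Num.max 0 (r ^+ 2 - ker_sqdist x (p i)).
have cpsi i : continuous (psi i).
  apply: cont_max; first exact: cont_cst.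
  by apply: cont_add; [exact: cont_cst|apply: cont_opp; exact: cont_kD].
have psi0 i x : 0 <= psi i x by rewrite le_max lexx.
pose S x := \sum_(i < n) psi i x.
have S0 x : 0 < S x.
  have [i xi] := np x; rewrite /S (bigD1 i)//= ltr_pwDl//; last exact: sumr_ge0.
  rewrite lt_max subr_gt0 orbC; apply/orP; left.
  by rewrite -[ker_sqdist _ _]sqr_sqrtr ?kD_ge0// ltr_pXn2r ?nnegrE ?sqrtr_ge0// ltW.
exists (fun i x => psi i x * (S x)^-1); split.
- by move=> i; apply: cont_mul => //; apply: cont_inv => //; exact: cont_sum.
- by move=> i x; rewrite mulr_ge0// invr_ge0 ltW.
- by move=> x; rewrite -mulr_suml; exact: divff (lt0r_neq0 (S0 x)).
- move=> i x; apply: contraR; rewrite -ltNge => rx.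
  rewrite /psi max_l ?mul0r// subr_le0 -[ker_sqdist _ _]sqr_sqrtr ?kD_ge0//.
  by rewrite ler_pXn2r ?nnegrE ?sqrtr_ge0 ?ltW.
Qed.

Lemma bdf_H M s : 0 <= M -> bdf M s -> lipk M (H s).
Proof.
move=> M0 [ls bs]; split => // x y.
rewrite /Hop -(linB ls); try exact: cont_kl.
apply: bs; [|exact: kd_ge0|].
  by apply: cont_add; [|apply: cont_opp]; exact: cont_kl.
move=> z; rewrite (gk_sym K z x) (gk_sym K z y).
by have [_ /(_ x y)] := lipk_kl z; rewrite mul1r.
Qed.

Lemma cont_H M s : bdf M s -> continuous (H s).
Proof.
move=> bs; apply: (@lipk_cont (Num.max 0 M)); apply: bdf_H; first by rewrite le_max lexx.
by apply: bdf_le bs; rewrite le_max lexx orbT.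
Qed.

Lemma H_sup M s x : bdf M s -> `|H s x| <= M.
Proof.
move=> [ls bs]; rewrite -[M]mulr1; apply: bs => //; first exact: cont_kl.
by move=> y; rewrite gtr0_norm ?gk_pos//; exact: (gk_up K).
Qed.

(* Take [a i = s (chi i)] for a partition of unity [chi] subordinate to the net [p]. *)
Lemma atomic_of s (r : R) n (p : 'I_n -> X) : 0 < r -> (forall x, exists i, ker_dist x (p i) < r) ->
  exists a : 'I_n -> R, forall M, 0 <= M -> bdf M s ->
  [/\ forall f L, lipk L f -> `|s f - \sum_(i < n) a i * f (p i)| <= M * (L * r),
    forall (c : 'I_n -> R) e, 0 <= e -> (forall i, `|c i| <= e) ->
     `|\sum_(i < n) a i * c i| <= M * e &
    (forall f, continuous f -> (forall x, 0 <= f x) -> 0 <= s f) -> forall i, 0 <= a i].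
Proof.
move=> r0 np; have [chi [cc c0 c1 cr]] := partition_of r0 np.
exists (fun i => s (chi i)) => M M0 [ls bs].
have sc (c : 'I_n -> R) : \sum_(i < n) s (chi i) * c i = s (fun x => \sum_(i < n) chi i x * c i).
  rewrite lin_sum//; first by apply: eq_bigr => i _; rewrite linZr.
  by move=> i; apply: cont_mul => //; exact: cont_cst.
have cS (c : 'I_n -> R) : continuous (fun x => \sum_(i < n) chi i x * c i).
  by apply: cont_sum => i; apply: cont_mul => //; exact: cont_cst.
split; last by move=> ps i; apply: ps.
  move=> f L lf; have cf := lipk_cont lf; have [L0 lf'] := lf.
  rewrite sc -linB//; apply: bs.
  - by apply: cont_add => //; exact: cont_opp.
  - by rewrite mulr_ge0// ltW.
  - move=> x; rewrite -[f x]mul1r -(c1 x) mulr_suml -sumrB.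
    apply: (le_trans (ler_norm_sum _ _ _)).
    rewrite -[leRHS]mul1r -(c1 x) mulr_suml; apply: ler_sum => i _.
    rewrite -mulrBr normrM ger0_norm//.
    have [->|cn0] := eqVneq (chi i x) 0; first by rewrite !mul0r.
    apply: ler_wpM2l => //; apply: (le_trans (lf' _ _)).
    by apply: ler_wpM2l => //; exact: cr.
move=> c e e0 ce; rewrite sc; apply: bs => // x.
apply: (le_trans (ler_norm_sum _ _ _)).
rewrite -[leRHS]mul1r -(c1 x) mulr_suml; apply: ler_sum => i _.
by rewrite normrM ger0_norm//; apply: ler_wpM2l.
Qed.

Lemma atomic M s (r : R) : 0 <= M -> bdf M s -> 0 < r ->
  exists n (p : 'I_n -> X) (a : 'I_n -> R),
  (forall f L, lipk L f -> `|s f - \sum_(i < n) a i * f (p i)| <= M * (L * r)) /\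
  (forall (c : 'I_n -> R) e, 0 <= e -> (forall i, `|c i| <= e) ->
     `|\sum_(i < n) a i * c i| <= M * e).
Proof.
move=> M0 bs r0; have [n [p np]] := net r0; have [a ha] := atomic_of s r0 np.
by have [h1 h2 _] := ha M M0 bs; exists n, p, a.
Qed.

Lemma le_eps_eq (x y C : R) : (forall r, 0 < r -> `|x - y| <= C * r) -> x = y.
Proof.
move=> h; apply/eqP; rewrite -subr_eq0 -normr_le0; apply/ler_addgt0Pr => e e0.
have C1 : 0 < Num.max 0 C + 1 by rewrite ltr_wpDl// le_max lexx.
have C2 : C <= Num.max 0 C by rewrite le_max lexx orbT.
have re : 0 < e / (Num.max 0 C + 1) by rewrite divr_gt0.
have h' := h _ re; rewrite add0r; apply: (le_trans h').
have := mulfVK (lt0r_neq0 C1) e; move: re; move: (_ / _) => u u0 ue.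
nra.
Qed.

(** Fubini's theorem for abstract functionals: for atomic [s] it is the linearity of [t], and a
    general [s] is approximated by atoms uniformly on functions with a common Lipschitz constant,
    such as [H t] and the [k(., y)]. *)
Lemma dot_sym M M' s t : 0 <= M -> 0 <= M' -> bdf M s -> bdf M' t -> dot s t = dot t s.
Proof.
move=> M0 M'0 bs bt; apply: (@le_eps_eq _ _ (M * M' + M' * M)) => r r0.
have [n [p [a [h1 h2]]]] := atomic M0 bs r0.
have e1 := h1 _ _ (bdf_H M'0 bt).
have ls := bs.1; have lt_ := bt.1.
rewrite mulrDl -!mulrA (_ : _ - _ = (dot s t - \sum_(i < n) a i * H t (p i)) +
  (\sum_(i < n) a i * H t (p i) - dot t s)); last by ring.
apply: (le_trans (ler_normD _ _)); apply: lerD => //.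
rewrite (_ : \sum_(i < n) a i * H t (p i) = t (fun y => \sum_(i < n) a i * k y (p i))); last first.
  rewrite lin_sum//; last by move=> i; apply: cont_mul; [exact: cont_cst|exact: cont_kl].
  by apply: eq_bigr => i _; rewrite linZ//; exact: cont_kl.
have cS : continuous (fun y => \sum_(i < n) a i * k y (p i)).
  by apply: cont_sum => i; apply: cont_mul; [exact: cont_cst|exact: cont_kl].
have cH := cont_H bs.
rewrite /kdot -linB//; apply: bt.2.
- by apply: cont_add => //; exact: cont_opp.
- by rewrite mulr_ge0// ltW.
- move=> y; rewrite distrC.
  have := h1 _ _ (lipk_kl y); rewrite mul1r /Hop => h; apply: le_trans h.
  rewrite le_eqVlt; apply/orP; left; apply/eqP; congr `|_|; congr (_ - _).
  by apply: eq_bigr => i _; rewrite (gk_sym K).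
Qed.

(** The atomic approximation is applied once to [H s] and once to each [k(., p i)], each time at the
    cost [M * (M * r)]. It transfers inequalities on finite Gram matrices to arbitrary measures. *)
Lemma dot_atomic M s : 0 <= M -> bdf M s -> forall r, 0 < r ->
  exists n (p : 'I_n -> X) (a : 'I_n -> R),
  (forall f L, lipk L f -> `|s f - \sum_(i < n) a i * f (p i)| <= M * (L * r)) /\
  `|dot s s - \sum_(i < n) \sum_(j < n) a i * a j * k (p i) (p j)| <= 2 * M ^+ 2 * r.
Proof.
move=> M0 bs r r0; have [n [p [a [h1 h2]]]] := atomic M0 bs r0.
exists n, p, a; split => //.
have e1 := h1 _ _ (bdf_H M0 bs).
rewrite (_ : _ - _ = (dot s s - \sum_(i < n) a i * H s (p i)) +
  \sum_(i < n) a i * (H s (p i) - \sum_(j < n) a j * k (p i) (p j))).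
  apply: (le_trans (ler_normD _ _)).
  rewrite (_ : 2 * _ * r = M * (M * r) + M * (M * r)); last by ring.
  apply: lerD => //; apply: h2; first by rewrite mulr_ge0// ltW.
  move=> i; have := h1 _ _ (lipk_kl (p i)); rewrite mul1r => h; apply: le_trans h.
  rewrite le_eqVlt; apply/orP; left; apply/eqP; congr `|_|; congr (_ - _).
  by apply: eq_bigr => j _; rewrite (gk_sym K).
under [X in _ = _ + X]eq_bigr do rewrite mulrBr.
rewrite sumrB addrA subrK; congr (_ - _); apply: eq_bigr => i _.
by rewrite mulr_sumr; apply: eq_bigr => j _; rewrite mulrA.
Qed.

Lemma dot_ge0 M s : 0 <= M -> bdf M s -> 0 <= dot s s.
Proof.
move=> M0 bs; apply/ler_addgt0Pr => e e0.
have C1 : 0 < 2 * M ^+ 2 + 1 by rewrite ltr_wpDl// mulr_ge0// sqr_ge0.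
have r0 : 0 < e / (2 * M ^+ 2 + 1) by rewrite divr_gt0.
have [n [p [a [_ h]]]] := dot_atomic M0 bs r0.
have := gk_psd K p a.
have : 2 * M ^+ 2 * (e / (2 * M ^+ 2 + 1)) <= e.
  by rewrite mulrCA ler_piMr ?ltW// ltr_pdivrMr// mul1r ltrDl.
by move: h; rewrite ler_norml => /andP[]; lra.
Qed.

Lemma H_lin s t (c d : R) : H (fun f => c * s f + d * t f) = fun x => c * H s x + d * H t x.
Proof. by []. Qed.

Lemma dot_linl s t s' (c d : R) :
  dot (fun f => c * s f + d * t f) s' = c * dot s s' + d * dot t s'.
Proof. by []. Qed.

Lemma dot_linr M M' s t s' (c d : R) : linC s' -> bdf M s -> bdf M' t ->
  dot s' (fun f => c * s f + d * t f) = c * dot s' s + d * dot s' t.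
Proof.
move=> ls' bs bt; rewrite /kdot H_lin linD//; last 2 first.
- by apply: cont_mul; [exact: cont_cst|exact: cont_H bs].
- by apply: cont_mul; [exact: cont_cst|exact: cont_H bt].
by rewrite !linZ//; [exact: cont_H bt|exact: cont_H bs].
Qed.

Lemma dot_CS M M' s t : 0 <= M -> 0 <= M' -> bdf M s -> bdf M' t ->
  dot s t ^+ 2 <= dot s s * dot t t.
Proof.
move=> M0 M'0 bs bt; apply: quad_disc => x y.
have bc := bdf_comb x y bs bt.
have := dot_ge0 _ bc; rewrite addr_ge0 ?mulr_ge0// => /(_ isT).
rewrite dot_linl (dot_linr _ _ _ bs bt); last exact: bs.1.
rewrite (dot_linr _ _ _ bs bt); last exact: bt.1.
rewrite (dot_sym M'0 M0 bt bs) => h; apply: (le_trans h).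
by rewrite le_eqVlt; apply/orP; left; apply/eqP; ring.
Qed.

Definition atoms n (p : 'I_n -> X) (a : 'I_n -> R) : (X -> R) -> R :=
  fun f => \sum_(i < n) a i * f (p i).

Lemma bdf_atoms n (p : 'I_n -> X) (a : 'I_n -> R) :
  bdf (\sum_(i < n) `|a i|) (atoms p a).
Proof.
split.
  move=> f g c cf cg; rewrite /atoms mulr_sumr -big_split; apply: eq_bigr => i _ /=; ring.
move=> f e cf e0 fe; apply: (le_trans (ler_norm_sum _ _ _)); rewrite mulr_suml.
by apply: ler_sum => i _; rewrite normrM ler_wpM2l.
Qed.

Lemma dot_atoms n (p : 'I_n -> X) (a : 'I_n -> R) :
  dot (atoms p a) (atoms p a) = \sum_(i < n) \sum_(j < n) a i * a j * k (p i) (p j).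
Proof.
rewrite /kdot /atoms /Hop; apply: eq_bigr => i _.
rewrite mulr_sumr; apply: eq_bigr => j _; rewrite (gk_sym K); ring.
Qed.

Lemma hb_H M s : 0 <= M -> bdf M s -> hb k (H s) (dot s s).
Proof.
move=> M0 bs; split; first exact: dot_ge0 bs.
move=> n x a; rewrite mulrC -dot_atoms.
apply: le_trans (dot_CS _ M0 (bdf_atoms x a) bs); last exact: sumr_ge0.
by [].
Qed.

(** For atomic [s] this is the definition of [hb]. The approximations of mesh [1 / (m + 1)] converge
    on [f], which is Lipschitz for [ker_dist], and in squared norm. *)
Lemma hb_CS M s f C : 0 <= M -> bdf M s -> hb k f C -> s f ^+ 2 <= C * dot s s.
Proof.
move=> M0 bs hf; have C0 := hb_ge0 hf; have lf := hb_lip hf.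
have [u hu] : exists u : nat -> R * R, forall m, [/\ `|s f - (u m).1| <= M * (Num.sqrt C * m.+1%:R^-1),
     `|dot s s - (u m).2| <= 2 * M ^+ 2 * m.+1%:R^-1 & (u m).1 ^+ 2 <= C * (u m).2].
  apply: (@choose_seq _ (fun m z => [/\ `|s f - z.1| <= M * (Num.sqrt C * m.+1%:R^-1),
     `|dot s s - z.2| <= 2 * M ^+ 2 * m.+1%:R^-1 & z.1 ^+ 2 <= C * z.2])) => m.
  have r0 : (0 : R) < m.+1%:R^-1 by rewrite invr_gt0.
  have [n [p [a [h1 h2]]]] := dot_atomic M0 bs r0.
  exists (\sum_(i < n) a i * f (p i), \sum_(i < n) \sum_(j < n) a i * a j * k (p i) (p j)).
  by split => //=; [exact: h1|exact: hf.2].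
have r0 : (fun n => n.+1%:R^-1 : R) @ ultraN --> (0 : R) by exact: cvg_ultraN_harmonic.
have u1 : (fun n => (u n).1) @ ultraN --> s f.
  apply: (@ultra_squeeze _ _ (fun n => M * Num.sqrt C * n.+1%:R^-1)).
    by rewrite -[X in _ --> X](mulr0 (M * Num.sqrt C)); apply: cvgMr.
  by apply: nearW => n; have [h _ _] := hu n; rewrite distrC -mulrA.
have u2 : (fun n => (u n).2) @ ultraN --> dot s s.
  apply: (@ultra_squeeze _ _ (fun n => 2 * M ^+ 2 * n.+1%:R^-1)).
    by rewrite -[X in _ --> X](mulr0 (2 * M ^+ 2)); apply: cvgMr.
  by apply: nearW => n; have [_ h _] := hu n; rewrite distrC.
apply: (ultra_le (u := fun n => (u n).1 * (u n).1) (v := fun n => C * (u n).2)).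
- by rewrite expr2; apply: cvgM.
- by apply: cvgMr.
- by apply: nearW => n; have [_ _] := hu n; rewrite expr2.
Qed.

Lemma hb_CS_abs M s f C : 0 <= M -> bdf M s -> hb k f C ->
  `|s f| <= Num.sqrt C * Num.sqrt (dot s s).
Proof.
move=> M0 bs hf; rewrite -sqrtrM; last by case: hf.
by apply: sq_abs_sqrt; exact: hb_CS bs hf.
Qed.

Lemma H_sup_dot M s x : 0 <= M -> bdf M s -> `|H s x| <= Num.sqrt (dot s s).
Proof. by move=> M0 bs; apply: hb_sup; exact: hb_H bs. Qed.

Lemma dot_sup M M' s t : 0 <= M -> 0 <= M' -> bdf M s -> bdf M' t ->
  `|dot s t| <= Num.sqrt (dot s s) * Num.sqrt (dot t t).
Proof. by move=> M0 M'0 bs bt; rewrite mulrC; apply: hb_CS_abs bs _ => //; exact: hb_H bt. Qed.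

(** Universality makes the kernel embedding of measures injective: [s] vanishes on the RKHS, hence
    on a dense set of continuous functions. *)
Lemma dot_nondeg M s : 0 <= M -> bdf M s -> dot s s <= 0 ->
  forall f, continuous f -> s f = 0.
Proof.
move=> M0 bs n0 f cf; apply: (@le_eps_eq _ _ M) => r r0.
have [h [C [hh fh]]] := gk_univ K cf r0.
have sh : s h = 0.
  apply/eqP; rewrite -sqrf_eq0 eq_le sqr_ge0 andbT.
  apply: (le_trans (hb_CS M0 bs hh)); apply: mulr_ge0_le0 => //; exact: hb_ge0 hh.
have ch := hb_cont hh.
rewrite subr0 -[s f]subr0 -sh -(linB bs.1)//; apply: bs.2 => //; last exact: ltW.
by apply: cont_add => //; exact: cont_opp.
Qed.

End Kernel.

Arguments net {R X} K {r}.

(** * Positive measures, the skew operator and weak limits *)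

Section Measures.
Context {R : realType} {X : pseudoMetricType R}.
Context {K : @pdkernel R X}.
Local Notation k := (ker K).
Local Notation kap := (kmin K).
Implicit Types (f g : X -> R) (s t a b : (X -> R) -> R) (Y : set X) (e M L C r d G : R).
Local Notation H := (Hop k).
Local Notation dot := (kdot k).

Lemma posfun_mono Y a f g : posfun Y a -> continuous f -> continuous g ->
  (forall y, Y y -> f y <= g y) -> a f <= a g.
Proof.
move=> [la pa] cf cg fg; rewrite -subr_ge0 -linB//; apply: pa.
  by apply: cont_add => //; exact: cont_opp.
by move=> y /fg; rewrite subr_ge0.
Qed.

Lemma posfun_eq Y a f g : posfun Y a -> continuous f -> continuous g ->
  (forall y, Y y -> f y = g y) -> a f = a g.
Proof.
move=> pa cf cg fg; apply/eqP; rewrite eq_le; apply/andP.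
by split; apply: (posfun_mono pa) => // y /fg ->.
Qed.

Lemma mass_ge0 Y a : posfun Y a -> 0 <= mass a.
Proof. by move=> [_ pa]; apply: pa => //; exact: cont_cst. Qed.

Lemma posfun_bd Y a f e : posfun Y a -> continuous f ->
  (forall y, Y y -> `|f y| <= e) -> `|a f| <= mass a * e.
Proof.
move=> pa cf fe; rewrite ler_norml; apply/andP; split.
  rewrite mulrC -mulNr -(lin_cst pa.1); apply: (posfun_mono pa) => //; first exact: cont_cst.
  by move=> y /fe; rewrite ler_norml => /andP[].
rewrite mulrC -(lin_cst pa.1); apply: (posfun_mono pa) => //; first exact: cont_cst.
by move=> y /fe; rewrite ler_norml => /andP[].
Qed.

Lemma posfun_bdf Y a : posfun Y a -> bdf (mass a) a.
Proof.
move=> pa; split; first exact: pa.1.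
by move=> f e cf e0 fe; exact: posfun_bd pa cf _.
Qed.

Lemma posfun_sub Y Y' a : Y `<=` Y' -> posfun Y a -> posfun Y' a.
Proof. by move=> YY [la pa]; split => // f cf f0; apply: pa => // y /YY /f0. Qed.

Lemma posfun_T Y a : posfun Y a -> posfun setT a.
Proof. exact: posfun_sub. Qed.

Lemma posfun0 Y : posfun Y (fun _ => 0).
Proof. by split => // f g c _ _; rewrite mulr0 addr0. Qed.

Lemma posfunD Y a b (c : R) : 0 <= c -> posfun Y a -> posfun Y b ->
  posfun Y (fun f => c * a f + b f).
Proof.
move=> c0 [la pa] [lb pb]; split.
  by move=> f g d cf cg; rewrite la// lb//; ring.
by move=> f cf f0; rewrite addr_ge0 ?mulr_ge0//; [exact: pa|exact: pb].
Qed.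

Lemma posfun_dirac Y y : Y y -> posfun Y (fun f => f y).
Proof. by move=> Yy; split => // f _; apply. Qed.

Lemma cont_bdd f : continuous f -> exists M : R, 0 <= M /\ forall x, `|f x| <= M.
Proof.
move=> cf; have : compact (range f).
  by apply: continuous_compact; [apply: continuous_subspaceT|exact: (gk_compact K)].
move/compact_bounded => [M [Mr hM]].
exists (Num.max 0 (M + 1)); split; first by rewrite le_max lexx.
move=> x; apply: (@le_trans _ _ (M + 1)); last by rewrite le_max lexx orbT.
by apply: (hM (M + 1)); [rewrite ltrDl|exists x].
Qed.

Definition wt g s : (X -> R) -> R := fun f => s (fun x => g x * f x).

Lemma linC_wt g s : continuous g -> linC s -> linC (wt g s).
Proof.
move=> cg ls f h c cf ch; rewrite /wt -ls; try exact: cont_mul.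
by congr s; apply/funext => x; ring.
Qed.

Lemma bdf_wt g s M G : continuous g -> 0 <= G -> (forall x, `|g x| <= G) -> bdf M s ->
  bdf (M * G) (wt g s).
Proof.
move=> cg G0 gG [ls bs]; split; first exact: linC_wt.
move=> f e cf e0 fe; rewrite -mulrA; apply: bs; [exact: cont_mul|exact: mulr_ge0|].
by move=> x; rewrite normrM; apply: ler_pM.
Qed.

Lemma bdf_wt_ex g s M : 0 <= M -> continuous g -> bdf M s -> exists2 M', 0 <= M' & bdf M' (wt g s).
Proof.
move=> M0 cg bs; have [G [G0 gG]] := cont_bdd cg.
by exists (M * G); [exact: mulr_ge0|exact: bdf_wt].
Qed.

Lemma posfun_wt Y g a : continuous g -> (forall y, Y y -> 0 <= g y) -> posfun Y a -> posfun Y (wt g a).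
Proof.
move=> cg g0 [la pa]; split; first exact: linC_wt.
by move=> f cf f0; apply: pa; [exact: cont_mul|move=> y Yy; apply: mulr_ge0; [exact: g0|exact: f0]].
Qed.

(* Fubini: both sides are the double integral of [g(x) f(y) k(x,y)]. *)
Lemma kernel_fubini M M' s t f g : 0 <= M -> 0 <= M' -> bdf M s -> bdf M' t ->
  continuous f -> continuous g ->
  s (fun x => g x * H (wt f t) x) = t (fun y => f y * H (wt g s) y).
Proof.
move=> M0 M'0 bs bt cf cg.
have [Mf Mf0 bf] := bdf_wt_ex M'0 cf bt; have [Mg Mg0 bg] := bdf_wt_ex M0 cg bs.
exact: (dot_sym Mg0 Mf0 bg bf).
Qed.

Lemma cont_Hp Y a : posfun Y a -> continuous (H a).
Proof. by move=> /posfun_bdf; exact: cont_H. Qed.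

(** As the kernel is at least [kmin], the dual norm controls the mass on the cone of positive
    measures; this is the source of compactness throughout. *)
Lemma mass_dot Y a : posfun Y a -> kap * mass a ^+ 2 <= dot a a.
Proof.
move=> pa; have m0 := mass_ge0 pa.
have Hm x : kap * mass a <= H a x.
  rewrite -(lin_cst pa.1); apply: (posfun_mono pa); [exact: cont_cst|exact: cont_kl|].
  by move=> y _; exact: (gk_low K).
rewrite /kdot expr2 mulrA -(lin_cst pa.1).
by apply: (posfun_mono pa); [exact: cont_cst|exact: cont_Hp pa|move=> y _; exact: Hm].
Qed.

Lemma mass_le Y a : posfun Y a -> mass a <= 1 + dot a a / kap.
Proof.
move=> pa; have := mass_dot pa; rewrite mulrC -ler_pdivlMr ?(gk_kap K)// => h.
have := mass_ge0 pa; nra.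
Qed.

Lemma H_ge0 Y a x : posfun Y a -> 0 <= H a x.
Proof. by move=> [_ pa]; apply: pa => [|y _]; [exact: cont_kl|exact/ltW/gk_pos]. Qed.

Lemma H_low Y a x : posfun Y a -> kap * mass a <= H a x.
Proof.
move=> pa; rewrite -(lin_cst pa.1); apply: (posfun_mono pa); [exact: cont_cst|exact: cont_kl|].
by move=> y _; exact: (gk_low K).
Qed.

Lemma H_up Y a x : posfun Y a -> H a x <= mass a.
Proof.
move=> pa; apply: (posfun_mono pa); [exact: cont_kl|exact: cont_cst|].
by move=> y _; exact: (gk_up K).
Qed.

Lemma H_pos Y a x : posfun Y a -> 0 < dot a a -> 0 < H a x.
Proof.
move=> pa d0; apply: lt_le_trans (H_low x pa); rewrite mulr_gt0 ?(gk_kap K)//.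
rewrite lt_neqAle eq_sym (mass_ge0 pa) andbT; apply/eqP => m0; move: d0.
have := posfun_bd (e := mass a) pa (cont_Hp pa); rewrite m0 mul0r => h.
have : `|dot a a| <= 0.
  apply: h => y _; rewrite ger0_norm ?(H_ge0 _ pa)//; rewrite -m0; exact: H_up pa.
by rewrite normr_le0 => /eqP ->; rewrite ltxx.
Qed.

Lemma hb_le f C C' : C <= C' -> hb k f C -> hb k f C'.
Proof.
move=> CC [C0 h]; split; first exact: le_trans CC.
move=> n x a; apply: (le_trans (h n x a)); apply: ler_wpM2r => //; exact: (gk_psd K).
Qed.

Section Skew.
Variables (U : X -> R) (cU : continuous U).

(* Multiplication by [U] minus its adjoint, acting on [H s]; hence skew for [dot]. *)
Definition skew_op s y : R := U y * H s y - H (wt U s) y.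

Lemma cont_Aop M s : 0 <= M -> bdf M s -> continuous (skew_op s).
Proof.
move=> M0 bs; have [M' M'0 bw] := bdf_wt_ex M0 cU bs.
apply: cont_add; first by apply: cont_mul => //; exact: cont_H bs.
by apply: cont_opp; exact: cont_H bw.
Qed.

Lemma Aop_skew M M' s t : 0 <= M -> 0 <= M' -> bdf M s -> bdf M' t ->
  t (skew_op s) = t (fun x => U x * H s x) - s (fun x => U x * H t x).
Proof.
move=> M0 M'0 bs bt; have [Ms Ms0 bw] := bdf_wt_ex M0 cU bs.
rewrite /skew_op (linB bt.1); [|by apply: cont_mul => //; exact: cont_H bs|exact: cont_H bw].
congr (_ - _); rewrite -/(kdot k t (wt U s)) (dot_sym M'0 Ms0 bt bw) //.
Qed.

Lemma Aop_anti M M' s t : 0 <= M -> 0 <= M' -> bdf M s -> bdf M' t ->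
  t (skew_op s) = - s (skew_op t).
Proof.
by move=> M0 M'0 bs bt; rewrite (Aop_skew M0 M'0)// (Aop_skew M'0 M0)//; ring.
Qed.

Lemma Aop_self M s : 0 <= M -> bdf M s -> s (skew_op s) = 0.
Proof. by move=> M0 bs; rewrite (Aop_skew M0 M0)// subrr. Qed.

Lemma Aop_sub s t y : skew_op (fun f => s f - t f) y = skew_op s y - skew_op t y.
Proof. by rewrite /skew_op /Hop /wt; ring. Qed.

(** Universality gives an approximant for each [y] but no common norm bound. It is applied at the
    points of a finite net, and moving [y] to the net costs at most the sup norm of [U] times the
    mesh. *)
Lemma unif_univ e : 0 < e -> exists C, 0 <= C /\
  forall y, exists h, hb k h C /\ forall x, `|U x * k x y - h x| <= e.
Proof.
move=> e0; have [G [G0 gG]] := cont_bdd cU.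
have r0 : 0 < e / 2 / (G + 1) by rewrite !divr_gt0// ltr_wpDl.
have [n [p np]] := net K r0.
have hh i : exists hC : (X -> R) * R, hb k hC.1 hC.2 /\
    forall x, `|U x * k x (p i) - hC.1 x| <= e / 2.
  have e2 : 0 < e / 2 by rewrite divr_gt0.
  have cUk : continuous (fun x => U x * k x (p i)) by apply: cont_mul => //; exact: cont_kl.
  have [h [C hC]] := gk_univ K cUk e2.
  by exists (h, C).
have [hC hCP] := choice hh.
have C0 i : 0 <= (hC i).2 by have [/hb_ge0] := hCP i.
exists (\sum_(i < n) (hC i).2); split; first exact: sumr_ge0.
move=> y; have [i yi] := np y; exists (hC i).1; have [h1 h2] := hCP i; split.
  by apply: hb_le h1; rewrite (bigD1 i)//= lerDl sumr_ge0.
move=> x; rewrite (_ : _ - _ = U x * (k x y - k x (p i)) + (U x * k x (p i) - (hC i).1 x)); last by ring.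
apply: (le_trans (ler_normD _ _)); rewrite (splitr e); apply: lerD => //.
rewrite normrM; apply: (@le_trans _ _ (G * (e / 2 / (G + 1)))).
  apply: ler_pM; rewrite ?normr_ge0 ?gG // (gk_sym K x y) (gk_sym K x (p i)).
  by apply: le_trans (ltW yi); have [_ /(_ y (p i))] := lipk_kl (K := K) x; rewrite mul1r.
have G1 : 0 < G + 1 by rewrite ltr_wpDl.
rewrite mulrCA ler_piMr//; first by rewrite ltW// divr_gt0.
by rewrite ler_pdivrMr// mul1r lerDl.
Qed.

(** In [H (U s) y = s (U k(., y))] the test function need not lie in the RKHS, so the dual norm
    alone does not estimate [A]. The test function is replaced by an element of the RKHS of norm
    bounded uniformly in [y]: its pairing with [s] is small with the dual norm, and the error is
    paid by the total variation [M]. *)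
Lemma Aop_modulus M e : 0 <= M -> 0 < e -> exists2 d, 0 < d &
  forall s, bdf M s -> dot s s <= d -> forall x, `|skew_op s x| <= e.
Proof.
move=> M0 e0; have [G [G0 gG]] := cont_bdd cU.
have M1 : 0 < M + 1 by rewrite ltr_wpDl.
have e1 : 0 < e / 2 / (M + 1) by rewrite !divr_gt0.
have [C [C0 hC]] := unif_univ e1.
have GC : 0 < G + Num.sqrt C + 1 by rewrite ltr_wpDl// addr_ge0// sqrtr_ge0.
have q0 : 0 < e / 2 / (G + Num.sqrt C + 1) by rewrite !divr_gt0.
exists ((e / 2 / (G + Num.sqrt C + 1)) ^+ 2); first by rewrite exprn_gt0.
move=> s bs sd x.
have sq : Num.sqrt (dot s s) <= e / 2 / (G + Num.sqrt C + 1).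
  by apply: sqrt_le_sq => //; exact: ltW.
have [h [hh hx]] := hC x.
have ch := hb_cont hh.
have b1 : `|U x * H s x| <= G * Num.sqrt (dot s s).
  by rewrite normrM; apply: ler_pM => //; exact: H_sup_dot bs.
have cUk : continuous (fun x0 => U x0 * k x0 x) by apply: cont_mul => //; exact: cont_kl.
have b2 : `|H (wt U s) x| <= M * (e / 2 / (M + 1)) + Num.sqrt C * Num.sqrt (dot s s).
  rewrite /Hop /wt.
  rewrite (_ : s _ = s (fun x0 => U x0 * k x0 x - h x0) + s h); last first.
    by rewrite (linB bs.1 cUk ch) subrK.
  apply: (le_trans (ler_normD _ _)); apply: lerD; last exact: hb_CS_abs bs hh.
  by apply: bs.2 => //; [apply: cont_add => //; exact: cont_opp|exact: ltW].
apply: (le_trans (ler_normB _ _)).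
have b3 : M * (e / 2 / (M + 1)) <= e / 2.
  by rewrite mulrCA ler_piMr ?ltW ?divr_gt0// ltr_pdivrMr// mul1r ltrDl.
have b4 : (G + Num.sqrt C) * Num.sqrt (dot s s) <= e / 2.
  apply: (@le_trans _ _ ((G + Num.sqrt C) * (e / 2 / (G + Num.sqrt C + 1)))).
    by apply: ler_wpM2l => //; rewrite addr_ge0// sqrtr_ge0.
  by rewrite mulrCA ler_piMr ?ltW ?divr_gt0// ltr_pdivrMr// mul1r ltrDl.
lra.
Qed.

End Skew.

(** Arzela-Ascoli along the ultrafilter: control on a finite net extends to [X] by the common
    Lipschitz constant. *)
Lemma ultra_unif (f : nat -> X -> R) g L :
  (\forall n \near ultraN, lipk (K := K) L (f n)) -> (forall x, f n x @[n --> ultraN] --> g x) ->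
  lipk (K := K) L g /\ forall e, 0 < e -> \forall n \near ultraN, forall x, `|f n x - g x| <= e.
Proof.
move=> lf fg.
have L0 : 0 <= L by have /filter_ex [n []] := lf.
have lg : lipk (K := K) L g.
  split => // x y; apply: (ultra_lec (u := fun n => `|f n x - f n y|)).
    by apply: cvg_norm; apply: cvgB; exact: fg.
  by apply: filterS lf => n [_ /(_ x y)].
split => // e e0.
have L1 : 0 < L + 1 by rewrite ltr_wpDl.
have r0 : 0 < e / 3 / (L + 1) by rewrite !divr_gt0.
have [m [p np]] := net K r0.
have hp : \forall n \near ultraN, forall i, `|f n (p i) - g (p i)| <= e / 3.
  by apply: filter_forall => i; have /ultraP := fg (p i); apply; rewrite divr_gt0.
apply: filterS2 lf hp => n [_ lf] hp x; have [i xi] := np x.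
have hL : L * ker_dist (K := K) x (p i) <= e / 3.
  apply: (@le_trans _ _ (L * (e / 3 / (L + 1)))); first by apply: ler_wpM2l => //; exact: ltW.
  by rewrite mulrCA ler_piMr ?ltW ?divr_gt0// ltr_pdivrMr// mul1r ltrDl.
rewrite (_ : _ - _ = (f n x - f n (p i)) + (f n (p i) - g (p i)) - (g x - g (p i))); last by ring.
apply: (le_trans (ler_normB _ _)).
have h1 := ler_normD (f n x - f n (p i)) (f n (p i) - g (p i)).
have h2 := lf x (p i); have h3 := hp i; have h4 := lg.2 x (p i).
lra.
Qed.

Lemma ultra_joint (s : nat -> (X -> R) -> R) t (f : nat -> X -> R) g M : 0 <= M ->
  (\forall n \near ultraN, bdf M (s n)) ->
  s n g @[n --> ultraN] --> t g ->
  (\forall n \near ultraN, continuous (f n)) -> continuous g ->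
  (forall e, 0 < e -> \forall n \near ultraN, forall x, `|f n x - g x| <= e) ->
  s n (f n) @[n --> ultraN] --> t g.
Proof.
move=> M0 bs sg cf cg fg; apply/ultraP => e e0.
have M1 : 0 < M + 1 by rewrite ltr_wpDl.
have r0 : 0 < e / 2 / (M + 1) by rewrite !divr_gt0.
have /ultraP/(_ (e / 2)) := sg; rewrite divr_gt0// => /(_ isT) h1.
have h2 := fg _ r0; have h3 : \forall n \near ultraN, continuous (f n) /\ bdf M (s n) by apply: filterS2 cf bs.
move: h1 h2 h3; apply: filterS3 => n h1 h2 [cfn bn].
rewrite (_ : _ - _ = s n (fun x => f n x - g x) + (s n g - t g)); last first.
  by rewrite (linB bn.1)//; ring.
apply: (le_trans (ler_normD _ _)); rewrite (splitr e); apply: lerD => //.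
apply: (@le_trans _ _ (M * (e / 2 / (M + 1)))).
  by apply: bn.2 => //; [apply: cont_add => //; exact: cont_opp|exact: ltW].
by rewrite mulrCA ler_piMr ?ltW ?divr_gt0// ltr_pdivrMr// mul1r ltrDl.
Qed.

(** The weak limit of measures. Under a bound on total variation it exists on every continuous
    function, which is the Banach-Alaoglu compactness in the form used here. *)
Definition uls (s : nat -> (X -> R) -> R) : (X -> R) -> R := fun f => ulim (fun n => s n f).

Lemma uls_cvg (s : nat -> (X -> R) -> R) M f : (\forall n \near ultraN, bdf M (s n)) -> continuous f ->
  s n f @[n --> ultraN] --> uls s f.
Proof.
move=> bs cf; have [G [G0 fG]] := cont_bdd cf.
by apply: (@ulim_cvg _ _ (M * G)); apply: filterS bs => n [_ bn]; apply: bn.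
Qed.

Lemma uls_lin (s : nat -> (X -> R) -> R) M : (\forall n \near ultraN, bdf M (s n)) -> linC (uls s).
Proof.
move=> bs f g c cf cg; apply: ulimE.
have : (fun n => c * s n f + s n g) @ ultraN --> c * uls s f + uls s g.
  by apply: cvgD; [apply: cvgMr|]; exact: uls_cvg bs _.
by apply: cvg_trans; apply: near_eq_cvg; apply: filterS bs => n [ln _]; rewrite ln.
Qed.

Lemma uls_bdf (s : nat -> (X -> R) -> R) M : (\forall n \near ultraN, bdf M (s n)) -> bdf M (uls s).
Proof.
move=> bs; split; first exact: uls_lin bs.
move=> f e cf e0 fe; apply: (ultra_lec (cvg_norm (uls_cvg bs cf))).
by apply: filterS bs => n [_ bn]; apply: bn.
Qed.

Lemma uls_posfun (s : nat -> (X -> R) -> R) M Y : (\forall n \near ultraN, posfun Y (s n) /\ mass (s n) <= M) ->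
  posfun Y (uls s) /\ \forall n \near ultraN, bdf M (s n).
Proof.
move=> ps.
have bs : \forall n \near ultraN, bdf M (s n).
  by apply: filterS ps => n [pn mn]; apply: bdf_le mn (posfun_bdf pn).
split => //; split; first exact: uls_lin bs.
move=> f cf f0; apply: (ultra_gec (uls_cvg bs cf)).
by apply: filterS ps => n [[_ pn] _]; exact: pn.
Qed.

Lemma uls_H (s : nat -> (X -> R) -> R) M : 0 <= M -> (\forall n \near ultraN, bdf M (s n)) ->
  forall e, 0 < e -> \forall n \near ultraN, forall x, `|H (s n) x - H (uls s) x| <= e.
Proof.
move=> M0 bs; apply: (@ultra_unif _ _ M _ _).2.
  by apply: filterS bs => n; exact: bdf_H.
by move=> x; apply: uls_cvg bs _; exact: cont_kl.
Qed.

(** Weak convergence of bounded measures makes the potentials [H (t n)] converge uniformly, so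
    scalar products pass to the limit and no norm is lost. *)
Lemma uls_dot (s t : nat -> (X -> R) -> R) M M' : 0 <= M -> 0 <= M' -> (\forall n \near ultraN, bdf M (s n)) ->
  (\forall n \near ultraN, bdf M' (t n)) ->
  dot (s n) (t n) @[n --> ultraN] --> dot (uls s) (uls t).
Proof.
move=> M0 M'0 bs bt; have cH := cont_H (uls_bdf bt).
apply: (ultra_joint M0 bs) => //; first exact: uls_cvg bs _.
  by apply: filterS bt => n; exact: cont_H.
exact: uls_H bt.
Qed.

(** The infimum in [hnorm2] is attained, because each finite family imposes a closed condition on
    the constant. *)
Lemma hnorm2_fin f : in_rkhs k f -> hb k f (hnorm k f ^+ 2).
Proof.
rewrite /in_rkhs /hnorm => fin.
pose S := [set C : R | hb k f C].
have n2E : hnorm2 k f = ereal_inf [set C%:E | C in S] by [].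
have lb : (0 <= hnorm2 k f)%E.
  by rewrite n2E; apply/ereal_infP => _ [C [C0 _] <-]; rewrite lee_fin.
have nE : (fine (hnorm2 k f))%:E = hnorm2 k f.
  by rewrite fineK// ge0_fin_numE.
have n0 : 0 <= fine (hnorm2 k f) by rewrite fine_ge0.
rewrite sqr_sqrtr//; split => // n x a.
apply/ler_addgt0Pr => e e0.
set A := \sum_(i < n) _; have A0 : 0 <= A by exact: (gk_psd K).
have A1 : 0 < A + 1 by rewrite ltr_wpDl.
have : (hnorm2 k f < (fine (hnorm2 k f) + e / (A + 1))%:E)%E.
  by rewrite -[X in (X < _)%E]nE lte_fin ltrDl divr_gt0.
rewrite {1}n2E => /ereal_inf_lt [_ [C [C0 hC] <-]]; rewrite lte_fin => Cle.
apply: (le_trans (hC n x a)); rewrite -/A.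
apply: (@le_trans _ _ ((fine (hnorm2 k f) + e / (A + 1)) * A)).
  by apply: ler_wpM2r => //; exact: ltW.
rewrite mulrDl lerD2l mulrAC -mulrA ler_piMr ?ltW//.
by rewrite ltr_pdivrMr// mul1r ltrDl.
Qed.

Lemma hb_hnorm f C : hb k f C -> in_rkhs k f /\ hnorm k f <= Num.sqrt C.
Proof.
move=> hf; have C0 := hb_ge0 hf.
have h1 : (hnorm2 k f <= C%:E)%E by apply: ge_ereal_inf; exists C%:E => //; exists C.
have lb : (0 <= hnorm2 k f)%E.
  by apply/ereal_infP => _ [D [D0 _] <-]; rewrite lee_fin.
have fin : in_rkhs k f by exact: le_lt_trans h1 (ltry _).
split => //; apply: ler_wsqrtr; rewrite -lee_fin fineK//.
by rewrite ge0_fin_numE.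
Qed.

Lemma hnorm_ge0 f : 0 <= hnorm k f. Proof. exact: sqrtr_ge0. Qed.

(** The lower bound on the norm comes from testing [H s] against [s] itself in [hb_CS]. *)
Lemma hnorm_H M s : 0 <= M -> bdf M s -> hnorm k (H s) = Num.sqrt (dot s s).
Proof.
move=> M0 bs; have [ih le1] := hb_hnorm (hb_H M0 bs).
apply/eqP; rewrite eq_le le1 /=.
have := hb_CS M0 bs (hnorm2_fin ih); rewrite -/(kdot k s s).
have d0 : 0 <= dot s s by exact: dot_ge0 bs.
have [->|dn0] := eqVneq (dot s s) 0; first by rewrite sqrtr0 hnorm_ge0.
rewrite expr2 ler_pM2r; last by rewrite lt_neqAle eq_sym dn0.
by apply: sqrt_le_sq; exact: hnorm_ge0.
Qed.

End Measures.

Arguments cont_bdd {R X} K {f}.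

(** * Supersolution flows *)

Section RealSteps.
Context {R : realType}.

Lemma step_ind (u v : R) (P : R -> Prop) : u <= v -> P u ->
  (exists2 d : R, 0 < d & forall s r, u <= s -> s <= r -> r <= v -> r <= s + d -> P s -> P r) ->
  P v.
Proof.
move=> uv Pu [d d0 st].
have Pi i : P (Num.min v (u + i%:R * d)).
  elim: i => [|i IH]; first by rewrite mul0r addr0 min_r.
  apply: st IH.
  - by rewrite le_min uv lerDl mulr_ge0// ltW.
  - rewrite le_min ge_min lexx /= ge_min; apply/orP; right.
    by rewrite lerD2l ler_pM2r// ler_nat.
  - by rewrite ge_min lexx.
  - rewrite -natr1 mulrDl mul1r addrA; case: (leP v (u + i%:R * d)) => h.
      by rewrite ge_min lerDl ltW.
    by rewrite ge_min lexx orbT.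
have [n hn] : exists n : nat, v <= u + n%:R * d.
  exists (Num.truncn ((v - u) / d)).+1.
  rewrite -lerBlDl -ler_pdivrMr//; exact/ltW/truncnS_gt.
by have := Pi n; rewrite min_l.
Qed.

Lemma chain (F : R -> R) (u v c : R) : u <= v ->
  (forall e, 0 < e -> exists2 d : R, 0 < d & forall s r, u <= s -> s <= r -> r <= v -> r <= s + d ->
     F r - F s >= (r - s) * (c - e)) ->
  F v - F u >= (v - u) * c.
Proof.
move=> uv h; apply/ler_addgt0Pr => e e0.
have vu : 0 < v - u + 1 by rewrite ltr_wpDl// subr_ge0.
have [d d0 hd] := h (e / (v - u + 1)) (divr_gt0 e0 vu).
have := @step_ind u v (fun r => F r - F u >= (r - u) * (c - e / (v - u + 1))) uv.
rewrite !subrr mul0r lexx => /(_ isT).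
have ee : (v - u) * (e / (v - u + 1)) <= e.
  by rewrite mulrCA ler_piMr ?ltW// ltr_pdivrMr// mul1r ltrDl.
move=> hh; suff : (v - u) * (c - e / (v - u + 1)) <= F v - F u by lra.
apply: hh; exists d => // s r us sr rv rd Ps.
by have := hd s r us sr rv rd; lra.
Qed.

(** The inequality [(g^2)' <= 2 C g] cannot simply be divided by [g], which vanishes at the start.
    Instead [g] is compared with [y(r) = e + (r - u) (C + e)]: since [y >= e], the error [e * e] is
    at most [e * y], and each increment of [y^2] dominates that of [g^2]. *)
Lemma sqrt_growth (g : R -> R) (u v C : R) : u <= v -> 0 <= C -> (forall r, 0 <= g r) -> g u = 0 ->
  (forall e, 0 < e -> exists2 d : R, 0 < d & forall s r, u <= s -> s <= r -> r <= v -> r <= s + d ->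
     g r ^+ 2 - g s ^+ 2 <= 2 * (r - s) * (C * g s + e)) ->
  g v <= C * (v - u).
Proof.
move=> uv C0 g0 gu h; apply/ler_addgt0Pr => e' e'0.
have vu : 0 < v - u + 1 by rewrite ltr_wpDl// subr_ge0.
pose e := e' / (v - u + 1); have e0 : 0 < e by rewrite divr_gt0.
have [d d0 hd] := h (e * e) (mulr_gt0 e0 e0).
suff : g v <= e + (v - u) * (C + e).
  have -> : e + (v - u) * (C + e) = C * (v - u) + e * (v - u + 1) by ring.
  by rewrite /e divfK ?gt_eqF.
apply: (@step_ind u v (fun r => g r <= e + (r - u) * (C + e))) => //.
  by rewrite gu subrr mul0r addr0 ltW.
exists d => // s r us sr rv rd Ps.
have := hd s r us sr rv rd; have := g0 s; have := g0 r.
set y := e + (s - u) * (C + e) in Ps.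
have -> : e + (r - u) * (C + e) = y + (r - s) * (C + e) by rewrite /y; ring.
have ye : e <= y by rewrite /y lerDl mulr_ge0 ?subr_ge0// addr_ge0// ltW.
have rs : 0 <= r - s by rewrite subr_ge0.
move: (r - s) rs => q q0 gr gs hq.
have y0 : 0 <= y + q * (C + e) by nra.
rewrite -(ler_pXn2r (ltn0Sn 1)) ?nnegrE//.
have h1 : C * g s <= C * y by apply: ler_wpM2l.
have h2 : e * e <= e * y by apply: ler_wpM2l => //; exact: ltW.
have h3 : g s ^+ 2 <= y ^+ 2 by rewrite ler_pXn2r ?nnegrE//; exact: le_trans gs Ps.
have h4 : 2 * q * (C * g s + e * e) <= 2 * q * (C * y + e * y).
  by apply: ler_wpM2l; [rewrite mulr_ge0|lra].
have -> : (y + q * (C + e)) ^+ 2 = y ^+ 2 + 2 * q * (C * y + e * y) + (q * (C + e)) ^+ 2 by ring.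
have := sqr_ge0 (q * (C + e)); lra.
Qed.

End RealSteps.

(** * The distance between measures in the dual norm *)

Section Norms.
Context {R : realType} {X : pseudoMetricType R} {K : @pdkernel R X}.
Variables (U : X -> R) (cU : continuous U).
Local Notation k := (ker K).
Implicit Types (f g w : X -> R) (s t : (X -> R) -> R) (Y : set X) (e M L C : R).
Local Notation H := (Hop k).
Local Notation dot := (kdot k).
Local Notation Aop := (skew_op (K := K) U).

Definition subf s t : (X -> R) -> R := fun f => s f - t f.
Definition dual_sqnorm s : R := dot s s.
Definition dual_norm s : R := Num.sqrt (dual_sqnorm s).

Lemma bdf_subf M M' s t : bdf M s -> bdf M' t -> bdf (M + M') (subf s t).
Proof. exact: bdf_sub. Qed.

Lemma kN_ge0 M s : 0 <= M -> bdf M s -> 0 <= dual_sqnorm s.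
Proof. by move=> M0 bs; exact: dot_ge0 bs. Qed.

Lemma knm_ge0 s : 0 <= dual_norm s. Proof. exact: sqrtr_ge0. Qed.

Lemma knm_sq M s : 0 <= M -> bdf M s -> dual_norm s ^+ 2 = dual_sqnorm s.
Proof. by move=> M0 bs; rewrite sqr_sqrtr// (kN_ge0 M0 bs). Qed.

Lemma kN_subf M M' s t : 0 <= M -> 0 <= M' -> bdf M s -> bdf M' t ->
  dual_sqnorm (subf s t) = dual_sqnorm s + dual_sqnorm t - 2 * dot s t.
Proof.
move=> M0 M'0 bs bt; rewrite /dual_sqnorm.
have E : subf s t = fun f => 1 * s f + (-1) * t f by apply/funext => f; rewrite /subf; ring.
have bst : bdf (M + M') (subf s t) by exact: bdf_subf.
rewrite {1}E /kdot; rewrite -/(kdot k s (subf s t)) -/(kdot k t (subf s t)) E.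
rewrite (dot_linr _ _ bs.1 bs bt) (dot_linr _ _ bt.1 bs bt).
by rewrite -/(kdot k s s) -/(kdot k t t) -/(kdot k s t) (dot_sym (K := K) M0 M'0 bs bt); ring.
Qed.

Lemma knm_tri M s t u : 0 <= M -> bdf M s -> bdf M t -> bdf M u ->
  dual_norm (subf s u) <= dual_norm (subf s t) + dual_norm (subf t u).
Proof.
move=> M0 bs bt bu.
have M2 : 0 <= M + M by rewrite addr_ge0.
have b1 := bdf_subf bs bt; have b2 := bdf_subf bt bu; have b3 := bdf_subf bs bu.
apply: sqrt_le_sq; first by rewrite addr_ge0// knm_ge0.
have h := le_trans (ler_norm _) (dot_sup (K := K) M2 M2 b1 b2).
rewrite sqrrD !(knm_sq M2)//.
have : dual_sqnorm (subf s u) = dual_sqnorm (subf s t) + dual_sqnorm (subf t u) + 2 * dot (subf s t) (subf t u).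
  rewrite !(kN_subf M0 M0)//.
  have -> : dot (subf s t) (subf t u) = dot s t - dot s u - (dot t t - dot t u).
    rewrite /kdot /subf; have E : forall v, Hop k (fun f => t f - u f) v = H t v - H u v by [].
    rewrite (_ : Hop k _ = fun v => H t v - H u v)//.
    by rewrite (linB bs.1) ?(linB bt.1)//; [exact: cont_H bt|exact: cont_H bu|exact: cont_H bt|exact: cont_H bu].
  by rewrite /dual_sqnorm; ring.
have {}h : dot (subf s t) (subf t u) <= dual_norm (subf s t) * dual_norm (subf t u) by exact: h.
by move=> ->; rewrite -mulr_natr; lra.
Qed.

Lemma H_subf s t x : H (subf s t) x = H s x - H t x. Proof. by []. Qed.

Lemma Aop_subf s t x : Aop (subf s t) x = Aop s x - Aop t x.
Proof. exact: Aop_sub. Qed.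

End Norms.

(** * Speed and contraction of supersolutions *)

Section Flows.
Context {R : realType} {X : pseudoMetricType R} {K : @pdkernel R X}.
Variables (U : X -> R) (cU : continuous U).
Local Notation k := (ker K).
Local Notation kap := (kmin K).
Implicit Types (f g w : X -> R) (s t h u : R) (Y : set X) (e M L C : R).
Implicit Types (a b : R -> (X -> R) -> R).
Local Notation H := (Hop k).
Local Notation dot := (kdot k).
Local Notation Aop := (skew_op (K := K) U).
Local Notation kN := (dual_sqnorm (K := K)).
Local Notation knm := (dual_norm (K := K)).

(* For [Y = setT], [U = 2 V / eps] and [b t = H (a t)]: the path [b] stays on the
   unit sphere and is a supersolution of the linear equation [b' = - A b].  These
   one-sided inequalities characterize Sinkhorn potential flows and, unlike the
   differential inclusion, they are stable under limits. *)
Record flow Y a : Prop := Flow {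
  fl_pos : forall t, 0 <= t -> posfun Y (a t);
  fl_nrm : forall t, 0 <= t -> kN (a t) = 1;
  fl_cont : forall T e, 0 < e -> exists2 d : R, 0 < d & forall s t,
    0 <= s -> s <= t -> t <= T -> t <= s + d -> kN (subf (a t) (a s)) <= e;
  fl_sup : forall T e, 0 < e -> exists2 d : R, 0 < d & forall s t y,
    0 <= s -> s <= t -> t <= T -> t <= s + d -> Y y ->
    H (a t) y - H (a s) y >= - (t - s) * (Aop (a s) y + e) }.

(** Bound on the mass of a positive measure of dual norm 1, as given by [mass_le]. *)
Definition m0 : R := 1 + 1 / kap.

Lemma m0_gt0 : 0 < m0.
Proof. by rewrite /m0 ltr_wpDr// divr_ge0// ltW// (gk_kap K). Qed.

Lemma m0_ge0 : 0 <= m0. Proof. exact/ltW/m0_gt0. Qed.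

Section OneFlow.
Variables (Y : set X) (a : R -> (X -> R) -> R) (fa : flow Y a).

Lemma fl_mass t : 0 <= t -> mass (a t) <= m0.
Proof. by move=> t0; have := mass_le (K := K) (fl_pos fa t0); rewrite -/(kN _) (fl_nrm fa t0). Qed.

Lemma fl_bdf t : 0 <= t -> bdf m0 (a t).
Proof. by move=> t0; apply: bdf_le (fl_mass t0) (posfun_bdf (fl_pos fa t0)). Qed.

Lemma fl_bdf2 s t : 0 <= s -> 0 <= t -> bdf (m0 + m0) (subf (a t) (a s)).
Proof. by move=> s0 t0; apply: bdf_subf; exact: fl_bdf. Qed.

Lemma m00_ge0 : 0 <= m0 + m0. Proof. by rewrite addr_ge0// m0_ge0. Qed.

Lemma kN_dist s t : 0 <= s -> 0 <= t -> kN (subf (a t) (a s)) = 2 - 2 * dot (a t) (a s).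
Proof.
move=> s0 t0; rewrite (kN_subf m0_ge0 m0_ge0 (fl_bdf t0) (fl_bdf s0)).
by rewrite !(fl_nrm fa)//; ring.
Qed.

Lemma fl_cont_H t : 0 <= t -> continuous (H (a t)).
Proof. by move=> t0; exact: cont_H (fl_bdf t0). Qed.

Lemma fl_cont_Aop t : 0 <= t -> continuous (Aop (a t)).
Proof. by move=> t0; exact: cont_Aop m0_ge0 (fl_bdf t0). Qed.

Lemma flow_shift h : 0 <= h -> flow Y (fun t => a (t + h)).
Proof.
move=> h0; split.
- by move=> t t0; apply: (fl_pos fa); rewrite addr_ge0.
- by move=> t t0; apply: (fl_nrm fa); rewrite addr_ge0.
- move=> T e e0; have [d d0 hd] := fl_cont fa (T + h) e0; exists d => // s t s0 st tT td.
  by apply: hd; rewrite ?addr_ge0 ?lerD2r//; lra.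
- move=> T e e0; have [d d0 hd] := fl_sup fa (T + h) e0; exists d => // s t y s0 st tT td Yy.
  have := hd (s + h) (t + h) y; rewrite !addr_ge0// !lerD2r.
  rewrite (_ : t + h - (s + h) = t - s); last by ring.
  by apply => //; lra.
Qed.

(** The pointwise error is taken to be [e / m0], so that integration against a measure of mass at
    most [m0] costs at most [e]. *)
Lemma fl_sup_int T e : 0 < e -> exists2 d : R, 0 < d & forall s t (b : (X -> R) -> R),
  0 <= s -> s <= t -> t <= T -> t <= s + d -> posfun Y b -> mass b <= m0 ->
  b (H (a t)) - b (H (a s)) >= - (t - s) * (b (Aop (a s)) + e).
Proof.
move=> e0; have e1 : 0 < e / m0 by rewrite divr_gt0// m0_gt0.
have [d d0 hd] := fl_sup fa T e1; exists d => // s t b s0 st tT td pb mb.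
have t0 := le_trans s0 st.
have cA := fl_cont_Aop s0; have cH := fl_cont_H t0; have cH' := fl_cont_H s0.
rewrite -(linB pb.1)//.
have : b (fun y => - (t - s) * (Aop (a s) y + e / m0)) <= b (fun y => H (a t) y - H (a s) y).
  apply: (posfun_mono pb).
  - by apply: cont_mul; [exact: cont_cst|apply: cont_add => //; exact: cont_cst].
  - by apply: cont_add => //; exact: cont_opp.
  - by move=> y Yy; exact: hd.
apply: le_trans; rewrite (linZ pb.1); last by apply: cont_add => //; exact: cont_cst.
rewrite (linD pb.1)//; last exact: cont_cst.
rewrite (lin_cst pb.1) !mulNr lerN2; apply: ler_wpM2l; first by rewrite subr_ge0.
rewrite lerD2l -[leRHS](@divfK _ m0) ?gt_eqF ?m0_gt0//.
by apply: ler_wpM2l => //; exact: ltW.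
Qed.

(** Let [g(r)] be the distance from [a t] to [a r], so that [g^2 = 2 - 2 <a t, a r>]. Testing the
    supersolution at time [r] against [a t] and moving [A] to the other factor, [(g^2)' <= - 2 a_r
    (A b_t) <= 2 a_r w = 2 (a_r - a_t) w <= 2 C g], the equality because [a t w = 0]. A velocity
    inequality at the single time [t] thus bounds the path at all later times. *)
Lemma speed t h w C : 0 <= t -> 0 <= h -> 0 <= C -> hb k w (C ^+ 2) ->
  (forall y, Y y -> - Aop (a t) y <= w y) -> a t w = 0 ->
  kN (subf (a (t + h)) (a t)) <= (C * h) ^+ 2.
Proof.
move=> t0 h0 C0 hw wA aw; have cw := hb_cont hw.
have th0 : 0 <= t + h by rewrite addr_ge0.
have bd r : 0 <= r -> bdf (m0 + m0) (subf (a r) (a t)) by move=> r0; exact: fl_bdf2.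
rewrite -(knm_sq m00_ge0 (bd _ th0)) ler_pXn2r ?nnegrE ?knm_ge0 ?mulr_ge0//.
have -> : C * h = C * ((t + h) - t) by congr (_ * _); ring.
apply: (@sqrt_growth _ (fun r => knm (subf (a r) (a t)))) => //.
- by rewrite lerDl.
- by move=> r; exact: knm_ge0.
- rewrite /knm /kN (_ : subf _ _ = fun _ => 0); last by apply/funext => f; rewrite /subf subrr.
  by rewrite /kdot sqrtr0.
move=> e e0; have [d d0 hd] := fl_sup_int (t + h) e0; exists d => // s r ts sr rth rd.
have s0 := le_trans t0 ts; have r0 := le_trans s0 sr.
have := hd s r _ s0 sr rth rd (fl_pos fa t0) (fl_mass t0).
rewrite (knm_sq m00_ge0 (bd _ r0)) (knm_sq m00_ge0 (bd _ s0)) !kN_dist// -/(kdot k (a t) (a r)) -/(kdot k (a t) (a s)).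
rewrite (dot_sym m0_ge0 m0_ge0 (fl_bdf t0) (fl_bdf r0)) (dot_sym m0_ge0 m0_ge0 (fl_bdf t0) (fl_bdf s0)).
rewrite (Aop_anti cU m0_ge0 m0_ge0 (fl_bdf s0) (fl_bdf t0)).
have h1 : - a s (Aop (a t)) <= a s w.
  rewrite -(linN (fl_bdf s0).1); last exact: fl_cont_Aop.
  apply: (posfun_mono (fl_pos fa s0)) => //; apply: cont_opp; exact: fl_cont_Aop.
have h2 : a s w <= C * knm (subf (a s) (a t)).
  have := hb_CS_abs m00_ge0 (bd _ s0) hw; rewrite sqrtr_sqr (ger0_norm C0) {1}/subf aw subr0 => hh.
  exact: le_trans (ler_norm _) hh.
have rs : 0 <= r - s by rewrite subr_ge0.
move=> h3.
have h4 : (r - s) * (- a s (Aop (a t)) + e) <= (r - s) * (C * knm (subf (a s) (a t)) + e).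
  by apply: ler_wpM2l => //; lra.
lra.
Qed.

End OneFlow.

Lemma contraction Y a b s t : flow Y a -> flow Y b -> 0 <= s -> s <= t ->
  dot (a s) (b s) <= dot (a t) (b t).
Proof.
move=> fa fb s0 st; rewrite -subr_ge0.
rewrite -[X in X <= _](mulr0 (t - s)); apply: (@chain _ (fun r => dot (a r) (b r)) s t 0 st) => e e0.
have m0p := m0_gt0.
have e1 : 0 < e / 3 by rewrite divr_gt0.
have e2 : 0 < e / 3 / m0 by rewrite divr_gt0.
have [d1 d10 h1] := Aop_modulus (K := K) cU m00_ge0 e2.
have [d2 d20 h2] := fl_cont fb t d10.
have [d3 d30 h3] := fl_sup_int fa t e1.
have [d4 d40 h4] := fl_sup_int fb t e1.
exists (Num.min d2 (Num.min d3 d4)); first by rewrite !lt_min d20 d30 d40.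
move=> u r su ur rt; rewrite -lerBlDl !le_min => /and3P[ud2 ud3 ud4].
have u0 := le_trans s0 su; have r0 := le_trans u0 ur.
have i3 := h3 u r _ u0 ur rt _ (fl_pos fb r0) (fl_mass fb r0).
have i4 := h4 u r _ u0 ur rt _ (fl_pos fa u0) (fl_mass fa u0).
have {}i3 := i3 ltac:(lra); have {}i4 := i4 ltac:(lra).
have bau := fl_bdf fa u0; have bbu := fl_bdf fb u0; have bar := fl_bdf fa r0; have bbr := fl_bdf fb r0.
(* The inequality for [a] is tested against [b r] and that for [b] against [a u], at different
   times. After the cancellation by skewness there remains [A] applied to [b r - b u], small by the
   modulus of [A]. *)
have i2 : `|a u (Aop (subf (b r) (b u)))| <= e / 3.
  have bs := fl_bdf2 fb u0 r0.
  have i1 := h1 _ bs (h2 u r u0 ur rt ltac:(lra)).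
  apply: (le_trans (posfun_bd (fl_pos fa u0) _ (fun y _ => i1 y))).
    exact: cont_Aop m00_ge0 bs.
  have := fl_mass fa u0; rewrite -(ler_pM2r e2) => /le_trans; apply.
  by rewrite mulrCA divff ?gt_eqF// mulr1.
move: i3 i4; rewrite -!/(kdot k _ _).
rewrite (Aop_anti cU m0_ge0 m0_ge0 bau bbr).
rewrite (dot_sym m0_ge0 m0_ge0 bbr bar) (dot_sym m0_ge0 m0_ge0 bbr bau) => i3 i4.
have E : a u (Aop (subf (b r) (b u))) = a u (Aop (b r)) - a u (Aop (b u)).
  rewrite -(linB bau.1); [|exact: (fl_cont_Aop fb)|exact: (fl_cont_Aop fb)].
  by congr (a u); apply/funext => y; rewrite Aop_subf.
move: i2; rewrite E ler_norml => /andP[i5 i6].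
have ru : 0 <= r - u by rewrite subr_ge0.
have j : (r - u) * (a u (Aop (b u)) - a u (Aop (b r))) <= (r - u) * (e / 3).
  by apply: ler_wpM2l => //; lra.
lra.
Qed.

End Flows.

(** * Growth from almost everywhere slopes *)

Section AbsCont.
Context {R : realType}.
Local Notation mu := (@lebesgue_measure R).

(** Continuous induction through the supremum of the valid initial segments; it serves where the
    admissible step depends on the point, with no uniform lower bound. *)
Lemma real_ind (u v : R) (P : R -> Prop) : u <= v -> P u ->
  (forall w, u < w -> w <= v -> (forall r, u <= r -> r < w -> P r) -> P w) ->
  (forall s, u <= s -> s < v -> P s ->
     exists2 d : R, 0 < d & forall r, s <= r -> r <= s + d -> r <= v -> P r) ->
  P v.
Proof.
move=> uv Pu Pl Pr.
pose S := [set w | u <= w <= v /\ forall r, u <= r -> r <= w -> P r].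
have Su : S u.
  split; first by rewrite lexx.
  by move=> r ur ru; have -> : r = u by apply/eqP; rewrite eq_le ru ur.
have hS : has_sup S by split; [exists u|exists v => w [/andP[]]].
have us : u <= sup S by exact: (sup_upper_bound hS).
have sv : sup S <= v by apply: ge_sup; [exists u|move=> w [/andP[]]].
have Plt r : u <= r -> r < sup S -> P r.
  move=> ur rs; have [w Sw rw] := sup_adherent (eps := sup S - r) ltac:(by rewrite subr_gt0) hS.
  by case: Sw => _; apply => //; lra.
have Ps : P (sup S).
  have [<-//|us'] := eqVneq u (sup S).
  by apply: Pl => //; rewrite lt_neqAle us' us.
have [<-//|sv'] := eqVneq (sup S) v.
have svl : sup S < v by rewrite lt_neqAle sv' sv.
have [d d0 hd] := Pr _ us svl Ps.
have : S (Num.min v (sup S + d)).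
  split; first by rewrite ge_min lexx le_min uv /= andbT; lra.
  move=> r ur; rewrite le_min => /andP[rv rd].
  by have [rs|sr] := ltP r (sup S); [exact: Plt|exact: hd].
move/(sup_upper_bound hS); rewrite ge_min => /orP[|]; first by rewrite leNgt svl.
by lra.
Qed.

(** The null set [N] is covered by an open [W] over which the integral of [f] is less than [e' / 2].
    The inequality propagated is [F r - F u >= - (r - u) e - J], with [J] the integral of [f] over
    the part of [W] in []u, r]]: at a point of [N] a step inside [W] is paid by the integral,
    elsewhere by the slope hypothesis. *)
Lemma ae_nondecreasing (F f : R -> R) (N : set R) (u v : R) : u <= v ->
  measurable N -> mu N = 0%E -> mu.-integrable setT (EFin \o f) -> (forall x, 0 <= f x) ->
  (forall s r, u <= s -> s <= r -> r <= v -> `|F r - F s| <= \int[mu]_(x in `]s, r]) f x) ->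
  (forall s, u <= s -> s < v -> ~ N s -> forall e, 0 < e ->
     exists2 d : R, 0 < d & forall r, s <= r -> r <= v -> r <= s + d -> F r - F s >= - (r - s) * e) ->
  F u <= F v.
Proof.
move=> uv mN N0 intf f0 Ff Fd.
pose J (A : set R) : R := \int[mu]_(x in A) f x.
have intA (A : set R) : measurable A -> mu.-integrable A (EFin \o f).
  by move=> mA; apply: (integrableS _ _ _ intf).
have J0 A : 0 <= J A by apply: Rintegral_ge0.
have JU A B : measurable A -> measurable B -> [disjoint A & B] -> J (A `|` B) = J A + J B.
  by move=> mA mB dAB; apply: Rintegral_setU => //; apply: intA; exact: measurableU.
have JS A B : measurable A -> measurable B -> A `<=` B -> J A <= J B.
  move=> mA mB AB; have -> : B = A `|` (B `\` A) by rewrite setDUK.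
  rewrite JU//; first by rewrite lerDl.
    exact: measurableD.
  by apply/disj_setPS => x [Ax []].
have Jsmall e : 0 < e -> exists2 d : R, 0 < d & forall A, measurable A -> (mu A < d%:E)%E -> J A < e.
  move=> e0; have [d [d0 hd]] := integral_normr_continuous intf e0.
  exists d => // A mA Ad; have := hd A mA Ad.
  rewrite (_ : Rintegral _ _ _ = J A)//; apply: eq_Rintegral => x _.
  by rewrite ger0_norm.
rewrite -subr_ge0; apply/ler_addgt0Pr => e' e'0.
have vu : 0 < v - u + 1 by rewrite ltr_wpDl// subr_ge0.
pose e := e' / 2 / (v - u + 1); have e0 : 0 < e by rewrite !divr_gt0.
have [d d0 hd] := Jsmall (e' / 2) ltac:(by rewrite divr_gt0).
have Noo : (mu N < +oo)%E by rewrite N0.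
have [W [oW NW Wd]] := lebesgue_regularity_outer mN Noo d0.
have mW : measurable W by exact: open_measurable.
have muO : (mu W < d%:E)%E.
  have -> : W = N `|` (W `\` N) by rewrite setDUK.
  apply: le_lt_trans Wd; rewrite -[leRHS]add0e -N0.
  by apply: measureU2 => //; exact: measurableD.
have mi (s r : R) : measurable (`]s, r] : set R) by exact: measurable_itv.
suff : F v - F u >= - (v - u) * e - J (W `&` `]u, v]).
  have : J (W `&` `]u, v]) < e' / 2.
    apply: le_lt_trans (hd W mW muO); apply: JS => //; exact: measurableI.
  have : (v - u) * e <= e' / 2.
    rewrite /e mulrCA ler_piMr ?divr_ge0 ?ltW//.
    by rewrite ltr_pdivrMr// mul1r ltrDl.
  by lra.
apply: (@real_ind u v (fun r => F r - F u >= - (r - u) * e - J (W `&` `]u, r]))) => //.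
- by rewrite !subrr oppr0 mul0r sub0r oppr_le0.
- move=> w uw wv Pr; apply/ler_addgt0Pr => e1 e10.
  have [d1 d10 hd1] := Jsmall (e1 / 2) ltac:(by rewrite divr_gt0).
  have C0 : 0 < `|e| + 1 by rewrite ltr_wpDl.
  pose q : R := Num.min (w - u) (Num.min (d1 / 2) (e1 / 2 / (`|e| + 1))).
  have q0 : 0 < q by rewrite !lt_min subr_gt0 uw !divr_gt0.
  have qu : q <= w - u by rewrite ge_min lexx.
  have qd : q < d1.
    apply: (@le_lt_trans _ _ (d1 / 2)); first by rewrite !ge_min lexx orbT.
    by rewrite ltr_pdivrMr// ltr_pMr// ltr1n.
  have qe : q * `|e| <= e1 / 2.
    apply: (@le_trans _ _ (e1 / 2 / (`|e| + 1) * `|e|)).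
      by apply: ler_wpM2r => //; rewrite !ge_min lexx !orbT.
    by rewrite mulrAC -mulrA ler_piMr ?divr_ge0 ?ltW// ltr_pdivrMr// mul1r ltrDl.
  have h1 := Pr (w - q) ltac:(lra) ltac:(lra).
  have h2 : `|F w - F (w - q)| <= J `]w - q, w]%classic by apply: Ff => //; lra.
  have h3 : J (`]w - q, w]%classic) < e1 / 2.
    apply: hd1 => //; rewrite lebesgue_measure_itv/= lte_fin.
    case: ifPn => // _; rewrite -EFinB lte_fin; lra.
  have h4 : J (W `&` `]u, w - q]) <= J (W `&` `]u, w]).
    apply: JS; [exact: measurableI|exact: measurableI|].
    apply: setIS => x /=; rewrite !in_itv/= => /andP[-> xw]; lra.
  move: h2; rewrite ler_norml => /andP[h2 _].
  have h5 : 0 <= q * e by rewrite mulr_ge0// ltW.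
  have E : - (w - u) * e = - (w - q - u) * e - q * e by ring.
  rewrite E; lra.
- move=> s us sv Ps.
  have JW r : s <= r -> J (W `&` `]u, r]) = J (W `&` `]u, s]) + J (W `&` `]s, r]).
    move=> sr; rewrite -JU; [|exact: measurableI|exact: measurableI|].
      rewrite -setIUr; congr (J (W `&` _)); apply/seteqP; split => x /=; rewrite !in_itv/=.
        move=> /andP[ux xr]; case: (leP x s) => xs; [left|right]; first by rewrite ux.
        by rewrite xr.
      by move=> [/andP[-> xs]|/andP[sx ->]] /=; rewrite ?andbT; lra.
    apply/disj_setPS => x [[_ /=]]; rewrite !in_itv/= => /andP[_ xs] [_ /andP[sx _]]; lra.
  have [Ns|nNs] := pselect (N s).
    have [/= q q0 hq] := oW _ (NW _ Ns).
    exists (q / 2) => [|r sr rq rv]; first by rewrite divr_gt0.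
    have := JW r sr; rewrite (_ : W `&` `]s, r] = `]s, r]%classic); last first.
      apply/seteqP; split => [x []//|x /=]; rewrite in_itv/= => /andP[sx xr]; split; last by rewrite /= ?in_itv/= sx.
      apply: hq; rewrite /ball/= ltr_norml; apply/andP; split; lra.
    have : `|F r - F s| <= J `]s, r]%classic by exact: Ff.
    rewrite ler_norml => /andP[h1 _].
    move=> hJ; rewrite hJ.
    have h5 : - (r - u) * e = - (s - u) * e - (r - s) * e by ring.
    have h6 : 0 <= (r - s) * e by rewrite mulr_ge0 ?subr_ge0// ltW.
    lra.
  have [q q0 hq] := Fd s us sv nNs e e0; exists q => // r sr rq rv.
  have := hq r sr rv rq; rewrite JW//; have := J0 (W `&` `]s, r]).
  have h5 : - (r - u) * e = - (s - u) * e - (r - s) * e by ring.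
  lra.
Qed.

Lemma integral_cst_itv (u v s r c : R) : u <= s -> s <= r -> r <= v ->
  \int[mu]_(x in `]s, r]) (c * \1_(`]u, v]%classic) x) = c * (r - s).
Proof.
move=> us sr rv; have ms : measurable (`]s, r] : set R) by exact: measurable_itv.
rewrite (@eq_Rintegral _ _ _ _ _ (fun=> c)).
  have E : fine (mu `]s, r]%classic) = r - s.
    rewrite lebesgue_measure_itv/= lte_fin; case: ifPn => h' //=.
    have -> : r = s by lra.
    by rewrite subrr.
  by rewrite Rintegral_cst// (_ : fine _ = r - s).
move=> x; rewrite inE/= in_itv/= => /andP[sx xr].
by rewrite indicE mem_set ?mulr1//= in_itv/=; apply/andP; split; lra.
Qed.

Lemma integrable_cst_itv (u v c : R) :
  mu.-integrable setT (EFin \o (fun x => c * \1_(`]u, v]%classic) x)).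
Proof.
have -> : EFin \o (fun x => c * \1_(`]u, v]%classic) x) =
  fun x => (c%:E * (\1_(`]u, v]%classic) x)%:E)%E by [].
by apply: integrableZl => //; exact: integrable_indic_itv.
Qed.

Lemma ae_growth (F f : R -> R) (N : set R) (u v c : R) : u <= v ->
  measurable N -> mu N = 0%E -> mu.-integrable setT (EFin \o f) -> (forall x, 0 <= f x) ->
  (forall s r, u <= s -> s <= r -> r <= v -> `|F r - F s| <= \int[mu]_(x in `]s, r]) f x) ->
  (forall s, u <= s -> s < v -> ~ N s -> forall e, 0 < e ->
     exists2 d : R, 0 < d & forall r, s <= r -> r <= v -> r <= s + d -> F r - F s >= (r - s) * (c - e)) ->
  F v - F u >= (v - u) * c.
Proof.
move=> uv mN N0 intf f0 Ff Fd.
pose h (x : R) : R := `|c| * \1_(`]u, v]%classic) x.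
have inth : mu.-integrable setT (EFin \o h) by exact: integrable_cst_itv.
suff : F u - c * u <= F v - c * v by lra.
apply: (@ae_nondecreasing (fun x => F x - c * x) (fun x => f x + h x) N) => //.
- have -> : EFin \o (fun x => f x + h x) = ((EFin \o f) \+ (EFin \o h))%E by [].
  by apply: integrableD.
- by move=> x; rewrite addr_ge0// mulr_ge0.
- move=> s r us sr rv; have ms : measurable (`]s, r] : set R) by exact: measurable_itv.
  rewrite RintegralD//; last 2 first.
  + by apply: (integrableS _ _ _ intf).
  + by apply: (integrableS _ _ _ inth).
  rewrite (_ : _ - _ = (F r - F s) - c * (r - s)); last by ring.
  apply: (le_trans (ler_normB _ _)); apply: lerD; first exact: Ff.
  rewrite integral_cst_itv// normrM (ger0_norm (_ : 0 <= r - s))// subr_ge0//.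
- move=> s us sv nN e e0; have [d d0 hd] := Fd s us sv nN e e0; exists d => // r sr rv rd.
  by have := hd r sr rv rd; lra.
Qed.

Lemma ae_growth_lip (F : R -> R) (N : set R) (u v c L : R) : u <= v ->
  measurable N -> mu N = 0%E -> 0 <= L ->
  (forall s r, u <= s -> s <= r -> r <= v -> `|F r - F s| <= L * (r - s)) ->
  (forall s, u <= s -> s < v -> ~ N s -> forall e, 0 < e ->
     exists2 d : R, 0 < d & forall r, s <= r -> r <= v -> r <= s + d -> F r - F s >= (r - s) * (c - e)) ->
  F v - F u >= (v - u) * c.
Proof.
move=> uv mN N0 L0 hL; apply: (ae_growth uv mN N0 (integrable_cst_itv u v L)).
  by move=> x; rewrite mulr_ge0.
by move=> s r us sr rv; rewrite integral_cst_itv//; exact: hL.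
Qed.

End AbsCont.

(** * Speed and derivative of a flow *)

Section Speed.
Context {R : realType} {X : pseudoMetricType R} {K : @pdkernel R X}.
Variables (U : X -> R) (cU : continuous U).
Local Notation k := (ker K).
Implicit Types (f g w : X -> R) (s t h u r : R) (e M L C : R).
Local Notation H := (Hop k).
Local Notation dot := (kdot k).
Local Notation Aop := (skew_op (K := K) U).
Local Notation kN := (dual_sqnorm (K := K)).
Local Notation knm := (dual_norm (K := K)).
Local Notation m0 := (m0 (K := K)).
Local Notation flow := (flow (K := K) U).

Lemma hb_ulim (f : nat -> X -> R) w C : 0 <= C -> (forall x, f n x @[n --> ultraN] --> w x) ->
  (\forall n \near ultraN, hb k (f n) C) -> hb k w C.
Proof.
move=> C0 fw hf; split => // n x a.
apply: (ultra_lec (u := fun m => (\sum_(i < n) a i * f m (x i)) * (\sum_(i < n) a i * f m (x i)))).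
  have h : (fun m => \sum_(i < n) a i * f m (x i)) @ ultraN --> \sum_(i < n) a i * w (x i).
    by apply: ultra_sum => i; apply: cvgMr; exact: fw.
  by rewrite expr2; apply: cvgM.
by apply: filterS hf => m [_ hm]; rewrite -expr2; exact: hm.
Qed.

Lemma knm_le M (s : (X -> R) -> R) C : 0 <= M -> bdf M s -> 0 <= C -> knm s <= C -> kN s <= C ^+ 2.
Proof. by move=> M0 bs C0 h; rewrite -(knm_sq M0 bs) ler_pXn2r ?nnegrE// knm_ge0. Qed.

Lemma kN_small (s : (X -> R) -> R) e : 0 <= e -> kN s <= e ^+ 2 -> knm s <= e.
Proof. by move=> e0 h; apply: sqrt_le_sq. Qed.

Lemma knm_subfC M (s t : (X -> R) -> R) : 0 <= M -> bdf M s -> bdf M t ->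
  knm (subf s t) = knm (subf t s).
Proof.
move=> M0 bs bt; rewrite /knm !(kN_subf M0 M0)// (dot_sym M0 M0 bs bt); congr Num.sqrt; ring.
Qed.

(* Weak limits of signed measures bounded in the dual norm; the masses need
   not be bounded, so the limit is only an element of the RKHS. *)
Lemma weak_limit (s : nat -> (X -> R) -> R) C : 0 <= C ->
  (\forall n \near ultraN, (exists2 M, 0 <= M & bdf M (s n)) /\ kN (s n) <= C) ->
  let w := fun x => ulim (fun n => H (s n) x) in
  [/\ hb k w C, (forall x, H (s n) x @[n --> ultraN] --> w x) &
   forall e, 0 < e -> \forall n \near ultraN, forall x, `|H (s n) x - w x| <= e].
Proof.
move=> C0 hs w.
have hbn : \forall n \near ultraN, hb k (H (s n)) C.
  by apply: filterS hs => n [[M M0 bn] nC]; apply: hb_le nC _; exact: hb_H bn.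
have cw x : H (s n) x @[n --> ultraN] --> w x.
  by apply: (@ulim_cvg _ _ (Num.sqrt C)); apply: filterS hbn => n; exact: hb_sup.
split => //; first exact: hb_ulim cw hbn.
apply: (@ultra_unif _ _ _ _ _ (Num.sqrt C) _ cw).2.
by apply: filterS hbn => n; exact: hb_lip.
Qed.

Lemma dot_subr M M' (b s t : (X -> R) -> R) : linC b -> bdf M s -> bdf M' t ->
  dot b (subf s t) = dot b s - dot b t.
Proof. by move=> lb bs bt; rewrite -(linB lb (cont_H bs) (cont_H bt)). Qed.

Variables (Y : set X) (a : R -> (X -> R) -> R) (fa : flow Y a).

Definition spd t L := 0 <= L /\ forall h, 0 <= h -> knm (subf (a (t + h)) (a t)) <= L * h.
(* The best Lipschitz constant of the path after time [t]; it is nonincreasing in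
   [t], hence continuous outside a countable set. *)
Definition phi t : R := inf [set L | spd t L].
(** Time 0 is excluded: for general initial data the speed bound obtained below is of order
    [t ^ (-1/2)]. *)
Definition regular := forall t, 0 < t -> exists L, spd t L.
(** Left continuity of [phi] at [t]. As [phi] is nonincreasing, it is then at most [phi t + e] on a
    neighbourhood of [t], which bounds every difference quotient taken there. *)
Definition good t := 0 < t /\ forall e, 0 < e ->
  exists2 d : R, 0 < d < t & phi (t - d) <= phi t + e.

Lemma spd_mono s t L : 0 <= s -> s <= t -> spd s L -> spd t L.
Proof.
move=> s0 st [L0 hL]; split => // h h0; apply: le_trans (hL h h0); apply: ler_wsqrtr.
have t0 := le_trans s0 st.
rewrite !(kN_dist fa) ?addr_ge0// lerD2l lerN2 ler_pM2l//.
have mm := m0_ge0 (K := K).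
rewrite (dot_sym mm mm (fl_bdf fa (addr_ge0 s0 h0)) (fl_bdf fa s0)).
rewrite (dot_sym mm mm (fl_bdf fa (addr_ge0 t0 h0)) (fl_bdf fa t0)).
exact: (contraction cU fa (flow_shift fa h0)).
Qed.

Lemma phi_le t L : spd t L -> phi t <= L.
Proof. by move=> sL; apply: ge_inf => //; exists 0 => M []. Qed.

Lemma phi_spd t : (exists L, spd t L) -> spd t (phi t).
Proof.
move=> [L sL]; have ne : [set L | spd t L] !=set0 by exists L.
split; first by apply: lb_le_inf => // M [].
move=> h h0; have [h00|hn0] := eqVneq h 0.
  by have := sL.2 0 (lexx _); rewrite h00 !mulr0.
have hp : 0 < h by rewrite lt_neqAle eq_sym hn0.
rewrite -ler_pdivrMr//; apply: lb_le_inf => // M [M0 hM].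
by rewrite ler_pdivrMr//; exact: hM.
Qed.

Hypothesis reg : regular.

Lemma phi_spd' t : 0 < t -> spd t (phi t). Proof. by move=> t0; apply: phi_spd; exact: reg. Qed.

Lemma phi_ge0 t : 0 < t -> 0 <= phi t. Proof. by move=> /phi_spd' []. Qed.

Lemma phi_mono s t : 0 < s -> s <= t -> phi t <= phi s.
Proof. by move=> s0 st; apply: phi_le; apply: (spd_mono (ltW s0) st); exact: phi_spd'. Qed.

(** At a positive time that is not good [phi] jumps down, and a rational number in the gap
    determines the time because [phi] is monotone. *)
Lemma good_countable : countable [set t | 0 < t /\ ~ good t].
Proof.
have hq t : exists q : rat, (0 < t /\ ~ good t) -> phi t < ratr q /\ forall s, 0 < s -> s < t -> ratr q < phi s.
  have [[t0 ng]|h] := pselect (0 < t /\ ~ good t); last by exists 0.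
  have [e e0 he] : exists2 e, 0 < e & forall d, 0 < d < t -> phi t + e < phi (t - d).
    apply: contrapT => nh; apply: ng; split => // e e0; apply: contrapT => nd.
    apply: nh; exists e => // d d0; rewrite ltNge; apply/negP => h; apply: nd.
    by exists d.
  have [q] := @rat_in_itvoo _ (phi t) (phi t + e) ltac:(by rewrite ltrDl).
  rewrite in_itv/= => /andP[q1 q2]; exists q => _; split => // s s0 st.
  apply: (lt_trans q2); have := he (t - s); rewrite (_ : t - (t - s) = s); last by ring.
  by apply; rewrite subr_gt0 st /= ltrBlDr ltrDl.
have [q hqP] := choice hq.
apply/countable_injP; exists (fun t => pickle (q t)) => t1 t2; rewrite !inE => b1 b2.
move/(pcan_inj (@pickleK _)) => qq.
have [h1 h1'] := hqP t1 b1; have [h2 h2'] := hqP t2 b2.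
case: (ltgtP t1 t2) => // tt.
  by have := h2' t1 b1.1 tt; rewrite -qq => /lt_trans/(_ h1); rewrite ltxx.
by have := h1' t2 b2.1 tt; rewrite qq => /lt_trans/(_ h2); rewrite ltxx.
Qed.

Definition qt s r : (X -> R) -> R := fun f => (r - s)^-1 * a r f + (- (r - s)^-1) * a s f.

Lemma bdf_qt s r : 0 <= s -> s < r -> exists2 M, 0 <= M & bdf M (qt s r).
Proof.
move=> s0 sr; have r0 : 0 <= r by rewrite ltW// (le_lt_trans s0).
exists (`|(r - s)^-1| * m0 + `|- (r - s)^-1| * m0).
  by rewrite addr_ge0// mulr_ge0//; exact: m0_ge0.
exact: (bdf_comb _ _ (fl_bdf fa r0) (fl_bdf fa s0)).
Qed.

Lemma qtE s r f : qt s r f = (r - s)^-1 * subf (a r) (a s) f.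
Proof. by rewrite /qt /subf; ring. Qed.

Lemma H_qt s r x : H (qt s r) x = (r - s)^-1 * (H (a r) x - H (a s) x).
Proof. by rewrite /Hop qtE. Qed.

Lemma dot_qtl s r (b : (X -> R) -> R) : dot (qt s r) b = (r - s)^-1 * dot (subf (a r) (a s)) b.
Proof. by rewrite /kdot qtE. Qed.

Lemma dot_qtr s r (b : (X -> R) -> R) : linC b -> 0 <= s -> s < r ->
  dot b (qt s r) = (r - s)^-1 * dot b (subf (a r) (a s)).
Proof.
move=> lb s0 sr; have r0 : 0 <= r by rewrite ltW// (le_lt_trans s0).
rewrite /kdot -(linZ lb); last exact: (cont_H (fl_bdf2 fa s0 r0)).
by congr b; apply/funext => x; rewrite H_qt.
Qed.

Lemma kN_qt s r : 0 <= s -> s < r -> kN (qt s r) = (r - s)^-2 * kN (subf (a r) (a s)).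
Proof.
move=> s0 sr; have r0 : 0 <= r by rewrite ltW// (le_lt_trans s0).
have [M M0 [lq _]] := bdf_qt s0 sr.
rewrite /kN dot_qtr// dot_qtl mulrA -invfM -expr2.
by congr (_ * _).
Qed.

Lemma knm_qt s r : 0 <= s -> s < r -> knm (qt s r) = (r - s)^-1 * knm (subf (a r) (a s)).
Proof.
move=> s0 sr; rewrite /knm kN_qt// sqrtrM; last by rewrite invr_ge0 sqr_ge0.
by congr (_ * _); rewrite -exprVn sqrtr_sqr ger0_norm// invr_ge0 subr_ge0 ltW.
Qed.

Lemma knm_qt_phi s r : 0 < s -> s < r -> knm (qt s r) <= phi s.
Proof.
move=> s0 sr; rewrite (knm_qt (ltW s0) sr) mulrC ler_pdivrMr ?subr_gt0//.
have [_ /(_ (r - s))] := phi_spd' s0.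
by rewrite (_ : s + (r - s) = r); [apply; rewrite subr_ge0 ltW|ring].
Qed.

Lemma fl_near t e : 0 <= t -> 0 < e -> exists2 d : R, 0 < d &
  forall s, 0 <= s -> `|s - t| <= d -> knm (subf (a s) (a t)) <= e.
Proof.
move=> t0 e0; have [d d0 hd] := fl_cont fa (t + 1) (exprn_gt0 2 e0).
exists (Num.min d 1); first by rewrite lt_min d0 ltr01.
move=> s s0; rewrite le_min => /andP[]; rewrite !ler_norml => /andP[h1 h2] /andP[h3 h4].
have [st|ts] := leP s t.
  rewrite (knm_subfC (m0_ge0 (K := K)) (fl_bdf fa s0) (fl_bdf fa t0)).
  by apply: kN_small; [exact: ltW|apply: hd => //; lra].
by apply: kN_small; [exact: ltW|apply: hd => //; lra].
Qed.

Lemma Aop_near t e : 0 <= t -> 0 < e -> exists2 d : R, 0 < d &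
  forall s, 0 <= s -> `|s - t| <= d -> forall x, `|Aop (a s) x - Aop (a t) x| <= e.
Proof.
move=> t0 e0; have [d d0 hd] := Aop_modulus (K := K) cU (m00_ge0 (K := K)) e0.
have [d' d'0 hd'] := fl_near t0 (e := Num.sqrt d) ltac:(by rewrite sqrtr_gt0).
exists d' => // s s0 st x; rewrite -Aop_subf; apply: hd; first exact: (fl_bdf2 fa t0 s0).
have b := fl_bdf2 fa t0 s0.
have := knm_le (m00_ge0 (K := K)) b (sqrtr_ge0 _) (hd' s s0 st).
by rewrite sqr_sqrtr ?(ltW d0)// => h; exact: h.
Qed.

Lemma qt_sup t e : 0 <= t -> 0 < e -> exists2 d : R, 0 < d &
  forall s r, 0 <= s -> s < r -> `|s - t| <= d -> `|r - t| <= d ->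
  forall y, Y y -> - Aop (a t) y - e <= H (qt s r) y.
Proof.
move=> t0 e0; have e2 : 0 < e / 2 by rewrite divr_gt0.
have [d1 d10 h1] := Aop_near t0 e2.
have [d2 d20 h2] := fl_sup fa (t + 1) e2.
exists (Num.min d1 (Num.min (d2 / 2) 1)); first by rewrite !lt_min d10 divr_gt0// ltr01.
move=> s r s0 sr; rewrite !le_min => /and3P[s1 s2 s3] /and3P[r1 r2 r3] y Yy.
move: s2 r2 r3; rewrite !ler_norml => /andP[s2 s2'] /andP[r2 r2'] /andP[r3 r3'].
have i3 := h2 s r y s0 (ltW sr) ltac:(lra) ltac:(lra) Yy.
have := h1 s s0 s1 y; rewrite ler_norml => /andP[i1 i2].
have rs : 0 < r - s by rewrite subr_gt0.
rewrite H_qt mulrC ler_pdivlMr//; apply: le_trans i3.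
by rewrite mulNr -mulrN mulrC ler_pM2l//; lra.
Qed.

(** The path lies on the unit sphere, so [a r - a s] is orthogonal to [a r + a s]. Replacing half
    the sum by [a t] costs the distances of [a r] and [a s] to [a t] times the norm of the
    quotient. *)
Lemma qt_orth t e L : 0 <= t -> 0 < e -> 0 <= L -> exists2 d : R, 0 < d &
  forall s r, 0 <= s -> s < r -> `|s - t| <= d -> `|r - t| <= d -> knm (qt s r) <= L ->
  `|a t (H (qt s r))| <= e.
Proof.
move=> t0 e0 L0; have L1 : 0 < L + 1 by rewrite ltr_wpDl.
have e2 : 0 < e / (L + 1) by rewrite divr_gt0.
have [d d0 hd] := fl_near t0 e2.
exists d => // s r s0 sr sd rd qL; have r0 : 0 <= r by rewrite ltW// (le_lt_trans s0).
have mm := m0_ge0 (K := K); have mmm := m00_ge0 (K := K).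
have [M M0 bq] := bdf_qt s0 sr.
have z : dot (a r) (qt s r) + dot (a s) (qt s r) = 0.
  rewrite (dot_qtr (fl_bdf fa r0).1 s0 sr) (dot_qtr (fl_bdf fa s0).1 s0 sr) -mulrDr.
  have -> : dot (a r) (subf (a r) (a s)) + dot (a s) (subf (a r) (a s)) =
      kN (a r) - kN (a s) + (dot (a s) (a r) - dot (a r) (a s)).
    rewrite (dot_subr (fl_bdf fa r0).1 (fl_bdf fa r0) (fl_bdf fa s0)).
    by rewrite (dot_subr (fl_bdf fa s0).1 (fl_bdf fa r0) (fl_bdf fa s0)) /dual_sqnorm; ring.
  rewrite !(fl_nrm fa)// (dot_sym mm mm (fl_bdf fa s0) (fl_bdf fa r0)); ring.
have E : a t (H (qt s r)) = - (1/2 * dot (subf (a r) (a t)) (qt s r) + 1/2 * dot (subf (a s) (a t)) (qt s r)).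
  rewrite {1 2}/kdot /subf -/(dot _ _) -!/(kdot k _ _); lra.
have b1 := dot_sup (K := K) mmm M0 (fl_bdf2 fa t0 r0) bq.
have b2 := dot_sup (K := K) mmm M0 (fl_bdf2 fa t0 s0) bq.
have n1 := hd r r0 rd; have n2 := hd s s0 sd.
have q0 : 0 <= knm (qt s r) by exact: knm_ge0.
have h u : 0 <= u -> `|u - t| <= d -> knm (subf (a u) (a t)) * knm (qt s r) <= e.
  move=> u0 ud; apply: (@le_trans _ _ (e / (L + 1) * L)).
    by apply: ler_pM => //; [exact: knm_ge0|exact: hd].
  by rewrite mulrAC -mulrA ler_piMr ?ltW// ltr_pdivrMr// mul1r ltrDl.
have c1 := le_trans b1 (h r r0 rd); have c2 := le_trans b2 (h s s0 sd).
move: c1 c2; rewrite E !ler_norml => /andP[? ?] /andP[? ?]; apply/andP; split; lra.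
Qed.

(* The admissible velocities at time [t]: [w] lies here iff [- w - A b] is in
   the normal cone, at [b = H (a t)], of the cone generated by [Y]. *)
Definition velo t w := (forall y, Y y -> - Aop (a t) y <= w y) /\ a t w = 0.

Lemma velo_limit t (s : nat -> (X -> R) -> R) C : 0 <= t -> 0 <= C ->
  (\forall n \near ultraN, (exists2 M, 0 <= M & bdf M (s n)) /\ kN (s n) <= C) ->
  (forall e, 0 < e -> \forall n \near ultraN, forall y, Y y -> - Aop (a t) y - e <= H (s n) y) ->
  (forall e, 0 < e -> \forall n \near ultraN, `|a t (H (s n))| <= e) ->
  velo t (fun x => ulim (fun n => H (s n) x)).
Proof.
move=> t0 C0 hs hA ho; have [hw cw uw] := weak_limit C0 hs; split.
  move=> y Yy; apply/ler_addgt0Pr => e e0; rewrite -lerBlDr.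
  by apply: (ultra_gec (cw y)); apply: filterS (hA e e0) => n; apply.
have c1 : a t (H (s n)) @[n --> ultraN] --> a t (fun x => ulim (fun n => H (s n) x)).
  apply: (@ultra_joint _ _ (fun=> a t) (a t) (fun n => H (s n)) _ m0 (m0_ge0 (K := K))).
  - by apply: nearW => _; exact: (fl_bdf fa t0).
  - exact: cvg_cst.
  - by apply: filterS hs => n [[M _ bn] _]; exact: cont_H bn.
  - exact: hb_cont hw.
  - exact: uw.
apply: (ultra_eq c1); apply/ultraP => e e0; have := ho e e0.
by apply: filterS => n; rewrite subr0.
Qed.

(** By [speed], no admissible velocity is shorter than [phi t]; this is the minimality against which
    limits of quotients are compared. *)
Lemma phi_velo t w C : 0 <= t -> 0 <= C -> hb k w (C ^+ 2) -> velo t w -> phi t <= C.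
Proof.
move=> t0 C0 hw [wA aw]; apply: phi_le; split => // h h0.
by apply: kN_small; [exact: mulr_ge0|exact: (speed cU fa t0 h0 C0 hw)].
Qed.

End Speed.

(** * Differentiability at good times *)

Section Derivative.
Context {R : realType} {X : pseudoMetricType R} {K : @pdkernel R X}.
Variables (U : X -> R) (cU : continuous U).
Local Notation k := (ker K).
Implicit Types (f g w : X -> R) (s t h u v r : R) (e M L C : R).
Local Notation H := (Hop k).
Local Notation dot := (kdot k).
Local Notation kN := (dual_sqnorm (K := K)).
Local Notation knm := (dual_norm (K := K)).
Local Notation m0 := (m0 (K := K)).
Local Notation flow := (flow (K := K) U).
Local Notation phi := (phi (K := K)).
Local Notation good := (good (K := K)).
Local Notation regular := (regular (K := K)).

Let mm : 0 <= m0 := m0_ge0 (K := K).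

Lemma kN_parallelogram M (s t : (X -> R) -> R) : 0 <= M -> bdf M s -> bdf M t ->
  kN (fun f => 1 / 2 * s f + 1 / 2 * t f) = kN s / 2 + kN t / 2 - kN (subf s t) / 4.
Proof.
move=> M0 bs bt; rewrite (kN_subf M0 M0 bs bt) /dual_sqnorm dot_linl.
rewrite (dot_linr _ _ bs.1 bs bt) (dot_linr _ _ bt.1 bs bt) (dot_sym M0 M0 bt bs).
by field.
Qed.

Variables (Y : set X) (a : R -> (X -> R) -> R) (fa : flow Y a) (reg : regular a).

Lemma good_phi t e : good a t -> 0 < e -> exists2 d : R, 0 < d < t &
  forall s, t - d <= s -> phi a s <= phi a t + e.
Proof.
move=> [t0 gt] e0; have [d dt hd] := gt e e0; exists d => // s ts.
by apply: le_trans hd; apply: (phi_mono cU fa reg) => //; lra.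
Qed.

Lemma seq_near t (s : nat -> R) : (forall n, `|s n - t| <= n.+1%:R^-1) ->
  forall d, 0 < d -> \forall n \near ultraN, `|s n - t| <= d.
Proof.
move=> hs d d0; have /ultraP/(_ d d0) := @cvg_ultraN_harmonic R.
by apply: filterS => n; rewrite subr0 => /ler_normlW; apply: le_trans.
Qed.

(* Two families of quotients that stay apart would produce, by averaging, an
   admissible velocity shorter than [phi a t]. *)
Lemma qt_cauchy t e : good a t -> 0 < e -> exists2 d : R, 0 < d < t &
  forall s r s' r', t - d <= s -> s < r -> r <= t + d -> t - d <= s' -> s' < r' -> r' <= t + d ->
    kN (subf (qt a s r) (qt a s' r')) <= e.
Proof.
move=> gt e0; have [t0 _] := gt; have tl := ltW t0.
apply: contrapT => nh.
pose dn (n : nat) : R := Num.min n.+1%:R^-1 (t / 2).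
have dn0 n : 0 < dn n by rewrite lt_min invr_gt0 ltr0n divr_gt0.
have dnt n : dn n < t by rewrite gt_min; apply/orP; right; lra.
have dnn n : dn n <= n.+1%:R^-1 by rewrite ge_min lexx.
have [z hz] : exists z : nat -> (R * R) * (R * R), forall n,
   [/\ t - dn n <= (z n).1.1 , (z n).1.1 < (z n).1.2 & (z n).1.2 <= t + dn n] /\
   [/\ t - dn n <= (z n).2.1 , (z n).2.1 < (z n).2.2 & (z n).2.2 <= t + dn n] /\
   e < kN (subf (qt a (z n).1.1 (z n).1.2) (qt a (z n).2.1 (z n).2.2)).
  apply: (@choose_seq _ (fun n z => [/\ t - dn n <= z.1.1 , z.1.1 < z.1.2 & z.1.2 <= t + dn n] /\
   [/\ t - dn n <= z.2.1 , z.2.1 < z.2.2 & z.2.2 <= t + dn n] /\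
   e < kN (subf (qt a z.1.1 z.1.2) (qt a z.2.1 z.2.2)))) => n.
  apply: contrapT => nz; apply: nh; exists (dn n); first by rewrite dn0 dnt.
  move=> s r s' r' h1 h2 h3 h4 h5 h6; rewrite leNgt; apply/negP => h7.
  by apply: nz; exists ((s, r), (s', r')).
have pos n : 0 < (z n).1.1 /\ 0 < (z n).2.1.
  by have [[h1 _ _] [[h2 _ _] _]] := hz n; have := dnt n; split; lra.
have near1 (p : nat -> R) : (forall n, t - dn n <= p n <= t + dn n) ->
    forall d, 0 < d -> \forall n \near ultraN, `|p n - t| <= d.
  move=> hp; apply: seq_near => n; apply: le_trans (dnn n).
  by have /andP[h1 h2] := hp n; rewrite ler_norml; apply/andP; split; lra.
have ns1 := near1 (fun n => (z n).1.1) ltac:(move=> n; have [[h1 h2 h3] _] := hz n; lra).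
have nr1 := near1 (fun n => (z n).1.2) ltac:(move=> n; have [[h1 h2 h3] _] := hz n; lra).
have ns2 := near1 (fun n => (z n).2.1) ltac:(move=> n; have [_ [[h1 h2 h3] _]] := hz n; lra).
have nr2 := near1 (fun n => (z n).2.2) ltac:(move=> n; have [_ [[h1 h2 h3] _]] := hz n; lra).
pose rho n : (X -> R) -> R := fun f => 1 / 2 * qt a (z n).1.1 (z n).1.2 f + 1 / 2 * qt a (z n).2.1 (z n).2.2 f.
have p0 := phi_ge0 reg t0.
pose eta : R := Num.min 1 (e / 8 / (2 * phi a t + 1)).
have q0 : 0 < 2 * phi a t + 1 by lra.
have eta0 : 0 < eta by rewrite lt_min ltr01 !divr_gt0.
have eta1 : (phi a t + eta) ^+ 2 <= phi a t ^+ 2 + e / 8.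
  have h1 : eta <= 1 by rewrite ge_min lexx.
  have h2 : eta * (2 * phi a t + 1) <= e / 8.
    by rewrite -ler_pdivlMr// ge_min lexx orbT.
  have h3 : eta * eta <= eta by rewrite -[leRHS]mulr1 ler_pM2l.
  by rewrite sqrrD -mulr_natr; nra.
have [d /andP[d0 dt] hd] := good_phi gt eta0.
have kb (s r : R) : 0 < s -> s < r -> `|s - t| <= d -> kN (qt a s r) <= phi a t ^+ 2 + e / 8.
  move=> s0 sr; rewrite ler_norml => /andP[h1 _].
  have [M M0 bq] := bdf_qt fa (ltW s0) sr.
  apply: (le_trans _ eta1); apply: (knm_le M0 bq); first by rewrite addr_ge0// ltW.
  by apply: (le_trans (knm_qt_phi fa reg s0 sr)); apply: hd; lra.
(* Each quotient has squared norm at most [phi ^ 2 + e / 8] and the two are more than [e] apart in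
   squared norm, so the parallelogram identity puts their mean below [phi ^ 2 + e / 8 - e / 4]. *)
pose C := phi a t ^+ 2 - e / 8.
have brho : \forall n \near ultraN, (exists2 M, 0 <= M & bdf M (rho n)) /\ kN (rho n) <= C.
  apply: filterS2 (ns1 d d0) (ns2 d d0) => n h1 h2.
  have [p1 p2] := pos n; have [[_ l1 _] [[_ l2 _] l3]] := hz n.
  have [M1 M10 b1] := bdf_qt fa (ltW p1) l1; have [M2 M20 b2] := bdf_qt fa (ltW p2) l2.
  split.
    by exists (`|1/2| * M1 + `|1/2| * M2); [rewrite addr_ge0// mulr_ge0|exact: bdf_comb].
  have M0 : 0 <= M1 + M2 by rewrite addr_ge0.
  have b1' : bdf (M1 + M2) (qt a (z n).1.1 (z n).1.2) by apply: bdf_le b1; lra.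
  have b2' : bdf (M1 + M2) (qt a (z n).2.1 (z n).2.2) by apply: bdf_le b2; lra.
  rewrite (kN_parallelogram M0 b1' b2').
  have := kb _ _ p1 l1 h1; have := kb _ _ p2 l2 h2.
  by rewrite /C; lra.
have C0 : 0 <= C.
  have /filter_ex [n [[M M0 bn] nC]] := brho.
  by apply: le_trans nC; exact: kN_ge0 bn.
have [hw cw uw] := weak_limit C0 brho.
have lrho n x : H (rho n) x = 1/2 * H (qt a (z n).1.1 (z n).1.2) x + 1/2 * H (qt a (z n).2.1 (z n).2.2) x by [].
have vw : velo (K := K) U Y a t (fun x => ulim (fun n => H (rho n) x)).
  apply: (velo_limit fa tl C0 brho) => e' e'0.
    have [d' d'0 hd'] := qt_sup cU fa tl e'0.
    apply: filterS2 (filterI (ns1 d' d'0) (nr1 d' d'0)) (filterI (ns2 d' d'0) (nr2 d' d'0)).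
    move=> n [h1 h2] [h3 h4] y Yy; have [p1 p2] := pos n; have [[_ l1 _] [[_ l2 _] l3]] := hz n.
    have := hd' _ _ (ltW p1) l1 h1 h2 y Yy; have := hd' _ _ (ltW p2) l2 h3 h4 y Yy.
    by rewrite lrho; lra.
  pose L := Num.sqrt (phi a t ^+ 2 + e / 8).
  have [d' d'0 hd'] := qt_orth fa tl e'0 (sqrtr_ge0 (phi a t ^+ 2 + e / 8)).
  have dd : 0 < Num.min d d' by rewrite lt_min d0.
  apply: filterS2 (filterI (ns1 _ dd) (nr1 _ dd)) (filterI (ns2 _ dd) (nr2 _ dd)).
  move=> n [h1 h2] [h3 h4]; move: h1 h2 h3 h4.
  rewrite !le_min => /andP[h1 h1'] /andP[h2 h2'] /andP[h3 h3'] /andP[h4 h4'].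
  have [p1 p2] := pos n; have [[_ l1 _] [[_ l2 _] l3]] := hz n.
  have i1 := hd' _ _ (ltW p1) l1 h1' h2' (ler_wsqrtr (kb _ _ p1 l1 h1)).
  have i2 := hd' _ _ (ltW p2) l2 h3' h4' (ler_wsqrtr (kb _ _ p2 l2 h3)).
  have [M1 M10 b1] := bdf_qt fa (ltW p1) l1; have [M2 M20 b2] := bdf_qt fa (ltW p2) l2.
  have -> : a t (H (rho n)) = 1/2 * a t (H (qt a (z n).1.1 (z n).1.2)) + 1/2 * a t (H (qt a (z n).2.1 (z n).2.2)).
    exact: (dot_linr _ _ (fl_bdf fa tl).1 b1 b2).
  move: i1 i2; rewrite !ler_norml => /andP[? ?] /andP[? ?]; apply/andP; split; lra.
have := phi_velo cU fa tl (sqrtr_ge0 C) _ vw.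
rewrite sqr_sqrtr// => /(_ hw) hC.
have : phi a t ^+ 2 <= Num.sqrt C ^+ 2 by rewrite ler_pXn2r// nnegrE ?sqrtr_ge0.
by rewrite sqr_sqrtr// /C; lra.
Qed.

Definition dseq t (n : nat) := qt a t (t + n.+1%:R^-1).
(* At a good time [dw], [dsd] and [nw] are the derivative of [H (a t)], that of
   [a t] as a functional on the RKHS, and the squared speed. *)
Definition dw t : X -> R := fun x => ulim (fun n => H (dseq t n) x).
Definition dsd t f : R := ulim (fun n => dseq t n f).
Definition nw t : R := dsd t (dw t).

Let rn (n : nat) : (0 : R) < n.+1%:R^-1. Proof. by rewrite invr_gt0. Qed.

Lemma dseq_near t d : 0 < d -> \forall n \near ultraN, [/\ t < t + n.+1%:R^-1,
  t + n.+1%:R^-1 <= t + d, n.+1%:R^-1 <= d & `|t + n.+1%:R^-1 - t| <= d].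
Proof.
have E (n : nat) : t + n.+1%:R^-1 - t = n.+1%:R^-1 by ring.
have h n : `|t + n.+1%:R^-1 - t| <= n.+1%:R^-1 by rewrite E ger0_norm// ltW.
move=> d0; apply: filterS (seq_near h d0) => n; rewrite E (ger0_norm (ltW (rn n))) => hn.
by rewrite ltrDl rn lerD2l.
Qed.

Lemma dseq_bnd t n : good a t -> (exists2 M, 0 <= M & bdf M (dseq t n)) /\ kN (dseq t n) <= phi a t ^+ 2.
Proof.
move=> [t0 _]; have tn : t < t + n.+1%:R^-1 by rewrite ltrDl rn.
have [M M0 bq] := bdf_qt fa (ltW t0) tn; split; first by exists M.
by apply: (knm_le M0 bq); [exact: (phi_ge0 reg)|exact: (knm_qt_phi fa reg)].
Qed.

Lemma dw_facts t : good a t -> [/\ hb k (dw t) (phi a t ^+ 2),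
  forall x, H (dseq t n) x @[n --> ultraN] --> dw t x & velo (K := K) U Y a t (dw t)].
Proof.
move=> gt; have [t0 _] := gt; have tl := ltW t0.
have C0 : 0 <= phi a t ^+ 2 by exact: sqr_ge0.
have hs : \forall n \near ultraN, (exists2 M, 0 <= M & bdf M (dseq t n)) /\ kN (dseq t n) <= phi a t ^+ 2.
  by apply: nearW => n; exact: dseq_bnd.
have [hw cw uw] := weak_limit C0 hs; split => //.
apply: (velo_limit fa tl C0 hs) => e e0.
  have [d d0 hd] := qt_sup cU fa tl e0; apply: filterS (dseq_near t d0) => n [h1 h2 h3 i2].
  have i1 : `|t - t| <= d by rewrite subrr normr0 ltW.
  exact: (hd _ _ tl h1 i1 i2).
have [d d0 hd] := qt_orth fa tl e0 (phi_ge0 reg t0); apply: filterS (dseq_near t d0) => n [h1 h2 h3 i2].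
have i1 : `|t - t| <= d by rewrite subrr normr0 ltW.
exact: (hd _ _ tl h1 i1 i2 (knm_qt_phi fa reg t0 h1)).
Qed.

Lemma dw_cont t : good a t -> continuous (dw t).
Proof. by move=> /dw_facts[/hb_cont]. Qed.

(** All intervals near [t] are allowed, not only those with endpoint [t]. This is strict
    differentiability, which lets two times on either side of [t] be compared in the energy
    estimates. *)
Lemma dw_conv t e : good a t -> 0 < e -> exists2 d : R, 0 < d < t &
  forall s r, t - d <= s -> s < r -> r <= t + d ->
    hb k (fun x => H (qt a s r) x - dw t x) e /\ (forall n, kN (subf (qt a s r) (dseq t n)) <= e \/ d < n.+1%:R^-1).
Proof.
move=> gt e0; have [t0 _] := gt; have tl := ltW t0.
have [d /andP[d0 dt] hd] := qt_cauchy gt e0; exists d; first by rewrite d0.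
move=> s r ts sr rt; have [_ cw _] := dw_facts gt.
have s0 : 0 <= s by lra.
have kn n : n.+1%:R^-1 <= d -> kN (subf (qt a s r) (dseq t n)) <= e.
  by move=> nd; apply: hd => //; rewrite ?ltrDl ?rn ?lerD2l//; lra.
split; last first.
  by move=> n; case: (leP n.+1%:R^-1 d) => h; [left; exact: kn|right].
apply: (@hb_ulim _ _ _ (fun n x => H (qt a s r) x - H (dseq t n) x)); first exact: ltW.
  by move=> x; apply: cvgB => //; exact: cvg_cst.
apply: filterS (dseq_near t d0) => n [_ _ h _].
have [[M M0 bn] _] := dseq_bnd n gt; have [M' M'0 bq] := bdf_qt fa s0 sr.
apply: (hb_le (kn n h)).
by apply: (@hb_H _ _ _ (M' + M)); [rewrite addr_ge0|exact: bdf_subf].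
Qed.

Lemma dsd_cvg t f C : good a t -> hb k f C -> dseq t n f @[n --> ultraN] --> dsd t f.
Proof.
move=> gt hf; apply: (@ulim_cvg _ _ (Num.sqrt C * phi a t)); apply: nearW => n.
have [[M M0 bn] nn] := dseq_bnd n gt.
apply: (le_trans (hb_CS_abs M0 bn hf)); apply: ler_wpM2l; first exact: sqrtr_ge0.
by apply: sqrt_le_sq => //; apply: (phi_ge0 reg); case: gt.
Qed.

Lemma dsd_conv t f C e : good a t -> hb k f C -> 0 < e -> exists2 d : R, 0 < d < t &
  forall s r, t - d <= s -> s < r -> r <= t + d -> `|qt a s r f - dsd t f| <= e.
Proof.
move=> gt hf e0; have [t0 _] := gt.
have C1 : 0 < Num.sqrt C + 1 by rewrite ltr_wpDl// sqrtr_ge0.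
have e1 : 0 < e / (Num.sqrt C + 1) by rewrite divr_gt0.
have [d /andP[d0 dt] hd] := dw_conv gt (exprn_gt0 2 e1); exists d; first by rewrite d0.
move=> s r ts sr rt; have [_ kn] := hd s r ts sr rt.
have s0 : 0 <= s by lra.
have cv := dsd_cvg gt hf.
apply: (ultra_lec (u := fun n => `|qt a s r f - dseq t n f|)).
  by apply: cvg_norm; apply: cvgB => //; exact: cvg_cst.
apply: filterS (dseq_near t d0) => n [_ _ h _].
have {}kn : kN (subf (qt a s r) (dseq t n)) <= (e / (Num.sqrt C + 1)) ^+ 2.
  by case: (kn n) => //; rewrite ltNge h.
have [[M M0 bn] _] := dseq_bnd n gt; have [M' M'0 bq] := bdf_qt fa s0 sr.
have := hb_CS_abs (addr_ge0 M'0 M0) (bdf_subf bq bn) hf.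
rewrite {1}/subf => /le_trans; apply.
apply: (@le_trans _ _ (Num.sqrt C * (e / (Num.sqrt C + 1)))).
  by apply: ler_wpM2l; [exact: sqrtr_ge0|apply: sqrt_le_sq => //; exact: ltW].
by rewrite mulrCA ler_piMr ?ltW// ltr_pdivrMr// mul1r ltrDl.
Qed.

Lemma dot_conv t e : good a t -> 0 < e -> exists2 d : R, 0 < d < t &
  forall s r s' r', t - d <= s -> s < r -> r <= t + d -> t - d <= s' -> s' < r' -> r' <= t + d ->
    `|dot (qt a s r) (qt a s' r') - nw t| <= e.
Proof.
move=> gt e0; have [t0 _] := gt; have p0 := phi_ge0 reg t0.
have e2 : 0 < e / 2 by rewrite divr_gt0.
have P1 : 0 < phi a t + 1 by rewrite ltr_wpDl.
have e1 : 0 < e / 2 / (phi a t + 1) by rewrite divr_gt0.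
have [hw _ _] := dw_facts gt.
have [d1 /andP[d10 d1t] h1] := dsd_conv gt hw e2.
have [d2 /andP[d20 d2t] h2] := dw_conv gt (exprn_gt0 2 e1).
have [d3 /andP[d30 d3t] h3] := good_phi gt ltr01.
pose d := Num.min d1 (Num.min d2 d3).
have dd : [/\ 0 < d, d <= d1, d <= d2 & d <= d3].
  by rewrite !lt_min d10 d20 d30 !ge_min !lexx !orbT.
have [d0 dd1 dd2 dd3] := dd; exists d; first by rewrite d0/=; lra.
move=> s r s' r' ts sr rt ts' sr' rt'.
have s0 : 0 <= s by lra. have s'0 : 0 <= s' by lra.
have i1 := h1 s r ltac:(lra) sr ltac:(lra).
have [i2 _] := h2 s' r' ltac:(lra) sr' ltac:(lra).
have i3 : knm (qt a s r) <= phi a t + 1.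
  by apply: (le_trans (knm_qt_phi fa reg _ sr)); [lra|apply: h3; lra].
have [M M0 bq] := bdf_qt fa s0 sr; have [M' M'0 bq'] := bdf_qt fa s'0 sr'.
have := hb_CS_abs M0 bq i2; rewrite sqrtr_sqr (ger0_norm (ltW e1)).
rewrite (linB bq.1 (cont_H (K := K) bq') (dw_cont gt)) => i4.
have i5 : e / 2 / (phi a t + 1) * knm (qt a s r) <= e / 2.
  rewrite -[leRHS](@divfK _ (phi a t + 1)) ?gt_eqF//.
  by apply: ler_wpM2l => //; exact: ltW.
have {i4} i4 := le_trans i4 i5.
move: i1 i4; rewrite -/(kdot k _ _) /nw !ler_norml => /andP[? ?] /andP[? ?]; apply/andP; split; lra.
Qed.

(** The squared norms of the quotients tend to [nw t], so the squared norm of [dw a t] is at most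
    [nw a t]; being an admissible velocity, [dw a t] is not shorter than [phi a t]. *)
Lemma nw_phi t : good a t -> phi a t ^+ 2 <= nw t.
Proof.
move=> gt; have [t0 _] := gt; have p0 := phi_ge0 reg t0.
apply/ler_addgt0Pr => e e0.
have [d /andP[d0 dt] hd] := dot_conv gt e0.
have [hw cw vw] := dw_facts gt.
have near : \forall n \near ultraN, kN (dseq t n) <= nw t + e.
  apply: filterS (dseq_near t d0) => n [h1 h2 h3 i2].
  have := hd t (t + n.+1%:R^-1) t (t + n.+1%:R^-1) ltac:(lra) h1 h2 ltac:(lra) h1 h2.
  by rewrite ler_norml => /andP[_ h4]; rewrite /dual_sqnorm /dseq; lra.
have n0 : 0 <= nw t + e.
  have /filter_ex [n hn] := near; apply: le_trans hn.
  by have [[M M0 bn] _] := dseq_bnd n gt; exact: kN_ge0 bn.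
have hw' : hb k (dw t) (Num.sqrt (nw t + e) ^+ 2).
  rewrite sqr_sqrtr//; apply: (hb_ulim n0 cw); apply: filterS near => n hn.
  by have [[M M0 bn] _] := dseq_bnd n gt; apply: hb_le hn _; exact: hb_H bn.
have := phi_velo cU fa (ltW t0) (sqrtr_ge0 _) hw' vw => h.
rewrite -[leRHS]sqr_sqrtr//; by rewrite ler_pXn2r ?nnegrE ?sqrtr_ge0.
Qed.

End Derivative.

(** * Energy dissipation *)

Lemma norm_sum3 {R : realType} (x1 x2 x3 b n e : R) : `|x1 - b| <= e / 4 -> `|x2 - b| <= e / 4 ->
  `|x3 - n| <= e / 4 -> 0 <= e -> `|x1 + x2 - x3 - (2 * b - n)| <= e.
Proof.
rewrite !ler_norml => /andP[? ?] /andP[? ?] /andP[? ?] ?; apply/andP; split; lra.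
Qed.

Lemma near_itv {R : realType} (s t d D : R) : `|s - t| <= d -> d <= D -> t - D <= s /\ s <= t + D.
Proof. by rewrite ler_norml => /andP[? ?] ?; split; lra. Qed.

Lemma near_add {R : realType} (u t h d D : R) : `|u - t| <= d -> h <= d -> d <= D / 2 -> u + h <= t + D.
Proof. by rewrite ler_norml => /andP[? ?] ? ?; lra. Qed.

Lemma half_le {R : realType} (d : R) : 0 < d -> d / 2 <= d.
Proof. by move=> ?; lra. Qed.

Lemma near_ge0 {R : realType} (s t d : R) : `|s - t| <= d -> d <= t -> 0 <= s.
Proof. by rewrite ler_norml => /andP[? ?] ?; lra. Qed.

Lemma norm_sub2 {R : realType} (x y z e : R) : `|x - y| <= e / 2 -> `|y - z| <= e / 2 -> `|x - z| <= e.
Proof. by rewrite !ler_norml => /andP[? ?] /andP[? ?]; apply/andP; split; lra. Qed.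

Section Energy.
Context {R : realType} {X : pseudoMetricType R} {K : @pdkernel R X}.
Variables (U : X -> R) (cU : continuous U).
Local Notation k := (ker K).
Implicit Types (f g w : X -> R) (s t h u v r : R) (e M L C : R).
Local Notation H := (Hop k).
Local Notation dot := (kdot k).
Local Notation Aop := (skew_op (K := K) U).
Local Notation kN := (dual_sqnorm (K := K)).
Local Notation knm := (dual_norm (K := K)).
Local Notation m0 := (m0 (K := K)).
Local Notation flow := (flow (K := K) U).
Local Notation phi := (phi (K := K)).
Local Notation good := (good (K := K)).
Local Notation regular := (regular (K := K)).
Local Notation dw := (dw (K := K)).
Local Notation nw := (nw (K := K)).
Local Notation mu := (@lebesgue_measure R).

Let mm : 0 <= m0 := m0_ge0 (K := K).

(** For [U = 2 V / eps] and [mu = (H b) b] this is [2 / eps] times the integral of [V] against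
    [mu]. *)
Definition Eng (b : (X -> R) -> R) : R := b (fun x => U x * H b x).

Lemma posfun_null Y b f g : posfun Y b -> continuous f -> continuous g ->
  (forall y, Y y -> 0 <= f y) -> b f = 0 -> b (fun x => f x * g x) = 0.
Proof.
move=> pb cf cg f0 bf; have [G [G0 gG]] := cont_bdd K cg.
have cfg : continuous (fun x => f x * g x) by exact: cont_mul.
have h (c : R) : b (fun x => c * f x) = 0 by rewrite (linZ pb.1)// bf mulr0.
apply/eqP; rewrite eq_le; apply/andP; split.
  rewrite -(h G); apply: (posfun_mono pb) => //; first by apply: cont_mul => //; exact: cont_cst.
  move=> y Yy; rewrite mulrC; apply: ler_wpM2r; first exact: f0.
  exact: le_trans (ler_norm _) (gG y).
rewrite -(h (- G)); apply: (posfun_mono pb) => //; first by apply: cont_mul => //; exact: cont_cst.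
move=> y Yy; rewrite [leRHS]mulrC; apply: ler_wpM2r; first exact: f0.
by have := gG y; rewrite ler_norml => /andP[].
Qed.

(* With [psi = U - (w + A b)/b], the function [w] equals [- b psi + H (psi b)]
   on the support, and the kernel is a reversible Markov kernel. *)
Lemma velo_work Y b w : posfun Y b -> kN b = 1 -> continuous w ->
  (forall y, Y y -> - Aop b y <= w y) -> b w = 0 -> b (fun x => U x * w x) <= 0.
Proof.
move=> pb nb cw wA bw.
have bb := posfun_bdf pb; have m0' := mass_ge0 pb.
have Hp x : 0 < H b x by apply: (H_pos _ pb); rewrite -/(dual_sqnorm b) nb.
have cH := cont_H (K := K) bb.
have cA := cont_Aop (K := K) cU m0' bb.
pose r x := w x + Aop b x.
have cr : continuous r by exact: cont_add.
have r0 y : Y y -> 0 <= r y by move=> /wA; rewrite /r; lra.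
have br : b r = 0 by rewrite /r (linD pb.1)// bw (Aop_self cU m0' bb) addr0.
have cHi : continuous (fun x => (H b x)^-1) by exact: cont_inv.
pose psi x := U x - r x * (H b x)^-1.
have cpsi : continuous psi by apply: cont_add => //; apply: cont_opp; exact: cont_mul.
(* [r] is nonnegative on [Y] with zero integral against [b], so [U b] and [psi b] are the same
   measure. *)
have HE x : H (wt U b) x = H (wt psi b) x.
  rewrite /Hop /wt; have cz : continuous (fun y => (H b y)^-1 * k y x).
    by apply: cont_mul => //; exact: cont_kl.
  have z := posfun_null pb cr cz r0 br.
  rewrite (_ : (fun y => psi y * k y x) = fun y => U y * k y x - r y * ((H b y)^-1 * k y x)).
    rewrite (linB pb.1) ?z ?subr0//; last exact: cont_mul.
    by apply: cont_mul => //; exact: cont_kl.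
  by apply/funext => y; rewrite /psi; ring.
have wE x : w x = - (H b x * psi x) + H (wt psi b) x.
  by rewrite -HE /psi /r /skew_op; have := lt0r_neq0 (Hp x); move: (H b x) => q q0; field.
have [M' M'0 bwt] := bdf_wt_ex (K := K) m0' cpsi bb.
have cHw := cont_H (K := K) bwt.
have E1 : b (fun x => U x * w x) = b (fun x => psi x * w x).
  have cz : continuous (fun y => (H b y)^-1 * w y) by exact: cont_mul.
  rewrite (_ : (fun x => U x * w x) = fun x => psi x * w x + r x * ((H b x)^-1 * w x)).
    rewrite (linD pb.1) ?(posfun_null pb cr cz r0 br) ?addr0//; exact: cont_mul.
  by apply/funext => y; rewrite /psi; ring.
have cp2 : continuous (fun x => psi x ^+ 2) by exact: cont_sqr.
have [M2 M20 bwt2] := bdf_wt_ex (K := K) m0' cp2 bb.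
have cH2 := cont_H (K := K) bwt2.
(* [Q x] is the integral in [y] of [k y x * (psi x - psi y) ^ 2] against [b]. Its own integral is
   twice the Dirichlet form of [psi], and that form equals [- b (U w)]. *)
pose Q x := psi x ^+ 2 * H b x - 2 * (psi x * H (wt psi b) x) + H (wt (fun x => psi x ^+ 2) b) x.
have Q0 x : 0 <= Q x.
  have ck : continuous (fun y => k y x) by exact: cont_kl.
  have -> : Q x = b (fun y => k y x * (psi x - psi y) ^+ 2).
    rewrite (_ : (fun y => _) = fun y => psi x ^+ 2 * k y x - 2 * psi x * (psi y * k y x) + psi y ^+ 2 * k y x).
      have c1 : continuous (fun y => psi x ^+ 2 * k y x) by apply: cont_mul => //; exact: cont_cst.
      have c2 : continuous (fun y => psi y * k y x) by exact: cont_mul.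
      have c3 : continuous (fun y => 2 * psi x * (psi y * k y x)) by apply: cont_mul => //; exact: cont_cst.
      have c4 : continuous (fun y => psi y ^+ 2 * k y x) by exact: cont_mul.
      rewrite (linD pb.1) ?(linB pb.1)//; last by apply: cont_add => //; exact: cont_opp.
      rewrite !(linZ pb.1)// /Q /Hop /wt; ring.
    by apply/funext => y; ring.
  apply: pb.2 => [|y _]; last by rewrite mulr_ge0 ?sqr_ge0// ltW// gk_pos.
  by apply: cont_mul => //; apply: cont_sqr; apply: cont_add; [exact: cont_cst|exact: cont_opp].
have cpH : continuous (fun x => psi x ^+ 2 * H b x) by exact: cont_mul.
have cpw : continuous (fun x => psi x * H (wt psi b) x) by exact: cont_mul.
have bQ : b Q = 2 * (b (fun x => psi x ^+ 2 * H b x) - b (fun x => psi x * H (wt psi b) x)).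
  have c1 : continuous (fun x => 2 * (psi x * H (wt psi b) x)) by apply: cont_mul => //; exact: cont_cst.
  rewrite /Q (linD pb.1) ?(linB pb.1)//; last by apply: cont_add => //; exact: cont_opp.
  rewrite (linZ pb.1)//.
  have -> : b (H (wt (fun x => psi x ^+ 2) b)) = b (fun x => psi x ^+ 2 * H b x).
    exact: (dot_sym (K := K) m0' M20 bb bwt2).
  ring.
have : 0 <= b Q by apply: pb.2 => //; apply: cont_add => //; apply: cont_add => //; apply: cont_opp; apply: cont_mul => //; exact: cont_cst.
have -> : b (fun x => U x * w x) = - b (fun x => psi x ^+ 2 * H b x) + b (fun x => psi x * H (wt psi b) x).
  rewrite E1 -(linN pb.1)// -(linD pb.1)//; last by exact: cont_opp.
  by congr b; apply/funext => x; rewrite {1}wE; ring.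
by rewrite bQ; lra.
Qed.

(** On measures of bounded total variation the dual norm is at least as strong as weak convergence:
    [f] is approximated in the RKHS, and the total variation pays for the error. *)
Lemma weak_modulus M f e : 0 <= M -> continuous f -> 0 < e -> exists2 d : R, 0 < d &
  forall s : (X -> R) -> R, bdf M s -> knm s <= d -> `|s f| <= e.
Proof.
move=> M0 cf e0; have M1 : 0 < M + 1 by rewrite ltr_wpDl.
have e1 : 0 < e / 2 / (M + 1) by rewrite !divr_gt0.
have [h [C [hh fh]]] := gk_univ K cf e1.
have C1 : 0 < Num.sqrt C + 1 by rewrite ltr_wpDl// sqrtr_ge0.
exists (e / 2 / (Num.sqrt C + 1)) => [|s b sd]; first by rewrite !divr_gt0.
have ch := hb_cont hh.
have cfh : continuous (fun x => f x - h x) by apply: cont_add => //; exact: cont_opp.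
have -> : s f = s (fun x => f x - h x) + s h by rewrite (linB b.1)//; ring.
apply: (le_trans (ler_normD _ _)); rewrite (splitr e); apply: lerD.
  apply: (le_trans (b.2 _ _ cfh (ltW e1) fh)).
  by rewrite mulrCA ler_piMr ?divr_ge0 ?ltW// ltr_pdivrMr// mul1r ltrDl.
apply: (le_trans (hb_CS_abs M0 b hh)).
apply: (@le_trans _ _ (Num.sqrt C * (e / 2 / (Num.sqrt C + 1)))).
  by apply: ler_wpM2l; [exact: sqrtr_ge0|exact: sd].
by rewrite mulrCA ler_piMr ?divr_ge0 ?ltW// ltr_pdivrMr// mul1r ltrDl.
Qed.

Variables (Y : set X) (a : R -> (X -> R) -> R) (fa : flow Y a).

Lemma fl_weak t f e : 0 <= t -> continuous f -> 0 < e -> exists2 d : R, 0 < d &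
  forall s, 0 <= s -> `|s - t| <= d -> `|a s f - a t f| <= e.
Proof.
move=> t0 cf e0; have [d1 d10 hd1] := weak_modulus (m00_ge0 (K := K)) cf e0.
have [d d0 hd] := fl_near fa t0 d10; exists d => // s s0 st.
exact: hd1 (fl_bdf2 fa t0 s0) (hd s s0 st).
Qed.

Lemma fl_UH s t : 0 <= s -> 0 <= t -> continuous (fun x => U x * (H (a s) x - H (a t) x)).
Proof.
move=> s0 t0; apply: cont_mul => //; apply: cont_add; first exact: (fl_cont_H fa).
by apply: cont_opp; exact: (fl_cont_H fa).
Qed.

(** Besides the two work terms, the difference of energies contains [- a_v (A b_u)], which closeness
    of [u] and [v] does not estimate to first order. The supersolution inequality at [u], tested
    against [a v], trades it for the scalar product of [a v] with a forward difference quotient, and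
    the scalar product of [a u] with that quotient is nonpositive because the path stays on the
    sphere. *)
Lemma energy_ineq T e : 0 < e -> exists2 d : R, 0 < d & forall u v h,
  0 <= u -> 0 <= v -> 0 < h -> h <= d -> u + h <= T ->
  Eng (a u) - Eng (a v) <= a u (fun x => U x * (H (a u) x - H (a v) x)) +
    a v (fun x => U x * (H (a u) x - H (a v) x)) - dot (subf (a u) (a v)) (qt a u (u + h)) + e.
Proof.
move=> e0; have [d d0 hd] := fl_sup_int cU fa T e0; exists d => // u v h u0 v0 h0 hd' uT.
have uh : u <= u + h by rewrite lerDl ltW.
have uh' : u < u + h by rewrite ltrDl.
have i1 := hd u (u + h) (a v) u0 uh uT ltac:(lra) (fl_pos fa v0) (fl_mass fa v0).
have uh0 : 0 <= u + h by lra.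
have bu := fl_bdf fa u0; have bv := fl_bdf fa v0.
rewrite (Aop_skew cU mm mm bu bv) in i1.
rewrite -(dot_subr (K := K) bv.1 (fl_bdf fa uh0) bu) in i1.
have q1 : dot (a v) (qt a u (u + h)) = h^-1 * dot (a v) (subf (a (u + h)) (a u)).
  by rewrite (dot_qtr fa bv.1 u0 uh'); congr (_^-1 * _); ring.
have q2 : dot (a u) (qt a u (u + h)) = h^-1 * dot (a u) (subf (a (u + h)) (a u)).
  by rewrite (dot_qtr fa bu.1 u0 uh'); congr (_^-1 * _); ring.
have q3 : dot (a u) (qt a u (u + h)) <= 0.
  rewrite q2 pmulr_rle0 ?invr_gt0// (dot_subr (K := K) bu.1 (fl_bdf fa uh0) bu).
  rewrite (dot_sym mm mm bu (fl_bdf fa uh0)) -/(dual_sqnorm _) (fl_nrm fa u0).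
  have := kN_dist fa u0 uh0; have := kN_ge0 (K := K) (m00_ge0 (K := K)) (fl_bdf2 fa u0 uh0).
  lra.
have q4 : - (a v (fun x => U x * H (a u) x) - a u (fun x => U x * H (a v) x) + e) <= dot (a v) (qt a u (u + h)).
  rewrite q1 mulrC ler_pdivlMr//; apply: le_trans i1.
  by rewrite le_eqVlt; apply/orP; left; apply/eqP; ring.
have q5 : dot (subf (a u) (a v)) (qt a u (u + h)) = dot (a u) (qt a u (u + h)) - dot (a v) (qt a u (u + h)) by [].
have cuu : continuous (fun x => U x * H (a u) x) by apply: cont_mul => //; exact: (fl_cont_H fa).
have cuv : continuous (fun x => U x * H (a v) x) by apply: cont_mul => //; exact: (fl_cont_H fa).
have e1 (b : (X -> R) -> R) : linC b -> b (fun x => U x * (H (a u) x - H (a v) x)) =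
   b (fun x => U x * H (a u) x) - b (fun x => U x * H (a v) x).
  by move=> lb; rewrite -(linB lb)//; congr b; apply/funext => x; ring.
rewrite (e1 _ bu.1) (e1 _ bv.1) /Eng q5; lra.
Qed.

Lemma work_bound G b s t : 0 <= G -> (forall x, `|U x| <= G) -> bdf m0 b -> 0 <= s -> 0 <= t ->
  `|b (fun x => U x * (H (a s) x - H (a t) x))| <= m0 * (G * knm (subf (a s) (a t))).
Proof.
move=> G0 UG bb s0 t0; apply: bb.2; [exact: fl_UH|by rewrite mulr_ge0// knm_ge0|].
move=> x; rewrite normrM; apply: ler_pM => //; rewrite -H_subf.
exact: (H_sup_dot x (m00_ge0 (K := K)) (fl_bdf2 fa t0 s0)).
Qed.

Lemma Eng_cont t e : 0 <= t -> 0 < e -> exists2 d : R, 0 < d &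
  forall s, 0 <= s -> `|s - t| <= d -> `|Eng (a s) - Eng (a t)| <= e.
Proof.
move=> t0 e0; have [G [G0 UG]] := cont_bdd K cU.
have mp := m0_gt0 (K := K).
have G1 : 0 < m0 * (G + 1) by rewrite mulr_gt0// ltr_wpDl.
have e1 : 0 < e / 2 / (m0 * (G + 1)) by rewrite !divr_gt0.
have e2 : 0 < e / 2 by rewrite divr_gt0.
have [d1 d10 h1] := fl_near fa t0 e1.
have cu : continuous (fun x => U x * H (a t) x) by apply: cont_mul => //; exact: (fl_cont_H fa).
have [d2 d20 h2] := fl_weak t0 cu e2.
exists (Num.min d1 d2); first by rewrite lt_min d10.
move=> s s0; rewrite le_min => /andP[i1 i2].
have cs : continuous (fun x => U x * H (a s) x) by apply: cont_mul => //; exact: (fl_cont_H fa).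
have E : Eng (a s) - Eng (a t) = a s (fun x => U x * (H (a s) x - H (a t) x)) +
   (a s (fun x => U x * H (a t) x) - a t (fun x => U x * H (a t) x)).
  rewrite (_ : (fun x => U x * (_ - _)) = fun x => U x * H (a s) x - U x * H (a t) x).
    by rewrite (linB (fl_bdf fa s0).1)// /Eng; ring.
  by apply/funext => x; ring.
rewrite E; apply: (le_trans (ler_normD _ _)); rewrite (splitr e); apply: lerD; last exact: h2.
apply: (le_trans (work_bound G0 UG (fl_bdf fa s0) s0 t0)).
apply: (@le_trans _ _ (m0 * (G + 1) * (e / 2 / (m0 * (G + 1))))).
  rewrite (mulrA m0 G); apply: ler_pM; [by rewrite mulr_ge0|exact: knm_ge0| |exact: h1].
  by apply: ler_wpM2l => //; rewrite lerDl.
by rewrite mulrC divfK// gt_eqF.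
Qed.

Lemma Eng_bound G t : 0 <= G -> (forall x, `|U x| <= G) -> 0 <= t -> `|Eng (a t)| <= G.
Proof.
move=> G0 UG t0; have pa := fl_pos fa t0.
have cH := fl_cont_H fa t0.
have E (c : R) : a t (fun x => c * H (a t) x) = c.
  by rewrite (linZ pa.1)// -/(kdot k _ _) -/(dual_sqnorm _) (fl_nrm fa t0) mulr1.
have H0 x : 0 <= H (a t) x by exact: (H_ge0 x pa).
have c1 (c : R) : continuous (fun x => c * H (a t) x) by apply: cont_mul => //; exact: cont_cst.
have c2 : continuous (fun x => U x * H (a t) x) by exact: cont_mul.
rewrite ler_norml -{1}(E (- G)) -{2}(E G); apply/andP; split;
  apply: (posfun_mono pa) => // y _; apply: ler_wpM2r => //; have := UG y; rewrite ler_norml => /andP[]//.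
Qed.

Hypothesis reg : regular a.

Lemma Eng_lip s : 0 < s -> exists2 L, 0 <= L & forall u v, s <= u -> u <= v ->
  `|Eng (a v) - Eng (a u)| <= L * (v - u).
Proof.
move=> s0; have [G [G0 UG]] := cont_bdd K cU; have p0 := phi_ge0 reg s0.
have key u v : s <= u -> s <= v -> Eng (a u) - Eng (a v) <= (m0 * G + m0 * G + phi a s) * knm (subf (a u) (a v)).
  move=> su sv; apply/ler_addgt0Pr => e e0.
  have [d d0 hd] := energy_ineq (u + 1) e0.
  have u0 : 0 < u by lra. have v0 : 0 < v by lra.
  have h0 : 0 < Num.min d 1 by rewrite lt_min d0 ltr01.
  have hh : Num.min d 1 <= d by rewrite ge_min lexx.
  have h1 : Num.min d 1 <= 1 by rewrite ge_min lexx orbT.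
  have i1 := hd u v _ (ltW u0) (ltW v0) h0 hh ltac:(lra).
  have uh : u < u + Num.min d 1 by rewrite ltrDl.
  have [M M0 bq] := bdf_qt fa (ltW u0) uh.
  have i2 := dot_sup (K := K) (m00_ge0 (K := K)) M0 (fl_bdf2 fa (ltW v0) (ltW u0)) bq.
  have i3 : knm (qt a u (u + Num.min d 1)) <= phi a s.
    by apply: (le_trans (knm_qt_phi fa reg u0 uh)); exact: (phi_mono cU fa reg).
  have i4 := work_bound G0 UG (fl_bdf fa (ltW u0)) (ltW u0) (ltW v0).
  have i5 := work_bound G0 UG (fl_bdf fa (ltW v0)) (ltW u0) (ltW v0).
  have i6 : knm (subf (a u) (a v)) * knm (qt a u (u + Num.min d 1)) <= knm (subf (a u) (a v)) * phi a s.
    by apply: ler_wpM2l => //; exact: knm_ge0.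
  have {i2 i6} i2 := le_trans i2 i6.
  move: i2 i4 i5; rewrite !ler_norml => /andP[? ?] /andP[? ?] /andP[? ?].
  lra.
exists ((m0 * G + m0 * G + phi a s) * phi a s); first by rewrite mulr_ge0// !addr_ge0// mulr_ge0.
move=> u v su uv; have u0 : 0 < u by lra. have v0 : 0 < v by lra.
have kn : knm (subf (a v) (a u)) <= phi a s * (v - u).
  have [_ /(_ (v - u))] := phi_spd' reg u0.
  rewrite (_ : u + (v - u) = v); last by ring.
  rewrite subr_ge0 => /(_ uv) h; apply: (le_trans h); apply: ler_wpM2r; first by rewrite subr_ge0.
  exact: (phi_mono cU fa reg).
have kn' : knm (subf (a u) (a v)) <= phi a s * (v - u).
  by rewrite (knm_subfC mm (fl_bdf fa (ltW u0)) (fl_bdf fa (ltW v0))).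
have i1 := key u v su ltac:(lra); have i2 := key v u ltac:(lra) su.
have B0 : 0 <= m0 * G + m0 * G + phi a s by rewrite !addr_ge0// mulr_ge0.
have j1 := ler_wpM2l B0 kn; have j2 := ler_wpM2l B0 kn'.
rewrite ler_norml -mulrA; apply/andP; split; lra.
Qed.

(** The limit of the bound in [energy_ineq] divided by [u - v]: each work term gives one copy of
    [a (U w)], and the scalar product of quotients gives the squared speed. *)
Definition dE t : R := 2 * a t (fun x => U x * dw a t x) - nw a t.

(** The bound is one-sided but holds for both orders of [u] and [v]; exchanging them yields the
    two-sided derivative. *)
Lemma Eng_deriv t e : good a t -> 0 < e -> exists2 d : R, 0 < d < t &
  forall u v, `|u - t| <= d -> `|v - t| <= d ->
  Eng (a u) - Eng (a v) <= (u - v) * dE t + e * `|u - v|.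
Proof.
move=> gt e0; have [t0 _] := gt; have tl := ltW t0; have mp := m0_gt0 (K := K).
have [G [G0 UG]] := cont_bdd K cU.
have cdw := dw_cont cU fa reg gt.
have cUd : continuous (fun x => U x * dw a t x) by exact: cont_mul.
have e4 : 0 < e / 4 by rewrite divr_gt0.
have e8 : 0 < e / 8 by rewrite divr_gt0.
have mG : 0 < m0 * (G + 1) by rewrite mulr_gt0// ltr_wpDl.
have e1 : 0 < e / 8 / (m0 * (G + 1)) by rewrite divr_gt0.
have [d1 /andP[d10 d1t] h1] := dw_conv cU fa reg gt (exprn_gt0 2 e1).
have [d2 d20 h2] := fl_weak tl cUd e8.
have [d3 /andP[d30 d3t] h3] := dot_conv cU fa reg gt e4.
pose d := Num.min d1 (Num.min d2 (d3 / 2)).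
have [d0 dd1 dd2 dd3] : [/\ 0 < d, d <= d1, d <= d2 & d <= d3 / 2].
  by rewrite !lt_min d10 d20 divr_gt0// !ge_min !lexx !orbT.
have dt : d <= t by apply: (le_trans dd1); exact: ltW.
have d33 : d3 / 2 <= d3 by exact: half_le.
have dd3' := le_trans dd3 d33.
have dlt : d < t := le_lt_trans dd1 d1t.
have conv b s r : 0 <= b -> `|b - t| <= d -> s < r -> `|s - t| <= d -> `|r - t| <= d ->
   `|a b (fun x => U x * H (qt a s r) x) - a t (fun x => U x * dw a t x)| <= e / 4.
  move=> b0 bt sr st rt.
  have [s1 _] := near_itv st dd1; have [_ r2] := near_itv rt dd1.
  have [hbd _] := h1 s r s1 sr r2.
  have s0 : 0 <= s := near_ge0 st dt.
  have [M M0 bq] := bdf_qt fa s0 sr; have cq := cont_H (K := K) bq.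
  have bb := fl_bdf fa b0.
  have i1 : `|a b (fun x => U x * (H (qt a s r) x - dw a t x))| <= e / 8.
    have -> : e / 8 = m0 * ((G + 1) * (e / 8 / (m0 * (G + 1)))).
      by rewrite (mulrA m0) (mulrC (m0 * _)) divfK ?gt_eqF.
    apply: bb.2.
    - by apply: cont_mul => //; apply: cont_add => //; exact: cont_opp.
    - by rewrite mulr_ge0// ?ltW// ltr_wpDl.
    - move=> x; rewrite normrM; apply: ler_pM => //.
        by apply: (le_trans (UG x)); rewrite lerDl.
      by have := hb_sup x hbd; rewrite sqrtr_sqr (ger0_norm (ltW e1)).
  have i2 := h2 b b0 (le_trans bt dd2).
  have E : a b (fun x => U x * (H (qt a s r) x - dw a t x)) =
     a b (fun x => U x * H (qt a s r) x) - a b (fun x => U x * dw a t x).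
    by rewrite -(linB bb.1)//; [congr (a b); apply/funext => x; ring|exact: cont_mul].
  have e82 : e / 8 = e / 4 / 2 by field.
  by rewrite E e82 in i1; rewrite e82 in i2; exact: norm_sub2 i1 i2.
exists d; first by rewrite d0.
move=> u v ut vt; have [->|uv] := eqVneq u v; first by rewrite !subrr normr0 mul0r mulr0 addr0.
have u0 : 0 <= u := near_ge0 ut dt. have v0 : 0 <= v := near_ge0 vt dt.
have [s [r [sr st rt sg]]] : exists s r, [/\ s < r, `|s - t| <= d, `|r - t| <= d &
    forall f, subf (a u) (a v) f = (u - v) * qt a s r f].
  case: (ltgtP u v) uv => // h _.
    exists u, v; split => // f; rewrite qtE mulrA (_ : (u - v) * (v - u)^-1 = -1); first by rewrite /subf; ring.
    by field; rewrite subr_eq0 gt_eqF.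
  exists v, u; split => // f; rewrite qtE mulrA divff ?mul1r// subr_eq0 gt_eqF//.
have s0 : 0 <= s := near_ge0 st dt.
have [M M0 bq] := bdf_qt fa s0 sr; have cq := cont_H (K := K) bq.
have HD x : H (a u) x - H (a v) x = (u - v) * H (qt a s r) x by rewrite -H_subf /Hop sg.
have cUq : continuous (fun x => U x * H (qt a s r) x) by exact: cont_mul.
have W b : 0 <= b -> a b (fun x => U x * (H (a u) x - H (a v) x)) = (u - v) * a b (fun x => U x * H (qt a s r) x).
  move=> b0; rewrite -(linZ (fl_bdf fa b0).1)//; congr (a b); apply/funext => x; rewrite HD; ring.
apply/ler_addgt0Pr => e' e'0.
have [d' d'0 hd'] := energy_ineq (t + d3) e'0.
pose h := Num.min d' d; have h0 : 0 < h by rewrite lt_min d'0.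
have hd1 : h <= d' by rewrite ge_min lexx.
have hd2 : h <= d by rewrite ge_min lexx orbT.
have uh3 : u + h <= t + d3 := near_add ut hd2 dd3.
have := hd' u v h u0 v0 h0 hd1 uh3.
rewrite (W u u0) (W v v0).
have D2 : dot (subf (a u) (a v)) (qt a u (u + h)) = (u - v) * dot (qt a s r) (qt a u (u + h)) by rewrite /kdot sg.
rewrite D2.
have c1 := conv u s r u0 ut sr st rt; have c2 := conv v s r v0 vt sr st rt.
have [s1 _] := near_itv st dd3'; have [_ r2] := near_itv rt dd3'; have [u1 _] := near_itv ut dd3'.
have uh : u < u + h by rewrite ltrDl.
have c3 := h3 s r u (u + h) s1 sr r2 u1 uh uh3.
move: c1 c2 c3.
move: (a u _) (a v _) (dot _ _) => A1 A2 A3 c1 c2 c3.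
have : `|A1 + A2 - A3 - dE t| <= e.
  exact: (norm_sum3 c1 c2 c3 (ltW e0)).
have nuv : 0 <= `|u - v| by exact: normr_ge0.
move=> c4; have c5 : (u - v) * (A1 + A2 - A3 - dE t) <= e * `|u - v|.
  apply: le_trans (ler_norm _) _; rewrite normrM mulrC; exact: ler_wpM2r.
lra.
Qed.

Lemma dE_phi t : good a t -> dE t <= - phi a t ^+ 2.
Proof.
move=> gt; have [t0 _] := gt; have [hw _ [wA aw]] := dw_facts cU fa reg gt.
have := nw_phi cU fa reg gt.
have := velo_work (fl_pos fa (ltW t0)) (fl_nrm fa (ltW t0)) (hb_cont hw) wA aw.
rewrite /dE; lra.
Qed.

Lemma bad_null : exists N : set R, [/\ measurable N, mu N = 0%E & forall t, 0 < t -> ~ N t -> good a t].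
Proof.
exists [set t | 0 < t /\ ~ good a t]; have cN := good_countable a; split.
- exact: countable_measurable.
- exact: countable_lebesgue_measure0.
- by move=> t t0 nN; apply: contrapT => ng; apply: nN.
Qed.

(** At almost every time [r] the slope of [- Eng] is at least [phi a r ^ 2], and [phi] is smallest
    at the right end. *)
Lemma energy_dissip s t : 0 < s -> s <= t -> (t - s) * phi a t ^+ 2 <= Eng (a s) - Eng (a t).
Proof.
move=> s0 st; have [N [mN N0 gN]] := bad_null; have [L L0 hL] := Eng_lip s0.
suff : (t - s) * phi a t ^+ 2 <= - Eng (a t) - - Eng (a s) by lra.
apply: (@ae_growth_lip _ (fun r => - Eng (a r)) N s t (phi a t ^+ 2) L st mN N0 L0).
  move=> u v su uv vt; rewrite (_ : - Eng (a v) - - Eng (a u) = - (Eng (a v) - Eng (a u))); last by ring.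
  by rewrite normrN; exact: hL.
move=> u su ut nN e e0; have u0 : 0 < u by lra.
have gu := gN u u0 nN; have [d /andP[d0 du] hd] := Eng_deriv gu e0; exists d => // v uv vt vd.
have := hd v u ltac:(rewrite ger0_norm; lra) ltac:(rewrite subrr normr0; lra).
have := dE_phi gu; have := phi_mono cU fa reg u0 (ltW ut).
have pt : 0 <= phi a t by apply: (phi_ge0 reg); lra.
rewrite (ger0_norm (_ : 0 <= v - u)) ?subr_ge0// => h1 h2.
have h3 : phi a t ^+ 2 <= phi a u ^+ 2 by rewrite ler_pXn2r ?nnegrE//; exact: le_trans h1.
have h4 : (v - u) * (phi a t ^+ 2 + dE u) <= 0 by apply: mulr_ge0_le0; [rewrite subr_ge0|lra].
lra.
Qed.

Lemma Eng_noninc s t : 0 <= s -> s <= t -> Eng (a t) <= Eng (a s).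
Proof.
move=> s0 st; have [<-|ss] := eqVneq s t; first exact: lexx.
have st' : s < t by rewrite lt_neqAle ss st.
apply/ler_addgt0Pr => e e0; have [d d0 hd] := Eng_cont s0 e0.
pose u := s + Num.min d (t - s).
have du : 0 < Num.min d (t - s) by rewrite lt_min d0 subr_gt0.
have dd : Num.min d (t - s) <= d by rewrite ge_min lexx.
have dt : Num.min d (t - s) <= t - s by rewrite ge_min lexx orbT.
have u0 : 0 < u by rewrite /u; lra.
have ut : u <= t by rewrite /u; lra.
have := energy_dissip u0 ut.
have : 0 <= (t - u) * phi a t ^+ 2 by rewrite mulr_ge0 ?subr_ge0 ?sqr_ge0.
have := hd u (ltW u0); rewrite (_ : u - s = Num.min d (t - s)); last by rewrite /u; ring.
rewrite (ger0_norm (ltW du)) => /(_ dd); rewrite ler_norml => /andP[? ?]; lra.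
Qed.

(** The dissipation over [[s, t]] with [s -> 0]. It bounds the speed by a multiple of [t ^ (-1/2)]
    determined by the energy drop alone, whatever the constants in [regular]. *)
Lemma phi_bound t : 0 < t -> t * phi a t ^+ 2 <= Eng (a 0) - Eng (a t).
Proof.
move=> t0; apply/ler_addgt0Pr => e e0.
have P1 : 0 < phi a t ^+ 2 + 1 by rewrite ltr_wpDl// sqr_ge0.
pose s := Num.min t (e / (phi a t ^+ 2 + 1)).
have s0 : 0 < s by rewrite lt_min t0 divr_gt0.
have st : s <= t by rewrite ge_min lexx.
have se : s * phi a t ^+ 2 <= e.
  apply: (@le_trans _ _ (e / (phi a t ^+ 2 + 1) * phi a t ^+ 2)).
    by apply: ler_wpM2r; [exact: sqr_ge0|rewrite ge_min lexx orbT].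
  by rewrite mulrAC -mulrA ler_piMr ?ltW// ltr_pdivrMr// mul1r ltrDl.
have := energy_dissip s0 st; have := Eng_noninc (lexx 0) (ltW s0); lra.
Qed.

(** Cauchy-Schwarz in time between the length, of density at most [phi], and the dissipation, of
    density at least [phi ^ 2]. It is obtained from [phi <= phi ^ 2 / (2 l) + l / 2], integrated
    over almost every time and then optimized at [l = g / (t - s)]. Only the energy enters the
    bound, so it does not see the set [Y]. *)
Lemma holder_pos s t : 0 < s -> s <= t -> kN (subf (a t) (a s)) <= (t - s) * (Eng (a s) - Eng (a t)).
Proof.
move=> s0 st; have [N [mN N0 gN]] := bad_null; have [L L0 hL] := Eng_lip s0.
have p0 := phi_ge0 reg s0; have t0 : 0 < t by lra.
have sl := ltW s0; have tl := ltW t0.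
have b2 := fl_bdf2 fa sl tl.
set g := knm (subf (a t) (a s)).
have gE : kN (subf (a t) (a s)) = g ^+ 2 by rewrite (knm_sq (m00_ge0 (K := K)) b2).
have g0 : 0 <= g by exact: knm_ge0.
have En := Eng_noninc sl st.
have key (l : R) : 0 < l -> g <= (Eng (a s) - Eng (a t)) / (2 * l) + l / 2 * (t - s).
  move=> l0; have l2 : 0 < 2 * l by rewrite mulr_gt0.
  pose F r := - (knm (subf (a r) (a s)) + Eng (a r) / (2 * l)).
  have tri u v : s <= u -> u <= v -> `|knm (subf (a v) (a s)) - knm (subf (a u) (a s))| <= phi a u * (v - u).
    move=> su uv; have u0 : 0 < u by lra. have v0 : 0 < v by lra.
    have bu := fl_bdf fa (ltW u0); have bv := fl_bdf fa (ltW v0); have bs := fl_bdf fa sl.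
    have t1 := knm_tri (K := K) mm bv bu bs; have t2 := knm_tri (K := K) mm bu bv bs.
    rewrite (knm_subfC mm bu bv) in t2.
    have [_ /(_ (v - u))] := phi_spd' reg u0.
    rewrite (_ : u + (v - u) = v); last by ring.
    rewrite subr_ge0 => /(_ uv) h; rewrite ler_norml; apply/andP; split; lra.
  have h1 : F t - F s >= (t - s) * (- (l / 2)).
    apply: (@ae_growth_lip _ F N s t _ (phi a s + L / (2 * l)) st mN N0).
    - by rewrite addr_ge0// divr_ge0// ltW.
    - move=> u v su uv vt; have i1 := tri u v su uv; have i2 := hL u v su uv.
      have i3 : phi a u * (v - u) <= phi a s * (v - u).
        by apply: ler_wpM2r; [rewrite subr_ge0|exact: (phi_mono cU fa reg)].
      have -> : F v - F u = - (knm (subf (a v) (a s)) - knm (subf (a u) (a s))) - (Eng (a v) - Eng (a u)) / (2 * l).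
        by rewrite /F; ring.
      apply: (le_trans (ler_normB _ _)); rewrite normrN [leRHS]mulrDl; apply: lerD; first exact: le_trans i1 i3.
      have l2i : 0 <= (2 * l)^-1 by rewrite invr_ge0 ltW.
      by rewrite normrM (ger0_norm l2i) mulrAC; apply: ler_wpM2r.
    - move=> u su ut nN e e0; have u0 : 0 < u by lra.
      have gu := gN u u0 nN; have e1 : 0 < e * (2 * l) by rewrite mulr_gt0.
      have [d /andP[d0 du] hd] := Eng_deriv gu e1; exists d => // v uv vt vd.
      have := hd v u ltac:(rewrite ger0_norm; lra) ltac:(rewrite subrr normr0; lra).
      have := dE_phi gu; have := tri u v su uv.
      have vu : 0 <= v - u by rewrite subr_ge0.
      rewrite (ger0_norm vu) => i1 i2 i3.
      have {i1} i1 := le_trans (ler_norm _) i1.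
      have i4 : (Eng (a v) - Eng (a u)) / (2 * l) <= (v - u) * (- phi a u ^+ 2 / (2 * l) + e).
        rewrite ler_pdivrMr//; apply: (le_trans i3).
        have -> : (v - u) * (- phi a u ^+ 2 / (2 * l) + e) * (2 * l) = (v - u) * (- phi a u ^+ 2) + e * (2 * l) * (v - u).
          by field; rewrite gt_eqF.
        by rewrite lerD2r; apply: ler_wpM2l.
      have i5 : phi a u - phi a u ^+ 2 / (2 * l) <= l / 2.
        have -> : phi a u - phi a u ^+ 2 / (2 * l) = l / 2 - (phi a u - l) ^+ 2 / (2 * l).
          by field; rewrite gt_eqF.
        by rewrite gerBl divr_ge0 ?sqr_ge0// ltW.
      have i6 : (v - u) * (phi a u - phi a u ^+ 2 / (2 * l)) <= (v - u) * (l / 2) by apply: ler_wpM2l.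
      rewrite /F; lra.
  have h2 : F s = - (Eng (a s) / (2 * l)).
    rewrite /F /knm (_ : subf (a s) (a s) = fun=> 0); last by apply/funext => f; rewrite /subf subrr.
    by rewrite /dual_sqnorm /kdot sqrtr0 add0r.
  move: h1; rewrite h2 /F -/g mulrBl; lra.
rewrite gE; have [g00|gn0] := eqVneq g 0.
  by rewrite g00 expr0n mulr_ge0// subr_ge0.
have gp : 0 < g by rewrite lt_neqAle eq_sym gn0.
have [st0|st0] := eqVneq s t.
  move: gp; rewrite /g st0 /knm (_ : subf _ _ = fun=> 0); last by apply/funext => f; rewrite /subf subrr.
  by rewrite /dual_sqnorm /kdot sqrtr0 ltxx.
have ts : 0 < t - s by rewrite subr_gt0 lt_neqAle st0.
have := key (g / (t - s)) (divr_gt0 gp ts).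
have -> : (Eng (a s) - Eng (a t)) / (2 * (g / (t - s))) + g / (t - s) / 2 * (t - s) =
   ((t - s) * (Eng (a s) - Eng (a t))) / (2 * g) + g / 2.
  by field; rewrite !gt_eqF.
move=> h; have : g / 2 <= (t - s) * (Eng (a s) - Eng (a t)) / (2 * g) by lra.
by rewrite ler_pdivlMr ?mulr_gt0// expr2; lra.
Qed.

Lemma holder s t : 0 <= s -> s <= t -> kN (subf (a t) (a s)) <= (t - s) * (Eng (a s) - Eng (a t)).
Proof.
move=> s0 st; have [<-|ss] := eqVneq s t.
  rewrite subrr mul0r (_ : subf _ _ = fun=> 0) //; last by apply/funext => f; rewrite /subf subrr.
have st' : s < t by rewrite lt_neqAle ss st.
have t0 : 0 <= t by lra.
have B0 : 0 <= (t - s) * (Eng (a s) - Eng (a t)).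
  by rewrite mulr_ge0 ?subr_ge0// Eng_noninc.
rewrite -(knm_sq (m00_ge0 (K := K)) (fl_bdf2 fa s0 t0)).
suff : knm (subf (a t) (a s)) <= Num.sqrt ((t - s) * (Eng (a s) - Eng (a t))).
  move=> h; rewrite -[leRHS]sqr_sqrtr// ler_pXn2r ?nnegrE ?sqrtr_ge0//; exact: knm_ge0.
apply/ler_addgt0Pr => e e0; have [d d0 hd] := fl_near fa s0 e0.
pose q := Num.min d (t - s).
have q0 : 0 < q by rewrite lt_min d0 subr_gt0.
have qd : q <= d by rewrite ge_min lexx.
have qt_ : q <= t - s by rewrite ge_min lexx orbT.
have u0 : 0 < s + q by lra.
have ut : s + q <= t by lra.
have h1 := holder_pos u0 ut.
have h2 := hd (s + q) (ltW u0); rewrite (_ : s + q - s = q) in h2; last by ring.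
rewrite (ger0_norm (ltW q0)) in h2; have {}h2 := h2 qd.
apply: (le_trans (knm_tri mm (fl_bdf fa t0) (fl_bdf fa (ltW u0)) (fl_bdf fa s0))).
apply: lerD => //; apply: ler_wsqrtr; apply: (le_trans h1).
have := Eng_noninc s0 (ltac:(lra) : s <= s + q).
have := Eng_noninc (ltW u0) ut.
move: (Eng (a (s + q))) => E1 i1 i2; apply: ler_pM; lra.
Qed.

End Energy.

(** * Existence of flows *)

Section Minimizer.
Context {R : realType} {X : pseudoMetricType R} {K : @pdkernel R X}.
Local Notation k := (ker K).
Local Notation kap := (kmin K).
Local Notation H := (Hop k).
Local Notation kN := (dual_sqnorm (K := K)).
Implicit Types (Y : set X) (b c : (X -> R) -> R).

Lemma kN_addZ Y b c (t : R) : posfun Y b -> posfun Y c ->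
  kN (fun f => t * c f + b f) = kN b + 2 * t * c (H b) + t ^+ 2 * kN c.
Proof.
move=> pb pc; have bb := posfun_bdf pb; have bc := posfun_bdf pc.
have mb := mass_ge0 pb; have mc := mass_ge0 pc.
have -> : (fun f => t * c f + b f) = fun f => t * c f + 1 * b f by apply/funext => f; rewrite mul1r.
rewrite /dual_sqnorm dot_linl (dot_linr _ _ bc.1 bc bb) (dot_linr _ _ bb.1 bc bb).
by rewrite (dot_sym mb mc bb bc) -/(kdot k c b); ring.
Qed.

(* Minimize [kN b / 2 - b g] over the cone. *)
Lemma cone_projection Y (g : X -> R) : continuous g -> exists b,
  [/\ posfun Y b, forall y, Y y -> g y <= H b y & b (H b) = b g].
Proof.
move=> cg; have [G [G0 gG]] := cont_bdd K cg.
pose Q b := kN b / 2 - b g.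
have kp := gk_kap K.
have Qlow b : posfun Y b -> kap * mass b ^+ 2 / 2 - G * mass b <= Q b.
  move=> pb; have := mass_dot (K := K) pb; rewrite -/(dual_sqnorm b).
  have := posfun_bd (e := G) pb cg (fun y _ => gG y); rewrite ler_norml => /andP[_].
  rewrite /Q; lra.
pose S := [set Q b | b in posfun Y].
have Sne : S !=set0 by exists (Q (fun=> 0)); exists (fun=> 0) => //; exact: posfun0.
have Slb : has_inf S.
  split => //; exists (- (G ^+ 2 / (2 * kap))) => _ [b pb <-].
  apply: le_trans (Qlow b pb).
  have -> : kap * mass b ^+ 2 / 2 - G * mass b = kap / 2 * (mass b - G / kap) ^+ 2 - G ^+ 2 / (2 * kap).
    by field; rewrite gt_eqF.
  by rewrite lerDr mulr_ge0 ?sqr_ge0// divr_ge0// ltW.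
pose I := inf S.
have [b_ hb_] : exists b_ : nat -> (X -> R) -> R, forall n, posfun Y (b_ n) /\ Q (b_ n) <= I + n.+1%:R^-1.
  apply: (@choose_seq _ (fun n b => posfun Y b /\ Q b <= I + n.+1%:R^-1)) => n.
  have n0 : (0 : R) < n.+1%:R^-1 by rewrite invr_gt0.
  by have [_ [b pb <-] h] := inf_adherent n0 Slb; exists b; split => //; exact: ltW.
(* Coercivity: [kap m^2 / 2 - G m <= Q b <= I + 1] forces [m <= 2 (G + |I + 1|) / kap] as soon as
   [m >= 1]. *)
pose M := 1 + 2 * (G + `|I + 1|) / kap.
have M0 : 0 <= M by rewrite addr_ge0// divr_ge0 ?mulr_ge0 ?addr_ge0// ltW.
have mM n : mass (b_ n) <= M.
  have [pb Qb] := hb_ n; have := Qlow _ pb; have m0 := mass_ge0 pb.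
  have Q1 : Q (b_ n) <= I + 1.
    by apply: (le_trans Qb); rewrite lerD2l invf_le1 ?ler1n ?ltr0n.
  have := Q1; have := ler_norm (I + 1).
  move=> h1 h2 h3; rewrite leNgt; apply/negP => mM.
  have m1 : 1 <= mass (b_ n).
    apply/ltW; apply: le_lt_trans mM; rewrite /M lerDl divr_ge0 ?mulr_ge0 ?addr_ge0// ltW//.
  have h4 : 2 * (G + `|I + 1|) / kap < mass (b_ n) by move: mM; rewrite /M; lra.
  rewrite ltr_pdivrMr// in h4.
  clear mM; move: (mass (b_ n)) m0 m1 h3 h4 => m m0 m1 h3 h4.
  have h5 : 2 * (G + `|I + 1|) * m < m * kap * m by rewrite ltr_pM2r//; lra.
  have h6 : `|I + 1| <= `|I + 1| * m by rewrite ler_peMr.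
  lra.
pose b := uls b_.
have pm : \forall n \near ultraN, posfun Y (b_ n) /\ mass (b_ n) <= M.
  by apply: nearW => n; split => //; have [] := hb_ n.
have [pb bn] := uls_posfun (K := K) pm; rewrite -/b in pb.
have QI : Q b <= I.
  have c1 : Q (b_ n) @[n --> ultraN] --> Q b.
    apply: cvgB; last exact: (uls_cvg (K := K) bn cg).
    by apply: cvgMl; exact: (uls_dot (K := K) M0 M0 bn bn).
  have c2 : (fun n => I + n.+1%:R^-1 : R) @ ultraN --> I + 0.
    by apply: cvgD; [exact: cvg_cst|exact: cvg_ultraN_harmonic].
  rewrite -[leRHS]addr0; apply: (ultra_le c1 c2).
  by apply: nearW => n; have [] := hb_ n.
have Qmin c : posfun Y c -> Q b <= Q c.
  by move=> pc; apply: (le_trans QI); apply: ge_inf; [case: Slb|exists c].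
have var c : posfun Y c -> c g <= c (H b).
  move=> pc; have mc := mass_ge0 pc; have n0 : 0 <= kN c := kN_ge0 (K := K) mc (posfun_bdf pc).
  apply/ler_addgt0Pr => e e0.
  pose t := e / (kN c + 1); have n1 : 0 < kN c + 1 by rewrite ltr_wpDl.
  have t0 : 0 < t by rewrite divr_gt0.
  have := Qmin _ (posfunD (ltW t0) pc pb); rewrite /Q (kN_addZ _ pb pc).
  have te : t * kN c <= e.
    by rewrite /t mulrAC -mulrA ler_piMr ?ltW// ltr_pdivrMr// mul1r ltrDl.
  move=> h; have h1 : t * (c g) <= t * (c (H b) + t * kN c / 2) by lra.
  rewrite ler_pM2l// in h1; apply: (le_trans h1); rewrite lerD2l.
  by have := mulr_ge0 (ltW t0) n0; lra.
exists b; split => //.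
  move=> y Yy; exact: (var _ (posfun_dirac Yy)).
apply/eqP; rewrite eq_le; apply/andP; split; last exact: var.
have nb0 : 0 <= kN b := kN_ge0 (K := K) (mass_ge0 pb) (posfun_bdf pb).
apply/ler_addgt0Pr => e e0.
have n1 : 0 < kN b + 1 by rewrite ltr_wpDl.
(* Shrinking [b] to [(1 - t) b] stays in the cone and gives [b (H b) <= b g], the inequality
   opposite to the one obtained by adding a multiple of [b]. *)
pose t := Num.min 1 (e / (kN b + 1)).
have t0 : 0 < t by rewrite lt_min ltr01 divr_gt0.
have t1 : t <= 1 by rewrite ge_min lexx.
have te : t * kN b <= e.
  apply: (@le_trans _ _ (e / (kN b + 1) * kN b)).
    by apply: ler_wpM2r => //; rewrite ge_min lexx orbT.
  by rewrite mulrAC -mulrA ler_piMr ?ltW// ltr_pdivrMr// mul1r ltrDl.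
have t1' : 0 <= 1 - t by rewrite subr_ge0.
have := Qmin _ (posfunD t1' pb (posfun0 Y)).
rewrite /Q (kN_addZ _ (posfun0 Y) pb) !addr0.
have -> : kN (fun=> 0) = 0 by [].
rewrite -/(kdot k b b) -/(dual_sqnorm b) => h.
have z : b (H (fun=> 0)) = 0 by exact: lin0 pb.1.
rewrite z in h.
have h1 : t * (kN b) <= t * (b g + t * kN b / 2) by lra.
rewrite ler_pM2l// in h1; apply: (le_trans h1); rewrite lerD2l.
by have := mulr_ge0 (ltW t0) nb0; lra.
Qed.

End Minimizer.

(** * Limits of approximate flows along the ultrafilter *)

Section FlowLimit.
Context {R : realType} {X : pseudoMetricType R} {K : @pdkernel R X}.
Variables (U : X -> R) (cU : continuous U).
Local Notation k := (ker K).
Local Notation kap := (kmin K).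
Local Notation H := (Hop k).
Local Notation dot := (kdot k).
Local Notation Aop := (skew_op (K := K) U).
Local Notation kN := (dual_sqnorm (K := K)).
Local Notation knm := (dual_norm (K := K)).
Local Notation flow := (flow (K := K) U).
Implicit Types (s t e T : R).

Lemma uls_Aop (b : nat -> (X -> R) -> R) (M : R) y : (\forall n \near ultraN, bdf M (b n)) ->
  Aop (b n) y @[n --> ultraN] --> Aop (uls b) y.
Proof.
move=> bn; apply: cvgB; first by apply: cvgMr; apply: (uls_cvg (K := K) bn); exact: cont_kl.
by apply: (uls_cvg (K := K) bn); apply: cont_mul => //; exact: cont_kl.
Qed.

Variables (Y : set X) (a : nat -> R -> (X -> R) -> R).
Hypothesis Hpos : forall t, 0 <= t -> \forall n \near ultraN, posfun Y (a n t).
Hypothesis Hnrm : forall t, 0 <= t -> kN (a n t) @[n --> ultraN] --> (1 : R).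
Hypothesis Hcont : forall T e, 0 < e -> exists2 d : R, 0 < d & forall s t,
    0 <= s -> s <= t -> t <= T -> t <= s + d ->
    \forall n \near ultraN, kN (subf (a n t) (a n s)) <= e.
(** Two errors of different nature: [e] determines the step [d] and is multiplied by [t - s], while
    [e'] absorbs discretization errors that vanish along the ultrafilter for fixed [s] and [t]. *)
Hypothesis Hsup : forall T e, 0 < e -> exists2 d : R, 0 < d & forall s t y,
    0 <= s -> s <= t -> t <= T -> t <= s + d -> Y y -> forall e', 0 < e' ->
    \forall n \near ultraN, H (a n t) y - H (a n s) y >= - (t - s) * (Aop (a n s) y + e) - e'.

Definition ulflow t := uls (fun n => a n t).

(** The mass bound for squared norm at most 2: the approximate paths are on the unit sphere only in
    the limit. *)
Let M1 : R := 1 + 2 / kap.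
Let M10 : 0 <= M1. Proof. by rewrite /M1 addr_ge0// divr_ge0// ltW// (gk_kap K). Qed.

Lemma ulflow_near t : 0 <= t -> \forall n \near ultraN, posfun Y (a n t) /\ mass (a n t) <= M1.
Proof.
move=> t0; have /ultraP/(_ _ ltr01) := Hnrm t0; apply: filterS2 (Hpos t0) => n pa.
rewrite ler_norml => /andP[_ h]; split => //; apply: (le_trans (mass_le (K := K) pa)).
by rewrite lerD2l ler_pM2r ?invr_gt0 ?(gk_kap K)// -/(dual_sqnorm _); lra.
Qed.

Lemma ulflow_bdf t : 0 <= t -> \forall n \near ultraN, bdf M1 (a n t).
Proof. by move=> /ulflow_near h; have [] := uls_posfun (K := K) h. Qed.

Lemma ulflow_kN s t : 0 <= s -> 0 <= t ->
  kN (subf (a n t) (a n s)) @[n --> ultraN] --> kN (subf (ulflow t) (ulflow s)).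
Proof.
move=> s0 t0; have bs := ulflow_bdf s0; have bt := ulflow_bdf t0.
have bst : \forall n \near ultraN, bdf (M1 + M1) (subf (a n t) (a n s)).
  by apply: filterS2 bs bt => n b1 b2; exact: bdf_subf.
have h := uls_dot (K := K) (addr_ge0 M10 M10) (addr_ge0 M10 M10) bst bst.
rewrite /dual_sqnorm; suff E : forall f, continuous f -> uls (fun n => subf (a n t) (a n s)) f = subf (ulflow t) (ulflow s) f.
  have -> : dot (subf (ulflow t) (ulflow s)) (subf (ulflow t) (ulflow s)) =
    dot (uls (fun n => subf (a n t) (a n s))) (uls (fun n => subf (a n t) (a n s))); last exact: h.
  have EH : Hop k (uls (fun n => subf (a n t) (a n s))) = Hop k (subf (ulflow t) (ulflow s)).
    by apply/funext => x; apply: E; exact: cont_kl.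
  rewrite /kdot E EH //; apply: (cont_H (K := K)).
  by apply: bdf_subf; apply: (uls_bdf (K := K)); exact: ulflow_bdf.
move=> f cf; apply: ulimE; apply: cvgB; exact: (uls_cvg (K := K) (ulflow_bdf _) cf).
Qed.

Lemma flow_limit : flow Y ulflow.
Proof.
split.
- by move=> t t0; have [] := uls_posfun (K := K) (ulflow_near t0).
- move=> t t0; have bt := ulflow_bdf t0.
  exact: (ultra_eq (uls_dot (K := K) M10 M10 bt bt) (Hnrm t0)).
- move=> T e e0; have [d d0 hd] := Hcont T e0; exists d => // s t s0 st tT td.
  by apply: (ultra_lec (ulflow_kN s0 (le_trans s0 st))); exact: hd.
- move=> T e e0; have [d d0 hd] := Hsup T e0; exists d => // s t y s0 st tT td Yy.
  have t0 := le_trans s0 st.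
  apply/ler_addgt0Pr => e' e'0; rewrite -lerBlDr.
  have c1 : H (a n t) y - H (a n s) y @[n --> ultraN] --> H (ulflow t) y - H (ulflow s) y.
    by apply: cvgB; apply: (uls_cvg (K := K) (ulflow_bdf _)) => //; exact: cont_kl.
  have c2 : (fun n => - (t - s) * (Aop (a n s) y + e) - e') @ ultraN --> - (t - s) * (Aop (ulflow s) y + e) - e'.
    apply: cvgB; last exact: cvg_cst.
    by apply: cvgMr; apply: cvgD; [exact: (@uls_Aop (fun n => a n s) M1 y (ulflow_bdf s0))|exact: cvg_cst].
  by apply: (ultra_le c2 c1); exact: hd.
Qed.

Lemma ulflow_spd t L : 0 <= t -> 0 <= L ->
  (forall h e, 0 <= h -> 0 < e -> \forall n \near ultraN, knm (subf (a n (t + h)) (a n t)) <= L * h + e) ->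
  spd (K := K) ulflow t L.
Proof.
move=> t0 L0 hL; split => // h h0; apply/ler_addgt0Pr => e e0.
have Lh : 0 <= L * h + e by rewrite addr_ge0 ?mulr_ge0// ltW.
apply: kN_small => //; have th := addr_ge0 t0 h0.
apply: (ultra_lec (ulflow_kN t0 th)).
have := hL h e h0 e0; apply: filterS3 (ulflow_bdf t0) (ulflow_bdf th) => n b1 b2.
exact: (knm_le (addr_ge0 M10 M10) (bdf_subf b2 b1) Lh).
Qed.

End FlowLimit.

(** * The Euler scheme where the dual norm controls total variation *)

Section FiniteFlow.
Context {R : realType} {X : pseudoMetricType R} {K : @pdkernel R X}.
Variables (U : X -> R) (cU : continuous U).
Local Notation k := (ker K).
Local Notation kap := (kmin K).
Local Notation H := (Hop k).
Local Notation dot := (kdot k).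
Local Notation Aop := (skew_op (K := K) U).
Local Notation kN := (dual_sqnorm (K := K)).
Local Notation knm := (dual_norm (K := K)).
Local Notation flow := (flow (K := K) U).
Implicit Types (s t e T tau : R) (Y : set X) (b c : (X -> R) -> R).

(** Equivalence of the dual norm and total variation on differences, as on a finite set. It makes
    the steps of the scheme Lipschitz in time, with a constant [MY] that is not controlled when the
    set is refined. *)
Definition tv_bounded Y (MY : R) := 0 <= MY /\ forall b c, posfun Y b -> posfun Y c ->
  forall f e, continuous f -> 0 <= e -> (forall x, `|f x| <= e) ->
  `|subf b c f| <= MY * knm (subf b c) * e.

Variables (Y : set X) (MY : R) (hY : tv_bounded Y MY).
Variables (G : R) (G0 : 0 <= G) (UG : forall x, `|U x| <= G).

Let mb : R := 1 + 2 / kap.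
Let mb0 : 0 <= mb. Proof. by rewrite /mb addr_ge0// divr_ge0// ltW// (gk_kap K). Qed.

Let mb_mass b : posfun Y b -> kN b <= 2 -> mass b <= mb.
Proof.
move=> pb h; apply: (le_trans (mass_le (K := K) pb)).
by rewrite lerD2l ler_pM2r ?invr_gt0 ?(gk_kap K).
Qed.

Definition Ec : R := mb * G * (MY + 1).

Lemma Ec_ge0 : 0 <= Ec.
Proof. by case: hY => h _; rewrite !mulr_ge0// addr_ge0. Qed.

(** The pairing is [(c - b)(U H b) - b (U H (c - b))]. The first term is bounded through total
    variation by [MY G mb], the second through the sup norm by [mb G]; together they make up
    [Ec]. *)
Lemma step_bound b c : posfun Y b -> kN b <= 2 -> posfun Y c ->
  `|subf c b (Aop b)| <= Ec * knm (subf c b).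
Proof.
move=> pb b2 pc; have mB := mb_mass pb b2.
have bb : bdf mb b by apply: bdf_le mB (posfun_bdf pb).
have bc := posfun_bdf pc; have mc := mass_ge0 pc.
have bD := bdf_subf bc bb; have mD : 0 <= mass c + mb by rewrite addr_ge0.
have cHD := cont_H (K := K) bD; have cHb := cont_H (K := K) bb.
have i1 : `|subf c b (fun x => U x * H b x)| <= MY * knm (subf c b) * (G * mb).
  apply: hY.2 => //; [exact: cont_mul|exact: mulr_ge0|move=> x].
  rewrite normrM; apply: ler_pM => //; rewrite ger0_norm; last exact: (H_ge0 x pb).
  exact: le_trans (H_up x pb) mB.
have i2 : `|b (fun x => U x * H (subf c b) x)| <= mb * (G * knm (subf c b)).
  apply: bb.2; [exact: cont_mul|by rewrite mulr_ge0// knm_ge0|move=> x].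
  by rewrite normrM; apply: ler_pM => //; exact: (H_sup_dot x mD bD).
rewrite (Aop_skew cU mb0 mD bb bD); apply: (le_trans (ler_normB _ _)).
by rewrite /Ec; lra.
Qed.

(** The optimality conditions for projecting the explicit step [H b - tau A b] on the cone: the
    excess of [H c] over it is nonnegative on [Y] and has zero integral against [c]. This excess is
    the discrete form of [tau r]. *)
Definition euler_step_of tau b c := [/\ posfun Y c,
  forall y, Y y -> H b y - tau * Aop b y <= H c y & c (H c) = c (fun y => H b y - tau * Aop b y)].

Lemma euler_step_ex : exists st : R -> ((X -> R) -> R) -> (X -> R) -> R,
  forall tau b, posfun Y b -> euler_step_of tau b (st tau b).
Proof.
have h (z : R * ((X -> R) -> R)) : exists c, posfun Y z.2 -> euler_step_of z.1 z.2 c.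
  case: z => tau b /=; have [pb|nb] := pselect (posfun Y b); last by exists b.
  have mb' := mass_ge0 pb; have bb := posfun_bdf pb.
  have cg : continuous (fun y => H b y - tau * Aop b y).
    apply: cont_add; first exact: (cont_H (K := K) bb).
    by apply: cont_opp; apply: cont_mul; [exact: cont_cst|exact: (cont_Aop cU mb' bb)].
  by have [c [pc h1 h2]] := cone_projection (K := K) Y cg; exists c.
by have [st hst] := choice h; exists (fun tau b => st (tau, b)) => tau b pb; exact: (hst (tau, b)).
Qed.

(** The projection is tested with [b] and with [c], and [b (A b) = 0] by skewness: the norm cannot
    decrease, and it increases only at second order in [tau]. Over [T / tau] steps the drift away
    from the unit sphere is of order [tau] and disappears in the limit. *)
Lemma euler_step_est tau b c : 0 <= tau -> posfun Y b -> kN b <= 2 -> euler_step_of tau b c ->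
  [/\ kN b <= kN c, kN c <= kN b + (tau * Ec) ^+ 2 & knm (subf c b) <= tau * Ec].
Proof.
move=> t0 pb b2 [pc hA hE]; have Ec0 := Ec_ge0.
have mb' := mass_ge0 pb; have bb := posfun_bdf pb; have bc := posfun_bdf pc; have mc := mass_ge0 pc.
have bD := bdf_subf bc bb; have mD : 0 <= mass c + mass b by rewrite addr_ge0.
have cHb := cont_H (K := K) bb; have cHc := cont_H (K := K) bc.
have cA := cont_Aop (K := K) cU mb' bb.
have ctA : continuous (fun y => tau * Aop b y) by apply: cont_mul => //; exact: cont_cst.
have cg : continuous (fun y => H b y - tau * Aop b y) by apply: cont_add => //; exact: cont_opp.
have e1 : kN c = dot c b - tau * subf c b (Aop b).
  rewrite /dual_sqnorm /kdot hE (linB bc.1)// (linZ bc.1)// /subf.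
  by rewrite (Aop_self cU mb' bb) subr0.
have e2 : kN b <= dot b c.
  have : b (fun y => H b y - tau * Aop b y) <= b (H c) by exact: (posfun_mono pb).
  by rewrite (linB bb.1)// (linZ bb.1)// (Aop_self cU mb' bb) mulr0 subr0.
rewrite (dot_sym mb' mc bb bc) in e2.
have e3 := kN_subf (K := K) mc mb' bc bb.
have e4 : kN (subf c b) = knm (subf c b) ^+ 2 by rewrite (knm_sq mD bD).
have i1 := step_bound pb b2 pc.
have n0 : 0 <= knm (subf c b) by exact: knm_ge0.
have i2 : - (tau * subf c b (Aop b)) <= tau * Ec * knm (subf c b).
  rewrite -mulrN -mulrA; apply: ler_wpM2l => //.
  by move: i1; rewrite ler_norml => /andP[]; lra.
move: (knm (subf c b)) (tau * subf c b (Aop b)) (tau * Ec) (mulr_ge0 t0 Ec0) n0 e1 e3 e4 i2 => x y z z0 x0 e1 e3 e4 i2.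
split.
- have := sqr_ge0 x; lra.
- have := sqr_ge0 (x - z); rewrite sqrrB -mulr_natr; lra.
- have h : x * x <= z * x by rewrite -expr2; lra.
  have [->//|xn0] := eqVneq x 0.
  by rewrite ler_pM2r// in h; rewrite lt_neqAle eq_sym xn0.
Qed.

Section Sequence.
Variables (st : R -> ((X -> R) -> R) -> (X -> R) -> R).
Hypothesis hst : forall tau b, posfun Y b -> euler_step_of tau b (st tau b).
Variables (b0 : (X -> R) -> R) (pb0 : posfun Y b0) (nb0 : kN b0 = 1).
Variables (tau : R) (tau0 : 0 < tau).

Definition eul n := iter n (st tau) b0.

Lemma eul_pos n : posfun Y (eul n).
Proof. by elim: n => [//|n IH]; have [] := hst tau IH. Qed.

Lemma eul_kN n : n%:R * (tau * Ec) ^+ 2 <= 1 -> 1 <= kN (eul n) <= 1 + n%:R * (tau * Ec) ^+ 2.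
Proof.
have s0 := sqr_ge0 (tau * Ec).
elim: n => [_|n IH]; first by rewrite mul0r addr0 nb0 lexx.
rewrite -natr1 mulrDl mul1r => h.
have /andP[h1 h2] := IH ltac:(lra).
have [e1 e2 _] := euler_step_est (ltW tau0) (eul_pos n) ltac:(lra) (hst tau (eul_pos n)).
apply/andP; split; first exact: le_trans h1 e1.
by apply: (le_trans e2); lra.
Qed.

Lemma eul_kN2 m n : (n <= m)%N -> m%:R * (tau * Ec) ^+ 2 <= 1 -> kN (eul n) <= 2.
Proof.
move=> nm h; have h' : n%:R * (tau * Ec) ^+ 2 <= 1.
  by apply: le_trans h; apply: ler_wpM2r; [exact: sqr_ge0|rewrite ler_nat].
by have /andP[_] := eul_kN h'; lra.
Qed.

Lemma eul_dist i m j : (j <= m)%N -> m%:R * (tau * Ec) ^+ 2 <= 1 -> (i <= j)%N ->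
  knm (subf (eul j) (eul i)) <= (j%:R - i%:R) * tau * Ec.
Proof.
elim: j => [|j IH] jm hm.
  rewrite leqn0 => /eqP ->; rewrite subrr !mul0r /knm /dual_sqnorm.
  rewrite (_ : subf _ _ = fun=> 0); first by rewrite /kdot sqrtr0.
  by apply/funext => f; rewrite /subf subrr.
rewrite leq_eqVlt => /orP[/eqP ->|].
  rewrite subrr !mul0r /knm /dual_sqnorm (_ : subf _ _ = fun=> 0); first by rewrite /kdot sqrtr0.
  by apply/funext => f; rewrite /subf subrr.
rewrite ltnS => ij; have jm' : (j <= m)%N by exact: ltnW.
have := IH jm' hm ij.
have [_ _ h] := euler_step_est (ltW tau0) (eul_pos j) (eul_kN2 jm' hm) (hst tau (eul_pos j)).
have bnd n : (n <= m)%N -> bdf mb (eul n).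
  by move=> nm; apply: bdf_le (mb_mass (eul_pos n) (eul_kN2 nm hm)) (posfun_bdf (eul_pos n)).
have := knm_tri (K := K) mb0 (bnd _ jm) (bnd _ jm') (bnd _ (leq_trans ij jm')).
rewrite -natr1; have : knm (subf (eul j.+1) (eul j)) <= tau * Ec by [].
lra.
Qed.

Lemma eul_sup i y e j : Y y -> (i <= j)%N ->
  (forall l, (i <= l)%N -> (l < j)%N -> Aop (eul l) y <= Aop (eul i) y + e) ->
  H (eul j) y - H (eul i) y >= - ((j%:R - i%:R) * tau) * (Aop (eul i) y + e).
Proof.
move=> Yy; elim: j => [|j IH].
  by rewrite leqn0 => /eqP -> _; rewrite !subrr mul0r oppr0 mul0r.
rewrite leq_eqVlt => /orP[/eqP -> _|].
  by rewrite !subrr mul0r oppr0 mul0r.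
rewrite ltnS => ij hl.
have h1 := IH ij (fun l il lj => hl l il (ltnW lj)).
have [_ /(_ y Yy) h2 _] := hst tau (eul_pos j).
have h3 := hl j ij (ltnSn j).
have h4 : tau * Aop (eul j) y <= tau * (Aop (eul i) y + e) by apply: ler_wpM2l => //; exact: ltW.
have h5 : H (eul j) y - tau * Aop (eul j) y <= H (eul j.+1) y by [].
rewrite -natr1; lra.
Qed.

End Sequence.

Lemma truncn_div t tau : 0 <= t -> 0 < tau ->
  (Num.truncn (t / tau))%:R * tau <= t /\ t <= (Num.truncn (t / tau))%:R * tau + tau.
Proof.
move=> t0 tp; have h : 0 <= t / tau by rewrite divr_ge0// ltW.
have /andP[h1 h2] := truncn_itv h; split; first by rewrite -ler_pdivlMr.
rewrite -[X in _ + X]mul1r -mulrDl natr1 -ler_pdivrMr//; exact: ltW.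
Qed.

Lemma finite_flow b0 : posfun Y b0 -> kN b0 = 1 ->
  exists a, [/\ flow Y a, regular (K := K) a & forall f, a 0 f = b0 f].
Proof.
move=> pb0 nb0; have [st hst] := euler_step_ex; have E0 := Ec_ge0.
pose tau (n : nat) : R := n.+1%:R^-1.
have tau0 n : 0 < tau n by rewrite invr_gt0.
pose I n t := Num.truncn (t / tau n).
pose a n t := eul st b0 (tau n) (I n t).
have tauc : tau @ ultraN --> (0 : R) by exact: cvg_ultraN_harmonic.
have tau_le d : 0 < d -> \forall n \near ultraN, tau n <= d.
  move=> d0; have /ultraP/(_ d d0) := tauc.
  by apply: filterS => n; rewrite subr0 => /ler_normlW.
have Ilo n t : 0 <= t -> (I n t)%:R * tau n <= t by move=> t0; have [] := truncn_div t0 (tau0 n).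
have Ihi n t : 0 <= t -> t <= (I n t)%:R * tau n + tau n by move=> t0; have [] := truncn_div t0 (tau0 n).
have Imono n s t : 0 <= s -> s <= t -> (I n s <= I n t)%N.
  by move=> s0 st'; apply: le_truncn; rewrite ler_pM2r// invr_gt0.
have IT T : \forall n \near ultraN, forall t, 0 <= t -> t <= T -> (I n t)%:R * (tau n * Ec) ^+ 2 <= 1.
  (* At most [T / tau] steps are made, so the total drift is at most [|T| tau Ec ^ 2], hence at most
     1 for small [tau]. *)
  have B1 : 0 < `|T| * Ec ^+ 2 + 1 by rewrite ltr_wpDl// mulr_ge0// sqr_ge0.
  apply: filterS (tau_le _ (divr_gt0 ltr01 B1)) => n hn t t0 tT.
  rewrite ler_pdivlMr// in hn.
  have := Ilo n t t0; have := tau0 n; move: (I n t)%:R (tau n) hn => i q hn q0 iq.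
  have h1 : (i * q) * (q * Ec ^+ 2) <= `|T| * (q * Ec ^+ 2).
    apply: ler_wpM2r; first by rewrite mulr_ge0 ?sqr_ge0// ltW.
    by apply: (le_trans iq); apply: (le_trans tT); exact: ler_norm.
  rewrite exprMn; lra.
have pos n t : posfun Y (a n t) by exact: eul_pos.
have dist T : \forall n \near ultraN, forall s t, 0 <= s -> s <= t -> t <= T ->
    (forall l, (I n s <= l)%N -> (l <= I n t)%N ->
     knm (subf (eul st b0 (tau n) l) (eul st b0 (tau n) (I n s))) <= (t - s + tau n) * Ec).
  apply: filterS (IT T) => n hn s t s0 st' tT l sl lt_.
  have t0 := le_trans s0 st'.
  apply: (le_trans (eul_dist hst pb0 nb0 (tau0 n) lt_ (hn t t0 tT) sl)).
  apply: ler_wpM2r => //; have := Ilo n t t0; have := Ihi n s s0.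
  have : l%:R * tau n <= (I n t)%:R * tau n by rewrite ler_pM2r// ler_nat.
  by rewrite mulrBl; lra.
have kN2 T : \forall n \near ultraN, forall s t, 0 <= t -> t <= T -> forall l, (l <= I n t)%N ->
    bdf mb (eul st b0 (tau n) l).
  apply: filterS (IT T) => n hn s t t0 tT l lt_.
  have p := eul_pos hst pb0 (tau n) l.
  exact: bdf_le (mb_mass p (eul_kN2 hst pb0 nb0 (tau0 n) lt_ (hn t t0 tT))) (posfun_bdf p).
have nrm t : 0 <= t -> kN (a n t) @[n --> ultraN] --> (1 : R).
  move=> t0; apply: (@ultra_squeeze _ _ (fun n => (t * Ec ^+ 2) * tau n)).
    by rewrite -[X in _ --> X](mulr0 (t * Ec ^+ 2)); apply: cvgMr.
  apply: filterS (IT t) => n /(_ t t0 (lexx _)) h.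
  have /andP[h1 h2] := eul_kN hst pb0 nb0 (tau0 n) h.
  rewrite ger0_norm ?subr_ge0// lerBlDl; apply: (le_trans h2); rewrite lerD2l.
  have := Ilo n t t0; have := tau0 n; move: (I n t)%:R (tau n) => i q q0 iq.
  have h3 : (i * q) * (q * Ec ^+ 2) <= t * (q * Ec ^+ 2).
    by apply: ler_wpM2r => //; rewrite mulr_ge0 ?sqr_ge0// ltW.
  rewrite exprMn; lra.
have E1 : 0 < 2 * (Ec + 1) by rewrite mulr_gt0// ltr_wpDl.
have small (d q : R) n t s : 0 < q -> d = q / (2 * (Ec + 1)) -> t <= s + d -> tau n <= d -> 
    (t - s + tau n) * Ec <= q.
  move=> q0 dE td nd; apply: (@le_trans _ _ ((d + d) * Ec)).
    by apply: ler_wpM2r => //; lra.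
  have -> : (d + d) * Ec = q * (Ec / (Ec + 1)) by rewrite dE; field; rewrite gt_eqF// ltr_wpDl.
  by rewrite ler_piMr ?ltW// ltr_pdivrMr ?mul1r ?ltrDl// ltr_wpDl.
have cont T e : 0 < e -> exists2 d : R, 0 < d & forall s t,
    0 <= s -> s <= t -> t <= T -> t <= s + d ->
    \forall n \near ultraN, kN (subf (a n t) (a n s)) <= e.
  move=> e0; have q0 : 0 < Num.sqrt e by rewrite sqrtr_gt0.
  exists (Num.sqrt e / (2 * (Ec + 1))); first by rewrite divr_gt0.
  move=> s t s0 st' tT td.
  apply: filterS3 (dist T) (kN2 T) (tau_le _ (divr_gt0 q0 E1)) => n h1 h2 h3.
  have t0 := le_trans s0 st'; have st2 := Imono n s t s0 st'.
  have i1 := h1 s t s0 st' tT _ st2 (leqnn _).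
  have i2 := le_trans i1 (small _ _ n t s q0 erefl td h3).
  have b1 := h2 s t t0 tT _ (leqnn _); have b2 := h2 s t t0 tT _ st2.
  have := knm_le (addr_ge0 mb0 mb0) (bdf_subf b1 b2) (ltW q0) i2.
  by rewrite sqr_sqrtr ?(ltW e0).
have sup T e : 0 < e -> exists2 d : R, 0 < d & forall s t y,
    0 <= s -> s <= t -> t <= T -> t <= s + d -> Y y -> forall e', 0 < e' ->
    \forall n \near ultraN, H (a n t) y - H (a n s) y >= - (t - s) * (Aop (a n s) y + e) - e'.
  move=> e0; have [d0 d00 hd0] := Aop_modulus (K := K) cU (addr_ge0 mb0 mb0) e0.
  have q0 : 0 < Num.sqrt d0 by rewrite sqrtr_gt0.
  exists (Num.sqrt d0 / (2 * (Ec + 1))); first by rewrite divr_gt0.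
  move=> s t y s0 st' tT td Yy e' e'0.
  have A0 : 0 <= G * mb + mb * G + e by rewrite !addr_ge0 ?mulr_ge0// ltW.
  have B1 : 0 < G * mb + mb * G + e + 1 by rewrite ltr_wpDl.
  apply: filterS3 (filterI (dist T) (kN2 T)) (tau_le _ (divr_gt0 q0 E1)) (tau_le _ (divr_gt0 e'0 B1)) => n [h1 h2] h3 h4.
  have t0 := le_trans s0 st'; have st2 := Imono n s t s0 st'.
  have bs := h2 s t t0 tT _ st2.
  have := @eul_sup st hst b0 pb0 (tau n) (tau0 n) (I n s) y e (I n t) Yy st2.
  rewrite -/(a n t) -/(a n s) => hh.
  have {}hh := hh _.
  have {}hh : - (((I n t)%:R - (I n s)%:R) * tau n) * (Aop (a n s) y + e) <= H (a n t) y - H (a n s) y.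
    apply: hh => l sl lt_.
    have i1 := h1 s t s0 st' tT _ sl (ltnW lt_).
    have i2 := le_trans i1 (small _ _ n t s q0 erefl td h3).
    have bl := h2 s t t0 tT _ (ltnW lt_).
    have bD := bdf_subf bl bs.
    have i3 := knm_le (addr_ge0 mb0 mb0) bD (ltW q0) i2.
    rewrite sqr_sqrtr ?(ltW d00)// in i3.
    have := hd0 _ bD i3 y; rewrite Aop_subf ler_norml => /andP[_].
    by rewrite lerBlDl.
  apply: le_trans hh.
  have Ab : `|Aop (a n s) y| <= G * mb + mb * G.
    apply: (le_trans (ler_normB _ _)); apply: lerD.
      by rewrite normrM; apply: ler_pM => //; exact: (H_sup (K := K) y bs).
    have bw := bdf_wt cU G0 UG bs.
    exact: (H_sup (K := K) y bw).
  (* Rounding times to multiples of [tau n] changes [t - s] by at most [tau n]; multiplied by the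
     bound on [A + e] this is less than [e']. *)
  have := Ilo n t t0; have := Ihi n s s0; have := Ilo n s s0; have := Ihi n t t0.
  have := tau0 n; move: Ab h4; rewrite ler_pdivlMr// ler_norml => /andP[A1 A2].
  move: (Aop (a n s) y) A1 A2 (tau n) (I n t)%:R (I n s)%:R => A A1 A2 q i j h4 qp i1 i2 i3 i4.
  have x1 : (i - j) * q - (t - s) <= q by lra.
  have x2 : - q <= (i - j) * q - (t - s) by lra.
  move: ((i - j) * q) x1 x2 => x x1 x2.
  have : (x - (t - s)) * (A + e) <= q * (G * mb + mb * G + e).
    apply: (le_trans (ler_norm _)); rewrite normrM; apply: ler_pM => //.
      by rewrite ler_norml; apply/andP; split; lra.
    by rewrite ler_norml; apply/andP; split; lra.
  lra.
have posn t : 0 <= t -> \forall n \near ultraN, posfun Y (a n t) by move=> _; exact: nearW.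
exists (ulflow a); split.
- exact: (flow_limit cU posn nrm cont sup).
- move=> t t0; exists Ec; apply: (ulflow_spd posn nrm) => //; first exact: ltW.
  move=> h e h0 e0; have e1 : 0 < e / (Ec + 1) by rewrite divr_gt0// ltr_wpDl.
  apply: filterS2 (dist (t + h)) (tau_le _ e1) => n h1 h2.
  have th : t <= t + h by rewrite lerDl.
  have := h1 t (t + h) (ltW t0) th (lexx _) _ (Imono n _ _ (ltW t0) th) (leqnn _).
  move/le_trans; apply; rewrite (_ : t + h - t + tau n = h + tau n); last by ring.
  rewrite mulrDl mulrC lerD2l; apply: (@le_trans _ _ (e / (Ec + 1) * Ec)).
    exact: ler_wpM2r.
  by rewrite mulrAC -mulrA ler_piMr ?ltW// ltr_pdivrMr ?mul1r ?ltrDl// ltr_wpDl.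
- move=> f; rewrite /ulflow /uls.
  rewrite (_ : (fun n => a n 0 f) = fun=> b0 f); first by apply: ulimE; exact: cvg_cst.
  by apply/funext => n; rewrite /a /I mul0r truncn0.
Qed.

End FiniteFlow.

(** * From finite sets to the whole space *)

Section Existence.
Context {R : realType} {X : pseudoMetricType R} {K : @pdkernel R X}.
Variables (U : X -> R) (cU : continuous U).
Local Notation k := (ker K).
Local Notation H := (Hop k).
Local Notation dot := (kdot k).
Local Notation Aop := (skew_op (K := K) U).
Local Notation kN := (dual_sqnorm (K := K)).
Local Notation knm := (dual_norm (K := K)).
Local Notation flow := (flow (K := K) U).
Local Notation kD := (ker_sqdist (K := K)).
Local Notation kd := (ker_dist (K := K)).
Local Notation m0 := (m0 (K := K)).
Implicit Types (s t e T L : R) (Y : set X) (b c : (X -> R) -> R).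

Let mm : 0 <= m0 := m0_ge0 (K := K).

Lemma kD0_eq x y z : kD x y = 0 -> kD z x = kD z y.
Proof.
move=> h; have E w : k x w = k y w.
  by apply/eqP; rewrite -subr_eq0 -sqrf_eq0 eq_le sqr_ge0 andbT -h; exact: k_lip2.
by rewrite /ker_sqdist (gk_sym K z x) (gk_sym K z y) E; congr (_ + _); rewrite E (gk_sym K y x) E.
Qed.

(** Points at kernel distance zero are merged, since [ker_sqdist] between distinct nodes appears in
    the denominators of the Lagrange functions. *)
Lemma separated_sublist (l : seq X) : exists l' : seq X,
  pairwise (fun x y => kD x y != 0) l' /\ forall x, x \in l -> exists2 y, y \in l' & kD x y = 0.
Proof.
elim: l => [|x l [l' [pl hl]]]; first by exists [::].
have [[y yl xy]|nx] := pselect (exists2 y, y \in l' & kD x y = 0).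
  exists l'; split => // z; rewrite inE => /orP[/eqP ->|]; [by exists y|exact: hl].
exists (x :: l'); split.
  rewrite pairwise_cons pl andbT; apply/allP => y yl; apply/eqP => h; apply: nx; by exists y.
move=> z; rewrite inE => /orP[/eqP ->|/hl [y yl zy]].
  by exists x; rewrite ?inE ?eqxx ?kDxx.
by exists y => //; rewrite inE yl orbT.
Qed.

Lemma separated_net r : 0 < r -> exists n (p : 'I_n -> X),
  (forall x, exists i, kd x (p i) < r) /\ forall i j, i != j -> kD (p i) (p j) != 0.
Proof.
move=> r0; have [n [p np]] := net K r0.
have [l [pl hl]] := separated_sublist [seq p i | i <- enum 'I_n].
exists (size l), (tnth (in_tuple l)); split.
  move=> x; have [i xi] := np x.
  have [y yl py] := hl (p i) (map_f p (mem_enum 'I_n i)).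
  have /(tnthP (in_tuple l))[j yj] : y \in in_tuple l by [].
  by exists j; rewrite -yj /ker_dist -(kD0_eq x py).
have lt i j : (i < j)%N -> forall (hi : (i < size l)%N) (hj : (j < size l)%N),
    kD (tnth (in_tuple l) (Ordinal hi)) (tnth (in_tuple l) (Ordinal hj)) != 0.
  move=> ij hi hj; have x0 : X := tnth (in_tuple l) (Ordinal hi).
  rewrite (tnth_nth x0) (tnth_nth x0)/=.
  exact: (pairwiseP x0 pl).
move=> [i hi] [j hj]; rewrite -val_eqE/= => ij.
case: (ltngtP i j) ij => // h _; first exact: lt.
by rewrite kD_sym; exact: lt.
Qed.

Lemma cont_prod n (P : pred 'I_n) (F : 'I_n -> X -> R) : (forall i, continuous (F i)) ->
  continuous (fun x => \prod_(i < n | P i) F i x).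
Proof.
move=> cF; rewrite (_ : (fun x => _) = (fun x => \prod_(i <- index_enum 'I_n | P i) F i x))//.
elim: (index_enum 'I_n) => [|i r IH].
  by under eq_fun do rewrite big_nil; exact: cont_cst.
under eq_fun do rewrite big_cons.
by case: (P i) => //; exact: cont_mul.
Qed.

(* Lagrange-type functions take the values [delta_ij] on a separated finite set. *)
Lemma separated_tv n (p : 'I_n -> X) : (forall i j, i != j -> kD (p i) (p j) != 0) ->
  exists MY, tv_bounded (K := K) [set x | exists i, x = p i] MY.
Proof.
move=> sp; pose Y := [set x | exists i, x = p i].
pose L i x := \prod_(j < n | j != i) (kD x (p j) / kD (p i) (p j)).
have cL i : continuous (L i).
  apply: cont_prod => j; apply: cont_mul; [exact: cont_kD|exact: cont_cst].
have LE i j : L i (p j) = (i == j)%:R.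
  have [<-|ij] := eqVneq i j.
    by rewrite /L big1// => l li; rewrite divff// sp// eq_sym.
  by rewrite /L (bigD1 j) 1?eq_sym//= kDxx !mul0r.
(* Summed over the [n] points, the approximation error [S q] contributes at most [S / 2], which the
   left side absorbs. *)
pose q : R := (2 * n.+1%:R)^-1.
have q0 : 0 < q by rewrite invr_gt0 mulr_gt0.
have nq : n%:R * q <= 1 / 2.
  rewrite /q invfM mulrCA mul1r ler_piMr// ler_pdivrMr// mul1r ler_nat; exact: leqnSn.
have [hC hCP] := choice (fun i => gk_univ K (cL i) q0).
have [C hP] := choice hCP.
have C0 i : 0 <= C i by have [/hb_ge0] := hP i.
pose B := \sum_(i < n) Num.sqrt (C i).
have B0 : 0 <= B by apply: sumr_ge0 => i _; exact: sqrtr_ge0.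
exists (2 * B); split; first exact: mulr_ge0.
move=> b c pb pc f e cf e0 fe.
have bb := posfun_bdf pb; have bc := posfun_bdf pc.
have bD := bdf_subf bb bc; have mD := addr_ge0 (mass_ge0 pb) (mass_ge0 pc).
set sg := subf b c in bD *.
have expand g : continuous g -> sg g = \sum_(i < n) sg (L i) * g (p i).
  move=> cg; have cs : continuous (fun x => \sum_(i < n) L i x * g (p i)).
    by apply: cont_sum => i; apply: cont_mul => //; exact: cont_cst.
  have E d : posfun Y d -> d g = d (fun x => \sum_(i < n) L i x * g (p i)).
    move=> pd; apply: (posfun_eq pd) => // y [j ->].
    rewrite (bigD1 j)//= LE eqxx mul1r big1 ?addr0// => i ij.
    by rewrite LE (negbTE ij) mul0r.
  rewrite /sg /subf (E b pb) (E c pc) -/(subf b c _) -/sg (lin_sum bD.1).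
    by apply: eq_bigr => i _; rewrite (linZr bD.1).
  by move=> i; apply: cont_mul => //; exact: cont_cst.
pose S := \sum_(i < n) `|sg (L i)|.
have Sb g d : continuous g -> 0 <= d -> (forall x, `|g x| <= d) -> `|sg g| <= S * d.
  move=> cg d0 gd; rewrite (expand g cg); apply: (le_trans (ler_norm_sum _ _ _)).
  by rewrite mulr_suml; apply: ler_sum => i _; rewrite normrM; apply: ler_wpM2l.
have Li i : `|sg (L i)| <= Num.sqrt (C i) * knm sg + S * q.
  have [hh hx] := hP i; have ch := hb_cont hh.
  rewrite (_ : sg (L i) = sg (hC i) + sg (fun x => L i x - hC i x)); last by rewrite (linB bD.1 (cL i) ch); ring.
  apply: (le_trans (ler_normD _ _)); apply: lerD; first exact: hb_CS_abs bD hh.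
  by apply: Sb => //; [apply: cont_add => //; exact: cont_opp|exact: ltW].
have S0 : 0 <= S by exact: sumr_ge0.
have SS : S <= 2 * B * knm sg.
  have : S <= B * knm sg + n%:R * (S * q).
    have -> : n%:R * (S * q) = \sum_(i < n) S * q by rewrite sumr_const card_ord mulr_natl.
    rewrite /B mulr_suml.
    by rewrite -big_split; apply: ler_sum => i _; exact: Li.
  have : n%:R * (S * q) <= S / 2.
    by rewrite mulrCA; apply: ler_wpM2l => //; rewrite -[2^-1]mul1r.
  lra.
by apply: (le_trans (Sb f e cf e0 fe)); apply: ler_wpM2r.
Qed.

Lemma net_measure r b : 0 < r -> posfun setT b -> exists (Y : set X) MY c,
  [/\ tv_bounded (K := K) Y MY, forall x, exists2 y, Y y & kd x y <= r, posfun Y c, mass c = mass b &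
   forall f L, lipk (K := K) L f -> `|b f - c f| <= mass b * (L * r)].
Proof.
move=> r0 pb; have [n [p [np sp]]] := separated_net r0.
have [MY hY] := separated_tv sp; have bb := posfun_bdf pb; have mb := mass_ge0 pb.
have [a ha] := atomic_of (K := K) b r0 np; have [h1 _ h3] := ha _ mb bb.
have a0 i : 0 <= a i by apply: h3 => f cf f0; apply: pb.2.
have lipc : lipk (K := K) 0 (fun=> 1) by split => // x y; rewrite subrr normr0 mul0r.
exists [set x | exists i, x = p i], MY, (atoms p a); split => //.
- by move=> x; have [i xi] := np x; exists (p i); [exists i|exact: ltW].
- split; first exact: (bdf_atoms p a).1.
  by move=> f cf f0; apply: sumr_ge0 => i _; rewrite mulr_ge0//; apply: f0; exists i.
- by have := h1 _ _ lipc; rewrite mul0r mulr0 normr_le0 subr_eq0 => /eqP.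
Qed.

Lemma lip_approx f e : continuous f -> 0 < e -> exists L h, lipk (K := K) L h /\ forall x, `|f x - h x| <= e.
Proof. by move=> cf e0; have [h [C [hh fh]]] := gk_univ K cf e0; exists (Num.sqrt C), h; split => //; exact: hb_lip. Qed.

(** Transfers the supersolution inequality from a point of the finite set to a nearby point of [X],
    uniformly over measures of bounded variation. [U] need not be Lipschitz for [ker_dist], so it is
    replaced by an approximant that is. *)
Lemma Aop_unifcont (M e : R) : 0 <= M -> 0 < e -> exists2 d : R, 0 < d &
  forall b x y, bdf M b -> kd x y <= d -> `|Aop b x - Aop b y| <= e.
Proof.
move=> M0 e0; have [G [G0 UG]] := cont_bdd K cU.
have M1 : 0 < M + 1 by rewrite ltr_wpDl.
have e1 : 0 < e / 6 / (M + 1) by rewrite !divr_gt0.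
have [L [h [lh Uh]]] := lip_approx cU e1.
have L0 : 0 <= L by case: lh.
pose D := L * M + G * M + M * G.
have D0 : 0 <= D by rewrite !addr_ge0// mulr_ge0.
have D1 : 0 < D + 1 by rewrite ltr_wpDl.
have d0 : 0 < e / 2 / (D + 1) by rewrite !divr_gt0.
exists (e / 2 / (D + 1)) => // s x y bs xy.
have U1 : `|U x - U y| <= 2 * (e / 6 / (M + 1)) + L * kd x y.
  have := Uh x; have := Uh y; have := lh.2 x y; rewrite !ler_norml => /andP[? ?] /andP[? ?] /andP[? ?].
  by apply/andP; split; lra.
have HM := H_sup (K := K) x bs.
have [_ H1] := bdf_H (K := K) M0 bs; have {}H1 := H1 x y.
have [_ H2] := bdf_H (K := K) (mulr_ge0 M0 G0) (bdf_wt cU G0 UG bs); have {}H2 := H2 x y.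
have kd0 : 0 <= kd x y by exact: kd_ge0.
have i1 : `|(U x - U y) * H s x| <= (2 * (e / 6 / (M + 1)) + L * kd x y) * M.
  by rewrite normrM; apply: ler_pM.
have i2 : `|U y * (H s x - H s y)| <= G * (M * kd x y) by rewrite normrM; apply: ler_pM.
have E : Aop s x - Aop s y = (U x - U y) * H s x + U y * (H s x - H s y) - (H (wt U s) x - H (wt U s) y).
  by rewrite /skew_op; ring.
have i3 : 2 * (e / 6 / (M + 1)) * M <= e / 2.
  have : e / 6 / (M + 1) * M <= e / 6.
    by rewrite mulrAC -mulrA ler_piMr ?divr_ge0 ?(ltW e0)// ler_pdivrMr// mul1r lerDl.
  lra.
have i4 : D * kd x y <= e / 2.
  apply: (@le_trans _ _ (D * (e / 2 / (D + 1)))); first exact: ler_wpM2l.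
  by rewrite mulrCA ler_piMr ?divr_ge0 ?(ltW e0)// ler_pdivrMr// mul1r lerDl.
have i5 : D * kd x y = L * kd x y * M + G * (M * kd x y) + M * G * kd x y by rewrite /D; ring.
rewrite E; apply: (le_trans (ler_normB _ _)).
apply: (@le_trans _ _ ((2 * (e / 6 / (M + 1)) + L * kd x y) * M + G * (M * kd x y) + M * G * kd x y)).
  by apply: lerD => //; apply: (le_trans (ler_normD _ _)); exact: lerD.
rewrite mulrDl; lra.
Qed.

Lemma kdot_ext (M : R) (s s' : (X -> R) -> R) : bdf M s ->
  (forall f, continuous f -> s f = s' f) -> dot s s = dot s' s'.
Proof.
move=> bs E; have EH : H s = H s' by apply/funext => x; apply: E; exact: cont_kl.
by rewrite /kdot -EH E//; exact: (cont_H bs).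
Qed.

Theorem flow_exists b : posfun setT b -> kN b = 1 ->
  exists a, [/\ flow setT a, regular (K := K) a & forall f, continuous f -> a 0 f = b f].
Proof.
move=> pb nb; have bb := posfun_bdf pb; have mb := mass_ge0 pb.
have [G [G0 UG]] := cont_bdd K cU.
have mbp : 0 < mass b.
  rewrite lt_neqAle eq_sym mb andbT; apply/eqP => m0'.
  have := posfun_bd (e := mass b) pb (cont_H (K := K) bb) => h.
  have : `|b (H b)| <= mass b * mass b.
    by apply: h => y _; rewrite ger0_norm ?(H_ge0 _ pb)//; exact: (H_up _ pb).
  by rewrite -/(kdot k b b) -/(dual_sqnorm b) nb normr1 m0' mul0r ler10.
pose tau (n : nat) : R := n.+1%:R^-1.
have tau0 n : 0 < tau n by rewrite invr_gt0.
have tauc : tau @ ultraN --> (0 : R) by exact: cvg_ultraN_harmonic.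
have tau_le d : 0 < d -> \forall n \near ultraN, tau n <= d.
  move=> d0; have /ultraP/(_ d d0) := tauc.
  by apply: filterS => n; rewrite subr0 => /ler_normlW.
have [z hz] : exists z : nat -> (set X) * ((X -> R) -> R), forall n,
   [/\ exists MY, tv_bounded (K := K) (z n).1 MY, forall x, exists2 y, (z n).1 y & kd x y <= tau n,
     posfun (z n).1 (z n).2, mass (z n).2 = mass b &
     forall f L, lipk (K := K) L f -> `|b f - (z n).2 f| <= mass b * (L * tau n)].
  apply: (@choose_seq _ (fun n z => [/\ exists MY, tv_bounded (K := K) z.1 MY, forall x, exists2 y, z.1 y & kd x y <= tau n,
     posfun z.1 z.2, mass z.2 = mass b &
     forall f L, lipk (K := K) L f -> `|b f - z.2 f| <= mass b * (L * tau n)])) => n.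
  have [Y [MY [c [h1 h2 h3 h4 h5]]]] := net_measure (tau0 n) pb.
  by exists (Y, c); split => //; exists MY.
pose c n := (z n).2.
have pc n : posfun (z n).1 (c n) by have [] := hz n.
have mc n : mass (c n) = mass b by have [] := hz n.
have bc : \forall n \near ultraN, bdf (mass b) (c n).
  by apply: nearW => n; rewrite -(mc n); exact: posfun_bdf (pc n).
have cc f : continuous f -> c n f @[n --> ultraN] --> b f.
  move=> cf; apply/ultraP => e e0.
  have e1 : 0 < e / 4 / (mass b + 1) by rewrite !divr_gt0// ltr_wpDl.
  have [L [h [lh fh]]] := lip_approx cf e1; have L0 : 0 <= L by case: lh.
  have ch := lipk_cont lh.
  have L1 : 0 < mass b * L + 1 by rewrite ltr_wpDl// mulr_ge0.
  have e2 : 0 < e / 2 / (mass b * L + 1) by rewrite !divr_gt0.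
  have := tau_le _ e2.
  apply: filterS2 bc => n bn tn; have [_ _ _ _ /(_ h L lh) hn] := hz n.
  have cfh : continuous (fun x => f x - h x) by apply: cont_add => //; exact: cont_opp.
  have j1 := bb.2 _ _ cfh (ltW e1) fh; have j2 := bn.2 _ _ cfh (ltW e1) fh.
  have j3 : mass b * (e / 4 / (mass b + 1)) <= e / 4.
    by rewrite mulrCA ler_piMr ?divr_ge0 ?(ltW e0)// ler_pdivrMr ?mul1r ?lerDl// ltr_wpDl.
  have j4 : mass b * (L * tau n) <= e / 2.
    rewrite mulrA; apply: (@le_trans _ _ (mass b * L * (e / 2 / (mass b * L + 1)))).
      by apply: ler_wpM2l => //; exact: mulr_ge0.
    by rewrite mulrCA ler_piMr ?divr_ge0 ?(ltW e0)// ler_pdivrMr ?mul1r ?lerDl.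
  move: j1 j2 hn; rewrite (linB bb.1)// (linB bn.1)// -/(c n) !ler_norml => /andP[? ?] /andP[? ?] /andP[? ?].
  apply/andP; split; lra.
have cN : kN (c n) @[n --> ultraN] --> (1 : R).
  rewrite -nb /dual_sqnorm -(kdot_ext (uls_bdf (K := K) bc)); last by move=> f cf; apply: ulimE; exact: cc.
  exact: (uls_dot (K := K) mb mb bc bc).
have cp n : 0 < kN (c n).
  by apply: lt_le_trans (mass_dot (K := K) (pc n)); rewrite mc mulr_gt0 ?(gk_kap K)// exprn_gt0.
(* Discretization keeps the mass but not the norm, whereas flows start on the unit sphere; the
   normalizing factor tends to 1. *)
pose q n := (knm (c n))^-1.
have q0 n : 0 <= q n by rewrite invr_ge0 knm_ge0.
pose c' n : (X -> R) -> R := fun f => q n * c n f + 0.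
have pc' n : posfun (z n).1 (c' n) by apply: (posfunD (q0 n) (pc n)); exact: posfun0.
have nc' n : kN (c' n) = 1.
  have mcn := mass_ge0 (pc n).
  rewrite /c' (kN_addZ _ (posfun0 _) (pc n)) /dual_sqnorm.
  have -> : dot (fun=> 0) (fun=> 0) = 0 by [].
  have -> : c n (Hop k (fun=> 0)) = 0 by exact: (lin0 (pc n).1).
  rewrite mulr0 !add0r -/(dual_sqnorm (c n)) /q exprVn (knm_sq mcn (posfun_bdf (pc n))).
  by rewrite mulVf// gt_eqF.
have [a ha] : exists a : nat -> R -> (X -> R) -> R, forall n,
    [/\ flow (z n).1 (a n), regular (K := K) (a n) & forall f, a n 0 f = c' n f].
  apply: (@choose_seq _ (fun n an => [/\ flow (z n).1 an, regular (K := K) an & forall f, an 0 f = c' n f])) => n.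
  have [[MY hY] _ _ _ _] := hz n.
  exact: (finite_flow cU hY G0 UG (pc' n) (nc' n)).
have fa n : flow (z n).1 (a n) by case: (ha n).
have ra n : regular (K := K) (a n) by case: (ha n).
have EG n t : 0 <= t -> `|Eng (K := K) U (a n t)| <= G by move=> t0; exact: (Eng_bound cU (fa n) G0 UG t0).
(* The constants of the Euler scheme depend on the finite set. The energy estimate depends only on
   the bound [G] of [U], so this equicontinuity is uniform in [n]. *)
have hol n s t : 0 <= s -> s <= t -> kN (subf (a n t) (a n s)) <= (t - s) * (2 * G).
  move=> s0 st; apply: (le_trans (holder cU (fa n) (ra n) s0 st)).
  apply: ler_wpM2l; first by rewrite subr_ge0.
  have := EG n s s0; have := EG n t (le_trans s0 st); rewrite !ler_norml => /andP[? ?] /andP[? ?]; lra.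
have G1 : 0 < 2 * G + 1 by lra.
have hol' n s t e : 0 <= s -> s <= t -> 0 < e -> t <= s + e / (2 * G + 1) -> kN (subf (a n t) (a n s)) <= e.
  move=> s0 st e0 td; apply: (le_trans (hol n s t s0 st)).
  apply: (@le_trans _ _ (e / (2 * G + 1) * (2 * G))).
    by apply: ler_wpM2r; [exact: mulr_ge0|lra].
  by rewrite mulrAC -mulrA ler_piMr ?(ltW e0)// ler_pdivrMr ?mul1r ?lerDl.
have pos t : 0 <= t -> \forall n \near ultraN, posfun setT (a n t).
  by move=> t0; apply: nearW => n; apply: posfun_T; exact: (fl_pos (fa n) t0).
have nrm t : 0 <= t -> kN (a n t) @[n --> ultraN] --> (1 : R).
  move=> t0; rewrite (_ : (fun n => kN (a n t)) = fun=> 1); first exact: cvg_cst.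
  by apply/funext => n; rewrite (fl_nrm (fa n) t0).
have cont T e : 0 < e -> exists2 d : R, 0 < d & forall s t,
    0 <= s -> s <= t -> t <= T -> t <= s + d -> \forall n \near ultraN, kN (subf (a n t) (a n s)) <= e.
  move=> e0; exists (e / (2 * G + 1)); first by rewrite divr_gt0.
  by move=> s t s0 st _ td; apply: nearW => n; exact: hol'.
have sup T e : 0 < e -> exists2 d : R, 0 < d & forall s t y,
    0 <= s -> s <= t -> t <= T -> t <= s + d -> [set: X] y -> forall e', 0 < e' ->
    \forall n \near ultraN, H (a n t) y - H (a n s) y >= - (t - s) * (Aop (a n s) y + e) - e'.
  move=> e0; have [d d0 hd] := Aop_modulus (K := K) cU (m00_ge0 (K := K)) e0.
  exists (d / (2 * G + 1)); first by rewrite divr_gt0.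
  move=> s t y s0 st tT td _ e' e'0; have t0 := le_trans s0 st.
  have ts1 : 0 < t - s + 1 by rewrite ltr_wpDl// subr_ge0.
  have e1 : 0 < e' / 2 / (t - s + 1) by rewrite !divr_gt0.
  have [d1 d10 hd1] := Aop_unifcont mm e1.
  have e2 : 0 < e' / 4 / (m0 + 1) by rewrite !divr_gt0// ltr_wpDl.
  apply: filterS2 (tau_le _ d10) (tau_le _ e2) => n t1 t2.
  have [_ /(_ y)[x Yx yx] _ _ _] := hz n.
  have bt := fl_bdf (fa n) t0; have bs := fl_bdf (fa n) s0.
  (* The step provided by [fl_sup (fa n)] depends on [n]. Chaining such steps gives the inequality
     on the whole of [[s, t]], whose admissible length comes from the uniform modulus alone. *)
  have main : (t - s) * (- (Aop (a n s) x + e)) <= H (a n t) x - H (a n s) x.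
    apply: (@chain _ (fun r => H (a n r) x) s t _ st) => e3 e30.
    have [d3 d30 hd3] := fl_sup (fa n) t e30; exists d3 => // r r' sr rr rt rd.
    have r0 : 0 <= r := le_trans s0 sr.
    apply: le_trans (hd3 r r' x r0 rr rt rd Yx).
    have bD := fl_bdf2 (fa n) s0 r0.
    have rd' : r <= s + d / (2 * G + 1) by lra.
    have := hd _ bD (hol' n s r d s0 sr d0 rd') x; rewrite Aop_subf ler_norml => /andP[_ i].
    rewrite mulNr -mulrN; apply: ler_wpM2l; first by rewrite subr_ge0.
    lra.
  have l1 b' : bdf m0 b' -> `|H b' y - H b' x| <= e' / 4.
    move=> b'b; have [_ /(_ y x) h] := bdf_H (K := K) mm b'b; apply: (le_trans h).
    apply: (@le_trans _ _ (m0 * (e' / 4 / (m0 + 1)))).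
      by apply: ler_wpM2l => //; exact: le_trans yx t2.
    by rewrite mulrCA ler_piMr ?divr_ge0 ?(ltW e'0)// ler_pdivrMr ?mul1r ?lerDl// ltr_wpDl.
  have l2 := hd1 _ y x bs (le_trans yx t1).
  have l3 : (t - s) * (Aop (a n s) x - Aop (a n s) y) <= e' / 2.
    apply: (@le_trans _ _ ((t - s) * (e' / 2 / (t - s + 1)))).
      by apply: ler_wpM2l; [rewrite subr_ge0|move: l2; rewrite ler_norml => /andP[]; lra].
    by rewrite mulrCA ler_piMr ?divr_ge0 ?(ltW e'0)// ler_pdivrMr ?mul1r ?lerDl.
  have := l1 _ bt; have := l1 _ bs; rewrite !ler_norml => /andP[? ?] /andP[? ?]; lra.
exists (ulflow a); split.
- exact: (flow_limit cU pos nrm cont sup).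
(* The constant is that of [phi_bound], the energy drop being at most [2 G]. *)
- move=> t t0; exists (Num.sqrt (2 * G / t)).
  apply: (ulflow_spd pos nrm (ltW t0) (sqrtr_ge0 _)) => h e h0 e0.
  apply: nearW => n; have [_ /(_ h h0) hs] := phi_spd' (ra n) t0.
  apply: (le_trans hs); apply: (@le_trans _ _ (Num.sqrt (2 * G / t) * h)); last by rewrite lerDl ltW.
  apply: ler_wpM2r => //; apply: sq_le_sqrt.
    by rewrite divr_ge0 ?mulr_ge0// ltW.
  rewrite ler_pdivlMr// mulrC; apply: (le_trans (phi_bound cU (fa n) (ra n) t0)).
  have := EG n 0 (lexx _); have := EG n t (ltW t0); rewrite !ler_norml => /andP[? ?] /andP[? ?]; lra.
- move=> f cf; apply: ulimE.
  rewrite (_ : (fun n => a n 0 f) = fun n => q n * c n f + 0); last first.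
    by apply/funext => n; have [_ _ ->] := ha n.
  have -> : b f = 1 * b f + 0 by rewrite mul1r addr0.
  apply: cvgD; last exact: cvg_cst.
  apply: cvgM; last exact: cc.
  rewrite -[X in _ --> X]invr1; apply: cvgV; first exact: oner_neq0.
  rewrite -(sqrtr1 R); apply: (continuous_cvg _ (@sqrt_continuous R 1)); exact: cN.
Qed.

End Existence.

(** * Schroedinger potentials and the Markov operator *)

Section Schroedinger.
Context {R : realType} {X : pseudoMetricType R} {K : @pdkernel R X}.
Local Notation k := (ker K).
Local Notation kap := (kmin K).
Local Notation H := (Hop k).
Local Notation kd := (ker_dist (K := K)).
Implicit Types (u v w f g psi : X -> R) (m M d q e : R).

Definition lam : R := kap ^+ 2.

Lemma lam_gt0 : 0 < lam. Proof. by rewrite exprn_gt0// (gk_kap K). Qed.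

Lemma lam_le1 (x : X) : lam <= 1.
Proof.
by apply: exprn_ile1; [exact/ltW/(gk_kap K)|exact: (le_trans (gk_low K x x) (gk_up K x x))].
Qed.

Variables (a : (X -> R) -> R) (pa : posfun setT a).

Let ba := posfun_bdf pa.
Let ma := mass_ge0 pa.

Lemma cont_Hwt f : continuous f -> continuous (H (wt f a)).
Proof. by move=> cf; have [M M0 bw] := bdf_wt_ex (K := K) ma cf ba; exact: (cont_H bw). Qed.

Lemma HwtB f g y : continuous f -> continuous g ->
  H (wt (fun x => f x - g x) a) y = H (wt f a) y - H (wt g a) y.
Proof.
move=> cf cg; have ck : continuous (fun x => k x y) by exact: cont_kl.
rewrite /Hop /wt -(linB pa.1); [|exact: cont_mul|exact: cont_mul].
by congr a; apply/funext => x; ring.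
Qed.

Lemma HwtZ c f y : continuous f -> H (wt (fun x => c * f x) a) y = c * H (wt f a) y.
Proof.
move=> cf; have ck : continuous (fun x => k x y) by exact: cont_kl.
rewrite /Hop /wt -(linZ pa.1); last exact: cont_mul.
by congr a; apply/funext => x; ring.
Qed.

Lemma Hwt_harnack f y y' : continuous f -> (forall x, 0 <= f x) ->
  kap * H (wt f a) y' <= H (wt f a) y.
Proof.
move=> cf f0; have pw := posfun_wt cf (fun y _ => f0 y) pa.
apply: (le_trans _ (H_low (K := K) y pw)); apply: ler_wpM2l; first exact/ltW/(gk_kap K).
exact: (H_up (K := K) y' pw).
Qed.

(* The normalized kernels seen from two points [y], [y'] dominate each other up to
   the factor [kap ^+ 2]. *)
Lemma doeblin u v m M : [set: X] !=set0 -> continuous u -> continuous v ->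
  (forall x, 0 <= v x) -> (forall y, 0 < H (wt v a) y) ->
  (forall x, m * v x <= u x <= M * v x) ->
  exists m' M', [/\ m <= m', m' <= M', M' <= M, M' - m' <= (1 - lam) * (M - m) &
   forall y, m' * H (wt v a) y <= H (wt u a) y <= M' * H (wt v a) y].
Proof.
move=> [x0 _] cu cv v0 Q0 uv.
have kp := gk_kap K; have l0 := lam_gt0; have l1 := lam_le1 x0.
pose P y := H (wt u a) y; pose Q y := H (wt v a) y; pose r y := P y / Q y.
have cmv (c : R) : continuous (fun x => c * v x) by apply: cont_mul => //; exact: cont_cst.
have lowP y : 0 <= P y - m * Q y.
  rewrite /P /Q -HwtZ// -HwtB//; apply: (H_ge0 (Y := setT)); apply: posfun_wt => //.
    by apply: cont_add => //; exact: cont_opp.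
  by move=> x _; rewrite subr_ge0; have /andP[] := uv x.
have upP y : 0 <= M * Q y - P y.
  rewrite /P /Q -HwtZ// -HwtB//; apply: (H_ge0 (Y := setT)); apply: posfun_wt => //.
    by apply: cont_add => //; exact: cont_opp.
  by move=> x _; rewrite subr_ge0; have /andP[] := uv x.
have harn g y y' : continuous g -> (forall x, 0 <= g x) -> 0 <= H (wt g a) y' ->
    lam * (H (wt g a) y' / Q y') <= H (wt g a) y / Q y.
  move=> cg g0 hg; have h1 := Hwt_harnack y y' cg g0; have h2 := Hwt_harnack y' y cv v0.
  rewrite ler_pdivlMr ?Q0// mulrAC mulrA ler_pdivrMr ?Q0// /lam.
  move: h1 h2 (Q0 y) (Q0 y') hg; rewrite -/(Q y) -/(Q y').
  move: (H (wt g a) y) (H (wt g a) y') (Q y) (Q y') => A B C D h1 h2 C0 D0 B0.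
  have j1 : kap * B * (kap * C) <= A * D.
    apply: ler_pM => //; first by rewrite mulr_ge0// ltW.
    by rewrite mulr_ge0// ltW.
  by lra.
have rm y y' : lam * (r y' - m) <= r y - m.
  have E z : r z - m = H (wt (fun x => u x - m * v x) a) z / Q z.
    by rewrite /r HwtB// HwtZ// mulrBl -/(Q z) mulfK// gt_eqF// Q0.
  rewrite !E; apply: harn.
  - by apply: cont_add => //; exact: cont_opp.
  - by move=> x; rewrite subr_ge0; have /andP[] := uv x.
  - by rewrite HwtB// HwtZ//; exact: lowP.
have rM y y' : lam * (M - r y') <= M - r y.
  have E z : M - r z = H (wt (fun x => M * v x - u x) a) z / Q z.
    by rewrite /r HwtB// HwtZ// mulrBl -/(Q z) mulfK// gt_eqF// Q0.
  rewrite !E; apply: harn.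
  - by apply: cont_add => //; exact: cont_opp.
  - by move=> x; rewrite subr_ge0; have /andP[] := uv x.
  - by rewrite HwtB// HwtZ//; exact: upP.
have mr y : m <= r y by rewrite ler_pdivlMr ?Q0// -subr_ge0; exact: lowP.
have rMx y : r y <= M by rewrite ler_pdivrMr ?Q0// -subr_ge0; exact: upP.
have hs : has_sup (range r) by split; [exists (r x0), x0|exists M => _ [y _ <-]].
have hi : has_inf (range r) by split; [exists (r x0), x0|exists m => _ [y _ <-]].
have supr y : r y <= sup (range r) by apply: (sup_upper_bound hs); exists y.
have infr y : inf (range r) <= r y by apply: (ge_inf hi.2); exists y.
(* [s1] and [s2] together give [(1 + lam) (sup - inf) <= (1 - lam) (M - m)]. *)
have s1 : lam * (sup (range r) - m) <= inf (range r) - m.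
  rewrite lerBrDr; apply: lb_le_inf; first exact: hi.1.
  move=> _ [y _ <-]; rewrite -lerBrDr mulrC -ler_pdivlMr// lerBlDr.
  apply: ge_sup; first exact: hs.1.
  by move=> _ [y' _ <-]; rewrite -lerBlDr ler_pdivlMr// mulrC; exact: rm.
have s2 : lam * (M - inf (range r)) <= M - sup (range r).
  rewrite lerBrDr -lerBrDl; apply: ge_sup; first exact: hs.1.
  move=> _ [y _ <-]; rewrite lerBrDl -lerBrDr mulrC -ler_pdivlMr// lerBlDl -lerBlDr.
  apply: lb_le_inf; first exact: hi.1.
  by move=> _ [y' _ <-]; rewrite lerBlDr -lerBlDl ler_pdivlMr// mulrC; exact: rM.
have is' : inf (range r) <= sup (range r) by exact: (le_trans (infr x0) (supr x0)).
exists (inf (range r)), (sup (range r)); split => //.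
- by apply: lb_le_inf; [exact: hi.1|move=> _ [y _ <-]].
- by apply: ge_sup; [exact: hs.1|move=> _ [y _ <-]].
- have : 0 <= lam * (sup (range r) - inf (range r)) by rewrite mulr_ge0 ?subr_ge0// ltW.
  lra.
- move=> y; apply/andP; split.
    by rewrite -ler_pdivlMr ?Q0//; exact: infr.
  by rewrite -ler_pdivrMr ?Q0//; exact: supr.
Qed.

(* Hilbert's projective distance from [u] to [v] is at most [ln (1 + q)]. *)
Definition prop_le q u v := exists2 m, 0 < m & forall x, m * v x <= u x <= m * (1 + q) * v x.

Lemma prop_scale q c u v : 0 < c -> prop_le q u v -> prop_le q (fun x => c * u x) v.
Proof.
move=> c0 [m mp h]; exists (c * m); first exact: mulr_gt0.
by move=> x; rewrite -!mulrA !ler_pM2l//; have := h x; rewrite mulrA.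
Qed.

Lemma prop_scaler q c u v : 0 < c -> prop_le q u v -> prop_le q u (fun x => c * v x).
Proof.
move=> c0 [m mp h]; exists (m / c); first exact: divr_gt0.
move=> x; have := h x; have -> : m / c * (c * v x) = m * v x by field; rewrite gt_eqF.
by have -> : m / c * (1 + q) * (c * v x) = m * (1 + q) * v x by field; rewrite gt_eqF.
Qed.

Lemma pos_lower f : continuous f -> (forall x, 0 < f x) -> exists2 m, 0 < m & forall x, m <= f x.
Proof.
move=> cf f0; have [M [M0 hM]] := cont_bdd K (cont_inv f0 cf).
exists (M + 1)^-1; first by rewrite invr_gt0 ltr_wpDl.
move=> x; rewrite -[f x]invrK lef_pV2 ?posrE ?invr_gt0 ?ltr_wpDl//.
by apply: (le_trans (ler_norm _)); apply: (le_trans (hM x)); rewrite lerDl.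
Qed.

Lemma prop_ex u v : continuous u -> continuous v -> (forall x, 0 < u x) -> (forall x, 0 < v x) ->
  exists2 q, 0 <= q & prop_le q u v.
Proof.
move=> cu cv u0 v0; have [mu mup hmu] := pos_lower cu u0; have [mv mvp hmv] := pos_lower cv v0.
have [Mu [Mu0 hMu]] := cont_bdd K cu; have [Mv [Mv0 hMv]] := cont_bdd K cv.
pose m := mu / (Mv + 1); have Mv1 : 0 < Mv + 1 by rewrite ltr_wpDl.
have mp : 0 < m by rewrite divr_gt0.
exists (Mu / (m * mv)); first by rewrite divr_ge0// mulr_ge0// ltW.
exists m => // x; apply/andP; split.
  apply: (le_trans _ (hmu x)); rewrite /m mulrAC -mulrA ler_piMr ?(ltW mup)//.
  rewrite ler_pdivrMr// mul1r; apply: (le_trans (ler_norm _)); apply: (le_trans (hMv x)); rewrite lerDl//.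
have h1 : u x <= Mu := le_trans (ler_norm _) (hMu x).
have -> : m * (1 + Mu / (m * mv)) * v x = m * v x + Mu * (v x / mv) by field; rewrite !gt_eqF.
have h2 : 1 <= v x / mv by rewrite ler_pdivlMr// mul1r.
have h3 : Mu <= Mu * (v x / mv) by rewrite ler_peMr.
have h4 : 0 <= m * v x by rewrite mulr_ge0// ltW.
lra.
Qed.

(** The map [T_eps(., a)] in the variable [u = exp (f / eps)]. It is homogeneous of degree -1, and
    self potentials become its positive fixed points. *)
Definition schr_map u y : R := (H (wt u a) y)^-1.

Hypothesis a1 : mass a = 1.

Lemma a_nonempty : [set: X] !=set0.
Proof.
apply: contrapT => nx; have : a (fun=> 1) = a (fun=> 0).
  by congr a; apply/funext => x; exfalso; apply: nx; exists x.
rewrite (lin0 pa.1) -/(mass a) a1 => /eqP; by rewrite oner_eq0.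
Qed.

Lemma Hwt_pos u y : continuous u -> (forall x, 0 < u x) -> 0 < H (wt u a) y.
Proof.
move=> cu u0; have [m mp hm] := pos_lower cu u0.
have pw : posfun setT (wt u a) by apply: posfun_wt => // x _; exact: ltW.
apply: (lt_le_trans _ (H_low (K := K) y pw)); rewrite mulr_gt0 ?(gk_kap K)//.
apply: (@lt_le_trans _ _ (a (fun=> m))); first by rewrite (lin_cst pa.1) a1 mulr1.
rewrite /mass /wt; apply: (posfun_mono pa); first exact: cont_cst.
  by apply: cont_mul => //; exact: cont_cst.
by move=> x _; rewrite mulr1.
Qed.

Lemma Phi_pos u : continuous u -> (forall x, 0 < u x) -> forall y, 0 < schr_map u y.
Proof. by move=> cu u0 y; rewrite invr_gt0; exact: Hwt_pos. Qed.

Lemma Phi_cont u : continuous u -> (forall x, 0 < u x) -> continuous (schr_map u).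
Proof. by move=> cu u0; apply: cont_inv; [move=> y; exact: Hwt_pos|exact: cont_Hwt]. Qed.

(** Inversion exchanges the two bounds and keeps their ratio. From [M' - m' <= (1 - lam) m q] and
    [m <= m'], the relative gap is at most [(1 - lam) q]. *)
Lemma Phi_contr q u v : 0 <= q -> continuous u -> continuous v -> (forall x, 0 < u x) -> (forall x, 0 < v x) ->
  prop_le q u v -> prop_le ((1 - lam) * q) (schr_map u) (schr_map v).
Proof.
move=> q0 cu cv u0 v0 [m mp h].
have Q0 y := Hwt_pos y cv v0; have P0 y := Hwt_pos y cu u0.
have [m' [M' [h1 h2 h3 h4 h5]]] := doeblin a_nonempty cu cv (fun x => ltW (v0 x)) Q0 h.
have m'p : 0 < m' by exact: lt_le_trans h1.
have M'p : 0 < M' by exact: lt_le_trans h2.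
exists M'^-1; first by rewrite invr_gt0.
move=> y; have /andP[h6 h7] := h5 y; rewrite /schr_map; apply/andP; split.
  by rewrite -invfM lef_pV2 ?posrE ?mulr_gt0 ?P0 ?Q0.
apply: (@le_trans _ _ (m'^-1 * (H (wt v a) y)^-1)).
  by rewrite -invfM lef_pV2 ?posrE ?mulr_gt0 ?P0 ?Q0.
apply: ler_wpM2r; first by rewrite invr_ge0 ltW.
rewrite mulrC ler_pdivlMr// ler_pdivrMl//.
have l1 : 0 <= 1 - lam by rewrite subr_ge0; have [x _] := a_nonempty; exact: lam_le1 x.
have h8 : (1 - lam) * (m * (1 + q) - m) <= (1 - lam) * (q * m').
  apply: ler_wpM2l => //; have : q * m <= q * m' by exact: ler_wpM2l.
  lra.
lra.
Qed.

Lemma pow_to0 q : 0 <= q -> q < 1 -> (fun n => q ^+ n : R) @ ultraN --> (0 : R).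
Proof. by move=> q0 q1; apply: cvg_ultraN; apply: cvg_expr; rewrite ger0_norm. Qed.

(** Because of the degree -1 the plain iterates may oscillate in scale, so each is rescaled to the
    value 1 at [x0]. The rescaled iterates are equi-Lipschitz, consecutive ones merge geometrically,
    and the limit is a fixed point up to a factor. *)
Theorem schroedinger_exists : exists w, [/\ continuous w, forall x, 0 < w x &
  forall y, w y = schr_map w y].
Proof.
have [x0 _] := a_nonempty; have kp := gk_kap K; have l0 := lam_gt0; have l1 := lam_le1 x0.
pose Psi u y : R := H (wt u a) x0 * schr_map u y.
pose u_ n := iter n Psi (fun=> 1).
have cp n : continuous (u_ n) /\ forall x, 0 < u_ n x.
  elim: n => [|n [IH1 IH2]]; first by split => //; exact: cont_cst.
  split.
    by apply: cont_mul; [exact: cont_cst|exact: Phi_cont].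
  by move=> x; rewrite /= mulr_gt0 ?Phi_pos// Hwt_pos.
have u1 n : u_ n x0 = 1.
  case: n => [//|n]; rewrite /= /Psi /schr_map divff// gt_eqF// Hwt_pos//; by case: (cp n).
have [q0 q00 hq0] := prop_ex (cp 1).1 (cp 0).1 (cp 1).2 (cp 0).2.
have hq n : prop_le ((1 - lam) ^+ n * q0) (u_ n.+1) (u_ n).
  elim: n => [|n IH]; first by rewrite mul1r.
  have q1 : 0 <= (1 - lam) ^+ n * q0 by rewrite mulr_ge0 ?exprn_ge0 ?subr_ge0.
  have := Phi_contr q1 (cp n.+1).1 (cp n).1 (cp n.+1).2 (cp n).2 IH.
  rewrite mulrA -exprS => h; apply: prop_scaler; first by exact: (Hwt_pos _ (cp n).1 (cp n).2).
  by apply: prop_scale => //; exact: (Hwt_pos _ (cp n.+1).1 (cp n.+1).2).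
have bnd n y : kap <= u_ n.+1 y <= kap^-1.
  rewrite /= /Psi /schr_map; have [cn pn] := cp n.
  have h1 := Hwt_harnack x0 y cn (fun x => ltW (pn x)); have h2 := Hwt_harnack y x0 cn (fun x => ltW (pn x)).
  have Py := Hwt_pos y cn pn.
  by rewrite ler_pdivlMr// ler_pdivrMr// ler_pdivlMl// h1.
have lip n : lipk (K := K) (kap^-1 * kap^-1) (u_ n.+1).
  split; first by rewrite mulr_ge0// invr_ge0 ltW.
  move=> x y; have [cn pn] := cp n.
  have pw : posfun setT (wt (u_ n) a) by apply: posfun_wt => // z _; exact: ltW.
  have bw := posfun_bdf pw; have [mw hw] := bdf_H (K := K) (mass_ge0 pw) bw.
  have p0 := H_up (K := K) x0 pw; have px := H_low (K := K) x pw; have py := H_low (K := K) y pw.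
  have := hw x y; have Px := Hwt_pos x cn pn; have Py := Hwt_pos y cn pn; have P0 := Hwt_pos x0 cn pn.
  rewrite /= /Psi /schr_map; move: (H _ x) (H _ y) (H _ x0) px py p0 Px Py P0 => A B C px py p0 A0 B0 C0 hAB.
  have mp : 0 < mass (wt (u_ n) a) by exact: lt_le_trans C0 p0.
  have -> : C * A^-1 - C * B^-1 = C * (A^-1 * B^-1) * (B - A) by field; rewrite !gt_eqF.
  rewrite normrM distrC ger0_norm; last by rewrite !mulr_ge0 ?invr_ge0// ltW.
  have d0 : 0 <= kd x y by exact: kd_ge0.
  move: (mass _) mp px py p0 hAB => p mp px py p0 hAB.
  have kp0 : 0 < kap * p by rewrite mulr_gt0.
  have i1 : A^-1 * B^-1 <= (kap * p)^-1 * (kap * p)^-1.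
    by apply: ler_pM; rewrite ?invr_ge0 ?lef_pV2 ?posrE// ltW.
  have i2 : C * (A^-1 * B^-1) <= p * ((kap * p)^-1 * (kap * p)^-1).
    by apply: ler_pM => //; [exact: ltW|rewrite mulr_ge0// invr_ge0 ltW].
  apply: (@le_trans _ _ (p * ((kap * p)^-1 * (kap * p)^-1) * (p * kd x y))).
    by apply: ler_pM => //; rewrite !mulr_ge0 ?invr_ge0// ltW.
  by rewrite le_eqVlt; apply/orP; left; apply/eqP; field; rewrite !gt_eqF.
pose w x := ulim (fun n => u_ n.+1 x).
have cw x : u_ n.+1 x @[n --> ultraN] --> w x.
  apply: (@ulim_cvg _ _ kap^-1); apply: nearW => n; have /andP[h1 h2] := bnd n x.
  by rewrite ger0_norm// (le_trans (ltW kp)).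
have [lw uw] := ultra_unif (K := K) (f := fun n => u_ n.+1) (nearW _ lip) cw.
have contw := lipk_cont lw.
have pw x : 0 < w x.
  by apply: (lt_le_trans kp); apply: (ultra_gec (cw x)); apply: nearW => n; have /andP[] := bnd n x.
have cH y : H (wt (u_ n.+1) a) y @[n --> ultraN] --> H (wt w a) y.
  have ck : continuous (fun x => k x y) by exact: cont_kl.
  apply: (ultra_joint ma (nearW _ (fun=> ba)) (t := a)).
  - exact: cvg_cst.
  - by apply: nearW => n; apply: cont_mul => //; case: (cp n.+1).
  - exact: cont_mul.
  - move=> e e0; apply: filterS (uw e e0) => n h x.
    rewrite -mulrBl normrM; apply: (le_trans _ (h x)); rewrite ler_piMr//.
    by rewrite gtr0_norm ?gk_pos//; exact: gk_up.
have lim2 y : u_ n.+2 y @[n --> ultraN] --> H (wt w a) x0 * schr_map w y.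
  by apply: cvgM; [exact: cH|apply: cvgV; [rewrite gt_eqF// Hwt_pos|exact: cH]].
(* Both iterates equal 1 at [x0], which turns projective closeness into closeness of values. *)
have diff y : u_ n.+2 y @[n --> ultraN] --> w y.
  have c0 : (fun n => (1 - lam) ^+ n.+1 * q0 * kap^-1) @ ultraN --> (0 : R).
    have -> : (0 : R) = ((1 - lam) * 0) * q0 * kap^-1 by rewrite mulr0 !mul0r.
    apply: cvgMl; apply: cvgMl; under eq_fun do rewrite exprS.
    by apply: cvgMr; apply: pow_to0; [rewrite subr_ge0|rewrite ltrBlDr ltrDl].
  have c1 : (fun n => u_ n.+2 y - u_ n.+1 y) @ ultraN --> (0 : R).
    apply: (ultra_squeeze c0); apply: nearW => n; rewrite subr0.
    have [m mp hm] := hq n.+1; have q1 : 0 <= (1 - lam) ^+ n.+1 * q0 by rewrite mulr_ge0 ?exprn_ge0 ?subr_ge0.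
    have := hm x0; rewrite !u1 !mulr1 => /andP[m1 m2].
    have := hm y; have := bnd n y; have := bnd n.+1 y.
    move: (u_ n.+2 y) (u_ n.+1 y) ((1 - lam) ^+ n.+1 * q0) q1 m2 => A B q q1 m2 /andP[A1 A2] /andP[B1 B2] /andP[h1 h2].
    have B0 : 0 < B by exact: lt_le_trans B1. have A0 : 0 < A by exact: lt_le_trans A1.
    have i1 : A <= (1 + q) * B.
      by apply: (le_trans h2); apply: ler_wpM2r; [exact: ltW|rewrite ler_piMl// addr_ge0].
    have i2 : B <= (1 + q) * A.
      have j1 : B <= m * (1 + q) * B by rewrite ler_peMl// ltW.
      have j2 : (1 + q) * (m * B) <= (1 + q) * A by apply: ler_wpM2l => //; rewrite addr_ge0.
      lra.
    have i3 : q * B <= q * kap^-1 by exact: ler_wpM2l.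
    have i4 : q * A <= q * kap^-1 by exact: ler_wpM2l.
    rewrite ler_norml; apply/andP; split; lra.
  have -> : w y = 0 + w y by rewrite add0r.
  rewrite (_ : (fun n => u_ n.+2 y) = fun n => (u_ n.+2 y - u_ n.+1 y) + u_ n.+1 y); last first.
    by apply/funext => n; rewrite subrK.
  exact: cvgD.
have wE y : w y = H (wt w a) x0 * schr_map w y by exact: ultra_eq (diff y) (lim2 y).
(* Since [schr_map (w / c) = c schr_map w], division by [c] removes the factor
   [H (wt w a) x0 = c ^ 2]. *)
pose c := Num.sqrt (H (wt w a) x0); have P0 := Hwt_pos x0 contw pw.
have c0 : 0 < c by rewrite sqrtr_gt0.
exists (fun x => c^-1 * w x); split.
- by apply: cont_mul => //; exact: cont_cst.
- by move=> x; rewrite mulr_gt0// invr_gt0.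
- move=> y; rewrite /schr_map HwtZ// {1}wE /schr_map.
  have Py := Hwt_pos y contw pw; have -> : H (wt w a) x0 = c * c by rewrite -expr2 sqr_sqrtr// ltW.
  by field; rewrite !gt_eqF.
Qed.

(** Two applications of [schr_map] return [u] and fix [w], so the projective distance from [u] to
    [w] contracts to 0 and [u] is a multiple of [w]. Pairs are treated because [f_pot] selects a
    pair whose two components are not assumed equal. *)
Lemma schroedinger_pair_unique u v w : continuous u -> continuous v -> continuous w ->
  (forall x, 0 < u x) -> (forall x, 0 < v x) -> (forall x, 0 < w x) ->
  (forall y, u y = schr_map v y) -> (forall y, v y = schr_map u y) -> (forall y, w y = schr_map w y) ->
  exists2 c, 0 < c & forall x, u x = c * w x /\ v x = c^-1 * w x.
Proof.
move=> cu cv cw u0 v0 w0 uE vE wE; have [x0 _] := a_nonempty.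
have l0 := lam_gt0; have l1 := lam_le1 x0.
have [q q0 hq] := prop_ex cu cw u0 w0.
have E2 : schr_map u = v by apply/funext => x; rewrite vE.
have E3 : schr_map w = w by apply/funext => x; rewrite -wE.
have E1 : schr_map v = u by apply/funext => x; rewrite uE.
have q1 n : 0 <= (1 - lam) ^+ n * q by rewrite mulr_ge0 ?exprn_ge0 ?subr_ge0.
have hev n : prop_le ((1 - lam) ^+ (n.*2) * q) u w.
  elim: n => [|n IH]; first by rewrite mul1r.
  have h1 := Phi_contr (q1 _) cu cw u0 w0 IH; rewrite E2 E3 in h1.
  have h2 : 0 <= (1 - lam) * ((1 - lam) ^+ n.*2 * q) by rewrite mulr_ge0 ?q1// subr_ge0.
  have := Phi_contr h2 cv cw v0 w0 h1; rewrite E1 E3 doubleS !exprS.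
  by rewrite !mulrA.
have key y y' : u y * w y' <= u y' * w y.
  have c0 : (fun n => (1 + (1 - lam) ^+ (n.*2) * q) * (u y' * w y)) @ ultraN --> (1 + 0 * q) * (u y' * w y).
    apply: cvgMl; apply: cvgD; first exact: cvg_cst.
    apply: cvgMl.
    have -> : (fun n => (1 - lam) ^+ n.*2) = fun n => ((1 - lam) ^+ 2) ^+ n.
      by apply/funext => n; rewrite -exprM mul2n.
    apply: pow_to0; first exact: sqr_ge0.
    by rewrite expr_lt1 ?subr_ge0// ltrBlDr ltrDl.
  rewrite mul0r addr0 mul1r in c0; apply: (ultra_gec c0); apply: nearW => n.
  have [m mp hm] := hev n; have /andP[_ h1] := hm y; have /andP[h2 _] := hm y'.
  have h3 : u y * w y' <= m * (1 + (1 - lam) ^+ n.*2 * q) * w y * w y' by apply: ler_wpM2r => //; exact: ltW.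
  have h4 : (1 + (1 - lam) ^+ n.*2 * q) * w y * (m * w y') <= (1 + (1 - lam) ^+ n.*2 * q) * w y * u y'.
    by apply: ler_wpM2l => //; rewrite mulr_ge0 ?addr_ge0 ?q1// ltW.
  lra.
pose c := u x0 / w x0; have c0 : 0 < c by rewrite divr_gt0.
have uc x : u x = c * w x.
  have h : u x * w x0 = u x0 * w x by apply/eqP; rewrite eq_le !key.
  by rewrite /c mulrAC -h mulfK// gt_eqF.
exists c => // x; split => //; rewrite vE.
have -> : u = fun x => c * w x by apply/funext.
by rewrite /schr_map HwtZ// invfM; congr (_ * _); rewrite [RHS]wE.
Qed.

End Schroedinger.

Lemma cont_approx {R : realType} {X : pseudoMetricType R} (psi : X -> R) :
  (forall e, 0 < e -> exists2 f : X -> R, continuous f & forall x, `|psi x - f x| <= e) ->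
  continuous psi.
Proof.
move=> h x; apply/cvgrPdist_le => e e0; have e4 : 0 < e / 4 by rewrite divr_gt0.
have [f cf fE] := h _ e4.
have /cvgrPdist_le/(_ _ e4) := cf x; apply: filterS => t ht.
have h1 := fE x; have h2 := fE t.
have -> : psi x - psi t = (psi x - f x) + (f x - f t) - (psi t - f t) by ring.
apply: (le_trans (ler_normB _ _)); apply: (le_trans (lerD (ler_normD _ _) (lexx _))).
lra.
Qed.

(** * The Markov operator and the inverse of [Id - K_mu^2] *)

Section Markov.
Context {R : realType} {X : pseudoMetricType R} {K : @pdkernel R X}.
Local Notation k := (ker K).
Local Notation H := (Hop k).
Local Notation lam := (@lam R X K).
Implicit Types (f g psi beta : X -> R) (m M d D e : R).

Variables (a : (X -> R) -> R) (pa : posfun setT a) (x0 : X).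
Hypothesis b0 : forall y, 0 < H a y.

Let X0 : [set: X] !=set0. Proof. by exists x0. Qed.

(* This is [K_mu] when [a = lift mu]. *)
Definition markov_op psi (y : X) : R := (H a y)^-1 * H (wt psi a) y.

Lemma Kk_cont psi : continuous psi -> continuous (markov_op psi).
Proof.
move=> cp; apply: cont_mul; last exact: cont_Hwt.
by apply: cont_inv => //; exact: (cont_H (posfun_bdf pa)).
Qed.

Lemma Kk_sub f g y : continuous f -> continuous g ->
  markov_op (fun x => f x - g x) y = markov_op f y - markov_op g y.
Proof. by move=> cf cg; rewrite /markov_op HwtB// mulrBr. Qed.

Lemma Kk_scale (c : R) f y : continuous f -> markov_op (fun x => c * f x) y = c * markov_op f y.
Proof. by move=> cf; rewrite /markov_op HwtZ// mulrCA. Qed.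

Lemma Kk_cst (c : R) y : markov_op (fun=> c) y = c.
Proof.
have -> : (fun=> c) = (fun x : X => c * (fun=> 1) x) by apply/funext => x; rewrite mulr1.
rewrite Kk_scale; last exact: cont_cst.
have -> : markov_op (fun=> 1) y = (H a y)^-1 * H a y.
  by rewrite /markov_op /Hop /wt; congr (_ * a _); apply/funext => x; rewrite mul1r.
by rewrite mulVf ?mulr1// gt_eqF// b0.
Qed.

Lemma Kk_osc psi m M : continuous psi -> (forall x, m <= psi x <= M) ->
  exists m' M', [/\ m <= m', M' <= M, m' <= M', M' - m' <= (1 - lam) * (M - m) &
    forall y, m' <= markov_op psi y <= M'].
Proof.
move=> cp h; have c1 : continuous (fun _ : X => 1 : R) by exact: cont_cst.
have E y : H (wt (fun=> 1) a) y = H a y.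
  by rewrite /Hop /wt; congr a; apply/funext => x; rewrite mul1r.
have E0 y : 0 < H (wt (fun=> 1) a) y by rewrite E.
have h' x : m * 1 <= psi x <= M * 1 by rewrite !mulr1.
have [m' [M' [h1 h2 h3 h4 h5]]] := doeblin (K := K) pa X0 cp c1 (fun=> ler01) E0 h'.
exists m', M'; split => // y; have := h5 y; rewrite E => /andP[h6 h7].
by rewrite /markov_op; apply/andP; split; rewrite mulrC ?ler_pdivlMr ?ler_pdivrMr.
Qed.

Lemma Kk_norm psi M y : continuous psi -> (forall x, `|psi x| <= M) -> `|markov_op psi y| <= M.
Proof.
move=> cp h; have [|m' [M' [h1 h2 _ _ h5]]] := @Kk_osc psi (- M) M cp.
  by move=> x; rewrite -ler_norml.
by have /andP[h6 h7] := h5 y; rewrite ler_norml (le_trans h1 h6) (le_trans h7 h2).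
Qed.

Lemma osc_fix psi (th : R) : 0 <= th -> th < 1 -> continuous psi ->
  (forall m M, (forall y, m <= psi y <= M) ->
     exists m' M', M' - m' <= th * (M - m) /\ forall y, m' <= psi y <= M') ->
  forall y y', psi y = psi y'.
Proof.
move=> th0 th1 cp h; have [D [D0 hD]] := cont_bdd K cp.
have hn n : exists m M, M - m <= th ^+ n * (D + D) /\ forall y, m <= psi y <= M.
  elim: n => [|n [m [M [IH1 IH2]]]].
    by exists (- D), D; rewrite mul1r opprK; split => // y; rewrite -ler_norml.
  have [m' [M' [h1 h2]]] := h _ _ IH2; exists m', M'; split => //.
  by apply: (le_trans h1); rewrite exprS -mulrA; exact: ler_wpM2l.
have key y y' : psi y <= psi y'.
  rewrite -subr_le0.
  have c0 : (fun n => th ^+ n * (D + D)) @ ultraN --> 0 * (D + D).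
    by apply: cvgMl; exact: pow_to0.
  rewrite mul0r in c0; apply: (ultra_gec c0); apply: nearW => n.
  have [m [M [h1 h2]]] := hn n; have /andP[_ h3] := h2 y; have /andP[h4 _] := h2 y'.
  by apply: (le_trans _ h1); exact: lerB.
by move=> y y'; apply/eqP; rewrite eq_le !key.
Qed.

Let l0 : 0 < lam. Proof. exact: lam_gt0. Qed.
Let l1 : lam <= 1. Proof. exact: (lam_le1 x0). Qed.
Let th0 : 0 <= 1 - lam. Proof. by rewrite subr_ge0. Qed.
Let th1 : 1 - lam < 1. Proof. by rewrite ltrBlDr ltrDl. Qed.

(** [- markov_op] contracts oscillation as well, so [beta] is constant; the operator fixes
    constants, whence [2 beta = 0]. *)
Lemma Kk_inj beta : continuous beta -> (forall y, beta y + markov_op beta y = 0) -> forall y, beta y = 0.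
Proof.
move=> cb hb; have eb y : beta y = - markov_op beta y by apply/eqP; rewrite -addr_eq0 hb.
have cst := @osc_fix beta _ th0 th1 cb.
have {}cst y : beta y = beta x0.
  apply: cst => m M h; have [m' [M' [h1 h2 _ h4 h5]]] := Kk_osc cb h.
  exists (- M'), (- m'); split; first by move: h4; lra.
  by move=> z; rewrite eb; have /andP[h6 h7] := h5 z; rewrite !lerN2 h6 h7.
move=> y; have := hb y; have -> : beta = fun=> beta x0 by apply/funext.
rewrite Kk_cst; lra.
Qed.

Lemma Kk2_osc psi m M : continuous psi -> (forall x, m <= psi x <= M) ->
  exists m' M', M' - m' <= (1 - lam) * (M - m) /\ forall y, m' <= markov_op (markov_op psi) y <= M'.
Proof.
move=> cp h; have [m' [M' [h1 h2 h3 h4 h5]]] := Kk_osc cp h.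
have [m2 [M2 [j1 j2 j3 j4 j5]]] := Kk_osc (Kk_cont cp) h5.
exists m2, M2; split => //; apply: (le_trans _ h4); exact: lerB.
Qed.

Lemma Kk2_unique psi (C : R) : continuous psi ->
  (forall y, psi y - markov_op (markov_op psi) y = C) -> forall y y', psi y = psi y'.
Proof.
move=> cp h; apply: (@osc_fix psi _ th0 th1 cp) => m M hm.
have [m' [M' [h1 h2]]] := Kk2_osc cp hm; exists (m' + C), (M' + C); split; first by lra.
by move=> y; have := h2 y; have := h y; move=> e /andP[e1 e2]; apply/andP; split; lra.
Qed.

(** Picard iteration for [psi = K^2 psi + g], normalized to vanish at [x0] because [Id - K^2] kills
    constants. The oscillation of the increments contracts by [1 - lam]; with the normalization it
    bounds their sup norm, and [4 D / lam] is the sum of the geometric series. *)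
Lemma Kk2_exists g : continuous g ->
  exists psi (C : R), continuous psi /\ forall y, psi y - markov_op (markov_op psi) y = g y + C.
Proof.
move=> cg; have [D [D0 hD]] := cont_bdd K cg.
pose S psi y := markov_op (markov_op psi) y + g y; pose T psi y := S psi y - S psi x0.
pose p_ n := iter n T (fun=> 0).
have cK2 f : continuous f -> continuous (markov_op (markov_op f)) by move=> cf; do 2!apply: Kk_cont.
have cp n : continuous (p_ n).
  elim: n => [|n IH]; first exact: cont_cst.
  apply: cont_add; last exact: cont_cst.
  by apply: cont_add => //; exact: cK2.
have cd n : continuous (fun x => p_ n.+1 x - p_ n x) by apply: cont_add => //; exact: cont_opp.
have dE n y : p_ n.+2 y - p_ n.+1 y = markov_op (markov_op (fun x => p_ n.+1 x - p_ n x)) y -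
    markov_op (markov_op (fun x => p_ n.+1 x - p_ n x)) x0.
  have E z : markov_op (markov_op (fun x => p_ n.+1 x - p_ n x)) z = markov_op (markov_op (p_ n.+1)) z - markov_op (markov_op (p_ n)) z.
    rewrite -Kk_sub; [|exact: Kk_cont..].
    by congr markov_op; apply/funext => u; exact: Kk_sub.
  by rewrite !E /= /T /S; ring.
have osc n : exists m M, M - m <= (1 - lam) ^+ n * (4 * D) /\ forall y, m <= p_ n.+1 y - p_ n y <= M.
  elim: n => [|n [m [M [h1 h2]]]].
    exists (- (2 * D)), (2 * D); split; first by rewrite mul1r; lra.
    move=> y; rewrite -ler_norml /= /T /S subr0.
    have K0 z : markov_op (markov_op (fun=> 0)) z = 0.
      have -> : markov_op (fun=> 0) = (fun=> 0) by apply/funext => u; exact: Kk_cst.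
      exact: Kk_cst.
    rewrite !K0 !add0r; apply: (le_trans (ler_normB _ _)).
    by have := hD y; have := hD x0; lra.
  have [m' [M' [h3 h4]]] := Kk2_osc (cd n) h2.
  exists (m' - markov_op (markov_op (fun x => p_ n.+1 x - p_ n x)) x0), (M' - markov_op (markov_op (fun x => p_ n.+1 x - p_ n x)) x0).
  split; last by move=> y; rewrite dE !lerD2r.
  have -> (q : R) : M' - q - (m' - q) = M' - m' by ring.
  by apply: (le_trans h3); rewrite exprS -mulrA; exact: ler_wpM2l.
have D4 : 0 <= 4 * D / lam by apply: mulr_ge0; [exact: mulr_ge0|rewrite invr_ge0; exact: ltW].
have px0 n : p_ n x0 = 0 by case: n => [//|n]; rewrite /= /T subrr.
have dn n y : `|p_ n.+1 y - p_ n y| <= (1 - lam) ^+ n * (4 * D).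
  have [m [M [h1 h2]]] := osc n; have := h2 x0; rewrite !px0 subrr => /andP[m0 M0].
  have /andP[h3 h4] := h2 y; rewrite ler_norml; apply/andP; split; lra.
have tail n j y : `|p_ (n + j)%N y - p_ n y| <= (1 - lam) ^+ n * (4 * D / lam).
  have : `|p_ (n + j)%N y - p_ n y| <= ((1 - lam) ^+ n - (1 - lam) ^+ (n + j)) * (4 * D / lam).
    elim: j => [|j IH]; first by rewrite addn0 !subrr normr0 mul0r.
    rewrite addnS; have h := dn (n + j)%N y.
    have -> : p_ (n + j).+1 y - p_ n y = (p_ (n + j).+1 y - p_ (n + j)%N y) + (p_ (n + j)%N y - p_ n y) by ring.
    apply: (le_trans (ler_normD _ _)); apply: (le_trans (lerD h IH)).
    rewrite exprS le_eqVlt; apply/orP; left; apply/eqP.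
    move: (_ ^+ (n + j)) (_ ^+ n) => A B; move: (lam) l0 => L L0; field.
    by rewrite gt_eqF.
  move=> h; apply: (le_trans h); apply: ler_wpM2r; first exact: D4.
  by rewrite lerBlDr lerDl exprn_ge0.
pose psi x := ulim (fun n => p_ n x).
have cpsi x : p_ n x @[n --> ultraN] --> psi x.
  apply: (@ulim_cvg _ _ (4 * D / lam)); apply: nearW => n.
  by have := tail 0%N n x; rewrite add0n mul1r /= subr0.
have unif n y : `|psi y - p_ n y| <= (1 - lam) ^+ n * (4 * D / lam).
  have c1 : `|p_ j y - p_ n y| @[j --> ultraN] --> `|psi y - p_ n y|.
    by apply: cvg_norm; apply: cvgB => //; exact: cvg_cst.
  apply: (ultra_lec c1); apply: filterS (ultraN_ge n) => j nj.
  by rewrite -(subnKC nj); exact: tail.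
have C0 : (fun n => (1 - lam) ^+ n * (4 * D / lam)) @ ultraN --> (0 : R).
  by rewrite -[0](mul0r (4 * D / lam)); apply: cvgMl; exact: pow_to0.
have contpsi : continuous psi.
  apply: cont_approx => e e0; have /ultraP/(_ e e0)/filter_ex[n hn] := C0.
  exists (p_ n) => // x; apply: (le_trans (unif n x)); apply: (le_trans (ler_norm _)).
  by move: hn; rewrite subr0.
have cKpsi y : markov_op (markov_op (p_ n)) y @[n --> ultraN] --> markov_op (markov_op psi) y.
  apply: (ultra_squeeze C0); apply: nearW => n.
  have h : markov_op (markov_op (p_ n)) y - markov_op (markov_op psi) y = markov_op (markov_op (fun x => p_ n x - psi x)) y.
    rewrite -Kk_sub; [|exact: Kk_cont..].
    by congr markov_op; apply/funext => u; rewrite Kk_sub.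
  rewrite h; apply: Kk_norm; first by apply: Kk_cont; apply: cont_add => //; exact: cont_opp.
  move=> x; apply: Kk_norm; first by apply: cont_add => //; exact: cont_opp.
  by move=> z; rewrite distrC.
exists psi, (- S psi x0); split => // y.
have c1 : p_ n.+1 y @[n --> ultraN] --> psi y.
  have : (fun n => psi y + (p_ n.+1 y - psi y)) @ ultraN --> psi y + 0.
    apply: cvgD; first exact: cvg_cst.
    apply: (ultra_squeeze C0); apply: nearW => n; rewrite subr0 distrC.
    apply: (le_trans (unif _ _)); apply: ler_wpM2r; first exact: D4.
    by rewrite exprS ler_piMl ?exprn_ge0// ltW.
  by rewrite addr0; under eq_fun do rewrite addrC subrK.
have c2 : p_ n.+1 y @[n --> ultraN] --> (markov_op (markov_op psi) y + g y) - S psi x0.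
  by apply: cvgB; apply: cvgD; by [exact: cKpsi|exact: cvg_cst].
by rewrite (ultra_eq c1 c2); ring.
Qed.

End Markov.

(** * The embedding [B] and its inverse *)

Section Bridge.
Context {R : realType} {X : pseudoMetricType R}.
Implicit Types (f g u v w b phi psi : X -> R) (mu : (X -> R) -> R) (t s e M C : R).

Lemma in_rkhs_hb (k : X -> X -> R) f : in_rkhs k f -> exists C, hb k f C.
Proof. by move=> /ereal_inf_lt [_ [C hC _] _]; exists C. Qed.

Lemma sinkhorn_kernel (eps : R) (c : X -> X -> R) : compact [set: X] -> 0 < eps ->
  continuous (fun p : X * X => c p.1 p.2) -> (forall x y, c x y = c y x) ->
  (forall x y, 0 <= c x y) ->
  (forall (n : nat) (x : 'I_n -> X) (a : 'I_n -> R),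
     0 <= \sum_(i < n) \sum_(j < n) a i * a j * k_c eps c (x i) (x j)) ->
  (forall f : X -> R, continuous f -> forall d : R, 0 < d ->
     exists h, in_rkhs (k_c eps c) h /\ forall x, `|f x - h x| < d) ->
  exists K : @pdkernel R X, ker K = k_c eps c.
Proof.
move=> cX e0 cc sc c0 psd univ.
have [M hM] : exists M, forall p : X * X, c p.1 p.2 <= M.
  have cXX : compact [set: X * X].
    by rewrite (_ : setT = setT `*` setT); [exact: compact_setX|apply/seteqP; split].
  have cf : compact ((fun p : X * X => c p.1 p.2) @` setT).
    by apply: continuous_compact => //; exact: continuous_subspaceT.
  have [N [_ hN]] := compact_bounded cf; exists (`|N| + 1) => p.
  have := hN (`|N| + 1); rewrite (le_lt_trans (ler_norm N)) ?ltrDl// => /(_ isT) h.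
  by apply: (le_trans (ler_norm _)); apply: h; exists p.
have cg : continuous (fun p : X * X => k_c eps c p.1 p.2).
  move=> p; apply: (continuous_comp (f := fun p : X * X => - c p.1 p.2 / eps) (g := expR)); last exact: continuous_expR.
  by apply: cvgMl; apply: cvgN; exact: cc.
have low x y : expR (- M / eps) <= k_c eps c x y.
  by rewrite /k_c ler_expR ler_pM2r ?invr_gt0// lerN2; exact: (hM (x, y)).
have up x y : k_c eps c x y <= 1.
  by rewrite /k_c -expR0 ler_expR mulNr oppr_le0 divr_ge0// ltW.
have sk x y : k_c eps c x y = k_c eps c y x by rewrite /k_c sc.
have u' f : continuous f -> forall d : R, 0 < d ->
     exists h C, hb (k_c eps c) h C /\ forall x, `|f x - h x| <= d.
  move=> cf d d0; have [h [/in_rkhs_hb[C hC] hd]] := univ f cf d d0.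
  by exists h, C; split => // x; exact: ltW.
by exists (PDKernel cX cg sk (expR_gt0 _) low up psd u').
Qed.

Lemma hb_conj (k k' : X -> X -> R) g phi C : (forall x y, k' x y = g x * k x y * g y) ->
  hb k phi C -> hb k' (fun x => g x * phi x) C.
Proof.
move=> kE [C0 h]; split => // n x a; have := h n x (fun i => a i * g (x i)).
rewrite (eq_bigr (fun i => a i * (g (x i) * phi (x i)))) => [|i _]; last by rewrite mulrA.
congr (_ <= _ * _); apply: eq_bigr => i _; apply: eq_bigr => j _; rewrite kE; ring.
Qed.

(** Multiplication by [g] is an isometry between the two spaces. It is used with [g = 1 / B(mu)],
    which turns [k_c] into [k_mu]. *)
Lemma hnorm2_conj (k k' : X -> X -> R) g phi : (forall x, g x != 0) ->
  (forall x y, k' x y = g x * k x y * g y) -> hnorm2 k' (fun x => g x * phi x) = hnorm2 k phi.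
Proof.
move=> g0 kE; have hE C : hb k phi C <-> hb k' (fun x => g x * phi x) C.
  split; first exact: hb_conj.
  move=> /(hb_conj (k' := k) (g := fun x => (g x)^-1)) h.
  rewrite (_ : phi = fun x => (g x)^-1 * (g x * phi x)).
    by apply: h => x y; rewrite kE; field; rewrite !g0.
  by apply/funext => x; rewrite mulKf.
rewrite /hnorm2; congr (ereal_inf [set _ | _ in _]); apply/seteqP; split => C hC; exact/hE.
Qed.

Lemma is_probP mu : is_prob mu <-> posfun setT mu /\ mass mu = 1.
Proof.
split => [[l p m]|[[l p] m]].
  by split => //; split => [f g a cf cg|f cf f0]; [exact: l|apply: p => // x; exact: f0].
by split => [f g a cf cg|f cf f0|]; [exact: l|apply: p => // x _; exact: f0|].
Qed.

Context {K : @pdkernel R X}.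
Variables (eps : R) (c : X -> X -> R) (e0 : 0 < eps) (KE : ker K = k_c eps c).
Local Notation k := (ker K).
Local Notation H := (Hop k).
Local Notation kN := (dual_sqnorm (K := K)).
Local Notation Phi := (@schr_map R X K).

Let en : eps != 0. Proof. by rewrite gt_eqF. Qed.

Lemma expdiv_cont f : continuous f -> continuous (fun x => expR (f x / eps)).
Proof.
move=> cf x; apply: (continuous_comp (f := fun x => f x / eps) (g := expR)); last exact: continuous_expR.
by apply: cvgMl; exact: cf.
Qed.

Lemma ln_cont w : continuous w -> (forall x, 0 < w x) -> continuous (fun x => eps * ln (w x)).
Proof.
move=> cw w0 x; apply: cvgMr.
by apply: (continuous_comp (f := w) (g := @ln R)); [exact: cw|exact: continuous_ln].
Qed.

Lemma Teps_Phi f mu y : is_prob mu -> continuous f ->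
  expR (Teps eps c f mu y / eps) = Phi mu (fun x => expR (f x / eps)) y.
Proof.
move=> /is_probP[pm m1] cf; rewrite /Teps /schr_map.
have -> : mu (fun x => expR ((f x - c x y) / eps)) = H (wt (fun x => expR (f x / eps)) mu) y.
  by rewrite /Hop /wt KE /k_c; congr mu; apply/funext => x; rewrite -expRD -mulrDl.
have -> (q : R) : - eps * q / eps = - q by field.
rewrite expRN lnK// posrE; apply: Hwt_pos => //; first exact: expdiv_cont.
by move=> x; exact: expR_gt0.
Qed.

(** By uniqueness up to scaling, the pair selected in [f_pot] is [eps ln w] plus and minus the same
    constant; the normalization [mu f1 = mu f2] makes this constant zero. *)
Lemma f_self_spec mu : is_prob mu -> exists w, [/\ continuous w, forall x, 0 < w x,
  forall y, w y = Phi mu w y & f_self eps c mu = fun x => eps * ln (w x)].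
Proof.
move=> pm; have /is_probP[qm m1] := pm.
have [w [cw w0 wE]] := schroedinger_exists (K := K) qm m1.
have cf := ln_cont cw w0.
have elw : (fun x => expR (eps * ln (w x) / eps)) = w.
  by apply/funext => x; rewrite (_ : eps * ln (w x) / eps = ln (w x)) ?lnK ?posrE//; field.
have inj (p q : R) : expR (p / eps) = expR (q / eps) -> p = q.
  by move=> /expR_inj /(congr1 (fun z => z * eps)); rewrite !divfK.
have sp : schr_pair eps c mu mu (fun x => eps * ln (w x), fun x => eps * ln (w x)).
  have E : (fun x => eps * ln (w x)) = Teps eps c (fun x => eps * ln (w x)) mu.
    apply/funext => y; apply: inj; rewrite Teps_Phi// elw -wE.
    by rewrite -[in RHS]elw.
  by split.
exists w; split => //; rewrite /f_self /f_pot.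
have := ClassicalEpsilon.epsilon_spec (inhabits ((fun _ => 0), (fun _ => 0)) : inhabited ((X -> R) * (X -> R)))
  (schr_pair eps c mu mu) (ex_intro _ _ sp).
case: (ClassicalEpsilon.epsilon _ _) => f1 f2 [/= c1 c2 E1 E2 E3].
have [y0 _] := a_nonempty qm m1.
have [|||||q q0 hq] := @schroedinger_pair_unique R X K mu qm m1 _ _ w (expdiv_cont c1) (expdiv_cont c2) cw _ _ w0.
- by move=> x; exact: expR_gt0.
- by move=> x; exact: expR_gt0.
- by move=> y; rewrite {1}E1 Teps_Phi.
- by move=> y; rewrite {1}E2 Teps_Phi.
- exact: wE.
have L1 x : f1 x = eps * ln (w x) + eps * ln q.
  have [h _] := hq x; apply: inj; rewrite h -mulrDr.
  have -> (z : R) : eps * z / eps = z by field.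
  by rewrite expRD !lnK ?posrE// mulrC.
have L2 x : f2 x = eps * ln (w x) + - (eps * ln q).
  have [_ h] := hq x; apply: inj; rewrite h -mulrBr.
  have -> (z : R) : eps * z / eps = z by field.
  by rewrite expRD expRN !lnK ?posrE// mulrC.
have q1 : eps * ln q = 0.
  have e1 : mu f1 = mu (fun x => eps * ln (w x)) + eps * ln q.
    rewrite (_ : f1 = fun x => eps * ln (w x) + (fun=> eps * ln q) x); last by apply/funext.
    by rewrite (linD qm.1)// ?(lin_cst qm.1) ?m1 ?mulr1//; exact: cont_cst.
  have e2 : mu f2 = mu (fun x => eps * ln (w x)) - eps * ln q.
    rewrite (_ : f2 = fun x => eps * ln (w x) + (fun=> - (eps * ln q)) x); last by apply/funext.
    by rewrite (linD qm.1)// ?(lin_cst qm.1) ?m1 ?mulr1//; exact: cont_cst.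
  by move: E3; rewrite e1 e2; lra.
by apply/funext => x; rewrite L1 q1 addr0.
Qed.

Lemma Bemb_spec mu : is_prob mu -> [/\ continuous (Bemb eps c mu), forall x, 0 < Bemb eps c mu x &
  forall y, Bemb eps c mu y = H (wt (fun x => (Bemb eps c mu x)^-1) mu) y].
Proof.
move=> pm; have [w [cw w0 wE fE]] := f_self_spec pm.
have E : Bemb eps c mu = fun x => (w x)^-1.
  apply/funext => x; rewrite /Bemb fE.
  by rewrite (_ : - (eps * ln (w x)) / eps = - ln (w x)) ?expRN ?lnK ?posrE//; field.
rewrite E; split.
- exact: cont_inv.
- by move=> x; rewrite invr_gt0.
- move=> y; rewrite {1}wE /schr_map invrK.
  by rewrite (_ : (fun x => (w x)^-1^-1) = w)//; apply/funext => x; rewrite invrK.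
Qed.

(** [1 / b] and [1 / B(mu)] are positive fixed points of [schr_map], hence proportional; as the map
    has degree -1, the factor equals its own inverse. *)
Lemma Bemb_unique mu b : is_prob mu -> continuous b -> (forall x, 0 < b x) ->
  (forall y, b y = H (wt (fun x => (b x)^-1) mu) y) -> Bemb eps c mu = b.
Proof.
move=> pm cb b0 bE; have /is_probP[qm m1] := pm; have [cB B0 BE] := Bemb_spec pm.
have F (d : X -> R) : (forall y, d y = H (wt (fun x => (d x)^-1) mu) y) ->
  forall y, (d y)^-1 = Phi mu (fun x => (d x)^-1) y by move=> h y; rewrite {1}h.
have i0 (d : X -> R) : (forall x, 0 < d x) -> forall x, 0 < (d x)^-1 by move=> h x; rewrite invr_gt0.
have [q q0 hq] := schroedinger_pair_unique qm m1 (cont_inv B0 cB) (cont_inv B0 cB) (cont_inv b0 cb)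
  (i0 _ B0) (i0 _ B0) (i0 _ b0) (F _ BE) (F _ BE) (F _ bE).
apply/funext => x; have [h1 h2] := hq x; apply: invr_inj; rewrite h1.
have : q * (b x)^-1 = q^-1 * (b x)^-1 by rewrite -h1 h2.
have bx : (b x)^-1 != 0 by rewrite invr_eq0 gt_eqF.
move=> /(mulIf bx) qq; have q1 : q * q = 1 by rewrite {1}qq mulVf// gt_eqF.
suff -> : q = 1 by rewrite mul1r.
have /eqP : (q - 1) * (q + 1) = 0 by rewrite -[RHS](subrr 1) -{3}q1; ring.
by rewrite mulf_eq0 => /orP[|]/eqP h; [lra|move: q0; lra].
Qed.

(** The measure [H_c^-1 [B(mu)]], that is [mu / B(mu)]. *)
Definition lift mu := wt (fun x => (Bemb eps c mu x)^-1) mu.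

Lemma lift_facts mu : is_prob mu -> [/\ posfun setT (lift mu), H (lift mu) = Bemb eps c mu & kN (lift mu) = 1].
Proof.
move=> pm; have [cB B0 BE] := Bemb_spec pm; have /is_probP[qm m1] := pm.
have HE : H (lift mu) = Bemb eps c mu by apply/funext => y; rewrite [RHS]BE.
split => //.
  by apply: posfun_wt => //; [exact: cont_inv|move=> x _; rewrite invr_ge0 ltW].
rewrite /dual_sqnorm /kdot HE /lift /wt -[RHS]m1 /mass; congr mu; apply/funext => x.
by rewrite mulVf// gt_eqF.
Qed.

Lemma lift_wt mu f : is_prob mu -> mu f = lift mu (fun x => Bemb eps c mu x * f x).
Proof.
move=> pm; have [_ B0 _] := Bemb_spec pm; rewrite /lift /wt; congr mu; apply/funext => x.
by rewrite mulKf// gt_eqF.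
Qed.

(** The inverse embedding, sending [b = H a] to the measure [b a]: [b] satisfies the equation that
    characterizes [B] of this measure. *)
Lemma unlift_facts a : posfun setT a -> kN a = 1 ->
  is_prob (wt (H a) a) /\ Bemb eps c (wt (H a) a) = H a.
Proof.
move=> pa na; have cH := cont_H (posfun_bdf pa).
have H0 x : 0 < H a x by apply: (H_pos (K := K) x pa); rewrite -/(dual_sqnorm a) na.
have pm : is_prob (wt (H a) a).
  apply/is_probP; split; first by apply: posfun_wt => // x _; exact: ltW.
  by rewrite /mass /wt -[RHS]na /dual_sqnorm /kdot; congr a; apply/funext => x; rewrite mulr1.
split => //; apply: Bemb_unique => // y.
rewrite /Hop /wt; congr a; apply/funext => x; rewrite mulVKf// gt_eqF// ; exact: H0.
Qed.

Lemma lift_unlift a : posfun setT a -> kN a = 1 -> lift (wt (H a) a) = a.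
Proof.
move=> pa na; have [pm BE] := unlift_facts pa na; apply/funext => f; rewrite /lift BE /wt.
have H0 x : 0 < H a x by apply: (H_pos (K := K) x pa); rewrite -/(dual_sqnorm a) na.
by congr a; apply/funext => x; rewrite mulVKf// gt_eqF.
Qed.

Lemma k_muE mu x y : is_prob mu ->
  k_mu eps c mu x y = (Bemb eps c mu x)^-1 * k x y * (Bemb eps c mu y)^-1.
Proof.
by move=> pm; rewrite /k_mu /Bemb KE /k_c -!expRN -!expRD; congr expR; field; exact: en.
Qed.

Lemma Kop_Kk mu phi y : is_prob mu -> continuous phi -> Kop eps c mu phi y = markov_op (K := K) (lift mu) phi y.
Proof.
move=> pm cphi; have [cB B0 BE] := Bemb_spec pm; have /is_probP[qm m1] := pm.
have [_ HE _] := lift_facts pm; have ck : continuous (fun x => k x y) by exact: cont_kl.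
have ci := cont_inv B0 cB.
rewrite /Kop /markov_op HE /Hop /wt /lift /wt -(linZ qm.1); last by do 2!apply: cont_mul => //.
by congr mu; apply/funext => x; rewrite k_muE//; ring.
Qed.

Lemma Kop_cont mu phi : is_prob mu -> continuous phi -> continuous (Kop eps c mu phi).
Proof.
move=> pm cphi; have [pl HE _] := lift_facts pm; have [cB B0 _] := Bemb_spec pm.
rewrite (_ : Kop _ _ _ _ = markov_op (K := K) (lift mu) phi); last by apply/funext => y; exact: Kop_Kk.
by apply: Kk_cont => // y; rewrite HE.
Qed.

Lemma rkhs_mu mu phi : is_prob mu -> hnorm2 (k_mu eps c mu) phi = hnorm2 k (fun x => Bemb eps c mu x * phi x).
Proof.
move=> pm; have [cB B0 _] := Bemb_spec pm.
rewrite -(@hnorm2_conj k (k_mu eps c mu) (fun x => (Bemb eps c mu x)^-1)).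
- by congr hnorm2; apply/funext => x; rewrite mulKf// gt_eqF.
- by move=> x; rewrite invr_eq0 gt_eqF.
- by move=> x y; rewrite k_muE.
Qed.

Lemma inv_IdK2_spec mu g : is_prob mu -> continuous g ->
  continuous (inv_IdK2 eps c mu g) /\ exists C : R, forall y, inv_IdK2 eps c mu g y -
    markov_op (K := K) (lift mu) (markov_op (K := K) (lift mu) (inv_IdK2 eps c mu g)) y = g y + C.
Proof.
move=> pm cg; have [pl HE _] := lift_facts pm; have [cB B0 _] := Bemb_spec pm.
have H0 y : 0 < H (lift mu) y by rewrite HE.
have /is_probP[qm m1] := pm; have [x0 _] := a_nonempty qm m1.
have E psi : continuous psi -> Kop eps c mu (Kop eps c mu psi) = markov_op (K := K) (lift mu) (markov_op (K := K) (lift mu) psi).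
  move=> cp; apply/funext => y; rewrite Kop_Kk//; last exact: Kop_cont.
  by congr markov_op; apply/funext => z; exact: Kop_Kk.
have [psi [C [cp hp]]] := Kk2_exists pl x0 H0 cg.
have := ClassicalEpsilon.epsilon_spec (inhabits (fun _ : X => (0 : R)))
    (fun psi : X -> R => continuous psi /\
       exists C : R, forall y, psi y - Kop eps c mu (Kop eps c mu psi) y = g y + C).
case; first by exists psi; split => //; exists C => y; rewrite E.
move=> c1 [C1 h1]; split => //; exists C1 => y; by rewrite -h1 -E.
Qed.

End Bridge.

(** * From Sinkhorn potential flows to supersolutions *)

Section Integrals.
Context {R : realType}.
Local Notation leb := (@lebesgue_measure R).
Implicit Types (f m : R -> R) (s t r e d T L : R).

(** By Lebesgue differentiation. Applied to a bound for the metric derivative, it gives at almost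
    every time a finite right Lipschitz constant, enough to extract weak limits of difference
    quotients. *)
Lemma ae_right_lip f : leb.-integrable setT (EFin \o f) ->
  exists N : set R, [/\ measurable N, leb N = 0%E & forall t, ~ N t ->
    exists L d, [/\ 0 <= L, 0 < d & forall r, t <= r -> r <= t + d ->
      \int[leb]_(x in `]t, r]) f x <= L * (r - t)]].
Proof.
move=> intf; have intA (A : set R) : measurable A -> leb.-integrable A (EFin \o f).
  by move=> mA; apply: (integrableS _ _ _ intf).
have locf : locally_integrable setT f by apply: open_integrable_locally => //; exact: openT.
have [N [mN N0 hN]] := FTC1Ny (fun y => intA _ (measurable_itv _)) locf.
exists N; split => // t nN.
pose F (x : R) : R := \int[leb]_(s in `]-oo, x]) f s.
have [dF _] : derivable F t 1 /\ derive1 F t = f t.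
  by apply: contrapT => h; apply: nN; apply: hN.
move: dF => /cvg_ex [l /= hl].
have FB r : t <= r -> \int[leb]_(x in `]t, r]) f x = F r - F t.
  move=> tr; rewrite /F (@Rintegral_itvB _ _ -oo%O (BRight r) t)//.
  by apply: intA.
exists (`|l| + 1).
have /cvgrPdist_lt/(_ 1 ltr01) [d /= d0 hd] := hl.
exists (d / 2); split => //; first by rewrite divr_gt0.
move=> r tr rd; have [->|rt] := eqVneq r t.
  by rewrite FB// !subrr mulr0.
have rt0 : 0 < r - t by rewrite subr_gt0 lt_neqAle eq_sym rt.
have := hd (r - t); rewrite /ball_/= sub0r normrN gtr0_norm//.
have dd : r - t < d by move: rd d0; lra.
move=> /(_ dd) /(_ (lt0r_neq0 rt0)).
have -> : (r - t)%:A + t = r by rewrite -[X in X + t]/((r - t) * 1) mulr1 subrK.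
rewrite -[(r - t)^-1 *: _]/((r - t)^-1 * _) FB// => h; rewrite -ler_pdivrMr//.
have : `|(F r - F t) / (r - t)| <= `|l| + 1.
  have -> : (F r - F t) / (r - t) = l - (l - (r - t)^-1 * (F r - F t)) by rewrite mulrC; ring.
  by apply: (le_trans (ler_normB _ _)); rewrite lerD2l ltW.
by apply: le_trans; exact: ler_norm.
Qed.

(** Domination of [m] by [1 + m ^ 2]; truncation to [[0, T]] gives a density integrable on the whole
    line, as [ae_growth] requires. *)
Lemma L2_integrable m T : measurable_fun setT m -> (forall r, 0 <= m r) ->
  (\int[leb]_(r in `[0%R, T]) ((m r) ^+ 2)%:E < +oo)%E ->
  exists f, [/\ leb.-integrable setT (EFin \o f), forall x, 0 <= f x &
    forall s t, 0 <= s -> s <= t -> t <= T ->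
      (\int[leb]_(r in `[s%R, t%R]) (m r)%:E = (\int[leb]_(x in `]s, t]) f x)%:E)%E].
Proof.
move=> mm m0 fin.
have mI : measurable (`[0%R, T] : set R) by exact: measurable_itv.
have int1 : leb.-integrable `[0%R, T] (EFin \o m).
  apply/integrableP; split; first by apply/measurable_EFinP; exact: measurable_funTS.
  apply: (@le_lt_trans _ _ (\int[leb]_(r in `[0%R, T]) (1%:E + ((m r) ^+ 2)%:E))%E).
    apply: ge0_le_integral => //.
    - by apply/measurable_EFinP; apply: measurableT_comp => //; exact: measurable_funTS.
    - apply: emeasurable_funD => //; apply/measurable_EFinP.
      by apply: measurable_funX; exact: measurable_funTS.
    - move=> x _; rewrite /= lee_fin ger0_norm//.
      by have := sqr_ge0 (m x - 1); rewrite sqrrB expr1n; have := m0 x; nra.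
  rewrite ge0_integralD//; last 2 first.
  - by move=> x _; rewrite lee_fin sqr_ge0.
  - by apply/measurable_EFinP; apply: measurable_funX; exact: measurable_funTS.
  rewrite lte_add_pinfty//.
  rewrite integral_cst//= mul1e lebesgue_measure_itv/=; case: ifP => _ //.
  by rewrite -EFinB ltry.
have i2 : leb.-integrable setT (EFin \o (m \_ `[0%R, T])).
  by move: int1; rewrite integrable_mkcond//= restrict_EFin.
exists (m \_ `[0%R, T]); split => //.
- by move=> x; rewrite patchE; case: ifP.
- move=> s t s0 st tT.
  have sub : `]s, t] `<=` (`[0%R, T] : set R).
    by move=> x /=; rewrite !in_itv/= => /andP[sx xt]; apply/andP; split; lra.
  rewrite -(@integral_itv_obnd_cbnd _ s (BRight t)); last first.
    by apply/measurable_EFinP; exact: measurable_funTS.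
  rewrite /Rintegral fineK.
    by apply: eq_integral => x /set_mem/sub xI; rewrite patchE mem_set.
  by apply: integrable_fin_num => //; apply: (integrableS _ _ _ i2).
Qed.

Lemma integral_small f e : leb.-integrable setT (EFin \o f) -> (forall x, 0 <= f x) -> 0 < e ->
  exists2 d, 0 < d & forall s t, s <= t -> t <= s + d -> \int[leb]_(x in `]s, t]) f x <= e.
Proof.
move=> intf f0 e0; have [d [d0 hd]] := integral_normr_continuous intf e0.
exists (d / 2) => [|s t st td]; first by rewrite divr_gt0.
have mi : measurable (`]s, t] : set R) by exact: measurable_itv.
have : (leb `]s, t]%classic < d%:E)%E.
  rewrite lebesgue_measure_itv/= lte_fin; case: ifPn => // _; rewrite -EFinB lte_fin; move: td d0; lra.
move=> /(hd _ mi) /ltW; rewrite (_ : Rintegral _ _ _ = \int[leb]_(x in `]s, t]) f x)//.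
by apply: eq_Rintegral => x _; rewrite ger0_norm.
Qed.

End Integrals.

Section Support.
Context {R : realType} {X : pseudoMetricType R} {K : @pdkernel R X}.

(* The complement of the support is a union of open sets of measure zero, each
   detected by a nonnegative function with zero integral; by compactness finitely
   many of them control [p]. *)
Lemma pressure_null (mu : (X -> R) -> R) (p f : X -> R) : is_prob mu -> pressures mu p -> continuous f ->
  mu (fun x => p x * f x) = 0.
Proof.
move=> pm [cp [p0 ps]] cf; have /is_probP[qm m1] := pm.
have cnp : continuous (fun x => - p x) by exact: cont_opp.
have [x0 _] := a_nonempty qm m1.
suff h : mu (fun x => - p x) = 0.
  have := @posfun_null R X K setT mu (fun x => - p x) (fun x => - f x) qm cnp (cont_opp cf) _ h.
  rewrite (_ : (fun x => - p x * - f x) = fun x => p x * f x); last by apply/funext => x; rewrite mulrNN.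
  by apply => y _; rewrite oppr_ge0.
apply/eqP; rewrite eq_le; apply/andP; split; last by apply: qm.2 => // y _; rewrite oppr_ge0.
apply/ler_addgt0Pr => e e0; rewrite add0r.
have [gx hgx] : exists gx : X -> X -> R, forall x, p x < 0 ->
    [/\ continuous (gx x), forall y, 0 <= gx x y, 0 < gx x x & mu (gx x) <= 0].
  suff : forall x, exists g : X -> R, p x < 0 -> [/\ continuous g, forall y, 0 <= g y, 0 < g x & mu g <= 0].
    by move=> h; have [gx hg] := choice h; exists gx.
  move=> x; have [xs|nxs] := pselect (supp mu x).
    by exists (fun=> 0); rewrite (ps _ xs) ltxx.
  have [g hg] : exists g : X -> R, ~ (continuous g -> (forall y, 0 <= g y) -> 0 < g x -> 0 < mu g).
    by apply: contrapT => h; apply: nxs => g; apply: contrapT => hg; apply: h; exists g.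
  exists g => _; split; first by apply: contrapT => h; apply: hg => /h.
  - by apply: contrapT => h; apply: hg => _ /h.
  - by apply: contrapT => h; apply: hg => _ _ /h.
  - by rewrite leNgt; apply/negP => h; apply: hg.
pose PX := isPointed.Build X x0; pose XP : ptopologicalType := HB.pack X PX.
pose Ox y : set X := if p y < 0 then [set x | 0 < gx y x] else [set x | - p x < e].
have : @compact XP setT by exact: (gk_compact K).
rewrite compact_cover => /(_ X setT Ox); case.
- move=> y _; rewrite /Ox; case: ifP => py.
    have [cg _ _ _] := hgx y py; have -> : [set x | 0 < gx y x] = gx y @^-1` [set z | 0 < z] by [].
    by apply: open_comp; [move=> ? _; exact: cg|exact: open_gt].
  have -> : [set x | - p x < e] = (fun x => - p x) @^-1` [set z | z < e] by [].
  by apply: open_comp; [move=> ? _; exact: cnp|exact: open_lt].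
- move=> x _; exists x => //; rewrite /Ox; case: ifP => px /=; first by have [] := hgx x px.
  by apply: (le_lt_trans _ e0); rewrite oppr_le0 leNgt px.
move=> D' _ cov; pose l := finmap.enum_fset D'.
pose G x := \sum_(y <- l | p y < 0) gx y x.
have hG (l' : seq X) : [/\ continuous (fun x => \sum_(y <- l' | p y < 0) gx y x),
    forall x, 0 <= \sum_(y <- l' | p y < 0) gx y x &
    mu (fun x => \sum_(y <- l' | p y < 0) gx y x) <= 0].
  elim: l' => [|y l' [c1 c2 c3]].
    have -> : (fun x : X => \sum_(y <- [::] | p y < 0) gx y x) = fun=> 0.
      by apply/funext => x; rewrite big_nil.
    by split; [exact: cont_cst|move=> x; rewrite big_nil|rewrite (lin0 qm.1)].
  have -> : (fun x => \sum_(z <- y :: l' | p z < 0) gx z x) =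
     if p y < 0 then fun x => gx y x + \sum_(z <- l' | p z < 0) gx z x
     else fun x => \sum_(z <- l' | p z < 0) gx z x.
    by apply/funext => x; rewrite big_cons; case: ifP.
  case: ifP => py; last by split => // x; rewrite big_cons py.
  have [cg g0 _ mg] := hgx y py; split; first exact: cont_add.
    by move=> x; rewrite big_cons py addr_ge0.
  rewrite (linD qm.1)//; move: mg c3; lra.
have [cG G0 mG] := hG l.
have cov' x : - p x < e \/ 0 < G x.
  have [y /= yD] := cov x I; rewrite /Ox; case: ifP => py /= h; last by left.
  right; rewrite /G big_mkcond.
  have yl : y \in l by [].
  apply: (lt_le_trans h); rewrite -big_mkcond.
  rewrite (perm_big _ (perm_to_rem yl)) big_cons py lerDl.
  by apply: sumr_ge0 => z pz; have [_ + _ _] := hgx z pz; exact.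
(* The denominator is positive by the covering and equals [G x] where [- p x > e]. Its bound [M]
   therefore yields [- p <= M G + e], with [G] of nonpositive integral. *)
have [|M [M0 hM]] := cont_bdd K (f := fun x => - p x / (G x + Num.max 0 (e + p x))).
  apply: cont_mul => //; apply: cont_inv.
    move=> x; case: (cov' x) => h; last by rewrite ltr_wpDr// le_max lexx.
    apply: (ltr_wpDl (G0 x)).
    by rewrite lt_max; apply/orP; right; move: h; lra.
  apply: cont_add => //; apply: cont_max; first exact: cont_cst.
  by apply: cont_add => //; exact: cont_cst.
have key x : - p x <= M * G x + e.
  have [px|px] := lerP (- p x) e.
    by apply: (le_trans px); rewrite lerDr; apply: mulr_ge0 => //; exact: G0.
  have E : Num.max 0 (e + p x) = 0 by apply/max_idPl; move: px; lra.
  have Gx : 0 < G x by case: (cov' x) => //; move: px; lra.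
  have := hM x; rewrite E addr0 => /(le_trans (ler_norm _)); rewrite ler_pdivrMr//.
  move=> h; apply: (le_trans h); rewrite lerDl; exact: ltW.
have : mu (fun x => - p x) <= mu (fun x => M * G x + (fun=> e) x).
  apply: (posfun_mono qm) => //.
  by apply: cont_add; [apply: cont_mul => //; exact: cont_cst|exact: cont_cst].
move=> /le_trans; apply; rewrite (linD qm.1); [|by apply: cont_mul => //; exact: cont_cst|exact: cont_cst].
rewrite (linZ qm.1)// (lin_cst qm.1) m1 mulr1 gerDr.
by rewrite mulr_ge0_le0.
Qed.

End Support.

Lemma is_derive_seq {R : realType} (F : R -> R) (t l : R) (r_ : nat -> R) :
  is_derive t 1 F l -> r_ @ ultraN --> t -> (forall n, r_ n != t) ->
  (fun n => (r_ n - t)^-1 * (F (r_ n) - F t)) @ ultraN --> l.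
Proof.
move=> [dF <-] rt rn.
have : (fun h => h^-1 *: (F (h *: 1 + t) - F t)) @ 0^' --> 'D_1 F t.
  by apply: cvg_trans dF => //; rewrite /derive; apply: cvg_trans.
move=> /cvgrPdist_le hD; apply/ultraP => e e0; have [d /= d0 hd] := hD e e0.
have /ultraP/(_ (d / 2)) := rt; rewrite divr_gt0// => /(_ isT); apply: filterS => n hn.
have := hd (r_ n - t); rewrite /ball_/= sub0r normrN.
have dd : `|r_ n - t| < d by apply: (le_lt_trans hn); move: d0; lra.
move=> /(_ dd); rewrite subr_eq0 => /(_ (rn n)).
have -> : (r_ n - t)%:A + t = r_ n by rewrite -[X in X + t]/((r_ n - t) * 1) mulr1 subrK.
by rewrite distrC.
Qed.

(** * The slope of a Sinkhorn potential flow *)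

Section PotentialFlow.
Context {R : realType} {X : pseudoMetricType R} {K : @pdkernel R X}.
Variables (eps : R) (c : X -> X -> R) (e0 : 0 < eps) (KE : ker K = k_c eps c).
Local Notation k := (ker K).
Local Notation H := (Hop k).
Local Notation dot := (kdot k).
Local Notation kN := (dual_sqnorm (K := K)).
Local Notation knm := (dual_norm (K := K)).
Local Notation Kk := (markov_op (K := K)).
Local Notation m0 := (m0 (K := K)).
Variables (V : X -> R) (cV : continuous V).
Let U x := 2 / eps * V x.
Local Notation Aop := (skew_op (K := K) U).

Let cU : continuous U. Proof. by apply: cont_mul => //; exact: cont_cst. Qed.

Variables (mu : R -> (X -> R) -> R).
Hypothesis mup : forall t, 0 <= t -> is_prob (mu t).
Let a t := lift eps c (mu t).
Let b t := Bemb eps c (mu t).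

Let pa t : 0 <= t -> posfun setT (a t).
Proof. by move=> t0; have [] := lift_facts e0 KE (mup t0). Qed.
Let Ha t : 0 <= t -> H (a t) = b t.
Proof. by move=> t0; have [] := lift_facts e0 KE (mup t0). Qed.
Let Na t : 0 <= t -> kN (a t) = 1.
Proof. by move=> t0; have [] := lift_facts e0 KE (mup t0). Qed.
Let ba t : 0 <= t -> bdf m0 (a t).
Proof.
move=> t0; have := mass_le (K := K) (pa t0); rewrite -/(kN _) Na// => h.
exact: bdf_le h (posfun_bdf (pa t0)).
Qed.
Let m00 : 0 <= m0. Proof. exact: m0_ge0. Qed.

(** By contradiction: times violating the slope accumulate at [t], and the quotients of the path
    along them have a weak limit [w]. The velocity [sg] is known only through test functions, so [w]
    is computed from the flow equation; it equals [- A b - b p'] with [p' = 2 p / eps], which is at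
    least [- A b]. *)
Lemma spf_slope t L d sg p (C e : R) (y : X) : 0 < t -> 0 <= L -> 0 < d ->
  (forall r, t <= r -> r <= t + d -> knm (subf (a r) (a t)) <= L * (r - t)) ->
  is_velocity eps c mu t sg -> pressures (mu t) p ->
  (forall y, eps / 2 * inv_IdK2 eps c (mu t) (Hop (k_mu eps c (mu t)) sg) y + V y + p y = C) ->
  0 < e -> exists2 d' : R, 0 < d' & forall r, t <= r -> r <= t + d' ->
    H (a r) y - H (a t) y >= (r - t) * (- Aop (a t) y - e).
Proof.
move=> t0 L0 d0 hL [_ vel] pr eqp ep0; have tl := ltW t0.
have [cb b0 _] := Bemb_spec e0 KE (mup tl); rewrite -/(b t) in cb b0.
apply: contrapT => nh.
have : forall n : nat, exists r, [/\ t < r, r <= t + n.+1%:R^-1, r <= t + d &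
    H (a r) y - H (a t) y < (r - t) * (- Aop (a t) y - e)].
  move=> n; apply: contrapT => nr; apply: nh; exists (Num.min d n.+1%:R^-1).
    by rewrite lt_min d0 invr_gt0 ltr0n.
  move=> r tr; rewrite -lerBlDl le_min !lerBlDl => /andP[rd rn].
  have [->|rt] := eqVneq r t; first by rewrite !subrr mul0r.
  rewrite leNgt; apply/negP => h; apply: nr; exists r; split => //.
  by rewrite lt_neqAle eq_sym rt.
move=> /choose_seq [r_ hr].
have rt n : t < r_ n by have [] := hr n.
have r0 n : 0 <= r_ n by apply: ltW; exact: lt_trans t0 (rt n).
have rp n : 0 < r_ n - t by rewrite subr_gt0.
have rc : (fun n => r_ n - t) @ ultraN --> (0 : R).
  apply: (ultra_squeeze (@cvg_ultraN_harmonic R)); apply: nearW => n.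
  by rewrite subr0 gtr0_norm// lerBlDl; have [] := hr n.
have rcvg : r_ @ ultraN --> t.
  rewrite -[t]add0r (_ : r_ = fun n => (r_ n - t) + t); last by apply/funext => n; rewrite subrK.
  by apply: cvgD => //; exact: cvg_cst.
pose q n : (X -> R) -> R := fun f => (r_ n - t)^-1 * subf (a (r_ n)) (a t) f.
have bs n : bdf (m0 + m0) (subf (a (r_ n)) (a t)) by apply: bdf_subf; exact: ba.
have knb n : knm (subf (a (r_ n)) (a t)) <= L * (r_ n - t).
  by apply: hL; [exact: ltW|have [] := hr n].
have bq n : bdf (`|(r_ n - t)^-1| * (m0 + m0) + `|0 : R| * m0) (q n).
  have -> : q n = fun f => (r_ n - t)^-1 * subf (a (r_ n)) (a t) f + 0 * a t f.
    by apply/funext => f; rewrite mul0r addr0.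
  exact: (bdf_comb _ _ (bs n) (ba tl)).
have m2 : 0 <= m0 + m0 by rewrite addr_ge0.
have kq n : kN (q n) <= L ^+ 2.
  have -> : kN (q n) = (r_ n - t)^-2 * kN (subf (a (r_ n)) (a t)).
    rewrite /dual_sqnorm /kdot {1}/q.
    have -> : H (q n) = fun x => (r_ n - t)^-1 * H (subf (a (r_ n)) (a t)) x by [].
    rewrite (linZ (bs n).1); last exact: (cont_H (bs n)).
    by rewrite mulrA; congr (_ * _); rewrite -invfM -expr2.
  rewrite mulrC ler_pdivrMr ?exprn_gt0// -exprMn.
  by apply: (knm_le m2 (bs n)) => //; rewrite mulr_ge0// ltW.
have hq : \forall n \near ultraN, (exists2 M, 0 <= M & bdf M (q n)) /\ kN (q n) <= L ^+ 2.
  by apply: nearW => n; split => //; eexists; last exact: bq; rewrite addr_ge0// mulr_ge0.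
have [hw cw uw] := weak_limit (sqr_ge0 L) hq.
set w := fun x => _ in hw cw uw; have ctw := hb_cont hw.
have aw f : continuous f -> a (r_ n) f @[n --> ultraN] --> a t f.
  move=> cf; apply/ultraP => e1 e10; have [d1 d10 hd1] := weak_modulus (K := K) m2 cf e10.
  have /ultraP/(_ (d1 / (L + 1))) := rc; rewrite divr_gt0// ?ltr_wpDl// => /(_ isT).
  apply: filterS => n; rewrite subr0 gtr0_norm// => hn.
  apply: (hd1 _ (bs n)); apply: (le_trans (knb n)).
  apply: (@le_trans _ _ (L * (d1 / (L + 1)))); first exact: ler_wpM2l.
  by rewrite mulrCA ler_piMr ?(ltW d10)// ler_pdivrMr ?mul1r ?lerDl// ltr_wpDl.
have cHq n : continuous (H (q n)) by exact: (cont_H (bq n)).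
have atw : a t w = 0.
  have cb2 : bdf m0 (a t) by exact: ba.
  have c1 : a t (H (q n)) @[n --> ultraN] --> a t w.
    apply: (ultra_joint m00 (nearW _ (fun=> cb2)) (t := a t)) => //; first exact: cvg_cst.
    by apply: nearW => n; exact: cHq.
  apply: (ultra_eq c1).
  have c2 : (fun n => L ^+ 2 / 2 * (r_ n - t)) @ ultraN --> (0 : R).
    by rewrite -[0](mulr0 (L ^+ 2 / 2)); exact: cvgMr.
  apply: (ultra_squeeze c2); apply: nearW => n; rewrite subr0.
  have E1 : a t (H (q n)) = (r_ n - t)^-1 * (dot (a t) (a (r_ n)) - 1).
    have -> : H (q n) = fun x => (r_ n - t)^-1 * H (subf (a (r_ n)) (a t)) x by [].
    rewrite (linZ cb2.1); last exact: (cont_H (bs n)).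
    congr (_ * _); have := dot_subr cb2.1 (ba (r0 n)) cb2; rewrite /kdot => ->.
    by rewrite -(Na tl).
  have E2 : kN (subf (a (r_ n)) (a t)) = 2 - 2 * dot (a t) (a (r_ n)).
    rewrite (kN_subf m00 m00 (ba (r0 n)) cb2) !Na//.
    by rewrite (dot_sym m00 m00 (ba (r0 n)) cb2); ring.
  have n1 := kN_ge0 m2 (bs n).
  have n2 : kN (subf (a (r_ n)) (a t)) <= (L * (r_ n - t)) ^+ 2.
    by apply: (knm_le m2 (bs n)) => //; rewrite mulr_ge0// ltW.
  have -> : a t (H (q n)) = - ((r_ n - t)^-1 * (kN (subf (a (r_ n)) (a t)) / 2)).
    by rewrite E1 E2; field; rewrite gt_eqF.
  rewrite normrN ger0_norm; last by rewrite mulr_ge0 ?invr_ge0 ?(ltW (rp n))// divr_ge0.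
  rewrite mulrC ler_pdivrMr//; apply: (@le_trans _ _ ((L * (r_ n - t)) ^+ 2 / 2)).
    by rewrite ler_pM2r.
  by rewrite exprMn -subr_ge0 (_ : _ - _ = 0)//; field.
have pat := pa tl.
have bt0 x : b t x != 0 by rewrite gt_eqF.
pose beta x := (b t x)^-1 * w x.
have cbeta : continuous beta by apply: cont_mul => //; exact: cont_inv.
pose g := Hop (k_mu eps c (mu t)) sg.
(* Product rule for [mu = b a] tested on [k_mu(., z)]: the variation of [b] contributes [K beta],
   and that of [a], tested on [k(., z) / b z], contributes [w z / b z]. *)
have gE z : g z = beta z + Kk (a t) beta z.
  pose phi x := k_mu eps c (mu t) x z.
  have phiE x : phi x = (b t x)^-1 * k x z * (b t z)^-1 by rewrite /phi (k_muE e0 KE)//; exact: mup.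
  have ckz : continuous (fun x => k x z) by exact: cont_kl.
  have cphi : continuous phi.
    rewrite (_ : phi = fun x => (b t x)^-1 * k x z * (fun=> (b t z)^-1) x); last by apply/funext.
    by apply: cont_mul; [apply: cont_mul => //; exact: cont_inv|exact: cont_cst].
  have bphi x : b t x * phi x = (b t z)^-1 * k x z by rewrite phiE; field; rewrite !bt0.
  have rphi : in_rkhs (k_mu eps c (mu t)) phi.
    rewrite /in_rkhs (rkhs_mu e0 KE phi (mup tl)) -/(b t).
    have bz : bdf 1 (fun f : X -> R => f z) by apply: posfun_bdf (posfun_dirac (Y := setT) I).
    have bz' : bdf (`|(b t z)^-1| * 1 + `|0 : R| * 1) (fun f : X -> R => (b t z)^-1 * f z + 0 * f z) by exact: (bdf_comb _ _ bz bz).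
    have Ez : (fun x => b t x * phi x) = H (fun f : X -> R => (b t z)^-1 * f z + 0 * f z).
      by apply/funext => x; rewrite bphi /Hop mul0r addr0 (gk_sym K).
    have M0 : 0 <= `|(b t z)^-1| * 1 + `|0 : R| * 1 by rewrite addr_ge0// mulr_ge0.
    by rewrite Ez; exact: (hb_hnorm (hb_H (K := K) M0 bz')).1.
  have c1 := is_derive_seq (vel phi rphi) rcvg (fun n => negbT (gt_eqF (rt n))).
  have qE n : (r_ n - t)^-1 * (mu (r_ n) phi - mu t phi) = a (r_ n) (fun x => H (q n) x * phi x) + (b t z)^-1 * H (q n) z.
    have E1 : mu (r_ n) phi = a (r_ n) (fun x => (r_ n - t) * (H (q n) x * phi x) + b t x * phi x).
      rewrite (lift_wt e0 KE phi (mup (r0 n))) -/(a _) -/(b _); congr a; apply/funext => x.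
      have -> : H (q n) x = (r_ n - t)^-1 * (b (r_ n) x - b t x) by rewrite -(Ha (r0 n)) -(Ha tl).
      by field; rewrite gt_eqF.
    have cHp : continuous (fun x => H (q n) x * phi x) by exact: cont_mul.
    have cbp : continuous (fun x => b t x * phi x) by exact: cont_mul.
    have br := ba (r0 n).
    rewrite E1 (linD br.1)//; last by apply: cont_mul => //; exact: cont_cst.
    rewrite (linZ br.1)// (lift_wt e0 KE phi (mup tl)) -/(a _) -/(b _).
    have E2 (s : (X -> R) -> R) : linC s -> s (fun x => b t x * phi x) = (b t z)^-1 * H s z.
      move=> ls; rewrite -(linZ ls)//; congr s; apply/funext => x; exact: bphi.
    rewrite (E2 _ br.1) (E2 _ (ba tl).1).
    have -> : H (q n) z = (r_ n - t)^-1 * (H (a (r_ n)) z - H (a t) z) by [].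
    by field; rewrite bt0 gt_eqF.
  have c2 : (r_ n - t)^-1 * (mu (r_ n) phi - mu t phi) @[n --> ultraN] -->
      a t (fun x => w x * phi x) + (b t z)^-1 * w z.
    under eq_fun do rewrite qE; apply: cvgD; last by apply: cvgMr; exact: cw.
    have cwp : continuous (fun x => w x * phi x) by exact: cont_mul.
    apply: (ultra_joint m00 (nearW _ (fun n => ba (r0 n))) (t := a t)) => //.
    - exact: aw.
    - by apply: nearW => n; exact: cont_mul.
    - move=> e1 e10; have [P [P0 hP]] := cont_bdd K cphi.
      have P1 : 0 < P + 1 by rewrite ltr_wpDl.
      have e2 : 0 < e1 / (P + 1) by rewrite divr_gt0.
      apply: filterS (uw _ e2) => n hn x; rewrite -mulrBl normrM.
      apply: (@le_trans _ _ (e1 / (P + 1) * P)); first by apply: ler_pM.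
      by rewrite mulrAC -mulrA ler_piMr ?(ltW e10)// ler_pdivrMr// mul1r lerDl.
  rewrite /g /Hop -/phi (ultra_eq c1 c2) addrC; congr (_ + _).
  rewrite /markov_op Ha// /Hop /wt -(linZ (ba tl).1); last by apply: cont_mul.
  by congr (a t _); apply/funext => x; rewrite phiE /beta; ring.
have Hpos x : 0 < H (a t) x by rewrite Ha.
have cg : continuous g.
  by rewrite (_ : g = fun z => beta z + Kk (a t) beta z); [apply: cont_add => //; apply: Kk_cont|apply/funext].
have [cpsi [Cp hpsi]] := inv_IdK2_spec e0 KE (mup tl) cg.
move: eqp cpsi hpsi; rewrite -/g -/(a t); set psi := inv_IdK2 _ _ _ _ => eqp cpsi hpsi.
have cKpsi : continuous (Kk (a t) psi) by exact: Kk_cont.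
pose gam x := psi x - Kk (a t) psi x.
have cgam : continuous gam by apply: cont_add => //; exact: cont_opp.
have [x0 _] := a_nonempty ((is_probP _).1 (mup tl)).1 ((is_probP _).1 (mup tl)).2.
(* [Id + K] is injective and maps the constant [Cp / 2] to [Cp], so it can be cancelled in [(Id +
   K)(Id - K) psi = (Id + K) beta + Cp]. *)
have bE x : beta x = gam x - Cp / 2.
  have cst : continuous (fun _ : X => Cp / 2) by exact: cont_cst.
  have cgc : continuous (fun x => gam x - (fun=> Cp / 2) x) by apply: cont_add => //; exact: cont_opp.
  have cd : continuous (fun x => beta x - (gam x - (fun=> Cp / 2) x)) by apply: cont_add => //; exact: cont_opp.
  suff : beta x - (gam x - Cp / 2) = 0 by lra.
  apply: (Kk_inj pat x0 Hpos cd) => z.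
  rewrite (Kk_sub pat z cbeta cgc) (Kk_sub pat z cgam cst) (Kk_cst pat Hpos).
  rewrite (Kk_sub pat z cpsi cKpsi).
  by have := hpsi z; rewrite gE /gam; lra.
have cHpsi : continuous (H (wt psi (a t))) by exact: cont_Hwt.
have bK x : b t x * Kk (a t) psi x = H (wt psi (a t)) x by rewrite /markov_op Ha// mulVKf.
have wE x : w x = b t x * psi x - H (wt psi (a t)) x - b t x * (Cp / 2).
  have : b t x * beta x = w x by rewrite /beta mulVKf.
  by rewrite bE /gam -bK => <-; ring.
have ab : a t (b t) = 1 by rewrite -[RHS](Na tl) -(Ha tl).
(* Integration against [a]: [a w = 0] because the path lies on the sphere, and the two terms in
   [psi] cancel by symmetry of the kernel. *)
have Cp0 : Cp = 0.
  have cbpsi : continuous (fun x => b t x * psi x) by exact: cont_mul.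
  have E : a t (H (wt psi (a t))) = a t (fun x => b t x * psi x).
    have c1 : continuous (fun _ : X => 1 : R) by exact: cont_cst.
    have F := kernel_fubini m00 m00 (ba tl) (ba tl) cpsi c1.
    have {1}-> : H (wt psi (a t)) = fun x => 1 * H (wt psi (a t)) x by apply/funext => x; rewrite mul1r.
    rewrite F; congr (a t _); apply/funext => x; rewrite -(Ha tl) mulrC; congr (_ * _).
    by rewrite /Hop /wt; congr (a t _); apply/funext => u; rewrite mul1r.
  move: atw; rewrite (_ : w = fun x => (b t x * psi x - H (wt psi (a t)) x) - b t x * (Cp / 2)); last by apply/funext.
  have lt := (ba tl).1.
  rewrite (linB lt); [|by apply: cont_add => //; exact: cont_opp|by apply: cont_mul => //; exact: cont_cst].
  by rewrite (linB lt)// (linZr lt)// ab E; lra.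
have wA x : - Aop (a t) x <= w x.
  pose p' x := 2 / eps * p x.
  have [cp [p0 _]] := pr.
  have cp' : continuous p' by apply: cont_mul => //; exact: cont_cst.
  have en : eps != 0 by rewrite gt_eqF.
  have psiE u : psi u = 2 / eps * C - U u - p' u.
    by rewrite /U /p' -(eqp u); field.
  (* The pressure is null for [mu], hence for [a]; only the pointwise term [- b p'] is left in [w],
     and it is nonnegative. *)
  have Hp : H (wt p' (a t)) x = 0.
    have ck : continuous (fun z => k z x) by exact: cont_kl.
    have cf : continuous (fun z => 2 / eps * ((b t z)^-1 * k z x)).
      by apply: cont_mul; [exact: cont_cst|apply: cont_mul => //; exact: cont_inv].
    have := pressure_null (K := K) (mup tl) pr cf.
    rewrite /Hop /wt /a /lift /wt -/(b t) => h; rewrite -[RHS]h; congr (mu t _).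
    by apply/funext => z; rewrite /p'; ring.
  have HE : H (wt psi (a t)) x = 2 / eps * C * b t x - H (wt U (a t)) x.
    have cC : continuous (fun _ : X => 2 / eps * C) by exact: cont_cst.
    have cCU : continuous (fun u => (fun=> 2 / eps * C) u - U u) by apply: cont_add => //; exact: cont_opp.
    rewrite (_ : psi = fun u => ((fun=> 2 / eps * C) u - U u) - p' u); last by apply/funext.
    rewrite (HwtB (pa tl))// (HwtB (pa tl))// Hp subr0; congr (_ - _).
    by rewrite /Hop /wt (linZ (ba tl).1) -?(Ha tl)//; exact: cont_kl.
  rewrite wE Cp0 HE psiE /skew_op Ha//.
  have : 0 <= - (b t x * p' x).
    by rewrite -mulrN mulr_ge0 ?(ltW (b0 x))// oppr_ge0 /p' pmulr_rle0// divr_gt0.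
  lra.
suff : w y <= - Aop (a t) y - e by have := wA y; move: ep0; lra.
apply: (ultra_lec (cw y)); apply: nearW => n; have [_ _ _ h] := hr n.
have -> : H (q n) y = (r_ n - t)^-1 * (H (a (r_ n)) y - H (a t) y) by [].
by rewrite ler_pdivrMl// ltW.
Qed.

(** The almost everywhere right slopes are integrated by [ae_growth], the bound on the metric
    derivative supplying absolute continuity. Freezing [A] at the initial time of a short interval
    costs [e] by the modulus of [A]. *)
Theorem SPF_flow mu0 : SPF eps c V mu0 mu -> flow (K := K) U setT a.
Proof.
move=> [[_ [_ [m [mm [m0' [fin hm]]]]]] _ [N2 [mN2 [N20 hN2]]]].
have m2 : 0 <= m0 + m0 by rewrite addr_ge0.
have bs s t : 0 <= s -> 0 <= t -> bdf (m0 + m0) (subf (a t) (a s)).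
  by move=> s0 t0; apply: bdf_subf; exact: ba.
have nE s t : 0 <= s -> 0 <= t -> hnorm (k_c eps c) (fun x => b t x - b s x) = knm (subf (a t) (a s)).
  move=> s0 t0; rewrite -KE -Ha// -Ha//.
  exact: (hnorm_H m2 (bs s t s0 t0)).
have hf T : exists f, [/\ (@lebesgue_measure R).-integrable setT (EFin \o f), forall x, 0 <= f x &
    forall s t, 0 <= s -> s <= t -> t <= T ->
      knm (subf (a t) (a s)) <= \int[@lebesgue_measure R]_(x in `]s, t]) f x].
  have T0 : 0 <= Num.max 0 T by rewrite le_max lexx.
  have [f [intf f0 hf]] := L2_integrable mm m0' (fin _ T0).
  exists f; split => // s t s0 st tT; have t0 := le_trans s0 st.
  rewrite -(nE _ _ s0 t0) -lee_fin -hf//; first exact: hm.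
  by rewrite le_max tT orbT.
have cont T e : 0 < e -> exists2 d : R, 0 < d & forall s t,
    0 <= s -> s <= t -> t <= T -> t <= s + d -> kN (subf (a t) (a s)) <= e.
  move=> ep; have [f [intf f0 kf]] := hf T.
  have es : 0 < Num.sqrt e by rewrite sqrtr_gt0.
  have [d d0 hd] := integral_small intf f0 es; exists d => // s t s0 st tT td.
  have t0 := le_trans s0 st; rewrite -[e]sqr_sqrtr; last exact: ltW.
  apply: (knm_le m2 (bs s t s0 t0)); first exact: ltW.
  exact: (le_trans (kf s t s0 st tT) (hd s t st td)).
split => // T e ep.
have [f [intf f0 kf]] := hf T.
have [N1 [mN1 N10 hN1]] := ae_right_lip intf.
have [d2 d20 hd2] := Aop_modulus (K := K) cU m2 ep.
have [d d0 hd] := cont T d2 d20.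
(* 0 joins the exceptional set since the flow equation concerns positive times. *)
pose N := (N1 `|` N2) `|` [set (0 : R)].
have mN : measurable N by apply: measurableU => //; exact: measurableU.
have N0 : lebesgue_measure N = 0%E.
  apply: null_set_setU => //; first exact: measurableU.
    exact: null_set_setU.
  exact: lebesgue_measure_set1.
exists d => // s t y s0 st tT td _.
suff : H (a t) y - H (a s) y >= (t - s) * (- (Aop (a s) y + e)) by rewrite mulrN mulNr.
apply: (ae_growth (F := fun r => H (a r) y) st mN N0 intf f0).
- move=> u r su ur rt; have u0 := le_trans s0 su; have r0 := le_trans u0 ur.
  apply: le_trans (kf u r u0 ur (le_trans rt tT)); rewrite -H_subf.
  exact: (hb_sup y (hb_H m2 (bs u r u0 r0))).
- move=> r sr rt nN e1 e10; have r0 := le_trans s0 sr.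
  have rp : 0 < r.
    by rewrite lt_neqAle r0 andbT; apply/eqP => r0'; apply: nN; right; rewrite -r0'.
  have [L [d1 [L0 d10 hd1]]] := hN1 r (fun h => nN (or_introl (or_introl h))).
  have [sg [vel [p [pr [C eqp]]]]] := hN2 r rp (fun h => nN (or_introl (or_intror h))).
  have dp : 0 < Num.min d1 (t - r) by rewrite lt_min d10 subr_gt0.
  have hL u : r <= u -> u <= r + Num.min d1 (t - r) -> knm (subf (a u) (a r)) <= L * (u - r).
    move=> ru; rewrite -lerBlDl le_min !lerBlDl => /andP[ud ut].
    apply: le_trans (hd1 u ru ud); apply: kf => //; apply: le_trans tT; move: ut; lra.
  have [d' d'0 hd'] := spf_slope y rp L0 dp hL vel pr eqp e10.
  exists d' => // u ru ut ud; apply: le_trans (hd' u ru ud).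
  apply: ler_wpM2l; first by rewrite subr_ge0.
  have := hd2 _ (bs s r s0 r0) (hd s r s0 sr (ltW (lt_le_trans rt tT)) _) y.
  have rd : r <= s + d by apply: le_trans td; exact: ltW.
  by move=> /(_ rd); rewrite Aop_subf ler_norml => /andP[_ h]; move: h; lra.
Qed.

End PotentialFlow.

(** * From supersolutions to Sinkhorn potential flows *)

Section HalfSpeed.
Context {R : realType}.
Local Notation leb := (@lebesgue_measure R).
Variables (phi E : R -> R) (G : R).
Hypothesis p0 : forall t, 0 < t -> 0 <= phi t.
Hypothesis pm : forall s t, 0 < s -> s <= t -> phi t <= phi s.

(* The delay [r / 2] lets the dissipation on [[r / 4, r / 2]] control the value at
   [r]; dyadic summation then gives square integrability up to time [0]. *)
Definition half_speed (r : R) : R := if 0 < r then phi (r / 2) else 0.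

Lemma half_speed_ge0 r : 0 <= half_speed r.
Proof. by rewrite /half_speed; case: ifP => // r0; apply: p0; rewrite divr_gt0. Qed.

Lemma half_speed_measurable : measurable_fun setT half_speed.
Proof.
move=> mT; apply: (measurability (@RGenCInfty.G R)) mT => [|/= _ [_] [r] -> <-].
  exact: RGenCInfty.measurableE.
rewrite setTI; have [r0|r0] := leP r 0.
  rewrite (_ : _ @^-1` _ = setT)//; apply/seteqP; split => // x _ /=.
  by rewrite in_itv/= andbT (le_trans r0)// half_speed_ge0.
apply: is_interval_measurable => s t /=; rewrite !in_itv/= !andbT => hs ht u /andP[su ut].
have s0 : 0 < s by move: hs; rewrite /half_speed; case: ifP => //; rewrite leNgt r0.
have u0 := lt_le_trans s0 su; have t0 := lt_le_trans u0 ut.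
rewrite in_itv/= andbT; apply: (le_trans ht); rewrite /half_speed u0 t0; apply: pm.
  by rewrite divr_gt0.
by rewrite ler_pM2r// invr_gt0.
Qed.

Let mms (D : set R) : measurable_fun D (fun r => ((half_speed r) ^+ 2)%:E).
Proof.
apply/measurable_EFinP; apply: measurable_funX; apply: measurable_funTS.
exact: half_speed_measurable.
Qed.

Lemma half_speed_ge s r x : 0 < s -> r <= 2 * s -> x <= r -> 0 < x -> phi s <= half_speed x.
Proof.
move=> s0 rs xr x0; rewrite /half_speed x0; apply: pm; first by rewrite divr_gt0.
by rewrite ler_pdivrMr//; lra.
Qed.

Hypothesis dissip : forall s t, 0 < s -> s <= t -> (t - s) * phi t ^+ 2 <= E s - E t.
Hypothesis EG : forall t, 0 <= t -> `|E t| <= G.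

Lemma half_speed_L2 T : (\int[leb]_(r in `[0%R, T]) ((half_speed r) ^+ 2)%:E < +oo)%E.
Proof.
have mI (u v : R) : measurable (`]u, v] : set R) by exact: measurable_itv.
have sq0 r : (0 <= ((half_speed r) ^+ 2)%:E)%E by rewrite lee_fin sqr_ge0.
wlog T0 : T / 0 < T => [h|].
  have T1 : 0 < Num.max 1 T by rewrite lt_max ltr01.
  apply: le_lt_trans (h _ T1); apply: ge0_subset_integral => //; first exact: mms.
  by move=> x /=; rewrite !in_itv/= => /andP[-> h1]; rewrite le_max h1 orbT.
rewrite -integral_itv_obnd_cbnd; last exact: mms.
pose J n := T / 2 ^+ n.
have J0 n : 0 < J n by rewrite divr_gt0// exprn_gt0.
have JS n : J n = 2 * J n.+1 by rewrite /J exprS; field; rewrite expf_neq0.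
have JSl n : J n.+1 <= J n by rewrite (JS n); have := J0 n.+1; lra.
(* On []J n.+1, J n]] the half speed is at most [phi (J n.+2)], and the dissipation on
   [[J n.+3, J n.+2]], an interval one quarter as long, bounds the square of the latter. The sum
   telescopes to a bound independent of [n]. *)
have key n : (\int[leb]_(r in `]J n, T]) ((half_speed r) ^+ 2)%:E <= (4 * (E (J n.+2) - E (J 2)))%:E)%E.
  elim: n => [|n IH].
    by rewrite /J expr0 divr1 set_itvoc0 integral_set0 subrr mulr0.
  have JT : J n <= T by rewrite /J ler_pdivrMr ?exprn_gt0// ler_peMr ?(ltW T0)// exprn_ege1// ler1n.
  have -> : `]J n.+1, T]%classic = `]J n.+1, J n] `|` `]J n, T].
    apply/seteqP; split => x /=; rewrite !in_itv/=.
      by move=> /andP[h1 h2]; case: (leP x (J n)) => h3; [left; rewrite h1|right; rewrite h2].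
    move=> [/andP[h1 h2]|/andP[h1 h2]]; apply/andP; split => //; first exact: le_trans h2 JT.
    exact: le_lt_trans (JSl n) h1.
  rewrite ge0_integral_setU//; last 2 first.
  - exact: mms.
  - apply/disj_setPS => x [] /=; rewrite !in_itv/= => /andP[_ h1] /andP[h2 _]; lra.
  apply: (@le_trans _ _ ((4 * (E (J n.+3) - E (J n.+2)))%:E + (4 * (E (J n.+2) - E (J 2)))%:E)%E); last first.
    by rewrite -EFinD lee_fin; lra.
  apply: leeD => //.
  apply: (@le_trans _ _ (\int[leb]_(r in `]J n.+1, J n]) ((phi (J n.+2)) ^+ 2)%:E)%E).
    apply: ge0_le_integral => //; first exact: mms.
    move=> r; rewrite /= in_itv/= => /andP[r1 r2]; have r0 := lt_trans (J0 n.+1) r1.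
    rewrite lee_fin ler_pXn2r ?nnegrE ?half_speed_ge0//; last exact: p0.
    rewrite /half_speed r0; apply: pm => //; rewrite ler_pdivlMr//.
    by move: r1; rewrite (JS n.+1); lra.
  rewrite integral_cst//= lebesgue_measure_itv/= lte_fin (JS n).
  case: ifPn => [_|/negP[]]; last by have := J0 n.+1; lra.
  rewrite -EFinB -EFinM lee_fin.
  have := dissip (J0 n.+3) (JSl n.+2); rewrite (JS n.+1) (JS n.+2).
  by move: (phi _ ^+ 2) => q; lra.
have cv : (\int[leb]_(r in `]J n, T]) ((half_speed r) ^+ 2)%:E @[n --> \oo] -->
    \int[leb]_(r in \bigcup_n `]J n, T]%classic) ((half_speed r) ^+ 2)%:E)%E.
  apply: ge0_nondecreasing_set_cvg_integral => //; last by move=> n; exact: mms.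
  move=> n m nm; apply/subsetPset => x /=; rewrite !in_itv/= => /andP[h1 ->]; rewrite andbT.
  apply: le_lt_trans h1; rewrite /J ler_pM2l// lef_pV2 ?posrE ?exprn_gt0//.
  by rewrite ler_eXn2l// ltr1n.
have U : \bigcup_n `]J n, T]%classic = `]0, T]%classic.
  apply/seteqP; split => x /=.
    by move=> [n _] /=; rewrite !in_itv/= => /andP[h1 ->]; rewrite andbT; exact: lt_trans (J0 n) h1.
  rewrite in_itv/= => /andP[x0 xT].
  have c0 : (fun n => (2^-1 : R) ^+ n) @ \oo --> (0 : R).
    by apply: cvg_expr; rewrite ger0_norm// invf_lt1// ltr1n.
  have /cvgrPdist_lt/(_ (x / T)) := c0; rewrite divr_gt0// => /(_ isT)[n _ hn].
  exists n => //=; rewrite in_itv/= xT andbT.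
  have := hn n (leqnn n); rewrite /= sub0r normrN ger0_norm ?exprn_ge0// ltr_pdivlMr// exprVn.
  by rewrite mulrC.
rewrite U in cv; apply: (@le_lt_trans _ _ (8 * G)%:E); last exact: ltry.
apply: (cvge_to_le cv); apply: nearW => n; apply: (le_trans (key n)); rewrite lee_fin.
have := EG (ltW (J0 n.+2)); have := EG (ltW (J0 2)); rewrite !ler_norml => /andP[h1 h2] /andP[h3 h4].
lra.
Qed.

(* [D s r] stands for the distance between the points of a curve at times [s] and [r]. *)
Lemma half_speed_dist (D : R -> R -> R) s t :
  (forall r, 0 <= r -> D r r = 0) ->
  (forall s u r, 0 <= s -> 0 <= u -> 0 <= r -> D s r <= D s u + D u r) ->
  (forall s r, 0 < s -> s <= r -> D s r <= phi s * (r - s)) ->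
  (forall e, 0 < e -> exists2 d : R, 0 < d & forall r, 0 <= r -> r <= d -> D 0 r <= e) ->
  0 <= s -> s <= t -> ((D s t)%:E <= \int[leb]_(r in `[s%R, t%R]) (half_speed r)%:E)%E.
Proof.
move=> Drr Dtri Dphi Dc s0 st.
have t0 := le_trans s0 st.
have [f [intf f0 fE]] := L2_integrable half_speed_measurable half_speed_ge0 (half_speed_L2 t).
have intA (A : set R) : measurable A -> leb.-integrable A (EFin \o f).
  by move=> mA; apply: (integrableS _ _ _ intf).
have add u v w : u <= v -> v <= w -> \int[leb]_(x in `]u, w]) f x =
    \int[leb]_(x in `]u, v]) f x + \int[leb]_(x in `]v, w]) f x.
  move=> uv vw; rewrite -(@Rintegral_itvB _ _ (BRight u) (BRight w) v) ?bnd_simp//; first by ring.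
  by apply: intA; exact: measurable_itv.
have pos u v : 0 < u -> u <= v -> v <= t -> D u v <= \int[leb]_(x in `]u, v]) f x.
  move=> u0 uv vt; apply: (@step_ind _ u v (fun r => D u r <= \int[leb]_(x in `]u, r]) f x)) => //.
    by rewrite Drr ?(ltW u0)//; apply: Rintegral_ge0.
  (* A step from [r] to [w] has [w <= r + u <= 2 r], so [x / 2 <= r] on it and the half speed is at
     least [phi r]. *)
  exists u => // r w ur rw wv wr Dr; have r0 := lt_le_trans u0 ur.
  have w0 := lt_le_trans r0 rw.
  apply: (le_trans (Dtri u r w (ltW u0) (ltW r0) (ltW w0))); rewrite (add u r w)//; apply: lerD => //.
  apply: (le_trans (Dphi r w r0 rw)); rewrite -lee_fin -fE//; [|exact: ltW|exact: le_trans wv vt].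
  apply: (@le_trans _ _ (\int[leb]_(x in `[r, w]) (phi r)%:E)%E).
    rewrite integral_cst//= lebesgue_measure_itv/= lte_fin; case: ifPn => [_|]; first by rewrite -EFinB -EFinM.
    rewrite -leNgt mule0 => wr'; have -> : w = r by apply/eqP; rewrite eq_le wr' rw.
    by rewrite subrr mulr0.
  apply: ge0_le_integral => //.
  - by move=> x _; rewrite lee_fin; exact: p0.
  - by apply/measurable_EFinP; apply: measurable_funTS; exact: half_speed_measurable.
  - move=> x; rewrite /= in_itv/= => /andP[rx xw]; rewrite lee_fin.
    by apply: (@half_speed_ge r w) => //; [lra|exact: lt_le_trans r0 rx].
rewrite fE// lee_fin; have [s1|] := ltP 0 s; first exact: pos.
move=> s1; have {s1 s0} -> : s = 0 by apply/eqP; rewrite eq_le s1 s0.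
apply/ler_addgt0Pr => e ep; have [d d0 hd] := Dc e ep.
have [->|tn] := eqVneq t 0.
  by rewrite Drr// addr_ge0 ?(ltW ep)//; apply: Rintegral_ge0.
pose u := Num.min d t; have u0 : 0 < u by rewrite lt_min d0 lt_neqAle eq_sym tn.
have ut : u <= t by rewrite ge_min lexx orbT.
have ud : u <= d by rewrite ge_min lexx.
apply: (le_trans (Dtri 0 u t (lexx 0) (ltW u0) t0)); rewrite addrC; apply: lerD; last by apply: hd => //; exact: ltW.
apply: (le_trans (pos u t u0 ut (lexx t))); rewrite (add 0 u t (ltW u0) ut) lerDr.
exact: Rintegral_ge0.
Qed.

End HalfSpeed.

Lemma is_deriveI {R : realType} (F : R -> R) (t l : R) :
  (forall e, 0 < e -> exists2 d : R, 0 < d & forall r, `|r - t| <= d ->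
     `|F r - F t - (r - t) * l| <= e * `|r - t|) -> is_derive t 1 F l.
Proof.
move=> h; have cv : (fun h => h^-1 *: ((F \o shift t) (h *: 1) - F t)) @ 0^' --> l.
  apply/cvgrPdist_le => e e0; have [d d0 hd] := h e e0.
  exists d => //= z; rewrite /= sub0r normrN => zd z0.
  have Ez : z%:A + t - t = z by rewrite -[z%:A]/(z * 1) mulr1 addrK.
  have := hd (z%:A + t); rewrite Ez => /(_ (ltW zd)) h1.
  rewrite -[z^-1 *: _]/(z^-1 * _) -(ler_pM2r (_ : 0 < `|z|)) ?normr_gt0//.
  rewrite -normrM; apply: le_trans h1; rewrite le_eqVlt; apply/orP; left; apply/eqP.
  rewrite -normrN; congr `|_|; rewrite mulrBl mulrAC mulVf// mul1r [l * z]mulrC opprB.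
  by congr (_ - _).
by split; [apply/cvg_ex; exists l|exact: cvg_lim cv].
Qed.

(** * The velocity of the curve of measures *)

Section Velocity.
Context {R : realType} {X : pseudoMetricType R} {K : @pdkernel R X}.
Variables (U : X -> R) (cU : continuous U).
Local Notation k := (ker K).
Local Notation H := (Hop k).
Local Notation m0 := (m0 (K := K)).
Local Notation flow := (flow (K := K) U).
Local Notation dseq := (@dseq R X).
Local Notation dsd := (@dsd R X).
Local Notation dw := (@dw R X K).
Variables (Y : set X) (a : R -> (X -> R) -> R) (fa : flow Y a) (reg : regular (K := K) a).
Variables (t : R) (gt : good (K := K) a t).

Let t0 : 0 < t. Proof. by case: gt. Qed.
Let tl : 0 <= t := ltW t0.

Lemma hb_add f g (C D : R) : hb k f C -> hb k g D -> hb k (fun x => f x + g x) (2 * (C + D)).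
Proof.
move=> [C0 hf] [D0 hg]; split => [|n x z]; first by rewrite mulr_ge0// addr_ge0.
have -> : \sum_(i < n) z i * (f (x i) + g (x i)) = \sum_(i < n) z i * f (x i) + \sum_(i < n) z i * g (x i).
  by rewrite -big_split; apply: eq_bigr => i _; rewrite mulrDr.
have := hf n x z; have := hg n x z; move: (\sum_(i < n) z i * _) (\sum_(i < n) z i * _) (\sum_(i < n) _) => A B Q h1 h2.
by have := sqr_ge0 (A - B); rewrite sqrrB sqrrD; nra.
Qed.

Lemma dsd_lin f g (c C D : R) : hb k f C -> hb k g D ->
  dsd a t (fun x => c * f x + g x) = c * dsd a t f + dsd a t g.
Proof.
move=> hf hg; apply: ulimE.
have : c * dseq a t n f + dseq a t n g @[n --> ultraN] --> c * dsd a t f + dsd a t g.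
  by apply: cvgD; [apply: cvgMr; exact: (dsd_cvg fa reg gt hf)|exact: (dsd_cvg fa reg gt hg)].
apply: cvg_trans; apply: near_eq_cvg; apply: nearW => n.
have [[M _ bn] _] := dseq_bnd fa reg n gt.
by rewrite bn.1//; [exact: hb_cont hf|exact: hb_cont hg].
Qed.

Lemma dsd_bound f C : hb k f C -> `|dsd a t f| <= Num.sqrt C * phi (K := K) a t.
Proof.
move=> hf; apply: (ultra_lec (cvg_norm (dsd_cvg fa reg gt hf))); apply: nearW => n.
have [[M M1 bn] nn] := dseq_bnd fa reg n gt.
apply: (le_trans (hb_CS_abs M1 bn hf)); apply: ler_wpM2l; first exact: sqrtr_ge0.
by apply: sqrt_le_sq => //; apply: (phi_ge0 reg).
Qed.

(** Symmetry of the scalar product in the limit: the derivative of [a] tested on [H s] is [s] tested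
    on the derivative of [H a]. *)
Lemma dsd_H M (s : (X -> R) -> R) : 0 <= M -> bdf M s -> dsd a t (H s) = s (dw a t).
Proof.
move=> M1 bs; apply: ulimE; apply/ultraP => e e0.
have hn : \forall n \near ultraN, (exists2 M, 0 <= M & bdf M (dseq a t n)) /\
    dual_sqnorm (K := K) (dseq a t n) <= phi (K := K) a t ^+ 2.
  by apply: nearW => n; exact: (dseq_bnd fa reg n gt).
have [hw _ uw] := weak_limit (sqr_ge0 _) hn.
have e1 : 0 < e / (M + 1) by rewrite divr_gt0// ltr_wpDl.
apply: filterS (uw _ e1) => n hu.
have [[M' M'0 bn] _] := dseq_bnd fa reg n gt.
rewrite -/(kdot k _ _) (dot_sym M'0 M1 bn bs) /kdot -(linB bs.1); [|exact: (cont_H bn)|exact: (dw_cont cU fa reg gt)].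
apply: (@le_trans _ _ (M * (e / (M + 1)))).
  apply: bs.2 => //; last exact: ltW.
  by apply: cont_add; [exact: (cont_H bn)|apply: cont_opp; exact: (dw_cont cU fa reg gt)].
by rewrite mulrCA ler_piMr ?(ltW e0)// ler_pdivrMr ?mul1r ?lerDl// ltr_wpDl.
Qed.

Definition prob_of_dual (b : (X -> R) -> R) := wt (H b) b.

(** The product rule for [mu = b a]: the derivative of [a] acts on [b f], which lies in the RKHS of
    [k] when [f] lies in that of [k_mu], and the second term varies [b]. *)
Definition vel f : R := dsd a t (fun x => H (a t) x * f x) + a t (fun x => dw a t x * f x).

Lemma unlift_deriv f C : continuous f -> hb k (fun x => H (a t) x * f x) C ->
  is_derive t 1 (fun r => prob_of_dual (a r) f) (vel f).
Proof.
move=> cf hf; apply: is_deriveI => e e0.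
have e3 : 0 < e / 3 by rewrite divr_gt0.
have mp := m0_gt0 (K := K); have cdw := dw_cont cU fa reg gt.
have [F [F0 hF]] := cont_bdd K cf; have F1 : 0 < F + 1 by rewrite ltr_wpDl.
have e1 : 0 < e / 3 / (F + 1) / m0 by rewrite !divr_gt0.
have [d1 /andP[d10 d1t] h1] := dsd_conv cU fa reg gt hf e3.
have [d2 /andP[d20 d2t] h2] := dw_conv cU fa reg gt (exprn_gt0 2 e1).
have [d3 d30 h3] := fl_weak fa tl (cont_mul cdw cf) e3.
pose d := Num.min d1 (Num.min d2 d3).
have [d0 dd1 dd2 dd3] : [/\ 0 < d, d <= d1, d <= d2 & d <= d3].
  by rewrite !lt_min d10 d20 d30 !ge_min !lexx !orbT.
exists d => // r rd; have [->|rt] := eqVneq r t.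
  by rewrite !subrr mul0r subrr normr0 mulr0.
have r0 : 0 <= r by move: rd; rewrite ler_norml => /andP[]; lra.
have rt0 : r - t != 0 by rewrite subr_eq0.
have [s [s' [ts ss s't qE]]] : exists s s', [/\ t - d <= s, s < s', s' <= t + d &
    qt a s s' = fun g => (r - t)^-1 * (a r g - a t g)].
  move: rd; rewrite ler_norml => /andP[g1 g2].
  have [lt|lt|eq] := ltgtP r t; last by rewrite eq eqxx in rt.
    exists r, t; split => //; [lra|lra|].
    apply/funext => g; rewrite qtE /subf -[r - t]opprB invrN; ring.
  exists t, r; split => //; [lra|lra|].
  by apply/funext => g; rewrite qtE.
have i1 := h1 s s' ltac:(lra) ss ltac:(lra).
have [i2 _] := h2 s s' ltac:(lra) ss ltac:(lra).
have i3 := h3 r r0 (le_trans rd dd3).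
have bt := fl_bdf fa tl; have br := fl_bdf fa r0.
have cHt := fl_cont_H fa tl; have cHr := fl_cont_H fa r0.
have s0 : 0 <= s by lra.
have [M M1 bq] := bdf_qt fa s0 ss.
have cq := cont_H (K := K) bq.
have chf : continuous (fun x => H (a t) x * f x) by exact: cont_mul.
have cqf : continuous (fun x => (H (qt a s s') x - dw a t x) * f x).
  by apply: cont_mul => //; apply: cont_add => //; exact: cont_opp.
have cdf : continuous (fun x => dw a t x * f x) by exact: cont_mul.
have E : prob_of_dual (a r) f - prob_of_dual (a t) f = (r - t) * (qt a s s' (fun x => H (a t) x * f x) +
    (a r (fun x => (H (qt a s s') x - dw a t x) * f x) + a r (fun x => dw a t x * f x))).
  have E1 : (fun x => H (a r) x * f x) = fun x =>
      (r - t) * ((H (qt a s s') x - dw a t x) * f x + dw a t x * f x) + H (a t) x * f x.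
    by apply/funext => x; rewrite qE /Hop; field.
  rewrite /prob_of_dual /wt E1 br.1//; last exact: cont_add.
  by rewrite (linD br.1)//; move: (a r _) (a r _) => A B; rewrite qE; field.
have i4 : `|a r (fun x => (H (qt a s s') x - dw a t x) * f x)| <= e / 3.
  have sup x : `|(H (qt a s s') x - dw a t x) * f x| <= e / 3 / (F + 1) / m0 * F.
    rewrite normrM; apply: ler_pM => //.
    by have := hb_sup x i2; rewrite sqrtr_sqr (ger0_norm (ltW e1)).
  have FF : 0 <= e / 3 / (F + 1) / m0 * F by rewrite mulr_ge0// ltW.
  apply: (le_trans (br.2 _ _ cqf FF sup)).
  have -> : m0 * (e / 3 / (F + 1) / m0 * F) = e / 3 * (F / (F + 1)).
    by field; rewrite !gt_eqF.
  by rewrite ler_piMr ?(ltW e3)// ler_pdivrMr// mul1r lerDl.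
rewrite E -mulrBr normrM mulrC; apply: ler_wpM2r => //.
move: i1 i3 i4; rewrite /vel; move: (qt _ _ _ _) (dsd _ _ _) (a r _) (a r _) (a t _) => A B C1 D1 E1.
by rewrite !ler_norml => /andP[? ?] /andP[? ?] /andP[? ?]; apply/andP; split; lra.
Qed.

End Velocity.

(** * The flow equation and the energy identity at good times *)

Section GoodTimes.
Context {R : realType} {X : pseudoMetricType R} {K : @pdkernel R X}.
Variables (eps : R) (c : X -> X -> R) (e0 : 0 < eps) (KE : ker K = k_c eps c).
Variables (V : X -> R) (cV : continuous V).
Local Notation k := (ker K).
Local Notation H := (Hop k).
Local Notation Kk := (markov_op (K := K)).
Local Notation m0 := (m0 (K := K)).
Let U x := 2 / eps * V x.
Local Notation Aop := (skew_op (K := K) U).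
Local Notation unlift := (@prob_of_dual R X K).

Let cU : continuous U. Proof. by apply: cont_mul => //; exact: cont_cst. Qed.

Variables (a : R -> (X -> R) -> R) (fa : flow (K := K) U setT a) (reg : regular (K := K) a).
Let mu t := unlift (a t).

Lemma unlift_prob t : 0 <= t -> is_prob (mu t).
Proof. by move=> t0; have [] := unlift_facts e0 KE (fl_pos fa t0) (fl_nrm fa t0). Qed.

Lemma unlift_Bemb t : 0 <= t -> Bemb eps c (mu t) = H (a t).
Proof. by move=> t0; have [] := unlift_facts e0 KE (fl_pos fa t0) (fl_nrm fa t0). Qed.

Lemma unlift_lift t : 0 <= t -> lift eps c (mu t) = a t.
Proof. by move=> t0; exact: (lift_unlift e0 KE (fl_pos fa t0) (fl_nrm fa t0)). Qed.

Lemma energy_Eng t : 0 <= t -> energy V (mu t) = eps / 2 * Eng (K := K) U (a t).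
Proof.
move=> t0; have ba := fl_bdf fa t0; have cH := fl_cont_H fa t0.
rewrite /energy /mu /prob_of_dual /wt /Eng -(linZ ba.1); last exact: cont_mul.
congr (a t _); apply/funext => x; rewrite /U; field; by rewrite gt_eqF.
Qed.

Variables (t : R) (gt : good (K := K) a t).
Let t0 : 0 < t. Proof. by case: gt. Qed.
Let tl : 0 <= t := ltW t0.
Let b := H (a t).
Let w := dw (K := K) a t.
Let sg := vel (K := K) a t.
Let ba := fl_bdf fa tl.
Let la : linC (a t) := ba.1.
Let pa : posfun setT (a t) := fl_pos fa tl.
Let mp : 0 <= m0. Proof. exact: m0_ge0. Qed.
Let cb : continuous b. Proof. exact: (fl_cont_H fa tl). Qed.
Let b0 x : 0 < b x.
Proof. by apply: (H_pos (K := K) x pa); rewrite -/(dual_sqnorm (a t)) (fl_nrm fa tl). Qed.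
Let bn x : b x != 0. Proof. by rewrite gt_eqF. Qed.
Let cib : continuous (fun x => (b x)^-1). Proof. exact: cont_inv. Qed.
Let hw : hb k w (phi (K := K) a t ^+ 2). Proof. by have [] := dw_facts cU fa reg gt. Qed.
Let cw : continuous w. Proof. exact: hb_cont hw. Qed.
Let aw : a t w = 0. Proof. by have [_ _ []] := dw_facts cU fa reg gt. Qed.
Let wA x : - Aop (a t) x <= w x.
Proof. by have [_ _ [+ _]] := dw_facts cU fa reg gt; apply. Qed.
Let hbb : hb k b 1. Proof. by have := hb_H (K := K) mp ba; rewrite -/(dual_sqnorm (K := K) (a t)) (fl_nrm fa tl). Qed.
Let dsdb : dsd a t b = 0. Proof. by rewrite (dsd_H cU fa reg gt mp ba). Qed.

Let rk f : in_rkhs (k_mu eps c (mu t)) f -> hb k (fun x => b x * f x) (hnorm (k_mu eps c (mu t)) f ^+ 2).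
Proof.
rewrite /in_rkhs /hnorm (rkhs_mu e0 KE f (unlift_prob tl)) unlift_Bemb// => h.
exact: hnorm2_fin.
Qed.

Let cont_rk f C : hb k (fun x => b x * f x) C -> continuous f.
Proof.
move=> /hb_cont h; rewrite (_ : f = fun x => (b x)^-1 * (b x * f x)); first exact: cont_mul.
by apply/funext => x; rewrite mulKf.
Qed.

Lemma vel_velocity : is_velocity eps c mu t sg.
Proof.
split; last first.
  move=> phi rphi; have hphi := rk rphi.
  exact: (unlift_deriv cU fa reg gt (cont_rk hphi) hphi).
split; last first.
  rewrite /sg /vel; under eq_fun do rewrite mulr1; under [X in _ + a t X]eq_fun do rewrite mulr1.
  by rewrite -/b -/w dsdb aw addr0.
split.
  move=> f g z rf rg; have hf := rk rf; have hg := rk rg.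
  have cf := cont_rk hf; have cg := cont_rk hg.
  have cwf : continuous (fun x => w x * f x) by exact: cont_mul.
  have cwg : continuous (fun x => w x * g x) by exact: cont_mul.
  rewrite /sg /vel -/b -/w.
  rewrite (_ : (fun x => b x * (z * f x + g x)) = fun x => z * (b x * f x) + b x * g x); last first.
    by apply/funext => x; ring.
  rewrite (_ : (fun x => w x * (z * f x + g x)) = fun x => z * (w x * f x) + w x * g x); last first.
    by apply/funext => x; ring.
  by rewrite (dsd_lin fa reg gt z hf hg) la//; ring.
have [W [W0 hW]] := cont_bdd K cw; have [I0 [I00 hI]] := cont_bdd K cib.
exists (phi (K := K) a t + m0 * (W * I0)) => f rf; have hf := rk rf; have cf := cont_rk hf.
set n := hnorm _ _ in hf *; have n0 : 0 <= n by exact: sqrtr_ge0.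
have i1 : `|dsd a t (fun x => b x * f x)| <= phi (K := K) a t * n.
  by have := dsd_bound fa reg gt hf; rewrite sqrtr_sqr (ger0_norm n0) mulrC.
have cwf : continuous (fun x => w x * f x) by exact: cont_mul.
have i2 : `|a t (fun x => w x * f x)| <= m0 * (W * (I0 * n)).
  apply: ba.2 => //; first by rewrite !mulr_ge0.
  move=> x; rewrite normrM; apply: ler_pM => //.
  have -> : f x = (b x)^-1 * (b x * f x) by rewrite mulKf.
  rewrite normrM; apply: ler_pM => //.
  by have := hb_sup x hf; rewrite sqrtr_sqr (ger0_norm n0).
rewrite /sg /vel; apply: (le_trans (ler_normD _ _)).
by rewrite mulrDl -!mulrA; exact: lerD.
Qed.

Let r x := w x + Aop (a t) x.
Let cA : continuous (Aop (a t)). Proof. exact: (fl_cont_Aop cU fa tl). Qed.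
Let cr : continuous r. Proof. exact: cont_add. Qed.
Let r0 x : 0 <= r x. Proof. by rewrite /r; have := wA x; lra. Qed.
Let ar f : continuous f -> a t (fun x => r x * f x) = 0.
Proof.
move=> cf; apply: (posfun_null (K := K) pa cr cf) => //.
by rewrite (linD la)// aw (Aop_self cU mp ba) addr0.
Qed.

Let g := Hop (k_mu eps c (mu t)) sg.
Let beta x := (b x)^-1 * w x.
Let cbeta : continuous beta. Proof. exact: cont_mul. Qed.

Let gE z : g z = beta z + Kk (a t) beta z.
Proof.
pose phi x := k_mu eps c (mu t) x z.
have phiE x : phi x = (b x)^-1 * k x z * (b z)^-1.
  by rewrite /phi (k_muE e0 KE)//; [rewrite unlift_Bemb|exact: unlift_prob].
have ckz : continuous (fun x => k x z) by exact: cont_kl.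
have bphi : (fun x => b x * phi x) = fun x => (b z)^-1 * k x z.
  by apply/funext => x; rewrite phiE; field; rewrite !bn.
have d1 : dsd a t (fun x => b x * phi x) = (b z)^-1 * w z.
  rewrite bphi; apply: ulimE; have [_ cv _] := dw_facts cU fa reg gt.
  have : (b z)^-1 * H (dseq a t n) z @[n --> ultraN] --> (b z)^-1 * w z by apply: cvgMr; exact: cv.
  apply: cvg_trans; apply: near_eq_cvg; apply: nearW => n.
  by have [[M _ bq] _] := dseq_bnd fa reg n gt; rewrite (linZ bq.1).
rewrite /g /Hop -/phi /sg /vel -/b -/w d1; congr (_ + _).
rewrite /markov_op -/b /Hop /wt -(linZ la); last exact: cont_mul.
by congr (a t _); apply/funext => x; rewrite phiE /beta; ring.
Qed.

Let bpos x : 0 < H (a t) x := b0 x.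
Let cg : continuous g.
Proof.
rewrite (_ : g = fun z => beta z + Kk (a t) beta z); last by apply/funext.
by apply: cont_add => //; apply: Kk_cont.
Qed.

(** An explicit solution of [psi0 - K psi0 = beta]: as [r] is null for [a], the measures [psi0 a]
    and [- U a] coincide, and [b psi0 - H (psi0 a) = r - U b + H (U a) = w]. *)
Let psi0 x := (b x)^-1 * r x - U x.
Let cbr : continuous (fun x => (b x)^-1 * r x). Proof. exact: cont_mul. Qed.
Let cpsi0 : continuous psi0. Proof. by apply: cont_add => //; exact: cont_opp. Qed.

Let bKpsi0 z : H (wt psi0 (a t)) z = - H (wt U (a t)) z.
Proof.
have ckz : continuous (fun x => k x z) by exact: cont_kl.
have := HwtB pa z cbr cU; rewrite -/psi0 => ->.
suff -> : H (wt (fun x => (b x)^-1 * r x) (a t)) z = 0 by rewrite sub0r.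
rewrite /Hop /wt -[RHS](ar (cont_mul cib ckz)); congr (a t _).
by apply/funext => x; ring.
Qed.

Let psi0E z : psi0 z - Kk (a t) psi0 z = beta z.
Proof. by rewrite /markov_op bKpsi0 /psi0 /beta /r /skew_op -/b; field; exact: bn. Qed.

Let psi := inv_IdK2 eps c (mu t) g.

Let psiE : exists kappa, psi = fun x => psi0 x + kappa.
Proof.
have [cpsi [C hC]] := inv_IdK2_spec e0 KE (unlift_prob tl) cg.
rewrite -/psi unlift_lift// in cpsi hC.
have [x0 _] : [set: X] !=set0.
  have /is_probP[q q1] := unlift_prob tl; exact: a_nonempty q q1.
have cK0 : continuous (Kk (a t) psi0) by exact: Kk_cont.
have cK : continuous (Kk (a t) psi) by exact: Kk_cont.
have e1 z : psi0 z - Kk (a t) (Kk (a t) psi0) z = g z.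
  rewrite gE -psi0E; have -> : beta = fun z => psi0 z - Kk (a t) psi0 z by apply/funext => y; rewrite psi0E.
  by rewrite (Kk_sub pa z cpsi0 cK0); ring.
have cd : continuous (fun z => psi z - psi0 z) by apply: cont_add => //; exact: cont_opp.
have cst := Kk2_unique pa x0 bpos cd (C := C).
exists (psi x0 - psi0 x0); apply/funext => x.
suff ex : psi x - psi0 x = psi x0 - psi0 x0 by rewrite -ex; ring.
apply: cst => y; have -> : Kk (a t) (fun z => psi z - psi0 z) = fun z => Kk (a t) psi z - Kk (a t) psi0 z.
  by apply/funext => z; rewrite (Kk_sub pa z cpsi cpsi0).
by rewrite (Kk_sub pa y cK cK0); have := hC y; have := e1 y; lra.
Qed.

(** The pressure is [- eps / 2] times [r / b]. It vanishes on the support because [r] is nonnegative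
    and continuous with zero integral against [mu]. *)
Lemma vel_equation : exists p, pressures (mu t) p /\ exists C, forall y,
  eps / 2 * inv_IdK2 eps c (mu t) (Hop (k_mu eps c (mu t)) sg) y + V y + p y = C.
Proof.
have [kappa pE] := psiE; have en : eps != 0 by rewrite gt_eqF.
exists (fun x => - (eps / 2) * ((b x)^-1 * r x)); split; last first.
  by exists (eps / 2 * kappa) => y; rewrite -/g -/psi pE /psi0 /U; field; rewrite bn en.
split; first by apply: cont_mul => //; exact: cont_cst.
have nn x : 0 <= (b x)^-1 * r x by rewrite mulr_ge0// invr_ge0 ltW.
split => x; first by rewrite mulNr oppr_le0 mulr_ge0// divr_ge0// ltW.
move=> sx; have rx0 : r x = 0.
  apply/eqP; rewrite eq_le r0 andbT leNgt; apply/negP => rx.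
  have := sx _ cr r0 rx; rewrite /mu /prob_of_dual /wt -/b.
  rewrite (_ : (fun x => b x * r x) = fun x => r x * b x) ?ar ?ltxx//.
  by apply/funext => y; rewrite mulrC.
by rewrite rx0 !mulr0.
Qed.

(** With [psi = psi0 + kappa] one has [b psi = kappa b + w + H (psi0 a)]. The derivative of [a]
    kills [b] and gives [nw + a (psi0 w)]; the variation of [b] gives [a (psi0 w)] once more, and
    [a (psi0 w) = - a (U w)]. So the velocity tested on [psi] is [nw - 2 a (U w) = - dE]. *)
Lemma energy_deriv : is_derive t 1 (fun s => energy V (mu s)) (- gmet eps c (mu t) sg).
Proof.
have [kappa pE] := psiE.
have cpw : continuous (fun x => psi0 x * w x) by exact: cont_mul.
have [M M0 bM] := bdf_wt_ex (K := K) mp cpsi0 ba.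
have sgpsi : sg psi = - dE (K := K) U a t.
  have h1 : hb k (H (wt psi0 (a t))) (kdot k (wt psi0 (a t)) (wt psi0 (a t))) by exact: (hb_H M0 bM).
  have h2 : (fun x => b x * psi x) = fun x => kappa * b x + (1 * w x + H (wt psi0 (a t)) x).
    apply/funext => x; rewrite pE mulrDr [b x * kappa]mulrC addrC; congr (_ + _).
    have := psi0E x; rewrite /beta /markov_op -/b => /(congr1 (fun z => b x * z)).
    by rewrite mulrBr !mulVKf// mul1r => <-; ring.
  have h3 := hb_add hw h1.
  rewrite (_ : (fun x => w x + _) = fun x => 1 * w x + H (wt psi0 (a t)) x) in h3; last first.
    by apply/funext => x; rewrite mul1r.
  rewrite /sg /vel -/b -/w h2 (dsd_lin fa reg gt kappa hbb h3) (dsd_lin fa reg gt 1 hw h1).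
  rewrite dsdb mulr0 add0r mul1r (dsd_H cU fa reg gt M0 bM) -/w.
  have -> : (fun x => w x * psi x) = fun x => kappa * w x + psi0 x * w x.
    by apply/funext => x; rewrite pE; ring.
  rewrite la// aw mulr0 add0r /wt.
  have E : a t (fun x => psi0 x * w x) = - a t (fun x => U x * w x).
    have cUw : continuous (fun x => U x * w x) by exact: cont_mul.
    have cf : continuous (fun x => (b x)^-1 * w x) by exact: cont_mul.
    have -> : (fun x => psi0 x * w x) = fun x => r x * ((b x)^-1 * w x) - U x * w x.
      by apply/funext => x; rewrite /psi0; ring.
    by rewrite (linB la)//; [rewrite ar// sub0r|exact: cont_mul].
  by rewrite E /dE /nw -/w; ring.
have -> : - gmet eps c (mu t) sg = eps / 2 * dE (K := K) U a t.
  by rewrite /gmet -/g -/psi sgpsi; ring.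
apply: is_deriveI => e ep; have ee : 0 < e / (eps / 2) by rewrite !divr_gt0.
have [d /andP[d0 dt] hd] := Eng_deriv cU fa reg gt ee.
exists d => // s sd; have s0 : 0 <= s by move: sd; rewrite ler_norml => /andP[]; lra.
rewrite !energy_Eng//.
have i1 := hd s t sd; rewrite subrr normr0 in i1; have {}i1 := i1 (ltW d0).
have i2 := hd t s; rewrite subrr normr0 in i2; have {}i2 := i2 (ltW d0) sd.
rewrite distrC in i2.
move: i1 i2; move: (Eng (K := K) U (a s)) (Eng (K := K) U (a t)) (dE (K := K) U a t) => A B D i1 i2.
have -> : eps / 2 * A - eps / 2 * B - (s - t) * (eps / 2 * D) = eps / 2 * (A - B - (s - t) * D) by ring.
have e2 : 0 < eps / 2 by rewrite divr_gt0.
rewrite normrM (gtr0_norm e2) -ler_pdivlMl// mulrA [_^-1 * _]mulrC.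
by rewrite ler_norml; apply/andP; split; lra.
Qed.

End GoodTimes.

(** * Long-time behaviour and the main theorem *)

Section Monotone.
Context {R : realType}.

(** Induction on the number of intervals, removing one whose left end is largest: the others, by
    disjointness, end before it starts. If it is degenerate it contributes nothing and is simply
    dropped. *)
Lemma disjoint_variation (h : R -> R) n (l u : 'I_n -> R) :
  (forall s t, 0 <= s -> s <= t -> h t <= h s) ->
  (forall i, 0 <= l i /\ l i <= u i) -> (forall i j, i != j -> u i <= l j \/ u j <= l i) ->
  forall N (S : {set 'I_n}) T, #|S| = N -> 0 <= T -> (forall i, i \in S -> u i <= T) ->
  \sum_(i in S) (h (l i) - h (u i)) <= h 0 - h T.
Proof.
move=> hm lu dis; elim => [|N IH] S T cS T0 uT.
  have -> : S = finset.set0 by apply/eqP; rewrite -cards_eq0 cS.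
  by rewrite big_set0 subr_ge0; exact: hm.
have [i0 i0S] : exists i, i \in S by apply/card_gt0P; rewrite cS.
have [i iS imax] : exists2 i, i \in S & forall j, j \in S -> l j <= l i.
  by exists [arg max_(i > i0 in S) l i]%O; case: Order.TotalTheory.arg_maxP.
have cD : #|S :\ i| = N by have := cardsD1 i S; rewrite cS iS add1n => -[].
have [l0 li] := lu i.
rewrite (big_setD1 i iS)/=; have [e|ne] := eqVneq (l i) (u i).
  rewrite -e subrr add0r; apply: IH => // j; rewrite in_setD1 => /andP[_]; exact: uT.
have lt : l i < u i by rewrite lt_neqAle ne.
have := IH (S :\ i) (l i) cD l0; have := hm (u i) T (le_trans l0 li) (uT i iS).
suff h1 : forall j, j \in S :\ i -> u j <= l i by move=> h2 /(_ h1); lra.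
move=> j; rewrite in_setD1 => /andP[ji jS]; have [//|h1] := dis j i ji.
by have := imax j jS; move: lt; lra.
Qed.

(** The Lipschitz constants may blow up at 0. Increments are split at a small [s]: beyond [s] they
    are Lipschitz, and before [s] monotonicity bounds their sum by the total decrease of [g] on
    [[0, s]]. *)
Lemma monotone_abs_cont (g : R -> R) : (forall s t, 0 <= s -> s <= t -> g t <= g s) ->
  (forall e, 0 < e -> exists2 d : R, 0 < d & forall s, 0 <= s -> s <= d -> `|g s - g 0| <= e) ->
  (forall s, 0 < s -> exists2 L : R, 0 <= L & forall u v, s <= u -> u <= v -> `|g v - g u| <= L * (v - u)) ->
  loc_abs_cont g.
Proof.
move=> gm g0 gl T T0 e e0; have e4 : 0 < e / 4 by rewrite divr_gt0.
have [s s0 hs] := g0 _ e4; have [L L0 hL] := gl s s0.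
have L1 : 0 < L + 1 by rewrite ltr_wpDl.
exists (e / 4 / (L + 1)); split; first by rewrite divr_gt0.
move=> n l u lu dis small.
pose h x := g (Num.min x s).
have hm x y : 0 <= x -> x <= y -> h y <= h x.
  move=> x0 xy; apply: gm; first by rewrite le_min x0 ltW.
  by rewrite le_min !ge_min xy lexx orbT.
have bound i : `|g (u i) - g (l i)| <= (h (l i) - h (u i)) + L * (u i - l i).
  have [l0 [li _]] := lu i; have u0 := le_trans l0 li.
  rewrite ler0_norm ?subr_le0; last exact: gm.
  rewrite opprB /h; case: (leP (u i) s) => us.
    rewrite (min_l (le_trans li us)) lerDl mulr_ge0// subr_ge0//.
  case: (leP (l i) s) => ls.
    have := hL s (u i) (lexx s) (ltW us); rewrite ler_norml => /andP[h1 _].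
    have h2 : L * (u i - s) <= L * (u i - l i) by apply: ler_wpM2l => //; rewrite lerD2l lerN2.
    lra.
  have := hL (l i) (u i) (ltW ls) li; rewrite ler_norml => /andP[h1 _]; lra.
apply: (@le_lt_trans _ _ (\sum_(i < n) ((h (l i) - h (u i)) + L * (u i - l i)))).
  by apply: ler_sum => i _; exact: bound.
rewrite big_split /= -mulr_sumr.
have i1 : \sum_(i < n) (h (l i) - h (u i)) <= e / 4.
  have lu' i : 0 <= l i /\ l i <= u i by have [l0 [li _]] := lu i.
  have uT i : i \in [set: 'I_n]%SET -> u i <= T by move=> _; have [_ []] := lu i.
  have := disjoint_variation hm lu' dis (erefl _) T0 uT.
  rewrite (eq_bigl xpredT) => [|i]; last by rewrite inE.
  move=> /le_trans; apply; rewrite /h min_l; last exact: ltW.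
  have m0 : 0 <= Num.min T s by rewrite le_min T0 ltW.
  have ms : Num.min T s <= s by rewrite ge_min lexx orbT.
  by have := hs _ m0 ms; rewrite ler_norml => /andP[]; lra.
have i2 : L * \sum_(i < n) (u i - l i) <= e / 4.
  apply: (@le_trans _ _ (L * (e / 4 / (L + 1)))); first by apply: ler_wpM2l => //; exact: ltW.
  by rewrite mulrCA ler_piMr ?(ltW e4)// ler_pdivrMr// mul1r lerDl.
lra.
Qed.

End Monotone.

(** * Equivalence with Sinkhorn potential flows, and long-time limits *)

Section Flows.
Context {R : realType} {X : pseudoMetricType R} {K : @pdkernel R X}.
Variables (eps : R) (c : X -> X -> R) (e0 : 0 < eps) (KE : ker K = k_c eps c).
Variables (V : X -> R) (cV : continuous V).
Local Notation k := (ker K).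
Local Notation kap := (kmin K).
Local Notation H := (Hop k).
Local Notation dot := (kdot k).
Local Notation kN := (dual_sqnorm (K := K)).
Local Notation knm := (dual_norm (K := K)).
Local Notation phi := (phi (K := K)).
Local Notation m0 := (m0 (K := K)).
Let U x := 2 / eps * V x.
Local Notation Aop := (skew_op (K := K) U).
Local Notation Eng := (Eng (K := K) U).
Local Notation unlift := (@prob_of_dual R X K).
Local Notation flow := (flow (K := K) U setT).

Let cU : continuous U. Proof. by apply: cont_mul => //; exact: cont_cst. Qed.
Let mp : 0 <= m0. Proof. exact: m0_ge0. Qed.
Let mp2 : 0 <= m0 + m0. Proof. exact: addr_ge0. Qed.

Lemma hnorm_flow (a a' : R -> (X -> R) -> R) s t : flow a -> flow a' -> 0 <= s -> 0 <= t ->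
  hnorm (k_c eps c) (fun x => H (a s) x - H (a' t) x) = knm (subf (a s) (a' t)).
Proof.
move=> fa fa' s0 t0; rewrite -KE; apply: (hnorm_H mp2).
by apply: bdf_subf; [exact: (fl_bdf fa)|exact: (fl_bdf fa')].
Qed.

Lemma kN_flows (a a' : R -> (X -> R) -> R) t : flow a -> flow a' -> 0 <= t ->
  kN (subf (a t) (a' t)) = 2 - 2 * dot (a t) (a' t).
Proof.
move=> fa fa' t0; rewrite (kN_subf mp mp (fl_bdf fa t0) (fl_bdf fa' t0)).
by rewrite (fl_nrm fa t0) (fl_nrm fa' t0); ring.
Qed.

Theorem flow_SPF mu0 a : is_prob mu0 -> flow a -> regular (K := K) a ->
  (forall f, continuous f -> a 0 f = lift eps c mu0 f) ->
  SPF eps c V mu0 (fun t => unlift (a t)).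
Proof.
move=> pmu fa reg a0; have [G [G0 UG]] := cont_bdd K cU.
have Be t : 0 <= t -> Bemb eps c (unlift (a t)) = H (a t) by exact: (unlift_Bemb e0 KE fa).
split.
- split; first by move=> t t0; exact: (unlift_prob e0 KE fa t0).
  split.
    move=> t t0; rewrite Be// -KE; exact: (hb_hnorm (hb_H (K := K) mp (fl_bdf fa t0))).1.
  have p0 t : 0 < t -> 0 <= phi a t by exact: (phi_ge0 reg).
  have pm s t : 0 < s -> s <= t -> phi a t <= phi a s by exact: (phi_mono cU fa reg).
  exists (half_speed (phi a)); split; first exact: (half_speed_measurable p0 pm).
  split; first exact: half_speed_ge0.
  split.
    move=> T _; apply: (half_speed_L2 p0 pm (E := fun t => Eng (a t)) (G := G)).
      by move=> s t s0 st; exact: (energy_dissip cU fa reg s0 st).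
    by move=> t t0; exact: (Eng_bound cU fa G0 UG t0).
  move=> s t s0 st; have t0 := le_trans s0 st; rewrite !Be// hnorm_flow//.
  apply: (@half_speed_dist _ (phi a) (fun t => Eng (a t)) G p0 pm _ _ (fun s r => knm (subf (a r) (a s)))) => //.
  + by move=> u v u0 uv; exact: (energy_dissip cU fa reg u0 uv).
  + by move=> u u0; exact: (Eng_bound cU fa G0 UG u0).
  + move=> u u0; rewrite /dual_norm (kN_flows fa fa u0) -/(dual_sqnorm (K := K) (a u)) (fl_nrm fa u0).
    by rewrite mulr1 subrr sqrtr0.
  + move=> u v w u0 v0 w0; rewrite addrC.
    exact: (knm_tri mp (fl_bdf fa w0) (fl_bdf fa v0) (fl_bdf fa u0)).
  + move=> u v u0 uv; have [_ h] := phi_spd' reg u0.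
    by have := h (v - u); rewrite (_ : u + (v - u) = v); [apply; rewrite subr_ge0|ring].
  + move=> e ep; have [d d0 hd] := fl_near fa (lexx 0) ep.
    by exists d => // r r0 rd; apply: hd => //; rewrite subr0 ger0_norm.
- move=> f cf; have [pl HE _] := lift_facts e0 KE pmu.
  have H0 : H (a 0) = Bemb eps c mu0.
    by rewrite -HE; apply/funext => x; apply: a0; exact: cont_kl.
  have [cB _ _] := Bemb_spec e0 KE pmu.
  rewrite (lift_wt e0 KE f pmu) /unlift /prob_of_dual /wt H0 a0//; exact: cont_mul.
- have [N [mN N0 gN]] := bad_null (K := K) a; exists N; split => //; split => // t t0 nN.
  have gt := gN t t0 nN; exists (vel (K := K) a t).
  by split; [exact: (vel_velocity e0 KE cV fa reg gt)|exact: (vel_equation e0 KE cV fa reg gt)].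
Qed.

Lemma lift_ext mu nu : is_prob mu -> is_prob nu -> meas_eq mu nu ->
  Bemb eps c mu = Bemb eps c nu /\ forall f, continuous f -> lift eps c mu f = lift eps c nu f.
Proof.
move=> pm pn E; have [cB B0 BE] := Bemb_spec e0 KE pn.
have BB : Bemb eps c mu = Bemb eps c nu.
  apply: (Bemb_unique e0 KE pm cB B0) => y; rewrite {1}BE /Hop /wt E//.
  by apply: cont_mul; [exact: cont_inv|exact: cont_kl].
split => // f cf; rewrite /lift BB /wt E//.
by apply: cont_mul => //; exact: cont_inv.
Qed.

(** Both lifts start at the same unit vector, so their scalar product starts at 1 and cannot
    decrease; the difference then has norm 0, and universality identifies the measures. *)
Theorem SPF_unique mu0 mu nu : SPF eps c V mu0 mu -> SPF eps c V mu0 nu ->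
  forall t, 0 <= t -> meas_eq (nu t) (mu t).
Proof.
move=> Sm Sn t t0.
have pm s : 0 <= s -> is_prob (mu s) by case: Sm => [[+ _] _ _]; apply.
have pn s : 0 <= s -> is_prob (nu s) by case: Sn => [[+ _] _ _]; apply.
have fm := SPF_flow e0 KE cV pm Sm; have fn := SPF_flow e0 KE cV pn Sn.
have E0 : meas_eq (nu 0) (mu 0).
  by case: Sm => [_ h1 _]; case: Sn => [_ h2 _] f cf; rewrite h1// h2.
have [B0 L0] := lift_ext (pn 0 (lexx 0)) (pm 0 (lexx 0)) E0.
have d0 : dot (lift eps c (nu 0)) (lift eps c (mu 0)) = 1.
  rewrite /kdot L0; last exact: (fl_cont_H fm (lexx 0)).
  exact: (fl_nrm fm (lexx 0)).
have dt := contraction cU fn fm (lexx 0) t0; rewrite d0 in dt.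
have kt := kN_flows fn fm t0.
have bt : bdf (m0 + m0) (subf (lift eps c (nu t)) (lift eps c (mu t))).
  by apply: bdf_subf; [exact: (fl_bdf fn t0)|exact: (fl_bdf fm t0)].
have Lt f : continuous f -> lift eps c (nu t) f = lift eps c (mu t) f.
  move=> cf; apply/eqP; rewrite -subr_eq0; apply/eqP.
  apply: (dot_nondeg (K := K) mp2 bt _ cf); rewrite -/(dual_sqnorm _) kt; lra.
have [_ Hn _] := lift_facts e0 KE (pn t t0); have [_ Hm _] := lift_facts e0 KE (pm t t0).
have Bt : Bemb eps c (nu t) = Bemb eps c (mu t).
  by rewrite -Hn -Hm; apply/funext => x; apply: Lt; exact: cont_kl.
move=> f cf; rewrite (lift_wt e0 KE f (pn t t0)) (lift_wt e0 KE f (pm t t0)) Bt Lt//.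
by apply: cont_mul => //; have [] := Bemb_spec e0 KE (pm t t0).
Qed.

Theorem SPF_nonexpansive mu1 mu2 n1 n2 : SPF eps c V n1 mu1 -> SPF eps c V n2 mu2 ->
  forall s t, 0 <= s -> s <= t ->
  hnorm (k_c eps c) (fun x => Bemb eps c (mu1 t) x - Bemb eps c (mu2 t) x)
  <= hnorm (k_c eps c) (fun x => Bemb eps c (mu1 s) x - Bemb eps c (mu2 s) x).
Proof.
move=> S1 S2 s t s0 st; have t0 := le_trans s0 st.
have p1 r : 0 <= r -> is_prob (mu1 r) by case: S1 => [[+ _] _ _]; apply.
have p2 r : 0 <= r -> is_prob (mu2 r) by case: S2 => [[+ _] _ _]; apply.
have f1 := SPF_flow e0 KE cV p1 S1; have f2 := SPF_flow e0 KE cV p2 S2.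
have E r : 0 <= r -> hnorm (k_c eps c) (fun x => Bemb eps c (mu1 r) x - Bemb eps c (mu2 r) x) =
    Num.sqrt (2 - 2 * dot (lift eps c (mu1 r)) (lift eps c (mu2 r))).
  move=> r0; have [_ <- _] := lift_facts e0 KE (p1 r r0); have [_ <- _] := lift_facts e0 KE (p2 r r0).
  by rewrite -(kN_flows f1 f2 r0); exact: (hnorm_flow f1 f2 r0 r0).
rewrite !E//; apply: ler_wsqrtr; have := contraction cU f1 f2 s0 st; lra.
Qed.

Section LongTime.
Variables (a : R -> (X -> R) -> R) (fa : flow a) (reg : regular (K := K) a).
Let E t := energy V (unlift (a t)).

Let EE t : 0 <= t -> E t = eps / 2 * Eng (a t).
Proof. exact: (energy_Eng e0 cV fa). Qed.

Lemma energy_abs_cont : loc_abs_cont E.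
Proof.
have e2 : 0 < eps / 2 by rewrite divr_gt0.
apply: monotone_abs_cont.
- move=> s t s0 st; rewrite !EE//; last exact: le_trans st.
  by rewrite ler_pM2l//; exact: (Eng_noninc cU fa reg s0 st).
- move=> e ep; have ee : 0 < e / (eps / 2) by rewrite divr_gt0.
  have [d d0 hd] := Eng_cont cU fa (lexx 0) ee; exists d => // s s0 sd.
  rewrite !EE// -mulrBr normrM (gtr0_norm e2) -ler_pdivlMl// mulrC; apply: hd => //.
  by rewrite subr0 ger0_norm.
- move=> s s0; have [L L0 hL] := Eng_lip cU fa reg s0; exists (eps / 2 * L).
    by rewrite mulr_ge0// ltW.
  move=> u v su uv; have u0 := le_trans (ltW s0) su; have v0 := le_trans u0 uv.
  by rewrite !EE// -mulrBr normrM (gtr0_norm e2) -mulrA ler_pM2l//; exact: hL.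
Qed.

Lemma energy_noninc s t : 0 <= s -> s <= t -> E t <= E s.
Proof.
move=> s0 st; rewrite !EE//; last exact: le_trans st.
by rewrite ler_pM2l ?divr_gt0//; exact: (Eng_noninc cU fa reg s0 st).
Qed.

(** One supersolution step, the increment of [H (a t)] at [y] being bounded by its RKHS norm and
    hence by [phi] times the step. *)
Lemma Aop_phi t y : 0 < t -> - Aop (a t) y <= phi a t.
Proof.
move=> t0; have tl := ltW t0; apply/ler_addgt0Pr => e ep.
have [d d0 hd] := fl_sup fa (t + 1) ep; pose h := Num.min 1 d.
have h0 : 0 < h by rewrite lt_min ltr01.
have h1 : h <= 1 by rewrite ge_min lexx.
have hdd : h <= d by rewrite ge_min lexx orbT.
have := hd t (t + h) y tl; rewrite lerDl !lerD2l => /(_ (ltW h0) h1 hdd I).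
rewrite (_ : t + h - t = h); last by ring.
have [_ sp] := phi_spd' reg t0; have th0 : 0 <= t + h by lra.
have := hb_sup y (hb_H (K := K) mp2 (fl_bdf2 fa tl th0)); rewrite H_subf => i1.
have := le_trans i1 (sp h (ltW h0)); rewrite ler_norml => /andP[_ i2] i3.
rewrite -(ler_pM2l h0); lra.
Qed.

(** At the minimizer [- A b] is the integral of the nonnegative function [(U - U xs) k(., xs)]
    against [a]. Since [k(., xs) >= kap] and [b <= m0], it dominates the energy gap up to the factor
    [m0 / kap]. *)
Lemma energy_gap xs t : (forall x, V xs <= V x) -> 0 < t ->
  0 <= Eng (a t) - U xs /\ Eng (a t) - U xs <= m0 / kap * phi a t.
Proof.
move=> Vm t0; have tl := ltW t0; have pa := fl_pos fa tl; have ba := fl_bdf fa tl.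
have cH := fl_cont_H fa tl.
have Um x : 0 <= U x - U xs.
  by rewrite subr_ge0 /U ler_pM2l ?divr_gt0.
have cUm : continuous (fun x => U x - U xs) by apply: cont_add => //; exact: cont_cst.
have E1 : Eng (a t) - U xs = a t (fun x => (U x - U xs) * H (a t) x).
  have -> : (fun x => (U x - U xs) * H (a t) x) = fun x => U x * H (a t) x - U xs * H (a t) x.
    by apply/funext => x; ring.
  rewrite (linB ba.1); [|exact: cont_mul|by apply: cont_mul => //; exact: cont_cst].
  by rewrite (linZ ba.1)// -[a t (H (a t))]/(dual_sqnorm (K := K) (a t)) (fl_nrm fa tl) mulr1.
have H0 x : 0 <= H (a t) x by exact: (H_ge0 x pa).
split; first by rewrite E1; apply: pa.2 => [|x _]; [exact: cont_mul|exact: mulr_ge0].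
have Hm x : H (a t) x <= m0 by apply: (le_trans (H_up x pa)); exact: (fl_mass fa tl).
have kp := gk_kap K; have ckx : continuous (fun x => k x xs) by exact: cont_kl.
have i1 : a t (fun x => (U x - U xs) * H (a t) x) <= a t (fun x => m0 / kap * ((U x - U xs) * k x xs)).
  apply: (posfun_mono pa).
  - exact: cont_mul.
  - by apply: cont_mul; [exact: cont_cst|exact: cont_mul].
  move=> x _; rewrite mulrCA; apply: ler_wpM2l => //; apply: (le_trans (Hm x)).
  rewrite -mulrA ler_peMr//; rewrite ler_pdivlMl// mulr1; exact: gk_low.
have i2 : a t (fun x => (U x - U xs) * k x xs) = - Aop (a t) xs.
  have -> : (fun x => (U x - U xs) * k x xs) = fun x => U x * k x xs - U xs * k x xs.
    by apply/funext => x; ring.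
  rewrite (linB ba.1); [|exact: cont_mul|by apply: cont_mul => //; exact: cont_cst].
  by rewrite (linZ ba.1)// /skew_op /Hop /wt; ring.
rewrite E1; apply: (le_trans i1).
rewrite (linZ ba.1); last exact: cont_mul.
rewrite i2; apply: ler_wpM2l; first by rewrite divr_ge0// ltW.
exact: Aop_phi.
Qed.

Lemma energy_cvg xs : (forall x, V xs <= V x) -> E t @[t --> +oo] --> V xs.
Proof.
move=> Vm; have [G [G0 UG]] := cont_bdd K cU; have kp := gk_kap K.
apply/cvgrPdist_le => e ep; pose d := 2 / eps * e; have d0 : 0 < d by rewrite mulr_gt0// divr_gt0.
have mp0 : 0 < m0 by exact: m0_gt0.
(* The squared gap is at most [(m0 / kap)^2 phi^2] and [t phi^2 <= 2 G], so it is below [d ^ 2] once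
   [t > C / d ^ 2]. *)
pose C := (m0 / kap) ^+ 2 * (2 * G); have C0 : 0 <= C by rewrite mulr_ge0 ?sqr_ge0// mulr_ge0.
have d2 : 0 < d ^+ 2 by rewrite exprn_gt0.
exists (C / d ^+ 2); split; first exact: num_real.
move=> t ht; have t0 : 0 < t by apply: le_lt_trans ht; rewrite divr_ge0// ltW.
have tl := ltW t0; have [g0 g1] := energy_gap Vm t0.
have gd : Eng (a t) - U xs <= d.
  rewrite leNgt; apply/negP => h; move: ht; rewrite ltNge => /negP; apply.
  rewrite ler_pdivlMr//; set q := Eng (a t) - U xs in g0 g1 h.
  have pb := phi_bound cU fa reg t0; have p0 := phi_ge0 reg t0.
  have := Eng_bound cU fa G0 UG (lexx 0); have := Eng_bound cU fa G0 UG tl.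
  rewrite !ler_norml => /andP[e1 e2] /andP[e3 e4].
  have q2 : q ^+ 2 <= (m0 / kap) ^+ 2 * phi a t ^+ 2.
    by rewrite -exprMn ler_pXn2r// nnegrE// mulr_ge0// divr_ge0// ltW.
  have dq : d ^+ 2 <= q ^+ 2 by rewrite ler_pXn2r// ?nnegrE// ltW.
  apply: (@le_trans _ _ ((m0 / kap) ^+ 2 * (t * phi a t ^+ 2))).
    by rewrite [leRHS]mulrCA; apply: ler_wpM2l => //; exact: le_trans q2.
  by apply: ler_wpM2l; [exact: sqr_ge0|lra].
have -> : V xs - E t = - (eps / 2 * (Eng (a t) - U xs)).
  by rewrite EE// /U; field; rewrite gt_eqF.
rewrite normrN ger0_norm; last by rewrite mulr_ge0// divr_ge0// ltW.
have -> : e = eps / 2 * d by rewrite /d; field; rewrite gt_eqF.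
by apply: ler_wpM2l => //; rewrite divr_ge0// ltW.
Qed.

(** The energy gap controls the test function through [|f - f xs| <= C (V - V xs) + e / 2]. The
    constant [C] bounds a quotient whose denominator is regularized by [max 0 (e / 2 - |f - f xs|)],
    positive at [xs] and zero where [|f - f xs| >= e / 2]. *)
Lemma weak_cvg xs f : (forall x, x != xs -> V xs < V x) -> continuous f ->
  unlift (a t) f @[t --> +oo] --> f xs.
Proof.
move=> Vm cf; have Vm' x : V xs <= V x by have [->//|/Vm/ltW] := eqVneq x xs.
apply/cvgrPdist_le => e ep; have e2 : 0 < e / 2 by rewrite divr_gt0.
have cD : continuous (fun x => f x - f xs) by apply: cont_add => //; exact: cont_cst.
have cDn : continuous (fun x => `|f x - f xs|) by exact: cont_norm.
have cW : continuous (fun x => V x - V xs) by apply: cont_add => //; exact: cont_cst.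
have W0 x : 0 <= V x - V xs by rewrite subr_ge0.
have [|C [C0 hC]] := cont_bdd K (f := fun x => `|f x - f xs| / (V x - V xs + Num.max 0 (e / 2 - `|f x - f xs|))).
  apply: cont_mul => //; apply: cont_inv.
    move=> x; have [->|xn] := eqVneq x xs.
      by rewrite subrr add0r lt_max; apply/orP; right; rewrite subrr normr0 subr0.
    by rewrite ltr_wpDr ?subr_gt0 ?Vm// le_max lexx.
  apply: cont_add => //; apply: cont_max; first exact: cont_cst.
  by apply: cont_add; [exact: cont_cst|exact: cont_opp].
have key x : `|f x - f xs| <= C * (V x - V xs) + e / 2.
  have [fx|fx] := lerP `|f x - f xs| (e / 2).
    by apply: (le_trans fx); rewrite lerDr mulr_ge0.
  have M0 : Num.max 0 (e / 2 - `|f x - f xs|) = 0 by apply/max_idPl; move: fx; lra.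
  have Wx : 0 < V x - V xs.
    have [xe|/Vm] := eqVneq x xs; last by rewrite subr_gt0.
    by move: fx; rewrite xe subrr normr0; lra.
  have := hC x; rewrite M0 addr0 => /(le_trans (ler_norm _)); rewrite ler_pdivrMr// => h.
  by apply: (le_trans h); rewrite lerDl ltW.
have C1 : 0 < C + 1 by rewrite ltr_wpDl.
have e3 : 0 < e / 2 / (C + 1) by rewrite divr_gt0.
have /cvgrPdist_le/(_ _ e3)[T [Tr hT]] := energy_cvg Vm'.
exists (Num.max 0 T); split; first by rewrite max_real// real0.
move=> t; rewrite gt_max => /andP[t0 tT]; have tl := ltW t0.
have /is_probP[q q1] := unlift_prob e0 KE fa tl.
have h1 : `|unlift (a t) (fun x => f x - f xs)| <= unlift (a t) (fun x => C * (V x - V xs) + e / 2).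
  have cr : continuous (fun x => C * (V x - V xs) + e / 2).
    by apply: cont_add; [apply: cont_mul => //; exact: cont_cst|exact: cont_cst].
  rewrite ler_norml -(linN q.1)//; apply/andP; split; apply: (posfun_mono q) => //; try exact: cont_opp.
    by move=> x _; have := key x; rewrite ler_norml => /andP[].
  by move=> x _; apply: le_trans (key x); exact: ler_norm.
have cst z : continuous (fun _ : X => z : R) by exact: cont_cst.
rewrite (linB q.1)// (lin_cst q.1) q1 mulr1 in h1.
rewrite distrC; apply: (le_trans h1).
rewrite (linD q.1)//; last by apply: cont_mul.
rewrite (linZ q.1)// (linB q.1)// !(lin_cst q.1) q1 !mulr1.
have := hT t tT; rewrite ler_norml => /andP[h2 _].
have h3 : C * (unlift (a t) V - V xs) <= C * (e / 2 / (C + 1)).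
  by apply: ler_wpM2l => //; move: h2; rewrite /E /energy; lra.
have h4 : C * (e / 2 / (C + 1)) <= e / 2.
  by rewrite mulrCA ler_piMr ?(ltW e2)// ler_pdivrMr// mul1r lerDl.
lra.
Qed.

End LongTime.

End Flows.

Theorem mainTheorem1 (R : realType) (X : pseudoMetricType R)
  (eps : R) (c : X -> X -> R) (V : X -> R) (mu0 : (X -> R) -> R) :
  hausdorff_space X -> compact [set: X] ->
  0 < eps ->
  continuous (fun p : X * X => c p.1 p.2) ->
  (forall x y, c x y = c y x) ->
  (forall x y, 0 <= c x y) ->
  (* k_c positive definite *)
  (forall (n : nat) (x : 'I_n -> X) (a : 'I_n -> R),
     0 <= \sum_(i < n) \sum_(j < n) a i * a j * k_c eps c (x i) (x j)) ->
  (* k_c universal: H_c dense in (C(X), sup norm) *)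
  (forall f : X -> R, continuous f -> forall d : R, 0 < d ->
     exists h, in_rkhs (k_c eps c) h /\ forall x, `|f x - h x| < d) ->
  continuous V ->
  is_prob mu0 ->
  exists mu : R -> (X -> R) -> R,
    [/\ SPF eps c V mu0 mu,
        (* uniqueness *)
        (forall nu, SPF eps c V mu0 nu -> forall t, 0 <= t -> meas_eq (nu t) (mu t)),
        (* (i) energy dissipation *)
        [/\ loc_abs_cont (fun t => energy V (mu t)),
            (forall s t, 0 <= s -> s <= t -> energy V (mu t) <= energy V (mu s)) &
            ae_pos (fun t => exists sg, is_velocity eps c mu t sg /\
               is_derive t 1 (fun r => energy V (mu r)) (- gmet eps c (mu t) sg))],
        (* (ii) long-term behaviour *)
        (forall m : R, (exists x, V x = m) -> (forall x, m <= V x) ->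
           [/\ (exists nu, is_prob nu /\ energy V nu = m),
               (forall nu, is_prob nu -> m <= energy V nu) &
               energy V (mu t) @[t --> +oo] --> m]) /\
        (forall xs : X, (forall x, x != xs -> V xs < V x) ->
           forall phi : X -> R, continuous phi ->
             mu t phi @[t --> +oo] --> dirac_f xs phi) &
        (* (iii) non-expansiveness, for any two flows of V *)
        (forall (mu1 mu2 : R -> (X -> R) -> R) (m1 m2 : (X -> R) -> R),
           SPF eps c V m1 mu1 -> SPF eps c V m2 mu2 ->
           forall s t, 0 <= s -> s <= t ->
             hnorm (k_c eps c) (fun x => Bemb eps c (mu1 t) x - Bemb eps c (mu2 t) x)
             <= hnorm (k_c eps c) (fun x => Bemb eps c (mu1 s) x - Bemb eps c (mu2 s) x))].
Proof.
move=> _ cX e0 cc sc c0 psd univ cV pm.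
have [K KE] := sinkhorn_kernel cX e0 cc sc c0 psd univ.
have [pl HE nl] := lift_facts e0 KE pm.
have cU : continuous (fun x => 2 / eps * V x) by apply: cont_mul => //; exact: cont_cst.
have [a [fa reg a0]] := flow_exists cU pl nl.
have S := flow_SPF e0 KE cV pm fa reg a0.
exists (fun t => prob_of_dual (K := K) (a t)); split => //.
- by move=> nu Sn t t0; exact: (SPF_unique e0 KE cV S Sn t0).
- split; first exact: (energy_abs_cont e0 cV fa reg).
    by move=> s t s0 st; exact: (energy_noninc e0 cV fa reg s0 st).
  have [N [mN N0 gN]] := bad_null (K := K) a; exists N; split => //; split => // t t0 nN.
  have gt := gN t t0 nN; exists (vel (K := K) a t).
  by split; [exact: (vel_velocity e0 KE cV fa reg gt)|exact: (energy_deriv e0 KE cV fa reg gt)].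
- split => [m [x <-] Vm|xs Vm phi cphi]; last exact: (weak_cvg e0 KE cV fa reg Vm cphi).
  split.
  + by exists (dirac_f x); split => //; apply/is_probP; split => //; exact: posfun_dirac.
  + move=> nu pn; have /is_probP[q q1] := pn.
    rewrite /energy -[V x]mulr1 -q1 -(lin_cst q.1); apply: (posfun_mono q) => //.
    exact: cont_cst.
  + exact: (energy_cvg e0 cV fa reg Vm).
- by move=> mu1 mu2 m1 m2 S1 S2 s t s0 st; exact: (SPF_nonexpansive e0 KE cV S1 S2 s0 st).
Qed.
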